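(* Let $\Lambda\subset E$ be an integral full-rank lattice. The map $$Z:S(E)\otimes\mathbb C^{\mathcal Z}\longrightarrow C^\infty(\mathbb T_E\times\mathbb T_E,L),$$ $$Z(\mathsf f)(\theta_1,\theta_2)=\frac1{\sqrt{|\mathcal Z|}}\langle-\theta_1/2,\theta_2\rangle\sum_{\gamma\in\mathcal Z}\sum_{\lambda\in\Lambda^*}f_\gamma(\theta_1+\lambda)\langle-\lambda,\theta_2\rangle\langle-\lambda,\gamma\rangle$$ is an isomorphism, with inverse $$Z^{-1}(s)(\theta,\gamma)=\frac1{\sqrt{|\mathcal Z|}}\sum_{\hat\gamma\in\mathcal Z}\langle\gamma,\hat\gamma\rangle\frac1{\mathrm{Vol}(\Lambda)}\int_{F_\Lambda}s(\theta-\hat\gamma,\tilde\theta)\,\langle\theta+\hat\gamma,\tilde\theta/2\rangle\,d\mathrm{vol}(\tilde\theta).$$ It satisfies $\langle\!\langle Z(\mathsf f),Z(\mathsf g)\rangle\!\rangle=\langle\!\langle\mathsf f,\mathsf g\rangle\!\rangle$ for all $\mathsf f,\mathsf g\in S(E)\otimes\mathbb C^{\mathcal Z}$, and thus extends to an isometry between $L^2(E)\otimes\mathbb C^{\mathcal Z}$ and $L^2(\mathbb T_E\times\mathbb T_E,L)$.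
   Context: $(E,(\cdot,\cdot))$ is a Euclidean space of finite dimension $n$, $\Lambda\subset E$ a full-rank lattice, $\mathbb T_E=E/\Lambda$. Notation: $\langle x,y\rangle=e^{2\pi i(x,y)}$ for $x,y\in E$. $\Lambda^*=\{\gamma\in E:\langle\lambda,\gamma\rangle=1\ \forall\lambda\in\Lambda\}$; $\Lambda$ is integral if $\Lambda\subseteq\Lambda^*$, and then $\mathcal Z=\Lambda^*/\Lambda$ is a finite abelian group. Expressions such as $\langle\lambda,\gamma\rangle$ with $\lambda\in\Lambda^*$, $\gamma\in\mathcal Z$ use any representative of $\gamma$ in $\Lambda^*$, and in the formula for $Z^{-1}$ each $\hat\gamma\in\mathcal Z$ is represented by any element of $\Lambda^*$ (the summand is independent of the choice). $L\to\mathbb T_E\times\mathbb T_E$ is the line bundle with multipliers $e_{\lambda_1\oplus\lambda_2}(x\oplus y)=(-1)^{(\lambda_1,\lambda_2)}e^{-\pi i((x,\lambda_2)-(\lambda_1,y))}$, i.e. its sections are functions $s$ on $E\times E$ with $s(x+\lambda_1,y+\lambda_2)=e_{\lambda_1\oplus\lambda_2}(x\oplus y)\,s(x,y)$ for $\lambda_1,\lambda_2\in\Lambda$; $C^\infty(\mathbb T_E\times\mathbb T_E,L)$ and $L^2(\mathbb T_E\times\mathbb T_E,L)$ are its smooth and square-integrable sections. $S(E)$ is the Schwartz space. Elements of $S(E)\otimes\mathbb C^{\mathcal Z}$ or $L^2(E)\otimes\mathbb C^{\mathcal Z}$ are written $\mathsf f=(f_\gamma)_{\gamma\in\mathcal Z}$,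 $\mathsf f(\theta,\gamma)=f_\gamma(\theta)$. $d\mathrm{vol}$ is Lebesgue measure on $E$ given by $(\cdot,\cdot)$, $F_\Lambda\subset E$ a fundamental domain for $\Lambda$, $\mathrm{Vol}(\Lambda)=\int_{F_\Lambda}d\mathrm{vol}$. Inner products: $\langle\!\langle\mathsf f,\mathsf g\rangle\!\rangle=\sum_{\gamma\in\mathcal Z}\int_Ef_\gamma\overline{g_\gamma}\,d\mathrm{vol}$ on $L^2(E)\otimes\mathbb C^{\mathcal Z}$, and $\langle\!\langle\psi,\phi\rangle\!\rangle=\frac1{\mathrm{Vol}(\Lambda)}\int_{F_\Lambda\times F_\Lambda}\psi\overline\phi\,d\mathrm{vol}(\theta_1,\theta_2)$ on sections (product measure). *)

(* Defs.v *)
From HB Require Import structures.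
From mathcomp Require Import all_boot all_order all_algebra.
From mathcomp Require Import finmap.
From mathcomp Require Import all_classical all_reals all_analysis.
From mathcomp Require Import complex.

Set Implicit Arguments.
Unset Strict Implicit.
Unset Printing Implicit Defensive.

Import Order.TTheory GRing.Theory Num.Theory.
Import numFieldNormedType.Exports.

Local Open Scope classical_set_scope.
Local Open Scope ring_scope.
Local Open Scope complex_scope.

(* R[i] has no normedModType structure over R, so derivatives, integrals and
   unordered sums of complex-valued functions are taken on the real and
   imaginary parts. *)

Section ComplexValued.
Variable R : realType.
Local Notation C := R[i].
Local Notation Re := (@complex.Re R).
Local Notation Im := (@complex.Im R).

Definition expi (t : R) : C := cos t +i* sin t.

Definition sqmod (z : C) : R := Re z ^+ 2 + Im z ^+ 2.

(* Sums over an arbitrary index set, meaningful for absolutely summable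
   families. *)
Definition rsum (I : choiceType) (S : set I) (F : I -> R) : R :=
  fine (esum S (EFin \o F)^\+ - esum S (EFin \o F)^\-)%E.

Definition csum (I : choiceType) (S : set I) (F : I -> C) : C :=
  rsum S (Re \o F) +i* rsum S (Im \o F).

Definition csummable (I : choiceType) (S : set I) (F : I -> C) : Prop :=
  summable S (EFin \o Re \o F) /\
  summable S (EFin \o Im \o F).

Section Integration.
Context d (T : measurableType d).
Variables (mu : set T -> \bar R) (D : set T) (f : T -> C).

Definition cmeasurable : Prop :=
  measurable_fun D (Re \o f) /\ measurable_fun D (Im \o f).

Definition cintegrable : Prop :=
  mu.-integrable D (EFin \o Re \o f) /\
  mu.-integrable D (EFin \o Im \o f).

Definition cintegral : C :=
  fine (\int[mu]_(x in D) (Re (f x))%:E)%E +i*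
  fine (\int[mu]_(x in D) (Im (f x))%:E)%E.

End Integration.

Section Smoothness.
Variable V : normedModType R.

Fixpoint iterD (vs : seq V) (g : V -> R) : V -> R :=
  if vs is v :: vs' then fun x => 'D_v (iterD vs' g) x else g.

(* All iterated directional derivatives exist and are continuous; for
   finite-dimensional V this is the usual C^oo. *)
Definition smooth (g : V -> R) : Prop :=
  forall vs, continuous (iterD vs g) /\
             (forall x v, derivable (iterD vs g) x v).

Definition csmooth (f : V -> C) : Prop :=
  smooth (Re \o f) /\ smooth (Im \o f).

Definition rapidly_decreasing (g : V -> R) : Prop :=
  forall (k : nat) (vs : seq V),
    exists M : R, forall x, `|x| ^+ k * `|iterD vs g x| <= M.

Definition schwartz (f : V -> C) : Prop :=
  [/\ csmooth f, rapidly_decreasing (Re \o f)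
    & rapidly_decreasing (Im \o f)].

End Smoothness.
End ComplexValued.

Section LebesgueMeasure.
Variable R : realType.

Fixpoint lebesgue_tuple (n : nat) :
    set (n.-tuple (measurableTypeR R)) -> \bar R :=
  match n with
  | 0 => dirac [tuple]
  | m.+1 =>
      pushforward (product_measure1 (@lebesgue_measure R) (@lebesgue_tuple m))
        (fun p => [tuple of p.1 :: p.2])
  end.

Definition borel (E : normedModType R) := g_sigma_algebraType (@open E).

Variable E : normedModType R.

(* The norm of E is the one of the inner product [ip], and [u] is an
   orthonormal basis, so that E has dimension n. *)
Definition euclidean (n : nat) (ip : {dot E for idfun}) (u : 'I_n -> E) : Prop :=
  [/\ forall x, `|x| ^+ 2 = ip x x,
      forall i j, ip (u i) (u j) = (i == j)%:R
    & forall x, x = \sum_i ip x (u i) *: u i].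

(* Lebesgue measure of R^n transported by the coordinates of [u]; when [u] is
   orthonormal it only depends on the inner product. *)
Definition vol (n : nat) (u : 'I_n -> E) : set (borel E) -> \bar R :=
  pushforward (@lebesgue_tuple n)
    (fun t => (\sum_i (tnth t i : R) *: u i) : borel E).

End LebesgueMeasure.

Section Lattice.
Variables (R : realType) (E : normedModType R) (ip : {dot E for idfun}).
Local Notation C := R[i].

Definition pairing (x y : E) : C := expi (2 * pi * ip x y).

(* [n] is meant to be the dimension of E. *)
Definition full_rank_lattice (n : nat) (L : set E) : Prop :=
  exists b : 'I_n -> E,
    (forall c : 'I_n -> R, \sum_i c i *: b i = 0 -> forall i, c i = 0) /\
    L = [set \sum_i b i *~ m i | m in [set: 'I_n -> int]].

Definition dual (L : set E) : set E :=
  [set y | forall l, L l -> pairing l y = 1].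

Definition integral_lattice (L : set E) : Prop := L `<=` dual L.

(* The underlying set of the quotient group (dual L) / L: the cosets x + L
   with x in dual L. *)
Definition discriminant (L : set E) : set (set E) :=
  [set [set x + l | l in L] | x in dual L].

Definition representatives (L : set E) (r : discriminant L -> E) : Prop :=
  forall g : discriminant L, (\val g : set E) (r g).

Definition order_discriminant (L : set E) : nat :=
  #|` fset_set [set: discriminant L] |.

Variables (n : nat) (u : 'I_n -> E).

(* Only up to null sets, so as to allow closed fundamental domains as well as
   exact sets of representatives of E / L. *)
Definition fundamental_domain (L : set E) (F : set E) : Prop :=
  [/\ measurable (F : set (borel E)),
      vol u (~` (\bigcup_(l in L) [set l + x | x in F])) = 0%E
    & forall l, L l -> l <> 0 -> vol u (F `&` [set l + x | x in F]) = 0%E].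

Variable L : set E.

Definition covolume (F : set E) : R := fine (vol u F).

(* For l1, l2 in an integral lattice, ip l1 l2 is an integer. *)
Definition multiplier (l1 l2 x y : E) : C :=
  (-1) ^ Num.floor (ip l1 l2) * expi (- pi * (ip x l2 - ip l1 y)).

Definition is_section (s : E * E -> C) : Prop :=
  forall l1 l2 x y, L l1 -> L l2 ->
    s (x + l1, y + l2) = multiplier l1 l2 x y * s (x, y).

Definition smooth_section (s : E * E -> C) : Prop :=
  is_section s /\ csmooth s.

Definition vol2 : set (borel E * borel E) -> \bar R :=
  product_measure1 (vol u) (vol u).

Definition L2_section (F : set E) (s : E * E -> C) : Prop :=
  [/\ is_section s, cmeasurable setT (s : borel E * borel E -> C)
    & (\int[vol2]_(p in F `*` F) (sqmod (s p))%:E < +oo)%E].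

Definition ae_eq_section (s t : E * E -> C) : Prop :=
  {ae vol2, forall p, s p = t p}.

Definition ip_section (F : set E) (s t : E * E -> C) : C :=
  ((covolume F)^-1)%:C * cintegral vol2 (F `*` F) (fun p => s p * conjc (t p)).

Local Notation family := (discriminant L -> E -> C).

Definition schwartz_family (f : family) : Prop := forall g, schwartz (f g).

Definition L2_family (f : family) : Prop :=
  forall g, cmeasurable setT (f g : borel E -> C) /\
            (\int[vol u]_x (sqmod (f g x))%:E < +oo)%E.

Definition ae_eq_family (f h : family) : Prop :=
  forall g, {ae vol u, forall x, f g x = h g x}.

Definition ip_family (f h : family) : C :=
  \sum_(g \in [set: discriminant L])
    cintegral (vol u) setT (fun x => f g x * conjc (h g x)).

Variable r : discriminant L -> E.

Definition inv_sqrt_order : C :=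
  ((Num.sqrt ((order_discriminant L)%:R : R))^-1)%:C.

Definition zak_term (f : family) (g : discriminant L) (t1 t2 l : E) : C :=
  f g (t1 + l) * pairing (- l) t2 * pairing (- l) (r g).

Definition zak (f : family) (p : E * E) : C :=
  inv_sqrt_order * pairing (- (2^-1 *: p.1)) p.2 *
  \sum_(g \in [set: discriminant L]) csum (dual L) (zak_term f g p.1 p.2).

Definition zak_inv_integrand (s : E * E -> C) (h : discriminant L) (t t' : E) : C :=
  s (t - r h, t') * pairing (t + r h) (2^-1 *: t').

Definition zak_inv (F : set E) (s : E * E -> C) : family := fun g t =>
  inv_sqrt_order *
  \sum_(h \in [set: discriminant L])
    (pairing (r g) (r h) *
     (((covolume F)^-1)%:C *
      cintegral (vol u) F (zak_inv_integrand s h t))).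

End Lattice.

(* Main.v *)
(* Multiplying a section s by <x/2, y> turns the multipliers of L into the
   quasi-periodicity G(x + l1, y + l2) = <l1, y> G(x, y).  Hence G(x, .) has a
   Fourier series over the dual lattice, and its coefficient at -l has the form
   c_l(x + l), where c_l only depends on the class of l modulo the lattice.  For
   G coming from Z(f), the c_l are the finite Fourier transform of (f_g)_g over
   the discriminant group, which is unitary by orthogonality of characters; so Z
   is inverted by taking Fourier coefficients in y and inverting the finite
   transform.  The coefficients of a smooth section are Schwartz functions because
   the derivatives of G, made covariant in y, are again quasi-periodic, hence
   bounded.  The isometry is Parseval on each slice {x} x E, followed by unfolding
   the sum over the dual lattice of the integrals over a cell.

   On L^2, Z is defined on truncations, whose series are finite sums, and extended
   by taking the almost everywhere limit of a rapidly converging subsequence.  For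
   surjectivity, Bessel's inequality puts the family f of Fourier coefficients of
   an L^2 section s in L^2, and almost every slice of s minus the transform of f
   has vanishing Fourier coefficients. *)

From Pilot Require Import Defs.
From HB Require Import structures.
From mathcomp Require Import all_boot all_order all_algebra.
From mathcomp Require Import finmap.
From mathcomp Require Import all_classical all_reals all_analysis.
From mathcomp Require Import measurable_realfun complex.
From mathcomp Require Import zify ring lra.

Set Implicit Arguments.
Unset Strict Implicit.
Unset Printing Implicit Defensive.

Import Order.TTheory GRing.Theory Num.Theory.
Import numFieldNormedType.Exports.

Import Normc.

Local Open Scope classical_set_scope.
Local Open Scope ring_scope.

(** * Lebesgue measure on a Euclidean space *)

(** The domain [F] is only a measurable set that tiles up to null sets; it need not be bounded or
    exact. The integrands over it are periodic, so their integrals are moved to the half-open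
    parallelepiped [cell], which is bounded, of finite measure and an exact set of representatives.
    Differentiating <l1, y> in y along w produces a factor 2 pi i (l1, w); this forces the covariant
    derivative, and its correction term -2 pi i (x, w) is what yields decay: integrating over a
    slice kills the plain derivative, so multiplying a coefficient by a coordinate of x gives, up to
    a constant, another integral of the same kind. In L^2 no formula defines the transform
    pointwise, so the argument runs through the relation [is_zak f s]: s is the L^2 limit of the
    transforms of the truncations of f. The series of a Schwartz family and the constructed
    extension both satisfy it; norm, linearity and uniqueness are proved once for the relation, and
    the Schwartz isometry is an instance of the L^2 one. *)

Section SigmaFinitePack.
Context d (T : measurableType d) (R : realType).
Variable m : {measure set T -> \bar R}.
Hypothesis sf : sigma_finite setT m.

(** An alias of [m], to which a sigma-finite structure can be attached when sigma-finiteness is only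
    a hypothesis. *)
Definition sigma_finite_pack : set T -> \bar R := m.
HB.instance Definition _ := Measure.on sigma_finite_pack.
HB.instance Definition _ :=
  Measure_isSigmaFinite.Build _ _ _ sigma_finite_pack sf.

Lemma sigma_finite_measure_ex :
  exists m' : {sigma_finite_measure set T -> \bar R}, forall A, m' A = m A.
Proof. by exists sigma_finite_pack. Qed.
End SigmaFinitePack.

Lemma pushforward_measure_ex d1 d2 (T1 : measurableType d1)
    (T2 : measurableType d2) (R : realType) (m : {measure set T1 -> \bar R})
    (f : T1 -> T2) : measurable_fun setT f ->
  exists m' : {measure set T2 -> \bar R}, forall A, m' A = m (f @^-1` A).
Proof. by move=> mf; unshelve eexists (pushforward m f). Qed.

Section LebesgueTuple.
Variable R : realType.
Local Open Scope ereal_scope.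
Local Notation mR := (measurableTypeR R).
Definition tuple_cons n (p : mR * n.-tuple mR) : n.+1.-tuple mR :=
  [tuple of p.1 :: p.2].

Lemma measurable_tuple_cons n : measurable_fun setT (@tuple_cons n).
Proof. exact: (@measurable_cons _ _ _ _ fst n snd). Qed.

Lemma measurable_box n (A : 'I_n -> set mR) : (forall i, measurable (A i)) ->
  measurable [set t : n.-tuple mR | forall i, A i (tnth t i)].
Proof.
move=> mA.
rewrite (_ : [set t | _] = \bigcap_(i in [set: 'I_n]) ((@tnth n mR)^~ i @^-1` A i)); last first.
  by apply/seteqP; split => [t tA i _|t tA i]; apply: tA.
apply: fin_bigcap_measurable => // i _.
by rewrite -[X in measurable X]setTI; apply: measurable_tnth.
Qed.

(** [lebesgue_tuple] is a bare set function. The product measure of the next dimension needs the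
    measure structure of the previous one, hence an existential carried through the induction. The
    box formula later gives finiteness on bounded sets and positivity on open sets. *)
Lemma lebesgue_tuple_measure n :
  exists m : {sigma_finite_measure set (n.-tuple mR) -> \bar R},
    (forall A, m A = lebesgue_tuple A) /\
    (forall A : 'I_n -> set mR, (forall i, measurable (A i)) ->
       m [set t | forall i, A i (tnth t i)] = \prod_i lebesgue_measure (A i)).
Proof.
elim: n => [|n [m [mE mP]]].
  pose m0 : {measure set (0.-tuple mR) -> \bar R} := dirac [tuple].
  have sf : sigma_finite setT m0.
    exists (fun=> setT); first by rewrite bigcup_const//; exists 0%N.
    by move=> _; split => //=; rewrite diracE ltry.
  have [m mE] := sigma_finite_measure_ex sf.
  exists m; split => // A mA; rewrite mE big_ord0 /= diracE mem_set//= => i.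
  by case: i.
have [m1 m1E] := @pushforward_measure_ex _ _ _ _ _
  (product_measure1 lebesgue_measure m) _ (@measurable_tuple_cons n).
have m1P (A : 'I_n.+1 -> set mR) : (forall i, measurable (A i)) ->
   m1 [set t | forall i, A i (tnth t i)] = \prod_i lebesgue_measure (A i).
  move=> mA.
  rewrite big_ord_recl -mP => [|i]; last exact: mA.
  rewrite -product_measure1E //; last exact: (measurable_box (A := fun i => A (lift ord0 i))).
  rewrite m1E; congr (_ _).
  apply/seteqP; split => [[x t]/= tA|[x t] /= [Ax tA] i].
    split; first by have := tA ord0.
    by move=> i; have := tA (lift ord0 i); rewrite tnthS.
  have [j ->|->//] := unliftP ord0 i; by rewrite tnthS; exact: tA.
have sf : sigma_finite setT m1.
  (* The cubes with coordinates in [-k, k] cover the space, and the box formula makes their measure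
     finite. *)
  exists (fun k => [set t | forall i, `[(- k%:R)%R, k%:R]%classic (tnth t i)]).
    apply/esym; rewrite -subTset => t _.
    exists (Num.bound (\sum_i `|tnth t i|)%R) => //= i.
    rewrite in_itv /= -ler_norml.
    rewrite (@le_trans _ _ (\sum_i `|tnth t i|)%R)//.
      by rewrite (bigD1 i)//= lerDl sumr_ge0.
    by rewrite ltW// archi_boundP// sumr_ge0.
  move=> k; split.
    by apply: (measurable_box (A := fun=> `[(- k%:R)%R, k%:R]%classic)) => i; exact: measurable_itv.
  rewrite (m1P (fun=> `[(- k%:R)%R, k%:R]%classic)); last first.
    by move=> i; exact: measurable_itv.
  rewrite (eq_bigr (fun=> (if - k%:R < k%:R :> R then k%:R - - k%:R else 0)%R%:E)); last first.
    by move=> i _; rewrite lebesgue_measure_itv/= lte_fin; case: ifP.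
  by rewrite prodEFin ltry.
have [m' m'E] := sigma_finite_measure_ex sf.
exists m'; split => [A|A mA]; last by rewrite m'E m1P.
rewrite m'E m1E; congr product_measure1.
by apply/funext => B; rewrite mE.
Qed.
End LebesgueTuple.

Section InvariantMap.
Context d (T : measurableType d) (R : realType) (mu : {measure set T -> \bar R}).
Variable phi : T -> T.
Hypothesis mphi : measurable_fun setT phi.
Hypothesis inv : forall A, measurable A -> mu (phi @^-1` A) = mu A.

Lemma ge0_integral_invariant (f : T -> \bar R) : measurable_fun setT f ->
  (forall x, 0 <= f x)%E -> (\int[mu]_x f (phi x) = \int[mu]_x f x)%E.
Proof.
move=> mf f0; transitivity (\int[pushforward mu phi]_x f x)%E.
  by rewrite ge0_integral_pushforward.
by apply: eq_measure_integral => A mA _; apply: inv.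
Qed.
End InvariantMap.

Section Translation.
Variable R : realType.
Local Open Scope ereal_scope.
Local Notation mR := (measurableTypeR R).

(** The image measure under the shift gives half-open intervals their length, which characterises
    Lebesgue measure. *)
Lemma lebesgue_measure_shift (c : R) (A : set mR) : measurable A ->
  lebesgue_measure ((fun x : mR => (x + c)%R : mR) @^-1` A) = lebesgue_measure A.
Proof.
move=> mA.
have mf : measurable_fun setT (fun x : mR => (x + c)%R : mR).
  by apply: measurable_funD => //; apply: measurable_cst.
have [m mE] := pushforward_measure_ex lebesgue_measure mf.
rewrite -mE; apply/esym/lebesgue_measure_unique => //= _ [[a b]] _ <-.
rewrite mE (_ : _ @^-1` _ = `](a - c)%R, (b - c)%R]%classic); last first.
  by apply/seteqP; split => x /=; rewrite !in_itv/= ltrBlDr lerBrDr.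
rewrite lebesgue_measure_itv/= [RHS](lebesgue_measure_itv `](a - c)%R, (b - c)%R])/= !lte_fin.
have -> : (a - c < b - c)%R = (a < b)%R by rewrite ltrD2r.
case: ifPn => // _.
by congr (_%:E); ring.
Qed.

Definition tuple_shift n (c t : n.-tuple mR) : n.-tuple mR :=
  [tuple (tnth t i + tnth c i)%R | i < n].

(** Induction on n: the measure is the integral, over the head x, of the measure of the section at
    x. Shifting the tail preserves the measure of each section, and shifting the head preserves the
    integral. *)
Lemma lebesgue_tuple_shift n (c : n.-tuple mR) (A : set (n.-tuple mR)) :
  measurable A -> lebesgue_tuple (tuple_shift c @^-1` A) = lebesgue_tuple A.
Proof.
elim: n c A => [|n IH] c A mA.
  congr (_ _); apply/funext => t; rewrite /preimage/=; congr (A _).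
  by rewrite tuple0; rewrite [RHS]tuple0.
have [m [mE _]] := lebesgue_tuple_measure R n.
pose c' : n.-tuple mR := [tuple of behead c].
have mA' : measurable (@tuple_cons R n @^-1` A).
  by rewrite -[X in measurable X]setTI; apply: measurable_tuple_cons.
pose g (x : mR) := @lebesgue_tuple R n (xsection (@tuple_cons R n @^-1` A) x).
have mg : measurable_fun setT g.
  rewrite (_ : g = m \o xsection (@tuple_cons R n @^-1` A)); last first.
    by apply/funext => x; rewrite /g /= mE.
  exact: measurable_fun_xsection.
rewrite [LHS](_ : _ = \int[lebesgue_measure]_x g ((x + tnth c ord0)%R : mR)); last first.
  apply: eq_integral => /= x _; rewrite /g -(IH c'); last exact: measurable_xsection.
  congr lebesgue_tuple; apply/seteqP; split => t /=; rewrite /xsection/= !inE/=;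
    rewrite (_ : tuple_shift c (tuple_cons (x, t)) = tuple_cons ((x + tnth c ord0)%R, tuple_shift c' t))//.
  - apply/eq_from_tnth => i; rewrite tnth_mktuple.
    have [j ->|->//] := unliftP ord0 i; rewrite !tnthS tnth_mktuple.
    rewrite tnth_behead (_ : inord j.+1 = lift ord0 j)//.
    by apply: val_inj; rewrite /= inordK// ltnS.
  - apply/eq_from_tnth => i; rewrite tnth_mktuple.
    have [j ->|->//] := unliftP ord0 i; rewrite !tnthS tnth_mktuple.
    rewrite tnth_behead (_ : inord j.+1 = lift ord0 j)//.
    by apply: val_inj; rewrite /= inordK// ltnS.
rewrite (@ge0_integral_invariant _ _ _ _ (fun x : mR => (x + tnth c ord0)%R : mR)) => //.
- by apply: measurable_funD => //; apply: measurable_cst.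
- by move=> B mB; apply: lebesgue_measure_shift.
- by move=> x; rewrite /g -mE.
Qed.
End Translation.

Section InnerProduct.
Variables (R : realType) (E : normedModType R) (ip : {dot E for idfun}).

Lemma ipC x y : ip x y = ip y x.
Proof. by rewrite (@hermitian_subproof _ _ _ _ ip x y) expr0 mul1r. Qed.
Lemma ipDr x y z : ip x (y + z) = ip x y + ip x z. Proof. exact: linearDr. Qed.
Lemma ipDl x y z : ip (x + y) z = ip x z + ip y z.
Proof. by rewrite ipC ipDr !(ipC z). Qed.
Lemma ipNr x y : ip x (- y) = - ip x y. Proof. exact: linearNr. Qed.
Lemma ipNl x y : ip (- x) y = - ip x y. Proof. by rewrite ipC ipNr ipC. Qed.
Lemma ipZr a x y : ip x (a *: y) = a * ip x y. Proof. exact: linearZr_LR. Qed.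
Lemma ipZl a x y : ip (a *: x) y = a * ip x y. Proof. by rewrite ipC ipZr ipC. Qed.
Lemma ip0r x : ip x 0 = 0. Proof. exact: linear0r. Qed.
Lemma ip0l x : ip 0 x = 0. Proof. by rewrite ipC ip0r. Qed.
Lemma ipBr x y z : ip x (y - z) = ip x y - ip x z. Proof. by rewrite ipDr ipNr. Qed.
Lemma ipBl x y z : ip (x - y) z = ip x z - ip y z. Proof. by rewrite ipDl ipNl. Qed.
Lemma ip_sumr I (s : seq I) (P : pred I) (F : I -> E) x :
  ip x (\sum_(i <- s | P i) F i) = \sum_(i <- s | P i) ip x (F i).
Proof. exact: linear_sumr. Qed.
Lemma ip_suml I (s : seq I) (P : pred I) (F : I -> E) x :
  ip (\sum_(i <- s | P i) F i) x = \sum_(i <- s | P i) ip (F i) x.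
Proof. by rewrite ipC ip_sumr; apply: eq_bigr => i _; rewrite ipC. Qed.
Lemma ipMzr x y (k : int) : ip x (y *~ k) = ip x y *~ k.
Proof. by rewrite -scaler_int ipZr mulrzl. Qed.

Variables (n : nat) (u : 'I_n -> E).
Hypothesis eu : euclidean ip u.

Lemma normE x : `|x| ^+ 2 = ip x x. Proof. by have [] := eu. Qed.
Lemma ip_onb i j : ip (u i) (u j) = (i == j)%:R. Proof. by have [] := eu. Qed.
Lemma onb_sum x : x = \sum_i ip x (u i) *: u i. Proof. by have [] := eu. Qed.
Lemma ip_sum_onb x y : ip x y = \sum_i ip x (u i) * ip y (u i).
Proof.
by rewrite {1}(onb_sum y) ip_sumr; apply: eq_bigr => i _; rewrite ipZr mulrC.
Qed.
Lemma ip_ge0 x : 0 <= ip x x. Proof. by rewrite -normE sqr_ge0. Qed.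
Lemma coord_le_norm x i : `|ip x (u i)| <= `|x|.
Proof.
rewrite -(@ler_pXn2r _ 2)// ?nnegrE// normE [leRHS]ip_sum_onb (bigD1 i)//=.
rewrite -normrX expr2 ger0_norm -?expr2 ?sqr_ge0// lerDl.
by apply: sumr_ge0 => j _; rewrite -expr2 sqr_ge0.
Qed.
Lemma norm_onb i : `|u i| = 1.
Proof.
by apply/eqP; rewrite -(@eqrXn2 _ 2)// normE ip_onb eqxx expr1n.
Qed.
Lemma norm_le_coords x : `|x| <= \sum_i `|ip x (u i)|.
Proof.
rewrite {1}(onb_sum x) (le_trans (ler_norm_sum _ _ _))//.
by apply: ler_sum => i _; rewrite normrZ norm_onb mulr1.
Qed.
Lemma CauchySchwarz x y : `|ip x y| <= `|x| * `|y|.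
Proof.
have [->|y0] := eqVneq y 0; first by rewrite ip0r !normr0 mulr0.
rewrite -(@ler_pXn2r _ 2)// ?nnegrE// ?mulr_ge0// exprMn !normE.
have yy : 0 < ip y y by rewrite -normE exprn_gt0// normr_gt0.
(* The squared norm of this vector is (y, y) times the defect (x, x)(y, y) - (x, y)^2. *)
have := ip_ge0 (ip y y *: x - ip x y *: y).
rewrite !(ipBl,ipBr,ipZl,ipZr) (ipC y x).
rewrite (_ : _ - _ = ip y y * (ip x x * ip y y - ip x y ^+ 2)); last by ring.
by rewrite pmulr_rge0// subr_ge0 real_normK// num_real.
Qed.
End InnerProduct.

(** * Lebesgue measure of E in orthonormal coordinates *)

Section VolMeasure.
Variables (R : realType) (E : normedModType R) (ip : {dot E for idfun}).
Variables (n : nat) (u : 'I_n -> E).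
Hypothesis eu : euclidean ip u.
Local Notation mR := (measurableTypeR R).

Definition of_coords (t : n.-tuple mR) : borel E := \sum_i (tnth t i : R) *: u i.
Definition to_coords (x : E) : n.-tuple mR := [tuple ip x (u i) | i < n].

Lemma to_coordsK x : of_coords (to_coords x) = x.
Proof.
rewrite [RHS](onb_sum eu); apply: eq_bigr => i _; by rewrite tnth_mktuple.
Qed.

Lemma of_coordsK : cancel of_coords to_coords.
Proof.
move=> t; apply/eq_from_tnth => i; rewrite tnth_mktuple ip_suml (bigD1 i)//=.
rewrite ipZl (ip_onb eu) eqxx mulr1 big1 ?addr0// => j ji.
by rewrite ipZl (ip_onb eu) (negbTE ji) mulr0.
Qed.

Lemma of_coords_shift t c :
  of_coords (tuple_shift c t) = (of_coords t : E) + (of_coords c : E).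
Proof.
by rewrite /of_coords -big_split; apply: eq_bigr => i _; rewrite tnth_mktuple scalerDl.
Qed.

Lemma of_coords_dist t s (e : R) : (forall i, `|tnth t i - tnth s i : R| <= e) ->
  `|(of_coords t : E) - (of_coords s : E)| <= n%:R * e.
Proof.
move=> ts; rewrite /of_coords -sumrB (le_trans (ler_norm_sum _ _ _))//.
rewrite mulr_natl -[n in leRHS]card_ord -sumr_const; apply: ler_sum => i _.
by rewrite -scalerBl normrZ (norm_onb eu) mulr1.
Qed.

Definition box (s : n.-tuple mR) (e : R) : set (n.-tuple mR) :=
  [set t | forall i, `](tnth s i - e), (tnth s i + e)[%classic (tnth t i)].

Lemma boxP s e t : box s e t <-> forall i, `|tnth t i - tnth s i : R| < e.
Proof.
by split => st i; move: (st i); rewrite /= in_itv/= distrC ltr_distlC.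
Qed.

Lemma measurable_openbox s e : measurable (box s e).
Proof.
apply: (measurable_box (A := fun i => `](tnth s i - e), (tnth s i + e)[%classic)).
by move=> i; exact: measurable_itv.
Qed.

Lemma open_box (U : set E) s : open U -> U (of_coords s) ->
  exists2 e : R, 0 < e & box s e `<=` of_coords @^-1` U.
Proof.
move=> oU Us; have [e e0 eU] : exists2 e : R, 0 < e & ball (of_coords s : E) e `<=` U.
  by have /nbhs_ballP[e /= e0 eU] := open_nbhs_nbhs (conj oU Us); exists e.
(* The n coordinate errors add up to at most n e / (n + 1), strictly below e even when n = 0. *)
exists (e / n.+1%:R); first by rewrite divr_gt0.
move=> t /boxP st; apply: eU; rewrite -ball_normE /= distrC.
apply: (le_lt_trans (of_coords_dist (e := e / n.+1%:R) _)) => [i|]; first exact: ltW.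
by rewrite mulrC -mulrA gtr_pMr// mulrC ltr_pdivrMr// mul1r ltr_nat.
Qed.

(** Tuples carry the product sigma-algebra, so the preimage of an open set must be exhibited as a
    countable union of boxes: those with rational centre and half-side 1/(k+1) that are contained in
    it. [W] returns the empty set for the other indices. *)
Lemma measurable_of_coords : measurable_fun setT of_coords.
Proof.
apply: (@measurability _ _ _ (borel E) setT of_coords (@open E)); first by [].
move=> _ [U oU <-]; rewrite setTI.
pose W (q : n.-tuple rat * nat) : set (n.-tuple mR) :=
  let b := box [tuple ratr (tnth q.1 i) : R | i < n] (q.2.+1%:R^-1) in
  if `[< b `<=` of_coords @^-1` U >] then b else set0.
rewrite (_ : _ @^-1` _ = \bigcup_k (if @choice.unpickle (n.-tuple rat * nat)%type k is Some q then W q else set0)).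
  apply: bigcupT_measurable => k; case: choice.unpickle => [q|//].
  rewrite /W; case: ifP => // _; exact: measurable_openbox.
apply/seteqP; split; last first.
  move=> t [k _]; case: choice.unpickle => // q; rewrite /W; case: asboolP => // qU; exact: qU.
move=> t Ut; have [e e0 eU] := open_box oU Ut.
(* The factor 2: a point of the box and t are each within 1/(k+1) of the rational centre, hence
   within 2/(k+1) < e of each other. *)
pose k := Num.bound (2 / e).
have ke : 2 / k.+1%:R < e.
  rewrite ltr_pdivrMr// mulrC -ltr_pdivrMr//.
  rewrite (lt_le_trans (archi_boundP _)) ?divr_ge0// ?ltW//.
  by rewrite ltr_nat.
have qex i : exists q : rat, `|tnth t i - ratr q| < k.+1%:R^-1.
  have [q] := @rat_in_itvoo R (tnth t i - k.+1%:R^-1) (tnth t i + k.+1%:R^-1) ltac:(by rewrite ltrBlDr -addrA ltrDl -mulr2n pmulrn_lgt0// invr_gt0).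
  by rewrite in_itv/= => tq; exists q; rewrite ltr_distlC.
pose q := [tuple projT1 (cid (qex i)) | i < n].
exists (choice.pickle (q, k)) => //; rewrite choice.pickleK /W /=.
have tq : box [tuple ratr (tnth q i) | i < n] k.+1%:R^-1 t.
  by apply/boxP => i; rewrite !tnth_mktuple; case: cid.
rewrite asboolT//.
apply: subset_trans eU => s /boxP sq; apply/boxP => i; apply: le_lt_trans ke.
move/boxP in tq.
have -> : tnth s i - tnth t i = (tnth s i - ratr (tnth q i)) - (tnth t i - ratr (tnth q i)).
  by ring.
rewrite (le_trans (ler_normB _ _))// mulr2n mulrDl mul1r lerD// ltW//.
  by have := sq i; rewrite tnth_mktuple.
by have := tq i; rewrite tnth_mktuple.
Qed.

(** [vol u] carries no measure structure; [mu] agrees with it on all sets, so the two are equal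
    functions. Beyond this equality, translation invariance, finiteness on bounded sets and
    positivity on nonempty open sets are all that the sequel uses of Lebesgue measure. *)
Theorem vol_measure :
  exists mu : {sigma_finite_measure set (borel E) -> \bar R},
  [/\ forall A, mu A = vol u A,
      forall (c : E) A, measurable A ->
        mu ((fun x : E => x + c : borel E) @^-1` A) = mu A,
      forall (A : set (borel E)) (M : R), measurable A ->
        (forall x : E, A x -> `|x| <= M) -> (mu A < +oo)%E
    & forall U : set E, open U -> U !=set0 -> (0 < mu (U : set (borel E)))%E].
Proof.
have [m [mE mP]] := lebesgue_tuple_measure R n.
have [m1 m1E] := pushforward_measure_ex m measurable_of_coords.
have bnd (A : set (borel E)) (M : R) : measurable A ->
    (forall x : E, A x -> `|x| <= M) -> (m1 A < +oo)%E.
  move=> mA AM; rewrite m1E.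
  have mB : measurable [set t : n.-tuple mR | forall i, `[- M, M]%classic (tnth t i)].
    by apply: (measurable_box (A := fun=> `[- M, M]%classic)) => i; exact: measurable_itv.
  apply: (@le_lt_trans _ _ (m [set t : n.-tuple mR | forall i, `[- M, M]%classic (tnth t i)])).
    apply: le_measure; rewrite ?inE//.
      by rewrite -[X in measurable X]setTI; apply: measurable_of_coords.
    move=> t /= /AM tM i; rewrite in_itv/= -ler_norml (le_trans _ tM)//.
    by rewrite -[t in tnth t i]of_coordsK tnth_mktuple coord_le_norm.
  rewrite (mP (fun=> `[(- M)%R, M]%classic)) => [|i]; last exact: measurable_itv.
  rewrite (eq_bigr (fun=> (if - M < M then M - - M else 0)%:E)); last first.
    by move=> i _; rewrite lebesgue_measure_itv/= lte_fin; case: ifP => // _; rewrite EFinB.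
  by rewrite prodEFin ltry.
have openM (U : set E) : open U -> measurable (U : set (borel E)).
  by move=> oU; apply: sub_sigma_algebra.
have sf : sigma_finite setT m1.
  exists (fun k => [set x : borel E | `|x : E| < k%:R]).
    apply/esym; rewrite -subTset => x _; exists (Num.bound `|x : E|) => //=.
    by rewrite archi_boundP.
  move=> k; have mk : measurable [set x : borel E | `|x : E| < k%:R].
    apply: openM; rewrite (_ : [set x : E| _] = ball 0 k%:R); first exact: ball_open.
    by apply/funext => x; rewrite -ball_normE /ball_/= sub0r normrN.
  split => //; apply: (bnd _ k%:R) => // x /=; exact: ltW.
have [mu muE] := sigma_finite_measure_ex sf.
exists mu; split => [A|c A mA|A M mA AM|U oU [x Ux]].
- by rewrite muE m1E; exact: mE.
- have mA' : measurable (of_coords @^-1` A).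
    by rewrite -[X in measurable X]setTI; apply: measurable_of_coords.
  rewrite !muE !m1E; etransitivity; first exact: mE.
  etransitivity; last by apply/esym; exact: mE.
  rewrite -[RHS](lebesgue_tuple_shift (to_coords c) mA').
  congr (@lebesgue_tuple R n _).
  by apply/seteqP; split => t /=; rewrite of_coords_shift to_coordsK.
- by rewrite muE; apply: bnd AM.
- rewrite muE m1E; have [e e0 eU] := @open_box U (to_coords x) oU ltac:(by rewrite to_coordsK).
  apply: (@lt_le_trans _ _ (m (box (to_coords x) e))); last first.
    apply: le_measure => //; rewrite inE.
      exact: measurable_openbox.
    by rewrite -[X in measurable X]setTI; apply: measurable_of_coords => //; apply: openM.
  rewrite (mP (fun i => `](tnth (to_coords x) i - e), (tnth (to_coords x) i + e)[%classic)) => [|i]; last exact: measurable_itv.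
  rewrite (eq_bigr (fun=> (e + e)%:E)); last first.
    move=> i _; rewrite lebesgue_measure_itv/= lte_fin ltrD2l gtrN // -EFinB; congr (_%:E); ring.
  by rewrite prodEFin lte_fin prodr_gt0// => i _; rewrite addr_gt0.
Qed.
End VolMeasure.

(** * Complex arithmetic and unordered sums *)

Section ComplexArith.
Variable R : realType.
Local Notation C := R[i].
Local Notation Re := (@complex.Re R).
Local Notation Im := (@complex.Im R).
Implicit Types z w : C.

Lemma complex_eqP z w : Re z = Re w -> Im z = Im w -> z = w.
Proof. by case: z w => [a b] [c d] /= -> ->. Qed.
Lemma ReD z w : Re (z + w) = Re z + Re w. Proof. by case: z w => [? ?] []. Qed.
Lemma ImD z w : Im (z + w) = Im z + Im w. Proof. by case: z w => [? ?] []. Qed.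
Lemma ReN z : Re (- z) = - Re z. Proof. by case: z. Qed.
Lemma ImN z : Im (- z) = - Im z. Proof. by case: z. Qed.
Lemma ReM z w : Re (z * w) = Re z * Re w - Im z * Im w.
Proof. by case: z w => [? ?] []. Qed.
Lemma ImM z w : Im (z * w) = Re z * Im w + Im z * Re w.
Proof. by case: z w => [? ?] []. Qed.
Lemma Re_sum I (s : seq I) (P : pred I) (F : I -> C) :
  Re (\sum_(i <- s | P i) F i) = \sum_(i <- s | P i) Re (F i).
Proof. exact: (big_morph Re ReD). Qed.
Lemma Im_sum I (s : seq I) (P : pred I) (F : I -> C) :
  Im (\sum_(i <- s | P i) F i) = \sum_(i <- s | P i) Im (F i).
Proof. exact: (big_morph Im ImD). Qed.
Lemma ReZ (a : R) z : Re (a%:C%C * z) = a * Re z.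
Proof. by rewrite ReM /= mul0r subr0. Qed.
Lemma ImZ (a : R) z : Im (a%:C%C * z) = a * Im z.
Proof. by rewrite ImM /= mul0r addr0. Qed.
Lemma ReJ z : Re (conjc z) = Re z. Proof. by case: z. Qed.
Lemma ImJ z : Im (conjc z) = - Im z. Proof. by case: z. Qed.

Lemma sqmod_ge0 z : 0 <= sqmod z. Proof. by rewrite addr_ge0 ?sqr_ge0. Qed.
Lemma sqmodM z w : sqmod (z * w) = sqmod z * sqmod w.
Proof. by rewrite /sqmod ReM ImM; ring. Qed.
Lemma sqmodN z : sqmod (- z) = sqmod z.
Proof. by rewrite /sqmod ReN ImN !sqrrN. Qed.
Lemma sqmod0 : sqmod (0 : C) = 0. Proof. by rewrite /sqmod /= expr0n/= addr0. Qed.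
Lemma sqmod_eq0 z : sqmod z = 0 -> z = 0.
Proof.
move=> /eqP; rewrite paddr_eq0 ?sqr_ge0// !sqrf_eq0 => /andP[/eqP a /eqP b].
exact: complex_eqP.
Qed.
Lemma sqmodD2 z w : sqmod (z + w) <= 2 * sqmod z + 2 * sqmod w.
Proof.
rewrite -subr_ge0; suff -> : 2 * sqmod z + 2 * sqmod w - sqmod (z + w) = sqmod (z - w).
  exact: sqmod_ge0.
by rewrite /sqmod !(ReD,ImD,ReN,ImN); ring.
Qed.
(** The difference of the two sides is |e z - w|^2 / e. The first coefficient can be taken close to
    1, so squared norms can be compared in an L^2 limit without taking square roots. *)
Lemma sqmodD_eps (e : R) z w : 0 < e ->
  sqmod (z + w) <= (1 + e) * sqmod z + (1 + e^-1) * sqmod w.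
Proof.
move=> e0; rewrite -subr_ge0.
suff -> : (1 + e) * sqmod z + (1 + e^-1) * sqmod w - sqmod (z + w)
   = e^-1 * sqmod (e%:C%C * z - w).
  by apply: mulr_ge0; [rewrite invr_ge0 ltW|exact: sqmod_ge0].
by rewrite /sqmod !(ReD,ImD,ReN,ImN,ReZ,ImZ); field; rewrite gt_eqF.
Qed.
Lemma normc_sqr z : normc z ^+ 2 = sqmod z.
Proof. by case: z => a b; rewrite /= sqr_sqrtr// addr_ge0 ?sqr_ge0. Qed.
Lemma normc_ge0 z : 0 <= normc z. Proof. by case: z => a b; rewrite /= sqrtr_ge0. Qed.
Lemma Re_le_normc z : `|Re z| <= normc z.
Proof.
by rewrite -(@ler_pXn2r _ 2)// ?nnegrE// ?normc_ge0// normc_sqr real_normK ?num_real// lerDl sqr_ge0.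
Qed.
Lemma Im_le_normc z : `|Im z| <= normc z.
Proof.
by rewrite -(@ler_pXn2r _ 2)// ?nnegrE// ?normc_ge0// normc_sqr real_normK ?num_real// lerDr sqr_ge0.
Qed.
Lemma normc_le_ReIm z : normc z <= `|Re z| + `|Im z|.
Proof.
rewrite -(@ler_pXn2r _ 2)// ?nnegrE ?normc_ge0 ?addr_ge0// normc_sqr /sqmod.
rewrite sqrrD !real_normK ?num_real// -addrA lerD2l lerDr.
by rewrite mulrn_wge0// mulr_ge0.
Qed.
Lemma normc_sum I (s : seq I) (P : pred I) (F : I -> C) :
  normc (\sum_(i <- s | P i) F i) <= \sum_(i <- s | P i) normc (F i).
Proof.
elim/big_ind2 : _ => //; first by rewrite normc0.
by move=> ? ? ? ? h1 h2; rewrite (le_trans (le_normcD _ _))// lerD.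
Qed.
Lemma mulcJ z : z * conjc z = (sqmod z)%:C%C.
Proof. by apply: complex_eqP; rewrite ?ReM ?ImM ReJ ImJ /= /sqmod; ring. Qed.
Lemma Re_mulJ z w : Re (z * conjc w) = 4^-1 * (sqmod (z + w) - sqmod (z - w)).
Proof. by rewrite ReM ReJ ImJ /sqmod !(ReD,ImD,ReN,ImN); field. Qed.
Lemma Im_mulJ z w :
  Im (z * conjc w) = 4^-1 * (sqmod (z + 'i%C * w) - sqmod (z - 'i%C * w)).
Proof. by rewrite ImM ReJ ImJ /sqmod !(ReD,ImD,ReN,ImN,ReM,ImM)/=; field. Qed.

Lemma expiD a b : expi (a + b) = expi a * expi b :> C.
Proof.
by apply: complex_eqP; rewrite ?ReM ?ImM /= ?cosD ?sinD //; ring.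
Qed.
Lemma expi0 : expi 0 = 1 :> C.
Proof. by rewrite /expi cos0 sin0. Qed.
Lemma expiNM a : expi (- a) * expi a = 1 :> C.
Proof. by rewrite -expiD addNr expi0. Qed.
Lemma expiJ a : conjc (expi a) = expi (- a) :> C.
Proof. by rewrite /expi cosN sinN. Qed.
Lemma sqmod_expi a : sqmod (expi a : C) = 1.
Proof. by rewrite /sqmod /= cos2Dsin2. Qed.
Lemma normc_expi a : normc (expi a : C) = 1.
Proof. by rewrite /expi /= cos2Dsin2 sqrtr1. Qed.
Lemma expi_neq0 a : expi a != 0 :> C.
Proof.
by apply/negP => /eqP e; have := sqmod_expi a; rewrite e sqmod0 => /esym/eqP; rewrite oner_eq0.
Qed.
End ComplexArith.

Section Pairing.
Variables (R : realType) (E : normedModType R) (ip : {dot E for idfun}).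
Local Notation pr := (pairing ip).
Lemma pairingDl x y z : pr (x + y) z = pr x z * pr y z.
Proof. by rewrite /pairing ipDl mulrDr expiD. Qed.
Lemma pairingDr x y z : pr x (y + z) = pr x y * pr x z.
Proof. by rewrite /pairing ipDr mulrDr expiD. Qed.
Lemma pairingC x y : pr x y = pr y x. Proof. by rewrite /pairing ipC. Qed.
Lemma pairing0l x : pr 0 x = 1. Proof. by rewrite /pairing ip0l mulr0 expi0. Qed.
Lemma pairingNr x y : pr x (- y) = pr (- x) y.
Proof. by rewrite /pairing ipNl ipNr. Qed.
Lemma pairingNM x y : pr (- x) y * pr x y = 1.
Proof. by rewrite -pairingDl addNr pairing0l. Qed.
Lemma pairingMN x y : pr x y * pr (- x) y = 1.
Proof. by rewrite -pairingDl addrN pairing0l. Qed.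
Lemma pairingJ x y : conjc (pr x y) = pr (- x) y.
Proof. by rewrite /pairing expiJ ipNl mulrN. Qed.
Lemma normc_pairing x y : normc (pr x y) = 1. Proof. exact: normc_expi. Qed.
Lemma sqmod_pairing x y : sqmod (pr x y) = 1. Proof. exact: sqmod_expi. Qed.
Lemma pairing_neq0 x y : pr x y != 0. Proof. exact: expi_neq0. Qed.
Lemma pairing_scale (a : R) x y : pr (a *: x) y = pr x (a *: y).
Proof. by rewrite /pairing ipZl ipZr. Qed.
End Pairing.

Section ComplexLimits.
Variable R : realType.
Local Notation C := R[i].
Local Notation Re := (@complex.Re R).
Local Notation Im := (@complex.Im R).

Definition ccvg (s : nat -> C) (z : C) : Prop :=
  (Re (s k) @[k --> \oo] --> Re z) /\ (Im (s k) @[k --> \oo] --> Im z).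

Lemma ccvg_unique s z w : ccvg s z -> ccvg s w -> z = w.
Proof.
move=> [a b] [c d]; apply: complex_eqP.
  by move/cvg_lim : a => <-//; move/cvg_lim : c => <-.
by move/cvg_lim : b => <-//; move/cvg_lim : d => <-.
Qed.
Lemma ccvg_cst z : ccvg (fun=> z) z. Proof. by split; apply: cvg_cst. Qed.
Lemma ccvgD s t z w : ccvg s z -> ccvg t w -> ccvg (fun k => s k + t k) (z + w).
Proof.
move=> [a b] [c d]; split.
  by rewrite ReD; under eq_cvg do rewrite ReD; apply: cvgD.
by rewrite ImD; under eq_cvg do rewrite ImD; apply: cvgD.
Qed.
Lemma ccvgM s t z w : ccvg s z -> ccvg t w -> ccvg (fun k => s k * t k) (z * w).
Proof.
move=> [a b] [c d]; split.
  by rewrite ReM; under eq_cvg do rewrite ReM; apply: cvgB; apply: cvgM.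
by rewrite ImM; under eq_cvg do rewrite ImM; apply: cvgD; apply: cvgM.
Qed.
Lemma ccvg_sum I (l : seq I) (s : I -> nat -> C) (z : I -> C) :
  (forall i, ccvg (s i) (z i)) ->
  ccvg (fun k => \sum_(i <- l) s i k) (\sum_(i <- l) z i).
Proof.
move=> h; elim: l => [|i l IH].
  by rewrite big_nil; under [X in ccvg X]eq_fun do rewrite big_nil; apply: ccvg_cst.
by rewrite big_cons; under [X in ccvg X]eq_fun do rewrite big_cons; apply: ccvgD.
Qed.
Lemma ccvg_sqmod s z : ccvg s z -> (sqmod (s k) @[k --> \oo] --> sqmod z).
Proof. by move=> [a b]; rewrite /sqmod; apply: cvgD; apply: cvgM. Qed.
Lemma ccvg_near s t z : (\forall k \near \oo, s k = t k) -> ccvg s z -> ccvg t z.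
Proof.
move=> st [a b]; split.
  apply: cvg_trans a; apply: near_eq_cvg; near do rewrite (near st)//.
apply: cvg_trans b; apply: near_eq_cvg; near do rewrite (near st)//.
Unshelve. all: by end_near. Qed.
End ComplexLimits.

Section UnorderedSums.
Variables (R : realType) (I : choiceType).
Local Notation C := R[i].
Local Notation Re := (@complex.Re R).
Local Notation Im := (@complex.Im R).

(** An increasing sequence of finite sets with union S. It turns unordered sums into limits of
    sequences, to which monotone and dominated convergence apply. *)
Definition exhaustion (S : set I) (ss : nat -> {fset I}) : Prop :=
  [/\ forall k i, i \in ss k -> S i,
      forall k l, (k <= l)%N -> {subset ss k <= ss l}
    & forall i, S i -> exists k, i \in ss k].

Lemma summable_le S (F G : I -> R) : (forall i, S i -> `|F i| <= `|G i|) ->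
  summable S (EFin \o G) -> summable S (EFin \o F).
Proof.
move=> FG; apply: le_lt_trans; apply: le_esum => i Si /=.
by rewrite lee_fin FG.
Qed.

Lemma summable_bounded S (F : I -> R) (M : R) :
  (forall A : {fset I}, (forall i, i \in A -> S i) -> \sum_(i <- A) `|F i| <= M) ->
  summable S (EFin \o F).
Proof.
move=> FM; apply: (@le_lt_trans _ _ M%:E); last by rewrite ltry.
apply: ge_ereal_sup => _ [A [finA AS] <-].
rewrite fsbig_finite//= sumEFin lee_fin; apply: FM => i.
by rewrite in_fset_set// inE => /AS.
Qed.

Lemma summableZ S (F : I -> R) (a : R) : summable S (EFin \o F) ->
  summable S (EFin \o (fun i => a * F i)).
Proof.
move=> sF.
suff : (\esum_(i in S) `|(a * F i)%:E| <= `|a|%:E * \esum_(i in S) `|(F i)%:E|)%E.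
  move=> h; apply: (le_lt_trans h); rewrite lte_mul_pinfty ?lee_fin//.
apply: ge_ereal_sup => _ [A [finA AS] <-].
rewrite fsbig_finite//= (eq_bigr (fun i => `|a|%:E * `|F i|%:E)%E); last first.
  by move=> i _; rewrite normrM EFinM.
rewrite -ge0_sume_distrr => [|i _]; last by rewrite lee_fin.
apply: lee_wpmul2l; first by rewrite lee_fin.
apply: ereal_sup_ubound; exists A => //; by rewrite fsbig_finite.
Qed.

(** Every finite subset of S lies in one stage, so the increasing partial sums reach the supremum
    over all finite subsets. *)
Lemma esum_exhaustion S ss (F : I -> \bar R) : exhaustion S ss ->
  (forall i, S i -> 0 <= F i)%E ->
  ((\sum_(i <- ss k) F i)%E @[k --> \oo] --> esum S F).
Proof.
move=> [ssS ssm ssU] F0.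
have nd : nondecreasing_seq (fun k => \sum_(i <- ss k) F i)%E.
  apply/nondecreasing_seqP => k; apply: lee_sum_nneg_subfset.
    by apply: ssm; rewrite leqnSn.
  by move=> i ik _; apply: F0; apply: (ssS k.+1); move: ik; rewrite !inE => /andP[].
have := ereal_nondecreasing_cvgn nd.
suff -> : ereal_sup (range (fun k => \sum_(i <- ss k) F i)%E) = esum S F by [].
apply/eqP; rewrite eq_le; apply/andP; split.
  apply: ge_ereal_sup => _ [k _ <-]; apply: ereal_sup_ubound.
  exists [set` ss k]; first by split => // i; exact: ssS.
  by rewrite fsbig_finite//= set_fsetK.
apply: ge_ereal_sup => _ [A [finA AS] <-].
have cover (l : seq I) : (forall i, i \in l -> S i) ->
    exists k, forall i, i \in l -> i \in ss k.
  elim: l => [|i l IH] h; first by exists 0%N.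
  have [k hk] := IH (fun j jl => h j (@mem_behead _ (i :: l) j jl)).
  have [k' hk'] := ssU i (h i (mem_head _ _)).
  exists (maxn k k') => j; rewrite inE => /orP[/eqP ->|/hk].
    by apply: ssm hk'; rewrite leq_maxr.
  by apply: ssm; rewrite leq_maxl.
have [|k Ak] := cover (fset_set A).
  by move=> i; rewrite in_fset_set// inE => /AS.
rewrite fsbig_finite//; apply: le_trans (ereal_sup_ubound _); last by exists k.
apply: lee_sum_nneg_subfset; first exact: Ak.
by move=> i ik _; apply: F0; apply: (ssS k); move: ik; rewrite !inE => /andP[].
Qed.

Lemma rsum_exhaustion S ss (F : I -> R) : exhaustion S ss ->
  summable S (EFin \o F) ->
  (\sum_(i <- ss k) F i) @[k --> \oo] --> rsum S F.
Proof.
move=> ex sF.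
have sp : esum S (EFin \o F)^\+%E \is a fin_num.
  have := summable_funepos sF; rewrite summableE.
  by rewrite (eq_esum (b := (EFin \o F)^\+)%E) // => i _; rewrite gee0_abs.
have sn : esum S (EFin \o F)^\-%E \is a fin_num.
  have := summable_funeneg sF; rewrite summableE.
  by rewrite (eq_esum (b := (EFin \o F)^\-)%E) // => i _; rewrite gee0_abs.
have cp := esum_exhaustion ex (F := (EFin \o F)^\+)%E (fun i _ => funepos_ge0 _ i).
have cn := esum_exhaustion ex (F := (EFin \o F)^\-)%E (fun i _ => funeneg_ge0 _ i).
rewrite /rsum; apply: (@fine_cvg _ _ _ _ (fun k => (\sum_(i <- ss k) F i)%:E)); rewrite fineK ?fin_numB ?sp ?sn//.
rewrite [X in X @ _](_ : _ = fun k => (\sum_(i <- ss k) (EFin \o F)^\+ i - \sum_(i <- ss k) (EFin \o F)^\- i)%E).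
  by apply: cvgeB => //; rewrite fin_num_adde_defr.
apply/funext => k; rewrite -sumEFin (eq_bigr (fun i => (EFin \o F)^\+ i - (EFin \o F)^\- i)%E); last first.
  by move=> i _; rewrite -[LHS]/((EFin \o F) i) {1}(funeposneg (EFin \o F)).
rewrite big_split /= sumeN// => i j _ _; rewrite fin_num_adde_defl//.
by rewrite funenegE /= -EFin_max.
Qed.

Lemma csum_exhaustion S ss (F : I -> C) : exhaustion S ss -> csummable S F ->
  ccvg (fun k => \sum_(i <- ss k) F i) (csum S F).
Proof.
move=> ex [sR sI]; split => /=.
  by under eq_cvg do rewrite Re_sum; exact: (rsum_exhaustion ex sR).
by under eq_cvg do rewrite Im_sum; exact: (rsum_exhaustion ex sI).
Qed.

Lemma csummable_le S (F : I -> C) (w : I -> R) :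
  (forall i, S i -> normc (F i) <= w i) -> summable S (EFin \o w) ->
  csummable S F.
Proof.
move=> Fw sw; split.
  apply: (summable_le _ sw) => i Si /=.
  by rewrite (le_trans (Re_le_normc _))// (le_trans (Fw _ Si))// ler_norm.
apply: (summable_le _ sw) => i Si /=.
by rewrite (le_trans (Im_le_normc _))// (le_trans (Fw _ Si))// ler_norm.
Qed.

Lemma summable_normc S (F : I -> C) : csummable S F ->
  summable S (EFin \o (fun i => normc (F i))).
Proof.
move=> [sR sI].
have [sR' sI'] : summable S (EFin \o (fun i => `|Re (F i)|)) /\
    summable S (EFin \o (fun i => `|Im (F i)|)).
  by split; [apply: summable_le sR|apply: summable_le sI] => i _ /=; rewrite normr_id.
apply: (@summable_le _ _ (fun i => `|Re (F i)| + `|Im (F i)|)).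
  move=> i _; rewrite (ger0_norm (normc_ge0 _)).
  by rewrite (ger0_norm (addr_ge0 (normr_ge0 _) (normr_ge0 _))); exact: normc_le_ReIm.
apply: le_lt_trans (summableD sR' sI'); apply: le_esum => i _ /=.
by rewrite lexx.
Qed.

Lemma csummableZ S (c : C) (F : I -> C) : csummable S F ->
  csummable S (fun i => c * F i).
Proof.
move=> /summable_normc/(summableZ (normc c)); apply: csummable_le => i _.
by rewrite normcM.
Qed.

Lemma csummableD S (F G : I -> C) : csummable S F -> csummable S G ->
  csummable S (fun i => F i + G i).
Proof.
move=> [FR FI] [GR GI]; split.
  apply: le_lt_trans (summableD FR GR); apply: le_esum => i _ /=.
  by rewrite ReD.
apply: le_lt_trans (summableD FI GI); apply: le_esum => i _ /=.
by rewrite ImD.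
Qed.

Lemma csummable0 S : csummable S (fun _ : I => 0 : C).
Proof.
apply: (@csummable_le _ _ (fun=> 0)) => [i _|]; first by rewrite normc0.
rewrite /summable esum1 ?ltry// => i _ /=; by rewrite normr0.
Qed.

Lemma csummable_sum S J (l : seq J) (F : J -> I -> C) :
  (forall j, csummable S (F j)) -> csummable S (fun i => \sum_(j <- l) F j i).
Proof.
move=> sF; elim: l => [|j l IH].
  by under [X in csummable S X]eq_fun do rewrite big_nil; apply: csummable0.
by under [X in csummable S X]eq_fun do rewrite big_cons; apply: csummableD.
Qed.

Lemma csumZ S ss (c : C) (F : I -> C) : exhaustion S ss -> csummable S F ->
  csum S (fun i => c * F i) = c * csum S F.
Proof.
move=> ex sF; have := csum_exhaustion ex (csummableZ c sF); move/ccvg_unique; apply.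
under [X in ccvg X]eq_fun do rewrite -big_distrr /=.
by apply: ccvgM (csum_exhaustion ex sF); apply: ccvg_cst.
Qed.

Lemma csumD S ss (F G : I -> C) : exhaustion S ss -> csummable S F ->
  csummable S G -> csum S (fun i => F i + G i) = csum S F + csum S G.
Proof.
move=> ex sF sG; have := csum_exhaustion ex (csummableD sF sG); move/ccvg_unique; apply.
under [X in ccvg X]eq_fun do rewrite big_split /=.
by apply: ccvgD; apply: csum_exhaustion.
Qed.

Lemma csum_sum S ss J (l : seq J) (F : J -> I -> C) : exhaustion S ss ->
  (forall j, csummable S (F j)) ->
  csum S (fun i => \sum_(j <- l) F j i) = \sum_(j <- l) csum S (F j).
Proof.
move=> ex sF; have := csum_exhaustion ex (csummable_sum l sF); move/ccvg_unique; apply.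
under [X in ccvg X]eq_fun do rewrite exchange_big /=.
by apply: ccvg_sum => j; exact: csum_exhaustion.
Qed.

Lemma eq_csum S (F G : I -> C) : (forall i, S i -> F i = G i) ->
  csum S F = csum S G.
Proof.
move=> FG; rewrite /csum /rsum; congr ((fine (_ - _)) +i* (fine (_ - _)))%C;
  by apply: eq_esum => i Si; rewrite ?funeposE ?funenegE /= FG.
Qed.

Lemma rsum_reindex S (e : I -> I) (F : I -> R) : set_bij S S e ->
  rsum S (F \o e) = rsum S F.
Proof.
move=> be; rewrite /rsum; congr (fine (_ - _)); apply/esym.
  by rewrite (reindex_esum S S e)//; apply: eq_esum => i _; rewrite !funeposE.
by rewrite (reindex_esum S S e)//; apply: eq_esum => i _; rewrite !funenegE.
Qed.

Lemma csum_reindex S (e : I -> I) (F : I -> C) : set_bij S S e ->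
  csum S (F \o e) = csum S F.
Proof.
move=> be; rewrite /csum -(rsum_reindex (Re \o F) be).
by rewrite -(rsum_reindex (Im \o F) be).
Qed.

Lemma exhaustion_diff S ss k m (G : I -> R) : exhaustion S ss -> (k <= m)%N ->
  \sum_(i <- ss m) G i - \sum_(i <- ss k) G i =
  \sum_(i <- ss m | i \notin ss k) G i.
Proof.
move=> [_ ssm _] km; rewrite (bigID (mem (ss k)))/= -big_filter.
rewrite (perm_big (ss k)) ?[_ + _ - _]addrAC ?subrr ?add0r//.
apply: uniq_perm; rewrite ?filter_uniq ?fset_uniq// => i.
by rewrite mem_filter; apply/andP/idP => [[]//|ik]; split => //; exact: ssm ik.
Qed.

(** The bound depends on F only through its majorant w: a series with a parameter converges
    uniformly as soon as one w dominates it. *)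
Lemma rsum_tail S ss (F w : I -> R) k : exhaustion S ss ->
  (forall i, S i -> `|F i| <= w i) -> summable S (EFin \o w) ->
  `|rsum S F - \sum_(i <- ss k) F i| <= rsum S w - \sum_(i <- ss k) w i.
Proof.
move=> ex Fw sw.
have sF : summable S (EFin \o F).
  apply: (summable_le _ sw) => i Si; by rewrite (le_trans (Fw _ Si))// ler_norm.
have h1 : `|\sum_(i <- ss m) F i - \sum_(i <- ss k) F i| @[m --> \oo] -->
    `|rsum S F - \sum_(i <- ss k) F i|.
  by apply: cvg_norm; apply: cvgB; [exact: rsum_exhaustion|exact: cvg_cst].
have h2 : (\sum_(i <- ss m) w i - \sum_(i <- ss k) w i) @[m --> \oo] -->
    rsum S w - \sum_(i <- ss k) w i.
  by apply: cvgB; [exact: rsum_exhaustion|exact: cvg_cst].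
apply: (ler_cvg_to h1 h2); near=> m.
have km : (k <= m)%N by near: m; exact: nbhs_infty_ge.
rewrite !(exhaustion_diff _ ex km) (le_trans (ler_norm_sum _ _ _))//.
rewrite [leLHS]big_seq_cond [leRHS]big_seq_cond; apply: ler_sum => i /andP[im _].
by apply: Fw; have [ssS _ _] := ex; exact: ssS im.
Unshelve. all: by end_near. Qed.
End UnorderedSums.

(** * Smooth functions and smooth series *)

Section Derivatives.
Variables (R : realType) (V : normedModType R).
Implicit Types (f g : V -> R) (x v : V).

(** Multiplied out, the difference quotient needs no exclusion of h = 0, where both sides vanish;
    remainders can then be added and integrated directly. *)
Lemma is_deriveP f x v (G : R) :
  is_derive x v f G <->
  forall e : R, 0 < e -> exists2 d : R, 0 < d &
    forall h, `|h| < d -> `|f (x + h *: v) - f x - h * G| <= e * `|h|.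
Proof.
split=> [[df dG] e e0|H].
  have : (fun h => h^-1 *: ((f \o shift x) (h *: v) - f x)) @ 0^' --> G.
    by rewrite -dG; exact: df.
  move=> /cvgrPdist_le/(_ _ e0)/=.
  rewrite /dnbhs near_withinE => /nbhs_ballP[d /= d0 dP].
  exists d => // h hd; have [->|h0] := eqVneq h 0.
    by rewrite scale0r addr0 subrr mul0r subr0 normr0 mulr0.
  have := dP h; rewrite /ball/= sub0r normrN => /(_ hd h0) hG.
  rewrite -ler_pdivrMr ?normr_gt0// -normfV mulrC -normrM mulrBr mulKf//.
  by rewrite distrC [x + _]addrC.
suff cv : (fun h => h^-1 *: ((f \o shift x) (h *: v) - f x)) @ 0^' --> G.
  by split; [apply/cvg_ex; exists G|apply/cvg_lim].
apply/cvgrPdist_le => /= e e0; have [d d0 dP] := H e e0.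
rewrite /dnbhs near_withinE; apply/nbhs_ballP; exists d => //= h.
rewrite /ball/= sub0r normrN => hd h0.
have := dP h hd; rewrite -ler_pdivrMr ?normr_gt0// -normfV mulrC -normrM mulrBr mulKf//.
by rewrite distrC [x + _]addrC.
Qed.

Lemma is_derive_unique f x v G : is_derive x v f G -> 'D_v f x = G.
Proof. by case. Qed.

Lemma is_derive_addM f g x v a b : is_derive x v f a -> is_derive x v g b ->
  is_derive x v (fun y => f y * g y) (f x * b + g x * a).
Proof.
move=> [fa <-] [gb <-]; split; first exact: (derivableM fa gb).
by rewrite -[LHS]/('D_v (f * g) x) deriveM.
Qed.

Lemma is_derive_addD f g x v a b : is_derive x v f a -> is_derive x v g b ->
  is_derive x v (fun y => f y + g y) (a + b).
Proof.
move=> [fa <-] [gb <-]; split; first exact: (derivableD fa gb).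
by rewrite -[LHS]/('D_v (f + g) x) deriveD.
Qed.

Lemma is_derive_line f x v t G : is_derive (x + t *: v) v f G ->
  is_derive t 1 (fun s : R => f (x + s *: v)) G.
Proof.
move=> [fD <-]; have fE : (fun h : R => f (h *: v + (x + t *: v))) =
   (fun s : R => f (x + s *: v)) \o shift t.
  by apply/funext => h /=; rewrite scalerDl addrCA addrA.
have E : (fun h : R => h^-1 *: (((fun s : R => f (x + s *: v)) \o shift t) (h *: 1) - f (x + t *: v)))
  = (fun h : R => h^-1 *: ((f \o shift (x + t *: v)) (h *: v) - f (x + t *: v))).
  apply/funext => h /=; congr (_ *: (f _ - _)).
  by rewrite [h *: 1]mulr1 scalerDl addrCA addrA.
by split; rewrite /derivable /derive E.
Qed.

Lemma is_derive_chain f (k : R -> R) x v a b :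
  is_derive (f x) 1 k a -> is_derive x v f b ->
  is_derive x v (fun y => k (f y)) (a * b).
Proof.
move=> ka fb.
have fb' : is_derive (0 : R) 1 (fun s : R => f (x + s *: v)) b.
  by apply: is_derive_line; rewrite scale0r addr0.
have : is_derive (0 : R) 1 (k \o (fun s : R => f (x + s *: v))) (a * b).
  by apply: is_derive1_comp; rewrite /= scale0r addr0.
case=> d1 d2.
have E : (fun h : R => h^-1 *: (((k \o (fun s : R => f (x + s *: v))) \o shift 0) (h *: 1) - (k \o (fun s : R => f (x + s *: v))) 0))
  = (fun h : R => h^-1 *: (((fun y => k (f y)) \o shift x) (h *: v) - k (f x))).
  by apply/funext => h /=; rewrite scale0r !addr0 [h *: 1]mulr1 [x + _]addrC.
by split; [rewrite /derivable -E|rewrite /derive -E].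
Qed.

(** The derivative is bounded on a segment only, because uniform estimates for series and Taylor
    remainders are only available locally. *)
Lemma mvt_line f (df : V -> R) x v (M r : R) :
  (forall y, is_derive y v f (df y)) ->
  (forall t, `|t| <= r -> `|df (x + t *: v)| <= M) ->
  forall h, `|h| <= r -> `|f (x + h *: v) - f x| <= M * `|h|.
Proof.
move=> fD dfM h hr.
have lD (t : R) : is_derive t 1 (fun s : R => f (x + s *: v)) (df (x + t *: v)).
  by apply: is_derive_line; exact: fD.
have lc : continuous (fun s : R => f (x + s *: v)).
  move=> t; apply: differentiable_continuous; apply/derivable1_diffP.
  by have [] := lD t.
have [h0|h0] := leP 0 h.
  have [c] := MVT_segment h0 (fun t _ => lD t) (continuous_subspaceT lc).
  rewrite in_itv /= scale0r addr0 subr0 => /andP[c0 ch] ->.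
  rewrite normrM ler_wpM2r// dfM//; apply: le_trans hr.
  by rewrite !ger0_norm.
have [c] := MVT_segment (ltW h0) (fun t _ => lD t) (continuous_subspaceT lc).
rewrite in_itv /= scale0r addr0 sub0r distrC => /andP[c0 ch] ->.
rewrite normrM normrN ler_wpM2r// dfM//; apply: le_trans hr.
by rewrite !ler0_norm ?lerN2// ltW.
Qed.

(** Uniform convergence is asked of the derivatives only, and only on a segment of the line through
    x. The mean value theorem applied to [fs m - fs k] turns it into a bound on increments, which
    survives the limit in m; the rest is an argument with three thirds of epsilon. *)
Lemma is_derive_limit (fs ds : nat -> V -> R) f x v (G : R) (a : nat -> R) :
  (forall k y, is_derive y v (fs k) (ds k y)) ->
  (forall y, (fs k y) @[k --> \oo] --> f y) ->
  (ds k x) @[k --> \oo] --> G ->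
  a k @[k --> \oo] --> 0 ->
  (forall k m t, (k <= m)%N -> `|t| <= 1 ->
     `|ds m (x + t *: v) - ds k (x + t *: v)| <= a k) ->
  is_derive x v f G.
Proof.
move=> fD ff dG a0 da; apply/is_deriveP => e e0.
have e3 : 0 < e / 3 by rewrite divr_gt0.
have [k [ak dk]] : exists k, a k <= e / 3 /\ `|G - ds k x| <= e / 3.
  have h1 : \forall k \near \oo, `|a k - 0| <= e / 3.
    by move/cvgrPdist_le : a0 => /(_ _ e3); apply: filterS => k; rewrite distrC.
  have h2 : \forall k \near \oo, `|G - ds k x| <= e / 3.
    by move/cvgrPdist_le : dG => /(_ _ e3).
  near \oo => k; exists k; split; last by near: k.
  by apply: (le_trans (ler_norm _)); rewrite -[a k]subr0; near: k.
have [d d0 dP] := (is_deriveP _ _ _ _).1 (fD k x) _ e3.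
exists (Num.min d 1); first by rewrite lt_min d0 ltr01.
move=> h; rewrite lt_min => /andP[hd /ltW h1].
have lim : `|(f (x + h *: v) - fs k (x + h *: v)) - (f x - fs k x)| <= e / 3 * `|h|.
  have c1 : `|(fs m (x + h *: v) - fs k (x + h *: v)) - (fs m x - fs k x)| @[m --> \oo]
     --> `|(f (x + h *: v) - fs k (x + h *: v)) - (f x - fs k x)|.
    apply: cvg_norm; apply: cvgB; apply: cvgB; try exact: cvg_cst; exact: ff.
  apply: (cvgr_to_le c1); near=> m.
  have km : (k <= m)%N by near: m; exact: nbhs_infty_ge.
  apply: (@mvt_line (fun y => fs m y - fs k y) (fun y => ds m y - ds k y) x v (e / 3) 1) => //.
  by move=> t t1; apply: le_trans ak; apply: da.
have -> : f (x + h *: v) - f x - h * G =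
  ((f (x + h *: v) - fs k (x + h *: v)) - (f x - fs k x)) +
  (fs k (x + h *: v) - fs k x - h * ds k x) + h * (ds k x - G) by ring.
rewrite (le_trans (ler_normD _ _))//.
have -> : e * `|h| = (e / 3 * `|h| + e / 3 * `|h|) + e / 3 * `|h| by field.
rewrite lerD//; last by rewrite normrM mulrC ler_wpM2r// distrC.
by rewrite (le_trans (ler_normD _ _))// lerD// dP.
Unshelve. all: by end_near. Qed.
End Derivatives.

Local Notation iterD := Pilot.Defs.iterD.

Section Smooth.
Variables (R : realType) (V : normedModType R).
Implicit Types (f g : V -> R) (x v : V).
Local Notation "''DD_' v" := (fun g : V -> R => (fun x => derive g x v)) (at level 8, v at level 2).

(** The head of the list is the outermost derivative. Peeling off the innermost one transfers
    smoothness and decay from g to its derivatives. *)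
Lemma iterD_rcons vs v g : iterD (rcons vs v) g = iterD vs ('DD_v g).
Proof. by elim: vs => //= w vs ->. Qed.

Section Coinduction.
Variable S : (V -> R) -> Prop.
Hypothesis Sc : forall g, S g -> continuous g.
Hypothesis Sd : forall g, S g -> forall x v, derivable g x v.
Hypothesis SD : forall g v, S g -> S ('DD_v g).

Lemma iterD_closed vs g : S g -> S (iterD vs g).
Proof. by elim: vs => //= v vs IH Sg; apply/SD/IH. Qed.

(** A coinduction principle: a class of continuous, directionally differentiable functions stable
    under directional derivatives consists of smooth functions. It serves for products, affine
    substitutions and series. *)
Lemma smooth_coind g : S g -> smooth g.
Proof.
by move=> Sg vs; split; [apply/Sc/iterD_closed|apply/Sd/iterD_closed].
Qed.
End Coinduction.

Lemma smooth_continuous g : smooth g -> continuous g.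
Proof. by move=> /(_ [::]) []. Qed.
Lemma smooth_derivable g x v : smooth g -> derivable g x v.
Proof. by move=> /(_ [::]) []. Qed.
Lemma smooth_is_derive g x v : smooth g -> is_derive x v g ('D_v g x).
Proof. by move=> /smooth_derivable h; apply: derivableP. Qed.
Lemma smooth_derive g v : smooth g -> smooth ('DD_v g).
Proof. by move=> sg vs; have := sg (rcons vs v); rewrite iterD_rcons. Qed.
(* Closed under directional derivatives, hence made of smooth functions. *)
Inductive smooth_alg : (V -> R) -> Prop :=
| alg_base g : smooth g -> smooth_alg g
| alg_cst (c : R) : smooth_alg (fun=> c)
| alg_add f g : smooth_alg f -> smooth_alg g -> smooth_alg (fun x => f x + g x)
| alg_mul f g : smooth_alg f -> smooth_alg g -> smooth_alg (fun x => f x * g x)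
| alg_cos g : smooth g -> smooth_alg (fun x => cos (g x))
| alg_sin g : smooth g -> smooth_alg (fun x => sin (g x)).

Lemma smooth_alg_continuous g : smooth_alg g -> continuous g.
Proof.
elim => {g}.
- by move=> g; apply: smooth_continuous.
- by move=> c; apply: cst_continuous.
- by move=> f g _ fc _ gc x; apply: cvgD; [apply: fc|apply: gc].
- by move=> f g _ fc _ gc x; apply: cvgM; [apply: fc|apply: gc].
- move=> g /smooth_continuous gc x.
  by apply: continuous_comp; [exact: gc|exact: continuous_cos].
- move=> g /smooth_continuous gc x.
  by apply: continuous_comp; [exact: gc|exact: continuous_sin].
Qed.

Lemma smooth_alg_derive g v : smooth_alg g ->
  exists2 dg, smooth_alg dg & forall x, is_derive x v g (dg x).
Proof.
elim => {g}.
- move=> g sg; exists ('DD_v g); first exact/alg_base/smooth_derive.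
  by move=> x; apply: smooth_is_derive.
- by move=> c; exists (fun=> 0) => [|x]; [apply: alg_cst|apply: is_derive_cst].
- move=> f g _ [df adf fD] _ [dg adg gD]; exists (fun x => df x + dg x) => [|x].
    exact: alg_add.
  exact: is_derive_addD.
- move=> f g af [df adf fD] ag [dg adg gD].
  exists (fun x => f x * dg x + g x * df x) => [|x]; last exact: is_derive_addM.
  by apply: alg_add; apply: alg_mul.
- move=> g sg; exists (fun x => (-1 * sin (g x)) * 'D_v g x) => [|x].
    apply: alg_mul; last exact/alg_base/smooth_derive.
    by apply: alg_mul; [apply: alg_cst|apply: alg_sin].
  rewrite mulN1r; apply: (@is_derive_chain _ _ g cos); last exact: smooth_is_derive.
- move=> g sg; exists (fun x => cos (g x) * 'D_v g x) => [|x].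
    by apply: alg_mul; [apply: alg_cos|apply/alg_base/smooth_derive].
  apply: (@is_derive_chain _ _ g sin); last exact: smooth_is_derive.
Qed.

Lemma smooth_alg_smooth g : smooth_alg g -> smooth g.
Proof.
apply: smooth_coind => {}g.
- exact: smooth_alg_continuous.
- by move=> + x v => /(smooth_alg_derive v)[dg _ /(_ x)[]].
- move=> v /(smooth_alg_derive v)[dg adg gD].
  by rewrite (_ : (fun x => _) = dg)//; apply/funext => x; have [_ ->] := gD x.
Qed.

Lemma smooth_cst (c : R) : smooth (fun _ : V => c).
Proof. exact/smooth_alg_smooth/alg_cst. Qed.
Lemma smoothD f g : smooth f -> smooth g -> smooth (fun x => f x + g x).
Proof. by move=> sf sg; apply/smooth_alg_smooth/alg_add; apply: alg_base. Qed.
Lemma smoothM f g : smooth f -> smooth g -> smooth (fun x => f x * g x).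
Proof. by move=> sf sg; apply/smooth_alg_smooth/alg_mul; apply: alg_base. Qed.
Lemma smoothN f : smooth f -> smooth (fun x => - f x).
Proof.
move=> sf; have := smoothM (smooth_cst (-1)) sf.
by under [X in smooth X -> _]eq_fun do rewrite mulN1r.
Qed.
Lemma smoothB f g : smooth f -> smooth g -> smooth (fun x => f x - g x).
Proof. by move=> sf sg; apply: smoothD => //; apply: smoothN. Qed.
Lemma smooth_cos f : smooth f -> smooth (fun x => cos (f x)).
Proof. by move=> sf; apply/smooth_alg_smooth/alg_cos. Qed.
Lemma smooth_sin f : smooth f -> smooth (fun x => sin (f x)).
Proof. by move=> sf; apply/smooth_alg_smooth/alg_sin. Qed.
Lemma smooth_sum I (s : seq I) (F : I -> V -> R) :
  (forall i, smooth (F i)) -> smooth (fun x => \sum_(i <- s) F i x).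
Proof.
move=> sF; elim: s => [|i s IH].
  by under [X in smooth X]eq_fun do rewrite big_nil; exact: smooth_cst.
by under [X in smooth X]eq_fun do rewrite big_cons; exact: smoothD.
Qed.

(** The derivative in direction v is the constant g v, so g and the constants form a class closed
    under derivatives. *)
Lemma smooth_linear g : continuous g ->
  (forall x v (h : R), g (x + h *: v) = g x + h * g v) -> smooth g.
Proof.
move=> gc gl.
pose S (k : V -> R) := k = g \/ exists c, k = fun=> c.
have gD x v : is_derive x v g (g v).
  apply/is_deriveP => e e0; exists 1 => // h _.
  by rewrite gl addrAC addrK subrr normr0 mulr_ge0// ltW.
apply: (smooth_coind (S := S)) => [k|k|k v|]; last by left.
- by move=> [->|[c ->]] //; apply: cst_continuous.
- move=> [->|[c ->]] x v; last exact: derivable_cst.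
  by have [] := gD x v.
- move=> [->|[c ->]]; right.
    by exists (g v); apply/funext => x; have [_ ->] := gD x v.
  by exists 0; apply/funext => x; rewrite -[LHS]/('D_v (cst c) x) derive_cst.
Qed.
End Smooth.

Section SmoothComp.
Variables (R : realType) (V W : normedModType R).

(** [A0] is the linear part of [A]. The derivative of g o A along v is the derivative of g along A0
    v, composed with A, so functions of this shape are closed under derivatives; this avoids a
    general chain rule. *)
Lemma smooth_comp_affine (A A0 : V -> W) (g : W -> R) : continuous A ->
  (forall x v (h : R), A (x + h *: v) = A x + h *: A0 v) ->
  smooth g -> smooth (fun x => g (A x)).
Proof.
move=> Ac Al sg.
pose S (k : V -> R) := exists2 g, smooth g & k = fun x => g (A x).
have kD (k : W -> R) x v : smooth k ->
    is_derive x v (fun x => k (A x)) ('D_(A0 v) k (A x)).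
  move=> sk; apply/is_deriveP => e e0.
  have [d d0 dP] := (is_deriveP _ _ _ _).1 (smooth_is_derive (A x) (A0 v) sk) _ e0.
  by exists d => // h hd; rewrite Al; apply: dP.
apply: (smooth_coind (S := S)) => [_ [k sk ->]|_ [k sk ->] x v|_ v [k sk ->]|].
- move=> x; apply: continuous_comp; [exact: Ac|exact: smooth_continuous].
- by have [] := kD k x v sk.
- exists (fun y => 'D_(A0 v) k y); first exact: smooth_derive.
  by apply/funext => x; have [_ ->] := kD k x v sk.
- by exists g.
Qed.

Lemma derive_comp_affine (A A0 : V -> W) (g : W -> R) x v :
  (forall x v (h : R), A (x + h *: v) = A x + h *: A0 v) ->
  smooth g -> 'D_v (fun x => g (A x)) x = 'D_(A0 v) g (A x).
Proof.
move=> Al sg; apply: is_derive_unique; apply/is_deriveP => e e0.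
have [d d0 dP] := (is_deriveP _ _ _ _).1 (smooth_is_derive (A x) (A0 v) sg) _ e0.
by exists d => // h hd; rewrite Al; apply: dP.
Qed.
End SmoothComp.

(** * Termwise differentiation of series *)

Section SmoothSeries.
Variables (R : realType) (V : normedModType R) (I : choiceType).
Variables (S : set I) (ss : nat -> {fset I}) (w : I -> R).
Hypothesis ex : exhaustion S ss.
Hypothesis sw : summable S (EFin \o w).
Hypothesis w0 : forall i, S i -> 0 <= w i.
Variable T : (I -> V -> R) -> Prop.
Hypothesis Tc : forall H i, T H -> continuous (H i).
Hypothesis Td : forall H i, T H -> forall x v, derivable (H i) x v.
Hypothesis TD : forall H v, T H -> T (fun i x => 'D_v (H i) x).
Hypothesis Tw : forall H (rho : R), T H -> exists2 C : R, 0 <= C &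
  forall i x, S i -> `|x| <= rho -> `|H i x| <= C * w i.

Local Notation tail k := (rsum S w - \sum_(i <- ss k) w i).

Lemma tail_cvg0 : (tail k) @[k --> \oo] --> 0.
Proof.
rewrite -[X in _ --> X](subrr (rsum S w)).
by apply: cvgB; [exact: cvg_cst|exact: rsum_exhaustion].
Qed.

Lemma locally_summable H x : T H -> summable S (EFin \o (fun i => H i x)).
Proof.
move=> TH; have [C C0 HC] := Tw `|x| TH.
apply: summable_le (summableZ C sw) => i Si.
by rewrite (le_trans (HC i x Si (lexx _)))// ler_norm.
Qed.

Lemma locally_tail H (rho : R) : T H -> exists2 C : R, 0 <= C &
  forall k x, `|x| <= rho ->
   `|rsum S (fun i => H i x) - \sum_(i <- ss k) H i x| <= C * tail k.
Proof.
move=> TH; have [C C0 HC] := Tw rho TH; exists C => // k x xr.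
have sCw := summableZ C sw.
have := rsum_tail k ex (fun i Si => HC i x Si xr) sCw.
suff -> : rsum S (fun i => C * w i) = C * rsum S w.
  by rewrite mulrBr big_distrr.
have h1 := rsum_exhaustion ex sCw; have h2 := rsum_exhaustion ex sw.
have h3 : (C * \sum_(i <- ss k) w i) @[k --> \oo] --> C * rsum S w.
  by apply: cvgM => //; apply: cvg_cst.
have E : (fun m => \sum_(i <- ss m) C * w i) = (fun m => C * \sum_(i <- ss m) w i).
  by apply/funext => m; rewrite big_distrr.
by move: h1; rewrite E => /cvg_lim <-//; move/cvg_lim : h3 => <-.
Qed.

Lemma series_continuous H : T H -> continuous (fun x => rsum S (fun i => H i x)).
Proof.
move=> TH x; apply/cvgrPdist_le => /= e e0.
have e3 : 0 < e / 3 by rewrite divr_gt0.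
have [C C0 HC] := locally_tail (`|x| + 1) TH.
have [k kC] : exists k, C * tail k <= e / 3.
  have : (C * tail k) @[k --> \oo] --> C * 0.
    by apply: cvgM; [exact: cvg_cst|exact: tail_cvg0].
  rewrite mulr0 => /cvgrPdist_le/(_ _ e3)[k _ kP]; exists k.
  by have := kP k (leqnn _); rewrite /= sub0r normrN; apply/le_trans/ler_norm.
have : (fun y => \sum_(i <- ss k) H i y) @ x --> \sum_(i <- ss k) H i x.
  elim: (enum_fset (ss k)) => [|i l IH].
    by under eq_cvg do rewrite big_nil; rewrite big_nil; apply: cvg_cst.
  under eq_cvg do rewrite big_cons; rewrite big_cons; apply: cvgD => //.
  exact: Tc.
move=> /cvgrPdist_le/(_ _ e3) hk; near=> y.
have y1 : `|y| <= `|x| + 1.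
  rewrite -lerBlDl (le_trans (lerB_dist _ _))// distrC ltW//.
have -> : rsum S (fun i => H i x) - rsum S (fun i => H i y) =
  (rsum S (fun i => H i x) - \sum_(i <- ss k) H i x) +
  (\sum_(i <- ss k) H i x - \sum_(i <- ss k) H i y) -
  (rsum S (fun i => H i y) - \sum_(i <- ss k) H i y) by ring.
rewrite (le_trans (ler_normB _ _))//.
have -> : e = e / 3 + e / 3 + e / 3 by field.
rewrite lerD//; last by apply: le_trans kC; apply: HC.
rewrite (le_trans (ler_normD _ _))// lerD//; last by near: y.
by apply: le_trans kC; apply: HC; rewrite lerDl.
Unshelve. all: by end_near. Qed.

Lemma series_is_derive H x v : T H ->
  is_derive x v (fun x => rsum S (fun i => H i x))
    (rsum S (fun i => 'D_v (H i) x)).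
Proof.
move=> TH; have TDH := TD v TH.
have [C C0 HC] := locally_tail (`|x| + `|v|) TDH.
have tail0 k m : (k <= m)%N -> C * tail m <= C * tail k.
  move=> km; rewrite ler_wpM2l// lerB// -subr_ge0 (exhaustion_diff _ ex km).
  rewrite big_seq_cond; apply: sumr_ge0 => i /andP[im _].
  by have [ssS _ _] := ex; exact/w0/(ssS _ _ im).
apply: (@is_derive_limit _ _ (fun k y => \sum_(i <- ss k) H i y)
  (fun k y => \sum_(i <- ss k) 'D_v (H i) y) _ _ _ _ (fun k => C * tail k + C * tail k)).
- move=> k y; elim: (enum_fset (ss k)) => [|i l IH].
    rewrite big_nil; under [X in is_derive _ _ X _]eq_fun do rewrite big_nil.
    exact: is_derive_cst.
  rewrite big_cons; under [X in is_derive _ _ X _]eq_fun do rewrite big_cons.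
  by apply: is_derive_addD => //; apply: derivableP; apply: Td.
- by move=> y; apply: rsum_exhaustion => //; apply: locally_summable.
- by apply: (rsum_exhaustion ex); exact: (locally_summable _ TDH).
- have h : (C * tail k) @[k --> \oo] --> C * 0.
    by apply: cvgM; [exact: cvg_cst|exact: tail_cvg0].
  rewrite mulr0 in h; rewrite -[X in _ --> X](addr0 (0 : R)).
  exact: (cvgD h h).
- move=> k m t km t1.
  have nx : `|x + t *: v| <= `|x| + `|v|.
    rewrite (le_trans (ler_normD _ _))// lerD2l normrZ.
    by rewrite ler_piMl.
  rewrite -(subrKA (rsum S (fun i => 'D_v (H i) (x + t *: v)))).
  rewrite (le_trans (ler_normD _ _))// lerD//; last exact: HC.
  by rewrite distrC (le_trans (HC _ _ nx))// tail0.
Qed.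

(** [T] is a class of families stable under termwise derivatives, each bounded on every ball by a
    multiple of the same summable [w]. Sums of such families are then closed under derivatives, and
    coinduction applies. *)
Lemma series_smooth H : T H -> smooth (fun x => rsum S (fun i => H i x)).
Proof.
move=> TH.
pose P (g : V -> R) := exists2 H, T H & g = fun x => rsum S (fun i => H i x).
apply: (smooth_coind (S := P)) => [_ [G TG ->]|_ [G TG ->] x v|_ v [G TG ->]|].
- exact: series_continuous.
- by have [] := series_is_derive x v TG.
- exists (fun i x => 'D_v (G i) x); first exact: TD.
  by apply/funext => x; have [_ ->] := series_is_derive x v TG.
- by exists H.
Qed.
End SmoothSeries.

(** * The lattice, its dual and the discriminant group *)

Section ExpiInt.
Variable R : realType.

Lemma expi_int (m : int) : expi (2 * pi * m%:~R) = 1 :> R[i].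
Proof.
have nat_case (k : nat) : expi (2 * pi * k%:R) = 1 :> R[i].
  elim: k => [|k IH]; first by rewrite mulr0 expi0.
  rewrite -[k.+1%:R]natr1 mulrDr mulr1 expiD IH mul1r /expi.
  by rewrite mulrC mulr_natr cos2pi sin2pi.
case: m => k; first exact: nat_case.
rewrite NegzE mulrNz mulrN; have := expiNM (2 * pi * k.+1%:R : R).
by rewrite -pmulrn nat_case mulr1.
Qed.

(** By the half-angle formula 1 - cos(2 pi x) = 2 sin(pi x)^2, and pi x lies strictly between 0 and
    pi. *)
Lemma cos_lt1 (x : R) : 0 < x < 1 -> cos (2 * pi * x) < 1.
Proof.
move=> /andP[x0 x1].
have -> : 2 * pi * x = (pi * x) *+ 2 by rewrite mulr2n; ring.
rewrite cos_mulr2n cos2sin2.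
have : 0 < sin (pi * x).
  apply: sin_gt0_pi; rewrite mulr_gt0 ?pi_gt0//= -[ltRHS]mulr1.
  by rewrite ltr_pM2l ?pi_gt0.
by nra.
Qed.

Lemma expi_eq1 (x : R) : expi (2 * pi * x) = 1 -> x \is a Num.int.
Proof.
move=> e1; have x0 : 0 <= x - (Num.floor x)%:~R < 1.
  by rewrite subr_ge0 ltrBlDl -intrD1 ge_floor/= floorD1_gt.
have : expi (2 * pi * (x - (Num.floor x)%:~R)) = 1.
  by rewrite mulrBr expiD e1 mul1r -mulrN -mulrNz expi_int.
case/andP: x0; rewrite le_eqVlt => /orP[/eqP/esym/eqP|x0 x1].
  by rewrite subr_eq0 => /eqP -> _ _; rewrite intr_int.
move=> /(congr1 (@complex.Re R)) /= c1.
by have := cos_lt1 (introT andP (conj x0 x1)); rewrite c1 ltxx.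
Qed.

Lemma expi_eq1P (x : R) : expi (2 * pi * x) = 1 <-> x \is a Num.int.
Proof. by split=> [/expi_eq1//|/intrP[m ->]]; rewrite expi_int. Qed.
End ExpiInt.

Section Lattice.
Variables (R : realType) (E : normedModType R) (ip : {dot E for idfun}).
Variables (n : nat).

(** [bd] is the basis dual to [b]: pairing with [bd i] reads the i-th coordinate in [b], pairing
    with [b i] the i-th coordinate in [bd]. It generates the dual lattice, so membership in either
    lattice becomes integrality of n coordinates. *)
Record lattice_basis (u b bd : 'I_n -> E) (L : set E) : Prop := {
  lat_onb : euclidean ip u;
  lat_ip : forall i j, ip (b i) (bd j) = (i == j)%:R;
  lat_sum : forall x, x = \sum_i ip x (bd i) *: b i;
  lat_set : L = [set \sum_i b i *~ m i | m in [set: 'I_n -> int]]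
}.

(** The matrix B of [b] in the orthonormal basis is square because the rank is the dimension, and
    freeness makes it invertible. The columns of its inverse are the coordinates of the dual
    basis. *)
Lemma lattice_basis_ex (u : 'I_n -> E) (L : set E) :
  euclidean ip u -> full_rank_lattice n L ->
  exists b bd, lattice_basis u b bd L.
Proof.
move=> eu [b [bfree LE]].
pose B : 'M[R]_n := \matrix_(i, j) ip (b i) (u j).
have Bu : B \in unitmx.
  rewrite -row_free_unit; apply/inj_row_free => v vB.
  have : \sum_i v 0 i *: b i = 0.
    rewrite (onb_sum eu (\sum_i _)) big1// => j _.
    have := congr1 (fun M : 'rV[R]_n => M 0 j) vB; rewrite !mxE => vBj.
    rewrite ip_suml (eq_bigr (fun i => v 0 i * B i j)) ?vBj ?scale0r//.
    by move=> i _; rewrite ipZl mxE.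
  by move/bfree => v0; apply/rowP => i; rewrite v0 mxE.
pose bd i := \sum_j invmx B j i *: u j.
have bbd x i : ip x (bd i) = \sum_j ip x (u j) * invmx B j i.
  by rewrite ip_sumr; apply: eq_bigr => j _; rewrite ipZr mulrC.
exists b, bd; split => // [i j|x].
  rewrite bbd; have := congr1 (fun M : 'M[R]_n => M i j) (mulmxV Bu).
  by rewrite !mxE => <-; apply: eq_bigr => k _; rewrite mxE.
pose xi : 'rV[R]_n := \row_j ip x (u j).
rewrite [LHS](onb_sum eu) [RHS](onb_sum eu); apply: eq_bigr => j _.
congr (_ *: _); rewrite ip_suml.
have := congr1 (fun M : 'rV[R]_n => M 0 j) (mulmxKV Bu xi); rewrite !mxE => <-.
apply: eq_bigr => i _; rewrite ipZl !mxE; congr (_ * _).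
by rewrite bbd; apply: eq_bigr => k _; rewrite mxE.
Qed.

Variables (u b bd : 'I_n -> E) (L : set E).
Hypothesis HL : lattice_basis u b bd L.
Local Notation dL := (Pilot.Defs.dual ip L).

Lemma ip_eq0 x : (forall y, ip x y = 0) -> x = 0.
Proof.
move=> /(_ x); rewrite -(normE (lat_onb HL)) => /eqP.
by rewrite expf_eq0/= normr_eq0 => /eqP.
Qed.

Lemma ip_bbd x y : ip x y = \sum_i ip x (bd i) * ip y (b i).
Proof.
rewrite {1}(lat_sum HL x) ip_suml; apply: eq_bigr => i _.
by rewrite ipZl (ipC _ (b i)).
Qed.

Lemma lat_dual_sum x : x = \sum_i ip x (b i) *: bd i.
Proof.
apply/eqP; rewrite -subr_eq0; apply/eqP/ip_eq0 => y.
rewrite ipBl ip_suml (ipC _ x) ip_bbd -sumrB big1// => i _.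
by rewrite ipZl (ipC _ (bd i)) mulrC subrr.
Qed.

Lemma latP l : L l <-> forall i, ip l (bd i) \is a Num.int.
Proof.
rewrite (lat_set HL); split=> [[m _ <-] i|H].
  rewrite ip_suml; apply: rpred_sum => j _.
  by rewrite ipC ipMzr ipC (lat_ip HL) rpredMz// rpred_nat.
exists (fun i => Num.floor (ip l (bd i))) => //.
rewrite [RHS](lat_sum HL); apply: eq_bigr => i _.
by rewrite -scaler_int floorK.
Qed.

Lemma pairing_eq1 x y : pairing ip x y = 1 <-> ip x y \is a Num.int.
Proof. exact: expi_eq1P. Qed.

Lemma lat_b i : L (b i).
Proof. by apply/latP => j; rewrite (lat_ip HL) rpred_nat. Qed.

Lemma dualP y : dL y <-> forall i, ip y (b i) \is a Num.int.
Proof.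
split=> [yd i|H l /latP Ll].
  by rewrite ipC; apply/pairing_eq1/yd/lat_b.
apply/pairing_eq1; rewrite ip_bbd; apply: rpred_sum => i _.
by apply: rpredM; [exact: Ll|exact: H].
Qed.

Lemma dual_bd i : dL (bd i).
Proof. by apply/dualP => j; rewrite ipC (lat_ip HL) rpred_nat. Qed.

Lemma lat0 : L 0. Proof. by apply/latP => i; rewrite ip0l rpred0. Qed.
Lemma latD x y : L x -> L y -> L (x + y).
Proof. by move=> /latP Lx /latP Ly; apply/latP => i; rewrite ipDl rpredD. Qed.
Lemma latN x : L x -> L (- x).
Proof. by move=> /latP Lx; apply/latP => i; rewrite ipNl rpredN. Qed.
Lemma latB x y : L x -> L y -> L (x - y).
Proof. by move=> Lx Ly; apply: latD => //; exact: latN. Qed.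
Lemma dual0 : dL 0. Proof. by apply/dualP => i; rewrite ip0l rpred0. Qed.
Lemma dualD x y : dL x -> dL y -> dL (x + y).
Proof. by move=> /dualP Lx /dualP Ly; apply/dualP => i; rewrite ipDl rpredD. Qed.
Lemma dualN x : dL x -> dL (- x).
Proof. by move=> /dualP Lx; apply/dualP => i; rewrite ipNl rpredN. Qed.
Lemma dualB x y : dL x -> dL y -> dL (x - y).
Proof. by move=> Lx Ly; apply: dualD => //; exact: dualN. Qed.

Lemma dual_pairing x y : L x -> dL y -> pairing ip x y = 1.
Proof. by move=> Lx dy; exact: dy. Qed.

Lemma bidual x : (forall y, dL y -> ip x y \is a Num.int) -> L x.
Proof. by move=> H; apply/latP => i; apply: H; exact: dual_bd. Qed.

(** The half-open parallelepiped spanned by [b]: an exact set of representatives of E modulo L,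
    whereas the fundamental domain of the theorem is one only up to null sets. *)
Definition cell : set E := [set x | forall i, 0 <= ip x (bd i) < 1].
Definition lat_floor (x : E) : E := \sum_i b i *~ Num.floor (ip x (bd i)).

Lemma ip_lat_sum (m : 'I_n -> int) i :
  ip (\sum_i b i *~ m i) (bd i) = (m i)%:~R.
Proof.
rewrite ip_suml (bigD1 i)//= ipC ipMzr ipC (lat_ip HL) eqxx big1 ?addr0// => j ji.
by rewrite ipC ipMzr ipC (lat_ip HL) (negbTE ji) mul0rz.
Qed.

Lemma lat_floor_lat x : L (lat_floor x).
Proof. by apply/latP => i; rewrite ip_lat_sum intr_int. Qed.

Lemma sub_lat_floor x : cell (x - lat_floor x).
Proof.
move=> i; rewrite ipBl ip_lat_sum subr_ge0 ltrBlDl -intrD1 ge_floor/=.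
by rewrite floorD1_gt.
Qed.

Lemma cell_unique x l : L l -> cell x -> cell (x + l) -> l = 0.
Proof.
move=> /latP Ll cx cxl; rewrite (lat_sum HL l) big1// => i _.
have /intrP[m lm] := Ll i; have := cx i; have := cxl i; rewrite ipDl lm.
move=> /andP[h1 h2] /andP[h3 h4].
have m1 : (m%:~R : R) < 1%:~R by lra.
have m2 : ((-1)%:~R : R) < m%:~R by rewrite mulrNz; lra.
rewrite !ltr_int in m1 m2; suff -> : m = 0 by rewrite scale0r.
by apply/eqP; rewrite eq_le -ltzD1 m1/=; rewrite -[0]/(-1 + 1 : int) lezD1.
Qed.

Lemma cell_bounded x : cell x -> `|x| <= \sum_i `|b i|.
Proof.
move=> cx; rewrite {1}(lat_sum HL x) (le_trans (ler_norm_sum _ _ _))//.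
apply: ler_sum => i _; rewrite normrZ ler_piMl//.
by have /andP[h1 h2] := cx i; rewrite ger0_norm// ltW.
Qed.

Definition dual_box (k : nat) : set E :=
  [set y | dL y /\ forall i, `|ip y (b i)| <= k%:R].

(** Each index has 2k+1 values, shifted by k, so each coordinate in [bd] runs over the integers from
    -k to k. *)
Definition box_point k (phi : {ffun 'I_n -> 'I_(k.*2.+1)}) : E :=
  \sum_i bd i *~ ((phi i)%:Z - k%:Z).

Lemma ip_box_point k (phi : {ffun 'I_n -> 'I_(k.*2.+1)}) i :
  ip (box_point phi) (b i) = (phi i)%:R - k%:R.
Proof.
rewrite ip_suml (bigD1 i)//= ipC ipMzr (lat_ip HL) eqxx big1 ?addr0 => [|j ji].
  by rewrite mulrzBr -!pmulrn.
by rewrite ipC ipMzr (lat_ip HL) eq_sym (negbTE ji) mul0rz.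
Qed.

Lemma dual_box_image k y : dual_box k y ->
  exists phi : {ffun 'I_n -> 'I_(k.*2.+1)}, y = box_point phi.
Proof.
move=> [/dualP yd yk].
pose m i : int := Num.floor (ip y (b i)).
have mE i : ip y (b i) = (m i)%:~R by rewrite floorK.
have mk i : 0 <= m i + k%:Z /\ m i + k%:Z < (k.*2.+1)%:Z.
  have := yk i; rewrite mE ler_norml => /andP[h1 h2].
  rewrite pmulrn -mulrNz ler_int in h1; rewrite pmulrn ler_int in h2.
  by lia.
have mk2 i : (absz (m i + k%:Z)%R < k.*2.+1)%N by have := mk i; lia.
exists [ffun i => Ordinal (mk2 i)].
rewrite [LHS]lat_dual_sum; apply: eq_bigr => i _.
rewrite mE scaler_int ffunE /=; congr (_ *~ _).
by have := mk i; lia.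
Qed.

Lemma finite_dual_box k : finite_set (dual_box k).
Proof.
apply: (@sub_finite_set _ _ ((@box_point k) @` [set: {ffun 'I_n -> 'I_(k.*2.+1)}])).
  by move=> y /dual_box_image[phi ->]; exists phi.
exact: finite_image.
Qed.

Lemma dual_box_bounded x (rho : R) : dL x -> `|x| <= rho ->
  dual_box (Num.bound (rho * \sum_i `|b i|)) x.
Proof.
move=> dx xr; split => // i.
have B0 : 0 <= \sum_i `|b i| by apply: sumr_ge0.
have r0 : 0 <= rho by apply: le_trans xr.
rewrite (le_trans (CauchySchwarz (lat_onb HL) _ _))//.
rewrite (@le_trans _ _ (rho * \sum_i `|b i|))//.
  by apply: ler_pM => //; rewrite (bigD1 i)//= lerDl sumr_ge0.
by rewrite ltW// archi_boundP// mulr_ge0.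
Qed.

Definition dual_fset (k : nat) : {fset E} := fset_set (dual_box k).

Lemma in_dual_fset k y : (y \in dual_fset k) <-> dual_box k y.
Proof.
rewrite in_fset_set; last exact: finite_dual_box.
by split=> [|h]; rewrite inE.
Qed.

Lemma dual_exhaustion : exhaustion dL dual_fset.
Proof.
split=> [k y /in_dual_fset[]//|k l kl y /in_dual_fset[dy yk]|y dy].
  apply/in_dual_fset; split => // i; rewrite (le_trans (yk i))// ler_nat//.
by exists (Num.bound (`|y| * \sum_i `|b i|)); apply/in_dual_fset/dual_box_bounded.
Qed.

(** The majorant of the lattice series of Schwartz functions. Being a product over the coordinates
    in [bd], it reduces summability over the dual lattice to the sum of 1/(1 + m^2) over the
    integers. *)
Definition weight (y : E) : R := \prod_i (1 + ip y (b i) ^+ 2)^-1.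

Lemma weight_ge0 y : 0 <= weight y.
Proof. by apply: prodr_ge0 => i _; rewrite invr_ge0 addr_ge0// sqr_ge0. Qed.

(** Telescoping: phi(x) = x / (1 + |x|) stays in [-1, 1], and its increment from m to m + 1 is at
    least a third of 1/(1 + m^2). Hence the bound 3 times 2. *)
Lemma sum_inv_sqr_bound (k : nat) :
  \sum_(j < k.*2.+1) (1 + (j%:R - k%:R) ^+ 2)^-1 <= 6 :> R.
Proof.
pose phi (x : R) := x / (1 + `|x|).
have phi1 x : `|phi x| <= 1.
  rewrite /phi normrM normfV (@ger0_norm _ (1 + _)) ?addr_ge0//.
  by rewrite ler_pdivrMr ?ltr_pwDl// mul1r lerDr.
have step (m : int) : (1 + (m%:~R : R) ^+ 2)^-1 <=
    3 * (phi (m + 1)%:~R - phi m%:~R).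
  rewrite intrD; set x : R := m%:~R.
  have [m0|m0] := leP 0 m.
    have x0 : 0 <= x by rewrite ler0z.
    have xm : 0 <= x * (x - 1).
      have [m00|m1] := eqVneq m 0; first by rewrite /x m00 mul0r.
      have x1 : 1 <= x by rewrite -[1]/(1%:~R) ler_int; lia.
      by rewrite mulr_ge0// subr_ge0.
    rewrite /phi !ger0_norm ?addr_ge0// -subr_ge0.
    have -> : 3 * ((x + 1) / (1 + (x + 1)) - x / (1 + x)) - (1 + x ^+ 2)^-1 =
      (2 * x ^+2 - 3 * x + 1) / ((1 + (x + 1)) * (1 + x) * (1 + x ^+ 2)).
      by field; rewrite !gt_eqF//; nra.
    rewrite mulr_ge0// ?invr_ge0; last by rewrite !mulr_ge0 ?addr_ge0 ?sqr_ge0.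
    have [m00|m1] := eqVneq m 0; first by rewrite /x m00; lra.
    have x1 : 1 <= x by rewrite -[1]/(1%:~R) ler_int; lia.
    by nra.
  have x0 : x <= -1 by rewrite -[-1]/((-1)%:~R) ler_int; lia.
  rewrite /phi !ler0_norm; [|lra|lra]; rewrite -subr_ge0.
  have -> : 3 * ((x + 1) / (1 - (x + 1)) - x / (1 - x)) - (1 + x ^+ 2)^-1 =
    (2 * x ^+ 2 + x + 3) / ((- x) * (1 - x) * (1 + x ^+ 2)).
    have n1 : 1 + x ^+ 2 != 0 by rewrite gt_eqF// ltr_pwDl// sqr_ge0.
    have n2 : 1 - x != 0 by rewrite gt_eqF//; lra.
    have n3 : x != 0 by rewrite lt_eqF//; lra.
    have n4 : 1 - (x + 1) != 0 by rewrite gt_eqF//; lra.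
    by field; rewrite -/x n1 n2 n3 n4.
  by rewrite mulr_ge0// ?invr_ge0; [nra|rewrite !mulr_ge0 ?addr_ge0 ?sqr_ge0//; lra].
have tele (N : nat) : \sum_(j < N) (1 + (j%:R - k%:R) ^+ 2)^-1 <=
    3 * (phi (N%:Z - k%:Z)%:~R - phi (- k%:Z)%:~R).
  elim: N => [|N IH]; first by rewrite big_ord0 sub0r subrr mulr0.
  rewrite big_ord_recr /= (le_trans (lerD IH (_ : _ <= 3 * (phi (N%:Z - k%:Z + 1)%:~R - phi (N%:Z - k%:Z)%:~R))))//.
    by rewrite (le_trans _ (step _))// mulrzBr -!pmulrn.
  have -> : (N.+1%:Z - k%:Z) = (N%:Z - k%:Z + 1) :> int by lia.
  by rewrite -mulrDr addrC subrKA.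
rewrite (le_trans (tele _))//.
have h1 := phi1 ((k.*2.+1)%:Z - k%:Z)%:~R; have h2 := phi1 (- k%:Z)%:~R.
move: h1 h2; rewrite !ler_norml => /andP[a1 a2] /andP[a3 a4]; lra.
Qed.

(** A finite set of dual vectors lies in a box, and over a box the sum of products is a product of n
    one-dimensional sums, each at most 6. *)
Lemma summable_weight : summable dL (EFin \o weight).
Proof.
apply: (@summable_bounded _ _ _ _ (6 ^+ n)) => A AdL.
have [k Ak] : exists k, forall y, y \in A -> y \in dual_fset k.
  have [_ ssm ssU] := dual_exhaustion.
  have cover (l : seq E) : (forall y, y \in l -> dL y) ->
      exists k, forall y, y \in l -> y \in dual_fset k.
    elim: l => [|y l IH] h; first by exists 0%N.
    have [k hk] := IH (fun j jl => h j (@mem_behead _ (y :: l) j jl)).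
    have [k' hk'] := ssU y (h y (mem_head _ _)).
    exists (maxn k k') => j; rewrite inE => /orP[/eqP ->|/hk].
      by apply: ssm hk'; rewrite leq_maxr.
    by apply: ssm; rewrite leq_maxl.
  exact: cover.
have wE y : `|weight y| = weight y by rewrite ger0_norm// weight_ge0.
rewrite (eq_bigr weight) => [|y _]; last exact: wE.
apply: (@le_trans _ _ (\sum_(phi : {ffun 'I_n -> 'I_(k.*2.+1)}) weight (box_point phi))).
  have -> : \sum_(phi : {ffun 'I_n -> 'I_(k.*2.+1)}) weight (box_point phi) =
     \sum_(y <- [seq box_point phi | phi <- enum {ffun 'I_n -> 'I_(k.*2.+1)}]) weight y.
    by rewrite big_map big_enum.
  have : {subset A <= [seq box_point phi | phi <- enum {ffun 'I_n -> 'I_(k.*2.+1)}]}.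
    move=> y /Ak/in_dual_fset/dual_box_image[phi ->].
    by apply: map_f; rewrite mem_enum.
  move: (map _ _) => s As.
  rewrite (le_trans _ (_ : \sum_(y <- undup s) weight y <= _))//.
    rewrite [leRHS](bigID (mem A))/= -[leLHS]addr0 lerD//; last first.
      by apply: sumr_ge0 => y _; exact: weight_ge0.
    rewrite -[leRHS]big_filter [leRHS](perm_big (A : seq E))//.
    apply: uniq_perm; rewrite ?filter_uniq ?undup_uniq ?fset_uniq// => y.
    rewrite mem_filter mem_undup; apply/andP/idP => [[]//|yA]; split => //.
    exact: As.
  elim: {A Ak As AdL} s => //= y s IH; case: ifP => _; rewrite !big_cons.
    by rewrite -[leLHS]add0r lerD// weight_ge0.
  by rewrite lerD2l.
have -> : \sum_(phi : {ffun 'I_n -> 'I_(k.*2.+1)}) weight (box_point phi) =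
  \prod_(i < n) \sum_(j < k.*2.+1) (1 + (j%:R - k%:R) ^+ 2)^-1.
  rewrite bigA_distr_bigA /=; apply: eq_bigr => phi _.
  by apply: eq_bigr => i _; rewrite ip_box_point.
rewrite prodr_const card_ord lerXn2r ?nnegrE ?sum_inv_sqr_bound//.
by apply: sumr_ge0 => j _; rewrite invr_ge0 addr_ge0// sqr_ge0.
Qed.

(** Each of the n factors 1 + (y, b_i)^2 is at most B^2 (1 + |y|)^2, which costs 2n powers of 1 +
    |y|; moreover 1 + |y| is at most r (1 + |t + y|) for t in the ball. So polynomial decay at t + y
    becomes summability in y, uniformly in t, with p powers to spare. *)
Lemma weight_bound (rho : R) (p : nat) : exists2 K : R, 0 <= K &
  forall t y : E, `|t| <= rho ->
    (1 + `|y|) ^+ p <= K * (1 + `|t + y|) ^+ (p + 2 * n) * weight y.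
Proof.
pose B := 1 + \sum_i `|b i|.
have B1 : 1 <= B by rewrite lerDl sumr_ge0.
pose r := 1 + `|rho|; have r1 : 1 <= r by rewrite lerDl.
exists ((B ^+ 2) ^+ n * r ^+ (p + 2 * n)).
  by rewrite mulr_ge0// exprn_ge0// ?exprn_ge0//; apply: le_trans ler01 _.
move=> t y tr.
have w1 : 1 <= (B ^+ 2 * (1 + `|y|) ^+ 2) ^+ n * weight y.
  rewrite -[in _ ^+ n](card_ord n) -prodr_const -big_split/=.
  elim/big_ind : _ => // [a c a1 c1|i _]; first by rewrite mulr_ege1.
  have P0 : 0 < 1 + ip y (b i) ^+ 2 by rewrite ltr_pwDl// sqr_ge0.
  rewrite ler_pdivlMr// mul1r.
  have := CauchySchwarz (lat_onb HL) y (b i).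
  have bB : 1 + `|b i| <= B by rewrite lerD2l (bigD1 i)//= lerDl sumr_ge0.
  move=> cs; rewrite -[ip y _ ^+ 2]real_normK ?num_real//.
  apply: (@le_trans _ _ ((1 + `|ip y (b i)|) ^+ 2)).
    by rewrite sqrrD expr1n lerD2r lerDl mul1r mulrn_wge0.
  rewrite -exprMn lerXn2r ?nnegrE ?addr_ge0 ?mulr_ge0 ?addr_ge0 ?sumr_ge0//.
  rewrite (@le_trans _ _ ((1 + `|b i|) * (1 + `|y|)))//; last by rewrite ler_wpM2r ?addr_ge0.
  by have := normr_ge0 y; have := normr_ge0 (b i); nra.
have yr : 1 + `|y| <= r * (1 + `|t + y|).
  have : `|y| <= `|t + y| + `|t|.
    by rewrite -[X in `|X| <= _](addKr t) addrC (le_trans (ler_normB _ _)).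
  have := normr_ge0 (t + y); have := normr_ge0 t.
  have := ler_norm rho; rewrite /r; nra.
apply: (@le_trans _ _ ((1 + `|y|) ^+ p * ((B ^+ 2 * (1 + `|y|) ^+ 2) ^+ n * weight y))).
  by rewrite ler_peMr// exprn_ge0// addr_ge0.
have E0 : (1 + `|y|) ^+ p * (B ^+ 2 * (1 + `|y|) ^+ 2) ^+ n =
   (B ^+ 2) ^+ n * (1 + `|y|) ^+ (p + 2 * n).
  by rewrite exprMn exprD [_ ^+ (2 * n)]exprM; ring.
rewrite mulrA ler_wpM2r ?weight_ge0// E0 -mulrA -exprMn ler_wpM2l//.
  by rewrite exprn_ge0// exprn_ge0//; apply: le_trans ler01 _.
by rewrite lerXn2r ?nnegrE ?mulr_ge0 ?addr_ge0//; apply: le_trans ler01 _.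
Qed.

Lemma finite_dual_bounded (rho : R) : finite_set [set y | dL y /\ `|y| <= rho].
Proof.
apply: sub_finite_set (finite_dual_box (Num.bound (rho * \sum_i `|b i|))).
by move=> y [dy yr]; exact: dual_box_bounded.
Qed.

(** * The discriminant group and orthogonality of its characters *)

Section Discriminant.
Hypothesis int_L : integral_lattice ip L.
Local Notation Zt := (discriminant ip L).

Lemma lat_dual l : L l -> dL l. Proof. exact: int_L. Qed.

Lemma coset_eq (x y : E) : L (x - y) ->
  [set x + l | l in L] = [set y + l | l in L].
Proof.
move=> Lxy; apply/seteqP; split => [_ [l Ll <-]|_ [l Ll <-]].
  by exists (x - y + l); [exact: latD|rewrite addrA [y + _]addrC subrK].
exists (l - (x - y)); first exact: latB.
by rewrite opprB addrCA [x + _]addrC subrK addrC.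
Qed.

(** Every class has a representative in [cell], which is bounded, and a bounded set contains
    finitely many dual vectors. *)
Lemma finite_discriminant : finite_set [set: Zt].
Proof.
have -> : [set: Zt] = (\val : Zt -> set E) @^-1` Zt.
  by apply/seteqP; split => // g _ /=; have := valP g; rewrite inE.
apply: finite_preimage; first by move=> g h _ _; exact: val_inj.
pose A := [set y | dL y /\ `|y| <= \sum_i `|b i|].
apply: (@sub_finite_set _ _ ((fun y => [set y + l | l in L]) @` A)); last first.
  exact/finite_image/finite_dual_bounded.
move=> _ [x dx <-]; exists (x - lat_floor x).
  split; last exact/cell_bounded/sub_lat_floor.
  by apply: dualB => //; exact/lat_dual/lat_floor_lat.
by apply: coset_eq; rewrite addrAC subrr add0r; exact/latN/lat_floor_lat.
Qed.

Definition disc_seq : seq Zt := fset_set [set: Zt].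

Lemma mem_disc g : g \in disc_seq.
Proof. by rewrite in_fset_set ?inE//; exact: finite_discriminant. Qed.
Lemma uniq_disc : uniq disc_seq. Proof. exact: fset_uniq. Qed.
Lemma size_disc : size disc_seq = order_discriminant ip L.
Proof. by []. Qed.

Lemma fsum_disc (G : Zt -> R[i]) :
  \sum_(g \in [set: Zt]) G g = \sum_(g <- disc_seq) G g.
Proof. by rewrite fsbig_finite//=; exact: finite_discriminant. Qed.

Section Representatives.
Variable r : Zt -> E.
Hypothesis rP : representatives r.

Lemma rep_dual g : dL (r g).
Proof.
have := rP g; have := valP g; rewrite inE => -[x dx <-] [l Ll <-].
by apply: dualD => //; exact: lat_dual.
Qed.

Lemma rep_ex y : dL y -> exists g, L (y - r g).
Proof.
move=> dy; have gP : [set y + l | l in L] \in Zt by rewrite inE; exists y.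
exists (SigSub gP); have := rP (SigSub gP); rewrite SubK => -[l Ll <-].
by rewrite opprD addrA subrr sub0r; exact: latN.
Qed.

Lemma rep_inj g h : L (r g - r h) -> g = h.
Proof.
move=> Lgh; apply: val_inj.
have cE k : val k = [set r k + l | l in L].
  have := rP k; have := valP k; rewrite inE => -[x dx <-] [l Ll <-].
  by apply: coset_eq; rewrite opprD addrA subrr sub0r; exact: latN.
by rewrite !cE; exact: coset_eq.
Qed.

Lemma order_disc_gt0 : (0 < order_discriminant ip L)%N.
Proof.
have [g _] := rep_ex dual0; rewrite -size_disc; have := mem_disc g.
by case: disc_seq.
Qed.

(** If y is outside L, biduality gives a dual vector x with <x, y> different from 1. Translation by
    x permutes the classes, so the sum T satisfies T = <x, y> T and vanishes. *)
Lemma character_sum y : dL y ->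
  \sum_(g <- disc_seq) pairing ip (r g) y =
  if `[< L y >] then (order_discriminant ip L)%:R else 0.
Proof.
move=> dy; case: asboolP => [Ly|nLy].
  rewrite (eq_bigr (fun=> 1)) => [|g _]; last first.
    by rewrite pairingC; exact/dual_pairing/rep_dual.
  by rewrite big_const_seq count_predT size_disc iter_addr addr0.
have [x dx xy] : exists2 x, dL x & pairing ip x y <> 1.
  apply: contrapT => H; apply: nLy; apply: bidual => x dx.
  rewrite ipC; apply/pairing_eq1; apply: contrapT => xy; apply: H.
  by exists x.
have sP g : exists h, L (r g + x - r h).
  by apply: rep_ex; apply: dualD => //; exact: rep_dual.
(* [s g] is the class of r g + x. Being injective on a finite set, s is a permutation. *)
pose s g := projT1 (cid (sP g)).
have sE g : L (r g + x - r (s g)) by rewrite /s; case: cid.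
have s_inj : injective s.
  move=> g h sgh; apply: rep_inj.
  have := latB (sE g) (sE h); rewrite sgh.
  by rewrite opprB addrA subrK opprD addrACA subrr addr0.
set T := \sum_(g <- _) _.
have : T = pairing ip x y * T.
  rewrite /T big_distrr /= [LHS](perm_big (map s disc_seq)); last first.
    apply: uniq_perm; rewrite ?map_inj_uniq ?uniq_disc// => g.
    rewrite mem_disc; apply/esym.
    have U : uniq (map s disc_seq) by rewrite map_inj_uniq ?uniq_disc.
    have sub : {subset map s disc_seq <= disc_seq} by move=> h _; exact: mem_disc.
    have [_ ->] := uniq_min_size U sub (eq_leq (esym (size_map s disc_seq))).
    exact: mem_disc.
  rewrite big_map; apply: eq_bigr => g _.
  rewrite -pairingDl addrC.
  have -> : r g + x = (r g + x - r (s g)) + r (s g) by rewrite subrK.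
  by rewrite pairingDl (dual_pairing (sE g) dy) mul1r.
move=> /eqP; rewrite -subr_eq0 -{1}[T]mul1r -mulrBl mulf_eq0 subr_eq0.
by case/orP => /eqP // /esym.
Qed.
End Representatives.
End Discriminant.
End Lattice.

(** * Integration over a fundamental domain *)

Section ComplexMeasurable.
Context d (T : measurableType d) (R : realType).
Local Notation C := R[i].
Local Notation Re := (@complex.Re R).
Local Notation Im := (@complex.Im R).
Variable D : set T.
Implicit Types f g : T -> C.
Local Notation cm := (cmeasurable D).

Lemma cmeasurable_cst (c : C) : cm (fun=> c).
Proof. by split; apply: measurable_cst. Qed.
Lemma cmeasurableD f g : cm f -> cm g -> cm (fun x => f x + g x).
Proof.
move=> [fR fI] [gR gI]; split.
  by rewrite (_ : _ \o _ = fun x => Re (f x) + Re (g x)); [exact: measurable_funD|apply/funext => x /=; rewrite ReD].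
by rewrite (_ : _ \o _ = fun x => Im (f x) + Im (g x)); [exact: measurable_funD|apply/funext => x /=; rewrite ImD].
Qed.
Lemma cmeasurableM f g : cm f -> cm g -> cm (fun x => f x * g x).
Proof.
move=> [fR fI] [gR gI]; split.
  rewrite (_ : _ \o _ = fun x => Re (f x) * Re (g x) - Im (f x) * Im (g x)); last first.
    by apply/funext => x /=; rewrite ReM.
  by apply: measurable_funB; apply: measurable_funM.
rewrite (_ : _ \o _ = fun x => Re (f x) * Im (g x) + Im (f x) * Re (g x)); last first.
  by apply/funext => x /=; rewrite ImM.
by apply: measurable_funD; apply: measurable_funM.
Qed.
Lemma cmeasurableN f : cm f -> cm (fun x => - f x).
Proof.
move=> mf; rewrite (_ : (fun x => _) = fun x => -1 * f x).
  by apply: cmeasurableM => //; exact: cmeasurable_cst.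
by apply/funext => x; rewrite mulN1r.
Qed.
Lemma cmeasurableB f g : cm f -> cm g -> cm (fun x => f x - g x).
Proof. by move=> mf mg; apply: cmeasurableD => //; exact: cmeasurableN. Qed.
Lemma cmeasurable_sum I (s : seq I) (F : I -> T -> C) : (forall i, cm (F i)) ->
  cm (fun x => \sum_(i <- s) F i x).
Proof.
move=> mF; elim: s => [|i s IH].
  by under [X in cm X]eq_fun do rewrite big_nil; exact: cmeasurable_cst.
by under [X in cm X]eq_fun do rewrite big_cons; exact: cmeasurableD.
Qed.
Lemma measurable_sqmod f : cm f -> measurable_fun D (fun x => sqmod (f x)).
Proof.
by move=> [fR fI]; apply: measurable_funD; apply: measurable_funX.
Qed.
Lemma cmeasurable_expi (q : T -> R) : measurable_fun D q ->
  cm (fun x => expi (q x)).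
Proof.
move=> mq; split.
  exact: (measurableT_comp (continuous_measurable_fun (@continuous_cos R)) mq).
exact: (measurableT_comp (continuous_measurable_fun (@continuous_sin R)) mq).
Qed.
End ComplexMeasurable.

Section ComplexIntegral.
Context d (T : measurableType d) (R : realType).
Variable mu : {measure set T -> \bar R}.
Local Notation C := R[i].
Local Notation Re := (@complex.Re R).
Local Notation Im := (@complex.Im R).
Variable D : set T.
Hypothesis mD : measurable D.
Implicit Types f g : T -> C.
Local Notation ci := (cintegrable mu D).

Lemma Re_cintegral f : Re (cintegral mu D f) = \int[mu]_(x in D) Re (f x).
Proof. by []. Qed.
Lemma Im_cintegral f : Im (cintegral mu D f) = \int[mu]_(x in D) Im (f x).
Proof. by []. Qed.

Lemma eq_cintegral f g : (forall x, D x -> f x = g x) ->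
  cintegral mu D f = cintegral mu D g.
Proof.
move=> fg; apply: complex_eqP; rewrite ?Re_cintegral ?Im_cintegral;
  by apply: eq_Rintegral => x; rewrite inE => /fg ->.
Qed.

Lemma eq_cintegrable f g : (forall x, D x -> f x = g x) -> ci f -> ci g.
Proof.
by move=> fg [h1 h2]; split; [apply: eq_integrable h1|apply: eq_integrable h2];
  rewrite // => x; rewrite inE => /fg /= ->.
Qed.

Lemma cintegrableD f g : ci f -> ci g -> ci (fun x => f x + g x).
Proof.
move=> [fR fI] [gR gI]; split.
  apply: eq_integrable (integrableD mD fR gR) => // x _ /=; by rewrite ReD.
apply: eq_integrable (integrableD mD fI gI) => // x _ /=; by rewrite ImD.
Qed.

Lemma cintegralD f g : ci f -> ci g ->
  cintegral mu D (fun x => f x + g x) = cintegral mu D f + cintegral mu D g.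
Proof.
move=> [fR fI] [gR gI]; apply: complex_eqP.
  rewrite ReD !Re_cintegral -RintegralD//; apply: eq_Rintegral => x _; exact: ReD.
rewrite ImD !Im_cintegral -RintegralD//; apply: eq_Rintegral => x _; exact: ImD.
Qed.

Lemma integrable_lin (a b : R) (p q : T -> R) :
  mu.-integrable D (EFin \o p) -> mu.-integrable D (EFin \o q) ->
  mu.-integrable D (EFin \o (fun x => a * p x + b * q x)) /\
  \int[mu]_(x in D) (a * p x + b * q x) =
  a * \int[mu]_(x in D) p x + b * \int[mu]_(x in D) q x.
Proof.
move=> ip iq.
have ip' : mu.-integrable D (EFin \o (fun x => a * p x)).
  by apply: eq_integrable (integrableZl mD a ip).
have iq' : mu.-integrable D (EFin \o (fun x => b * q x)).
  by apply: eq_integrable (integrableZl mD b iq).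
split; first by apply: eq_integrable (integrableD mD ip' iq').
by rewrite RintegralD// !RintegralZl.
Qed.

Lemma cintegrableZ (c : C) f : ci f -> ci (fun x => c * f x).
Proof.
move=> [fR fI]; split.
  have [h _] := integrable_lin (Re c) (- Im c) fR fI.
  by apply: eq_integrable h => // x _ /=; rewrite ReM mulNr.
have [h _] := integrable_lin (Im c) (Re c) fR fI.
by apply: eq_integrable h => // x _ /=; rewrite ImM addrC.
Qed.

Lemma cintegralZ (c : C) f : ci f ->
  cintegral mu D (fun x => c * f x) = c * cintegral mu D f.
Proof.
move=> [fR fI]; apply: complex_eqP.
  have [_ h] := integrable_lin (Re c) (- Im c) fR fI.
  rewrite ReM !Re_cintegral Im_cintegral -mulNr -h.
  by apply: eq_Rintegral => x _; rewrite ReM mulNr.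
have [_ h] := integrable_lin (Im c) (Re c) fR fI.
rewrite ImM !Im_cintegral Re_cintegral addrC -h.
by apply: eq_Rintegral => x _; rewrite ImM addrC.
Qed.

Lemma cintegrable0 : ci (fun=> 0).
Proof. by split; exact: integrable0. Qed.
Lemma cintegral0 : cintegral mu D (fun=> 0 : C) = 0.
Proof. by apply: complex_eqP; rewrite ?Re_cintegral ?Im_cintegral /Rintegral integral0. Qed.

Lemma cintegrable_sum I (s : seq I) (F : I -> T -> C) : (forall i, ci (F i)) ->
  ci (fun x => \sum_(i <- s) F i x).
Proof.
move=> mF; elim: s => [|i s IH].
  by under [X in ci X]eq_fun do rewrite big_nil; exact: cintegrable0.
by under [X in ci X]eq_fun do rewrite big_cons; exact: cintegrableD.
Qed.

Lemma cintegral_sum I (s : seq I) (F : I -> T -> C) : (forall i, ci (F i)) ->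
  cintegral mu D (fun x => \sum_(i <- s) F i x) = \sum_(i <- s) cintegral mu D (F i).
Proof.
move=> mF; elim: s => [|i s IH].
  rewrite big_nil; under [X in cintegral _ _ X]eq_fun do rewrite big_nil.
  exact: cintegral0.
rewrite big_cons; under [X in cintegral _ _ X]eq_fun do rewrite big_cons.
by rewrite cintegralD// ?IH//; exact: cintegrable_sum.
Qed.

Hypothesis fD : (mu D < +oo)%E.

Lemma cintegrable_bounded f (M : R) : cmeasurable D f ->
  (forall x, D x -> normc (f x) <= M) -> ci f.
Proof.
move=> [fR fI] fM; split; apply: measurable_bounded_integrable => //;
  exists M; split; rewrite ?num_real// => N MN x Dx /=; apply: le_trans (ltW MN);
  apply: le_trans (fM x Dx); [exact: Re_le_normc|exact: Im_le_normc].
Qed.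

Lemma integrable_cst (c : R) : mu.-integrable D (EFin \o (fun=> c)).
Proof.
apply: measurable_bounded_integrable => //.
by exists `|c|; split; rewrite ?num_real// => N cN x _; exact: ltW.
Qed.

Lemma cintegrable_L2 f : cmeasurable D f ->
  (\int[mu]_(x in D) (sqmod (f x))%:E < +oo)%E -> ci f.
Proof.
move=> mf f2; have [fR fI] := mf.
have i1 : mu.-integrable D (EFin \o (fun x => sqmod (f x))).
  apply/integrableP; split; first by apply/measurable_EFinP/measurable_sqmod.
  by under eq_integral do rewrite /= ger0_norm ?sqmod_ge0//.
have i2 : mu.-integrable D (EFin \o (fun x => 1 + sqmod (f x))).
  by apply: eq_integrable (integrableD mD (integrable_cst 1) i1).
have nn x : `|1 + sqmod (f x)| = 1 + sqmod (f x).
  by rewrite ger0_norm// addr_ge0 ?sqmod_ge0.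
split; (apply: (le_integrable mD _ _ i2); first exact/measurable_EFinP);
  move=> x _ /=; rewrite lee_fin nn /sqmod.
  have := sqr_ge0 (Im (f x)); have := sqr_ge0 (Re (f x)).
  have := sqr_ge0 (`|Re (f x)| - 1).
  by rewrite sqrrB expr1n mulr1 real_normK ?num_real//; lra.
have := sqr_ge0 (Re (f x)); have := sqr_ge0 (Im (f x)).
have := sqr_ge0 (`|Im (f x)| - 1).
by rewrite sqrrB expr1n mulr1 real_normK ?num_real//; lra.
Qed.
End ComplexIntegral.

Section SumIntegral.
Context d (T : measurableType d) (R : realType).
Variable mu : {measure set T -> \bar R}.
Variables (I : choiceType) (S : set I) (ss : nat -> {fset I}).
Hypothesis ex : exhaustion S ss.
Local Open Scope ereal_scope.

Lemma esum_exhaustion_nd (F : I -> \bar R) : (forall i, 0 <= F i) ->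
  nondecreasing_seq (fun k => \sum_(i <- ss k) F i).
Proof.
move=> F0; apply/nondecreasing_seqP => k; apply: lee_sum_nneg_subfset.
  by have [_ ssm _] := ex; apply: ssm.
by move=> i _ _; exact: F0.
Qed.

Lemma measurable_esum D (a : I -> T -> \bar R) : measurable D ->
  (forall i, measurable_fun D (a i)) -> (forall i x, 0 <= a i x) ->
  measurable_fun D (fun x => esum S (a ^~ x)).
Proof.
move=> mD ma a0.
apply: (emeasurable_fun_cvg (fun k x => \sum_(i <- ss k) a i x)).
  by move=> k; apply: emeasurable_sum.
by move=> x _; apply: esum_exhaustion.
Qed.

Lemma integral_esum D (a : I -> T -> \bar R) : measurable D ->
  (forall i, measurable_fun D (a i)) -> (forall i x, 0 <= a i x) ->
  \int[mu]_(x in D) esum S (a ^~ x) = esum S (fun i => \int[mu]_(x in D) a i x).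
Proof.
move=> mD ma a0.
have c1 : (\sum_(i <- ss k) \int[mu]_(x in D) a i x) @[k --> \oo] -->
   esum S (fun i => \int[mu]_(x in D) a i x).
  by apply: esum_exhaustion => // i _; apply: integral_ge0 => x _; exact: a0.
have c2 : (\int[mu]_(x in D) \sum_(i <- ss k) a i x) @[k --> \oo] -->
    \int[mu]_(x in D) esum S (a ^~ x).
  have -> : \int[mu]_(x in D) esum S (a ^~ x) =
     \int[mu]_(x in D) lim ((\sum_(i <- ss k) a i x) @[k --> \oo]).
    by apply: eq_integral => x _; apply/esym/cvg_lim => //; exact: esum_exhaustion.
  apply: cvg_monotone_convergence => //.
  - by move=> k; apply: emeasurable_sum.
  - by move=> k x _; apply: sume_ge0.
  - by move=> x _; apply: esum_exhaustion_nd.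
rewrite -(cvg_lim _ c1)// -(cvg_lim _ c2)//.
apply: congr_lim; apply/funext => k.
by rewrite ge0_integral_sum.
Qed.

Lemma esum_single (F : I -> \bar R) i0 : S i0 -> 0 <= F i0 ->
  (forall i, S i -> i <> i0 -> F i = 0) -> esum S F = F i0.
Proof.
move=> Si0 F0 Fi; rewrite (esumID [set i0])//; last first.
  move=> i Si; have [->//|/eqP ii0] := eqVneq i i0; by rewrite Fi.
rewrite (_ : S `&` [set i0] = [set i0]); last first.
  by apply/seteqP; split => [i []//|i ->].
by rewrite esum_set1// esum1 ?adde0// => i [Si ii0]; exact: Fi.
Qed.

Lemma negligible_exhaustion (A : I -> set T) :
  (forall i, S i -> mu.-negligible (A i)) -> mu.-negligible (\bigcup_(i in S) A i).
Proof.
move=> nA; apply: (@negligibleS _ _ _ _ (\bigcup_k \big[setU/set0]_(i <- ss k) A i)).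
  move=> x [i Si Aix]; have [_ _ /(_ i Si)[k ik]] := ex; exists k => //.
  by rewrite -bigcup_seq; exists i.
apply: negligible_bigcup => k; have [ssS _ _] := ex.
have : forall s : seq I, (forall i, i \in s -> S i) ->
    mu.-negligible (\big[setU/set0]_(i <- s) A i).
  elim=> [|i s IH] h; first by rewrite big_nil; exact: negligible_set0.
  rewrite big_cons; apply: negligibleU; first by apply/nA/h; rewrite inE eqxx.
  by apply: IH => j js; apply: h; rewrite inE js orbT.
by apply; exact: ssS.
Qed.

Lemma measurable_bigcup_exhaustion (A : I -> set T) :
  (forall i, S i -> measurable (A i)) -> measurable (\bigcup_(i in S) A i).
Proof.
move=> mA; rewrite (_ : \bigcup_(i in S) A i = \bigcup_k \big[setU/set0]_(i <- ss k) A i).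
  apply: bigcupT_measurable => k; have [ssS _ _] := ex.
  have : forall s : seq I, (forall i, i \in s -> S i) ->
      measurable (\big[setU/set0]_(i <- s) A i).
    elim=> [|i s IH] h; first by rewrite big_nil.
    rewrite big_cons; apply: measurableU; first by apply/mA/h; rewrite inE eqxx.
    by apply: IH => j js; apply: h; rewrite inE js orbT.
  by apply; exact: ssS.
apply/seteqP; split => [x [i Si Aix]|x [k _]].
  have [_ _ /(_ i Si)[k ik]] := ex; exists k => //.
  by rewrite -bigcup_seq; exists i.
rewrite -bigcup_seq => -[i ik Aix]; exists i => //.
by have [ssS _ _] := ex; exact: ssS ik.
Qed.
End SumIntegral.

Section BorelMeasurability.
Variables (R : realType) (E : normedModType R).

Lemma open_borel (U : set E) : open U -> measurable (U : set (borel E)).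
Proof. by move=> oU; apply: sub_sigma_algebra. Qed.

Lemma continuous_borel (g : E -> R) : continuous g ->
  measurable_fun setT (g : borel E -> R).
Proof.
move=> gc; apply: (measurability _ (RGenOInfty.measurableE R)) => _ [_ [x ->] <-].
rewrite setTI; apply: open_borel; apply: open_comp; last exact: interval_open.
by move=> y _; exact: gc.
Qed.

Lemma continuous_borel_borel (g : E -> E) : continuous g ->
  measurable_fun setT (g : borel E -> borel E).
Proof.
move=> gc; apply: (@measurability _ _ _ (borel E) setT _ (@open E)) => //.
move=> _ [U oU <-]; rewrite setTI; apply: open_borel.
by apply: open_comp => // y _; exact: gc.
Qed.

Lemma shift_continuous (c : E) : continuous (fun x : E => x + c).
Proof. by move=> x; apply: cvgD; [exact: cvg_id|exact: cvg_cst]. Qed.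

Lemma measurable_shift (c : E) :
  measurable_fun setT ((fun x : E => x + c) : borel E -> borel E).
Proof. by apply: continuous_borel_borel; exact: shift_continuous. Qed.

Lemma measurable_shift_set (A : set (borel E)) (c : E) : measurable A ->
  measurable ((fun x : E => x + c) @^-1` A : set (borel E)).
Proof.
by move=> mA; rewrite -[X in measurable X]setTI; apply: measurable_shift.
Qed.

Lemma measurable_comp_shift d (T : measurableType d) (g : E -> T) (c : E) :
  measurable_fun setT (g : borel E -> T) ->
  measurable_fun setT ((fun x => g (x + c)) : borel E -> T).
Proof. by move=> mg; exact: (measurableT_comp mg (measurable_shift c)). Qed.

Lemma ip_continuous (ip : {dot E for idfun}) n (u : 'I_n -> E) y :
  euclidean ip u -> continuous (fun x => ip x y).
Proof.
move=> eu x; apply/cvgrPdist_lt => e e0.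
have y0 : 0 < `|y| + 1 by rewrite ltr_wpDl.
apply/nbhs_normP; exists (e / (`|y| + 1)); first by rewrite /= divr_gt0.
move=> z /= xz; rewrite -ipBl (le_lt_trans (CauchySchwarz eu _ _))//.
apply: (@le_lt_trans _ _ (`|x - z| * (`|y| + 1))).
  by rewrite ler_wpM2l// lerDl.
by rewrite -ltr_pdivlMr.
Qed.
End BorelMeasurability.

Record invariant_measure (R : realType) (E : normedModType R)
    (mu : {sigma_finite_measure set (borel E) -> \bar R}) : Prop := {
  inv_shift : forall (c : E) A, measurable A ->
    mu ((fun x : E => x + c : borel E) @^-1` A) = mu A;
  inv_fin : forall (A : set (borel E)) (M : R), measurable A ->
    (forall x : E, A x -> `|x| <= M) -> (mu A < +oo)%E;
  inv_pos : forall U : set E, open U -> U !=set0 -> (0 < mu (U : set (borel E)))%E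
}.

(** * Tilings of E by lattice translates and unfolding of integrals *)

Section Tiling.
Variables (R : realType) (E : normedModType R) (ip : {dot E for idfun}).
Variables (n : nat) (u b bd : 'I_n -> E) (L : set E).
Hypothesis HL : lattice_basis ip u b bd L.
Hypothesis int_L : integral_lattice ip L.
Variable mu : {sigma_finite_measure set (borel E) -> \bar R}.
Hypothesis Hmu : invariant_measure mu.
Local Open Scope ereal_scope.
Local Notation cell := (cell ip bd).

Lemma ge0_integral_shift (f : E -> \bar R) (c : E) :
  measurable_fun setT (f : borel E -> \bar R) -> (forall x, 0 <= f x) ->
  \int[mu]_x f (x + c)%R = \int[mu]_x f x.
Proof.
move=> mf f0; apply: (@ge0_integral_invariant _ _ _ mu ((fun x : E => x + c)%R : borel E -> borel E)) => //.
  exact: measurable_shift.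
exact: inv_shift.
Qed.

Definition lat_fset (k : nat) : {fset E} := fset_set (dual_box ip b L k `&` L).

Lemma lat_exhaustion : exhaustion L lat_fset.
Proof.
have fin k : finite_set (dual_box ip b L k `&` L).
  by apply: sub_finite_set (finite_dual_box HL k) => y [].
have inP k y : (y \in lat_fset k) <-> (y \in dual_fset ip b L k) /\ L y.
  rewrite in_fset_set//; split.
    by rewrite inE => -[h1 h2]; split => //; exact/(in_dual_fset HL).
  by move=> [/(in_dual_fset HL) h1 h2]; rewrite inE.
have [ssS ssm ssU] := dual_exhaustion HL.
split=> [k y /inP[]//|k l kl y /inP[yk Ly]|y Ly].
  by apply/inP; split => //; exact: (ssm k l).
by have [k yk] := ssU y (int_L Ly); exists k; apply/inP.
Qed.

Definition multiplicity (F : set E) (x : E) : \bar R :=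
  esum L (fun l => (\1_F (x + l)%R)%:E).

(** Covering and disjointness up to null sets, condensed into one identity, the form in which they
    enter unfolded integrals. *)
Definition tiles (F : set E) : Prop :=
  measurable (F : set (borel E)) /\
  {ae mu, forall x : borel E, multiplicity F x = 1}.

Lemma measurable_cell : measurable (cell : set (borel E)).
Proof.
rewrite (_ : cell = \bigcap_(i in [set: 'I_n]) ((fun x : E => ip x (bd i)) @^-1` `[0%R, 1%R[)); last first.
  apply/seteqP; split => [x cx i _|x cx i]; first by rewrite /= in_itv/=; exact: cx.
  by have := cx i I; rewrite /= in_itv.
apply: fin_bigcap_measurable => // i _; rewrite -[X in measurable X]setTI.
have := continuous_borel (ip_continuous (y := bd i) (lat_onb HL)).
by apply => //; exact: measurable_itv.
Qed.

Lemma measurable_indic_shift (F : set E) (c : E) : measurable (F : set (borel E)) ->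
  measurable_fun setT (fun x : borel E => (\1_F ((x : E) + c)%R : R)%:E).
Proof.
move=> mF; apply/measurable_EFinP.
by apply: (measurable_comp_shift (g := \1_F : E -> R)); exact: measurable_indic.
Qed.

Lemma cell_multiplicity (c x : E) :
  multiplicity ((fun y : E => y + c)%R @^-1` cell) x = 1.
Proof.
pose l0 := (- lat_floor ip b bd (x + c))%R.
have Ll0 : L l0 by apply: (latN HL); exact: (lat_floor_lat HL).
have cl0 : ((fun y : E => y + c)%R @^-1` cell) (x + l0)%R.
  rewrite /= addrAC; exact: (sub_lat_floor HL (x + c)%R).
rewrite /multiplicity (esum_single Ll0)//.
- by rewrite indicE mem_set.
- move=> l Ll ll0; rewrite indicE memNset// => cl; apply: ll0.
  apply/eqP; rewrite -subr_eq0; apply/eqP.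
  apply: (cell_unique HL (x := (x + l0 + c)%R)) => //; first exact: (latB HL).
  have -> : (x + l0 + c + (l - l0) = x + l + c)%R.
    by rewrite [LHS]addrAC -[in LHS](addrA x) (addrC l0) subrK.
  exact: cl.
Qed.

Lemma cell_shift_tiles (c : E) : tiles ((fun y : E => y + c)%R @^-1` cell).
Proof.
split; first by apply: measurable_shift_set; exact: measurable_cell.
by apply: aeW => x; exact: cell_multiplicity.
Qed.

Lemma integral_unfold (h : E -> \bar R) :
  measurable_fun setT (h : borel E -> \bar R) -> (forall x, 0 <= h x) ->
  \int[mu]_x h x = esum L (fun l => \int[mu]_(x in cell) h (x + l)%R).
Proof.
move=> mh h0.
pose a l (x : borel E) := (h x * (\1_cell ((x : E) - l)%R)%:E).
have ma l : measurable_fun setT (a l).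
  apply: emeasurable_funM => //; exact: (measurable_indic_shift (- l)%R measurable_cell).
have a0 l x : 0 <= a l x by apply: mule_ge0 => //; rewrite lee_fin.
transitivity (\int[mu]_x esum L (a ^~ x)).
  apply: eq_integral => x _.
  have Ll0 := lat_floor_lat HL x.
  rewrite (esum_single Ll0) => [||l Ll ll0]; last first.
  - rewrite /a indicE memNset ?mule0// => cl; apply: ll0.
    apply/esym/eqP; rewrite -subr_eq0; apply/eqP.
    apply: (cell_unique HL (x := (x - lat_floor ip b bd x)%R)) => //.
    + by apply: (latB HL) => //; exact: (lat_floor_lat HL).
    + exact: (sub_lat_floor HL).
    + by rewrite addrA subrK.
  - exact: a0.
  - by rewrite /a indicE mem_set ?mule1//; exact: (sub_lat_floor HL).
rewrite (integral_esum _ lat_exhaustion)//; apply: eq_esum => l Ll.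
rewrite -(ge0_integral_shift l (ma l) (a0 l)) [RHS]integral_mkcond.
apply: eq_integral => x _; rewrite /a addrK patchE indicE.
by case: ifPn => _; rewrite ?mule1 ?mule0.
Qed.

Lemma measurable_cell_shift (h : E -> \bar R) l :
  measurable_fun setT (h : borel E -> \bar R) ->
  measurable_fun (cell : set (borel E)) (fun x : borel E => h ((x : E) + l)%R).
Proof.
by move=> mh; apply: measurable_funTS; exact: measurable_comp_shift.
Qed.

Lemma integral_unfold_sum (h : E -> \bar R) :
  measurable_fun setT (h : borel E -> \bar R) -> (forall x, 0 <= h x) ->
  \int[mu]_x h x = \int[mu]_(x in cell) esum L (fun l => h (x + l)%R).
Proof.
move=> mh h0; rewrite integral_unfold// -(integral_esum mu lat_exhaustion)//.
- exact: measurable_cell.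
- by move=> l; exact: measurable_cell_shift.
Qed.

Definition periodic_fun A (g : E -> A) := forall l x, L l -> g (x + l)%R = g x.

Lemma ge0_esumZl (I : choiceType) (S : set I) ss (c : \bar R) (F : I -> \bar R) :
  exhaustion S ss -> 0 <= c -> (forall i, 0 <= F i) ->
  esum S (fun i => c * F i) = c * esum S F.
Proof.
move=> ex c0 F0.
(* An infinite c must be allowed: the factor will be the value of an inner integral, finite only
   almost everywhere at best. *)
have [c1|cfin] : c = +oo \/ c \is a fin_num by case: c c0 => // [r|]; [right|left].
  have [F1|[i Si Fi]] : (forall i, S i -> F i = 0) \/ (exists2 i, S i & F i != 0).
  - have [|h] := pselect (exists2 i, S i & F i != 0); first by right.
    left => i Si; apply/eqP; apply: contrapT => /negP Fi; apply: h.
    by exists i.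
  - by rewrite !esum1 ?mule0// => i Si; rewrite F1 ?mule0.
  have Fp : 0 < F i by rewrite lt_neqAle eq_sym Fi F0.
  have h (G : I -> \bar R) : (forall i, 0 <= G i) -> G i <= esum S G.
    move=> G0; apply: ereal_sup_ubound; exists [set i]; last by rewrite fsbig_set1.
    by split => // _ ->.
  rewrite c1 gt0_mulye; last exact: lt_le_trans Fp (h _ F0).
  apply/eqP; rewrite -leye_eq; apply: le_trans (h _ _); first by rewrite gt0_mulye.
  by move=> k; rewrite mule_ge0.
have h1 := esum_exhaustion ex (F := fun i => c * F i) (fun i _ => mule_ge0 c0 (F0 i)).
have h2 := esum_exhaustion ex (F := F) (fun i _ => F0 i).
rewrite -(cvg_lim _ h1)//; apply/cvg_lim => //.
rewrite (_ : (fun k => _) = fun k => c * \sum_(i <- ss k) F i); last first.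
  by apply/funext => k; rewrite ge0_sume_distrr.
exact: cvgeZl.
Qed.

(** Unfolding the integral of g 1_F over E onto [cell] gives g times the multiplicity of F, which is
    1 almost everywhere. *)
Lemma ge0_integral_tiles F (g : E -> \bar R) : tiles F ->
  measurable_fun setT (g : borel E -> \bar R) -> (forall x, 0 <= g x) ->
  periodic_fun g ->
  \int[mu]_(x in F) g x = \int[mu]_(x in cell) g x.
Proof.
move=> [mF aeF] mg g0 pg.
pose h (x : E) := (g x * (\1_F x)%:E).
have mh : measurable_fun setT (h : borel E -> \bar R).
  apply: emeasurable_funM => //; apply/measurable_EFinP; exact: measurable_indic.
have h0 x : 0 <= h x by apply: mule_ge0 => //; rewrite lee_fin.
transitivity (\int[mu]_x h x).
  rewrite integral_mkcond; apply: eq_integral => x _; rewrite patchE /h indicE.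
  by case: ifPn => _; rewrite ?mule1 ?mule0.
rewrite integral_unfold_sum//.
have E1 (x : E) : esum L (fun l => h (x + l)%R) = g x * multiplicity F x.
  rewrite /multiplicity -(ge0_esumZl lat_exhaustion)//.
  by apply: eq_esum => l Ll; rewrite /h pg.
apply: ae_eq_integral => //.
- exact: measurable_cell.
- apply: (measurable_esum lat_exhaustion) => // [|l]; first exact: measurable_cell.
  exact: measurable_cell_shift.
- exact: measurable_funTS.
- by apply: filterS aeF => x mx _; rewrite E1 mx mule1.
Qed.

Lemma integral_tiles F (g : E -> R) : tiles F ->
  measurable_fun setT (g : borel E -> R) -> periodic_fun g ->
  \int[mu]_(x in F) (g x)%:E = \int[mu]_(x in cell) (g x)%:E.
Proof.
move=> tF mg pg; rewrite integralE [RHS]integralE.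
have mg' : measurable_fun setT (EFin \o g : borel E -> \bar R) by exact/measurable_EFinP.
congr (_ - _); apply: ge0_integral_tiles => //.
- exact: measurable_funepos.
- by move=> l x Ll; rewrite !funeposE /= pg.
- exact: measurable_funeneg.
- by move=> l x Ll; rewrite !funenegE /= pg.
Qed.

(** A translate of [cell] is again a tile, and all tiles give a periodic function the same
    integral. *)
Lemma integral_cell_shift (g : E -> R) (c : E) :
  measurable_fun setT (g : borel E -> R) -> periodic_fun g ->
  \int[mu]_(x in cell) (g (x + c)%R)%:E = \int[mu]_(x in cell) (g x)%:E.
Proof.
move=> mg pg.
have ge0case (k : E -> \bar R) : measurable_fun setT (k : borel E -> \bar R) ->
    (forall x, 0 <= k x) -> periodic_fun k ->
    \int[mu]_(x in cell) k (x + c)%R = \int[mu]_(x in cell) k x.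
  move=> mk k0 pk; rewrite -[RHS](ge0_integral_tiles (cell_shift_tiles (- c)%R))//.
  rewrite integral_mkcond [RHS]integral_mkcond.
  rewrite -[RHS](ge0_integral_shift c)//.
  - apply: eq_integral => x _; rewrite !patchE; congr (if _ then _ else _).
    by apply/idP/idP; rewrite !inE /= addrK.
  - apply/(measurable_restrictT _ _).1 => //; first exact: (cell_shift_tiles (- c)%R).1.
    exact: measurable_funTS.
  - by move=> x; apply: erestrict_ge0 => y _; exact: k0.
rewrite integralE [RHS]integralE.
have mg' : measurable_fun setT (EFin \o g : borel E -> \bar R) by exact/measurable_EFinP.
congr (_ - _).
- rewrite -(ge0case ((EFin \o g)^\+))//.
  + by apply: eq_integral => x _; rewrite !funeposE.
  + exact: measurable_funepos.
  + by move=> l x Ll; rewrite !funeposE /= pg.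
- rewrite -(ge0case ((EFin \o g)^\-))//.
  + by apply: eq_integral => x _; rewrite !funenegE.
  + exact: measurable_funeneg.
  + by move=> l x Ll; rewrite !funenegE /= pg.
Qed.

Lemma cell_fin : mu cell < +oo.
Proof. exact: (inv_fin Hmu measurable_cell (fun x => cell_bounded HL (x := x))). Qed.

(** If the part of U in [cell] were null, so would be all its translates, and unfolding would make U
    null. *)
Lemma open_cell_pos (U : set E) : open U -> (forall l x, L l -> U x -> U (x + l)%R) ->
  U !=set0 -> 0 < mu ((U `&` cell) : set (borel E)).
Proof.
move=> oU pU U0; rewrite lt_neqAle measure_ge0 andbT; apply/eqP => /esym mU0.
have mU := open_borel oU; have mcell := measurable_cell.
have := inv_pos Hmu oU U0; rewrite -[mu U](_ : \int[mu]_x (\1_U x)%:E = _); last first.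
  by rewrite integral_indic// setIT.
rewrite integral_unfold.
- rewrite esum1 ?ltxx// => l Ll; rewrite -[RHS]mU0 -integral_indic//.
  apply: eq_integral => x _; rewrite !indicE; congr ((nat_of_bool _)%:R%:E).
  apply/idP/idP; rewrite !inE; last exact: pU.
  by move=> /(pU _ _ (latN HL Ll)); rewrite addrK.
- by apply/measurable_EFinP; exact: measurable_indic.
- by move=> x; rewrite lee_fin.
Qed.
End Tiling.

Section DominatedConvergence.
Context d (T : measurableType d) (R : realType).
Variables (mu : {measure set T -> \bar R}) (D : set T) (mD : measurable D).

Lemma Rintegral_dominated (f_ : nat -> T -> R) (f g : T -> R) :
  (forall k, measurable_fun D (f_ k)) ->
  (forall x, D x -> f_ k x @[k --> \oo] --> f x) ->
  mu.-integrable D (EFin \o g) -> (forall k x, D x -> `|f_ k x| <= g x) ->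
  mu.-integrable D (EFin \o f) /\
  \int[mu]_(x in D) f_ k x @[k --> \oo] --> \int[mu]_(x in D) f x.
Proof.
move=> mf cf ig fg.
have cf' : forall x, D x -> (EFin \o f_ k) x @[k --> \oo] --> (EFin \o f) x.
  by move=> x Dx; apply: cvg_EFin; [exact: nearW|exact: cf].
have mf' k : measurable_fun D (EFin \o f_ k) by apply/measurable_EFinP.
have mff : measurable_fun D (EFin \o f).
  exact: (emeasurable_fun_cvg (fun k => EFin \o f_ k) _ mf' cf').
have [i1 _ c1] := dominated_convergence mD mf' mff (aeW _ cf') ig
  (aeW _ (fun x k Dx => fg k x Dx : (`|(EFin \o f_ k) x| <= (EFin \o g) x)%E)).
split => //; rewrite /Rintegral; apply: fine_cvg.
by rewrite fineK//; exact: integrable_fin_num.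
Qed.
End DominatedConvergence.

Section CellIntegrals.
Variables (R : realType) (E : normedModType R) (ip : {dot E for idfun}).
Variables (n : nat) (u b bd : 'I_n -> E) (L : set E).
Hypothesis HL : lattice_basis ip u b bd L.
Hypothesis int_L : integral_lattice ip L.
Variable mu : {sigma_finite_measure set (borel E) -> \bar R}.
Hypothesis Hmu : invariant_measure mu.
Local Notation dL := (Pilot.Defs.dual ip L).
Local Notation cell := (cell ip bd : set (borel E)).
Local Notation mfun g := (measurable_fun [set: borel E] (g : borel E -> R)).
Local Notation mcell := (measurable_cell HL).
Local Notation V := (fine (mu cell)).

(** The multiplicity differs from 1 only at points that no translate covers or that two translates
    cover; both sets are null, the second as a countable union of null overlaps. *)
Lemma fundamental_tiles (F : set E) : measurable (F : set (borel E)) ->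
  mu (~` (\bigcup_(l in L) [set l + x | x in F])) = 0%E ->
  (forall l, L l -> l <> 0 -> mu (F `&` [set l + x | x in F]) = 0%E) ->
  tiles L mu F.
Proof.
move=> mF cov dis; split => //.
have trE l : [set l + x | x in F] = (fun x : E => x - l) @^-1` F.
  apply/seteqP; split => [_ [x Fx <-]|x Fx]; first by rewrite /preimage/= addrAC subrr add0r.
  by exists (x - l) => //; rewrite addrC subrK.
have mtr l : measurable ([set l + x | x in F] : set (borel E)).
  by rewrite trE; apply: measurable_shift_set.
have n1 : mu.-negligible (~` (\bigcup_(l in L) [set l + x | x in F]) : set (borel E)).
  exists (~` (\bigcup_(l in L) [set l + x | x in F])); split => //.
  apply: measurableC; apply: (measurable_bigcup_exhaustion (lat_exhaustion HL int_L)).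
  by move=> l _; exact: mtr.
(* The points x such that x + l and x + l' both lie in F, written as a translate of an overlap of F
   with one of its own translates, so that invariance and the hypothesis apply. *)
pose B l l' : set (borel E) := (fun x : E => x + l) @^-1` (F `&` [set (l - l') + x | x in F]).
have n2 : mu.-negligible (\bigcup_(l in L) \bigcup_(l' in [set l' | L l' /\ l' <> l]) B l l').
  apply: (negligible_exhaustion (lat_exhaustion HL int_L)) => l Ll.
  pose ss k := [fset l' in lat_fset ip b L k | l' != l]%fset.
  have ex : exhaustion [set l' | L l' /\ l' <> l] ss.
    have [ssS ssm ssU] := lat_exhaustion HL int_L.
    split=> [k y|k m km y|y [Ly yl]].
    - by rewrite !inE /= => /andP[/ssS Ly /eqP].
    - by rewrite !inE /= => /andP[/(ssm _ _ km) -> ->].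
    - by have [k yk] := ssU y Ly; exists k; rewrite !inE /= yk; apply/eqP.
  apply: (negligible_exhaustion ex) => l' [Ll' ll'].
  exists (B l l'); split => //.
    by apply: measurable_shift_set; apply: measurableI.
  rewrite /B; apply: (eq_trans (inv_shift Hmu _ _)); first by apply: measurableI.
  apply: dis; first exact: (latB HL).
  by move/eqP; rewrite subr_eq0 => /eqP/esym.
apply: negligibleS (negligibleU n1 n2) => x /= nx.
apply: contrapT => /not_orP[/contrapT[l Ll [y Fy ylx]] nB]; apply: nx.
have Fxl : F (x - l) by rewrite -ylx addrAC subrr add0r.
rewrite /multiplicity (esum_single (latN HL Ll)).
- by rewrite indicE mem_set.
- by rewrite lee_fin.
- move=> l' Ll' ll'; rewrite indicE memNset// => Fl'; apply: nB.
  exists (- l); first exact: (latN HL).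
  exists l' => //; split => //.
  by exists (x + l') => //; rewrite addrACA addNr addr0 addrC.
Qed.

Lemma cell_integrable (g : E -> R) (M : R) : mfun g ->
  (forall x, cell x -> `|g x| <= M) -> mu.-integrable cell (EFin \o g).
Proof.
move=> mg gM; apply: measurable_bounded_integrable.
- exact: mcell.
- exact: (cell_fin HL Hmu).
- exact: measurable_funTS.
- exists M; split; rewrite ?num_real// => N MN x cx; apply: le_trans (ltW MN).
  exact: gM.
Qed.

Lemma cell_pos : 0 < V.
Proof.
have := @open_cell_pos _ _ _ _ _ _ _ _ HL int_L mu Hmu setT openT.
rewrite setTI => /(_ (fun _ _ _ _ => Logic.I) (ex_intro _ 0 Logic.I)) h.
by rewrite fine_gt0// h/= (cell_fin HL Hmu).
Qed.

Lemma cintegral_cell_shift (g : E -> R[i]) (c : E) :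
  cmeasurable [set: borel E] (g : borel E -> R[i]) -> periodic_fun L g ->
  cintegral mu cell (fun x => g (x + c)) = cintegral mu cell g.
Proof.
move=> [gR gI] pg; rewrite /cintegral.
rewrite (integral_cell_shift HL int_L Hmu c gR); last by move=> l x Ll /=; rewrite pg.
by rewrite (integral_cell_shift HL int_L Hmu c gI)// => l x Ll /=; rewrite pg.
Qed.

Lemma pairing_measurable y :
  cmeasurable [set: borel E] (fun t : borel E => pairing ip y t).
Proof.
apply: cmeasurable_expi; apply: measurable_funM => //.
rewrite [X in measurable_fun _ X](_ : _ = fun t : borel E => ip (t : E) y); last first.
  by apply/funext => t; rewrite ipC.
exact: (continuous_borel (ip_continuous (y := y) (lat_onb HL))).
Qed.

Lemma pairing_periodic y : dL y -> periodic_fun L (fun t => pairing ip y t).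
Proof.
by move=> dy l x Ll; rewrite pairingDr (pairingC _ y l) (dual_pairing Ll dy) mulr1.
Qed.

Lemma pairing_integrable y : cintegrable mu cell (fun t => pairing ip y t).
Proof.
apply: (@cintegrable_bounded _ _ _ _ _ mcell (cell_fin HL Hmu) _ 1).
  have [h1 h2] := pairing_measurable y; split; exact: measurable_funTS.
by move=> x _; rewrite normc_pairing.
Qed.

(** For y nonzero, the shift by v = y / (2 (y, y)) multiplies the character by <y, v> = -1 and does
    not change the integral over [cell], which is therefore 0. *)
Lemma character_integral y : dL y ->
  cintegral mu cell (fun t => pairing ip y t) = if y == 0 then V%:C%C else 0.
Proof.
move=> dy; have [->|y0] := eqVneq y 0.
  under [X in cintegral _ _ X]eq_fun do rewrite pairing0l.
  apply: complex_eqP; rewrite ?Re_cintegral ?Im_cintegral/=.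
    by rewrite Rintegral_cst ?mul1r//; exact: mcell.
  by rewrite Rintegral_cst ?mul0r//; exact: mcell.
have yy : ip y y != 0 by rewrite -(normE (lat_onb HL)) expf_neq0// normr_eq0.
pose v := (2 * ip y y)^-1 *: y.
have pv : pairing ip y v = -1.
  rewrite /pairing /v ipZr (_ : 2 * pi * _ = pi); last by field.
  by rewrite /expi cospi sinpi; apply/eqP; rewrite eq_complex/= oppr0 !eqxx.
have := cintegral_cell_shift v (pairing_measurable y) (pairing_periodic dy).
under [X in cintegral _ _ X]eq_fun do rewrite pairingDr pv mulrC.
rewrite (cintegralZ mcell _ (pairing_integrable y)) mulN1r => /eqP.
rewrite -subr_eq0 -opprD oppr_eq0 -mulr2n -mulr_natl mulf_eq0 => /orP[|/eqP//].
by rewrite pnatr_eq0.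
Qed.

Lemma ge0_integral_prod (A B : set (borel E)) (f : borel E * borel E -> \bar R) :
  measurable A -> measurable B ->
  measurable_fun [set: borel E * borel E] f -> (forall p, 0 <= f p)%E ->
  (\int[product_measure1 mu mu]_(p in A `*` B) f p =
   \int[mu]_(x in A) \int[mu]_(y in B) f (x, y))%E.
Proof.
move=> mA mB mf f0.
rewrite integral_mkcond fubini_tonelli1; last 2 first.
- apply/(measurable_restrictT _ _).1; first exact: measurableX.
  exact: measurable_funTS.
- by move=> p; apply: erestrict_ge0.
rewrite [RHS]integral_mkcond; apply: eq_integral => x _; rewrite patchE.
case: ifPn => xA; last first.
  rewrite /fubini_F; apply: integral0_eq => y _; rewrite patchE ifF//.
  by apply/negP; rewrite inE => -[/= /mem_set]; rewrite (negbTE xA).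
rewrite [RHS]integral_mkcond; apply: eq_integral => y _; rewrite !patchE.
congr (if _ then _ else _); apply/idP/idP; rewrite !inE; first by case.
by split => //; move: xA; rewrite inE.
Qed.

Lemma ge0_measurable_section (A : set (borel E)) (f : borel E * borel E -> \bar R) :
  measurable A -> measurable_fun [set: borel E * borel E] f -> (forall p, 0 <= f p)%E ->
  measurable_fun [set: borel E] (fun x => \int[mu]_(y in A) f (x, y))%E.
Proof.
move=> mA mf f0.
rewrite (_ : (fun x => _) = fun x => (\int[mu]_y (f (x, y) * (\1_A y)%:E))%E); last first.
  apply/funext => x; rewrite integral_mkcond; apply: eq_integral => y _.
  by rewrite patchE indicE; case: ifPn; rewrite ?mule1 ?mule0.
apply: (@measurable_fun_fubini_tonelli_F _ _ _ _ _ mu (fun p => f p * (\1_A p.2)%:E)%E).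
  apply: emeasurable_funM => //; apply/measurable_EFinP.
  have mA' : measurable_fun setT (\1_A : borel E -> R) by exact: measurable_indic.
  by exact: (measurableT_comp mA' measurable_snd).
by move=> p; rewrite mule_ge0// lee_fin.
Qed.

Lemma ge0_integral_prod_tiles (F : set E) (f : borel E * borel E -> \bar R) :
  tiles L mu F -> measurable_fun [set: borel E * borel E] f ->
  (forall p, 0 <= f p)%E ->
  (forall l1 l2 x y, L l1 -> L l2 -> f ((x + l1 : E), (y + l2 : E)) = f (x, y)) ->
  (\int[product_measure1 mu mu]_(p in F `*` F) f p =
   \int[mu]_(x in cell) \int[mu]_(y in cell) f (x, y))%E.
Proof.
move=> tF mf f0 pf; have [mF _] := tF.
rewrite ge0_integral_prod//.
transitivity (\int[mu]_(x in F) \int[mu]_(y in cell) f (x, y))%E.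
  apply: eq_integral => x _; apply: (ge0_integral_tiles HL int_L) => //.
    by have := measurableT_comp mf (pair1_measurable x).
  by move=> l y Ll; rewrite -{1}[x](addr0 (x : E)) pf//; exact: (lat0 HL).
apply: (ge0_integral_tiles HL int_L) => //.
- by apply: ge0_measurable_section => //; exact: mcell.
- by move=> x; apply: integral_ge0.
- move=> l x Ll; apply: eq_integral => y _.
  by rewrite -{1}[y](addr0 (y : E)) pf//; exact: (lat0 HL).
Qed.
End CellIntegrals.

(** * Uniqueness of Fourier coefficients *)

Section FourierUniqueness.
Variables (R : realType) (E : normedModType R) (ip : {dot E for idfun}).
Variables (n : nat) (u b bd : 'I_n -> E) (L : set E).
Hypothesis HL : lattice_basis ip u b bd L.
Hypothesis int_L : integral_lattice ip L.
Variable mu : {sigma_finite_measure set (borel E) -> \bar R}.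
Hypothesis Hmu : invariant_measure mu.
Local Notation dL := (Pilot.Defs.dual ip L).
Local Notation cell := (cell ip bd : set (borel E)).
Local Notation mfun g := (measurable_fun [set: borel E] (g : borel E -> R)).
Local Notation I f := (\int[mu]_(x in cell) f x).
Local Notation mcell := (measurable_cell HL).
Local Notation V := (fine (mu cell)).
Local Notation arg y t := (2 * pi * ip y t).

(** Real trigonometric polynomials with frequencies in the dual lattice. Frequency 0 gives the
    constants, and the product-to-sum formulas give closure under products. *)
Inductive trig_poly : (E -> R) -> Prop :=
| tp_cos y : dL y -> trig_poly (fun t => cos (arg y t))
| tp_sin y : dL y -> trig_poly (fun t => sin (arg y t))
| tp_scale c p : trig_poly p -> trig_poly (fun t => c * p t)
| tp_add p q : trig_poly p -> trig_poly q -> trig_poly (fun t => p t + q t).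

Lemma trig_poly_ext p q : p =1 q -> trig_poly p -> trig_poly q.
Proof. by move=> /funext ->. Qed.

Lemma trig_poly_cst c : trig_poly (fun=> c).
Proof.
apply: (trig_poly_ext (p := fun t => c * cos (arg 0 t))) => [t|].
  by rewrite ip0l mulr0 cos0 mulr1.
by apply/tp_scale/tp_cos; exact: (dual0 HL).
Qed.

Lemma argD y z t : arg (y + z) t = arg y t + arg z t.
Proof. by rewrite ipDl mulrDr. Qed.
Lemma argB y z t : arg (y - z) t = arg y t - arg z t.
Proof. by rewrite ipBl mulrBr. Qed.

Lemma trig_polyM p q : trig_poly p -> trig_poly q -> trig_poly (fun t => p t * q t).
Proof.
move=> tp; elim: tp q => {p}.
- move=> y dy q; elim => {q}.
  + move=> z dz; apply: (trig_poly_ext (p := fun t => 2^-1 * (cos (arg (y - z) t) + cos (arg (y + z) t)))).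
      by move=> t /=; rewrite argB argD cosB cosD; field.
    by apply: tp_scale; apply: tp_add; apply: tp_cos; [exact: (dualB HL)|exact: (dualD HL)].
  + move=> z dz; apply: (trig_poly_ext (p := fun t => 2^-1 * (sin (arg (y + z) t) + (-1) * sin (arg (y - z) t)))).
      by move=> t /=; rewrite argB argD sinB sinD; field.
    apply: tp_scale; apply: tp_add; first by apply: tp_sin; exact: (dualD HL).
    by apply/tp_scale/tp_sin; exact: (dualB HL).
  + move=> c q _ IH; apply: (trig_poly_ext (p := fun t => c * (cos (arg y t) * q t))).
      by move=> t; ring.
    exact: tp_scale.
  + move=> q1 q2 _ IH1 _ IH2; apply: (trig_poly_ext (p := fun t => cos (arg y t) * q1 t + cos (arg y t) * q2 t)).
      by move=> t; ring.
    exact: tp_add.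
- move=> y dy q; elim => {q}.
  + move=> z dz; apply: (trig_poly_ext (p := fun t => 2^-1 * (sin (arg (y + z) t) + sin (arg (y - z) t)))).
      by move=> t /=; rewrite argB argD sinB sinD; field.
    by apply: tp_scale; apply: tp_add; apply: tp_sin; [exact: (dualD HL)|exact: (dualB HL)].
  + move=> z dz; apply: (trig_poly_ext (p := fun t => 2^-1 * (cos (arg (y - z) t) + (-1) * cos (arg (y + z) t)))).
      by move=> t /=; rewrite argB argD cosB cosD; field.
    apply: tp_scale; apply: tp_add; first by apply: tp_cos; exact: (dualB HL).
    by apply/tp_scale/tp_cos; exact: (dualD HL).
  + move=> c q _ IH; apply: (trig_poly_ext (p := fun t => c * (sin (arg y t) * q t))).
      by move=> t; ring.
    exact: tp_scale.
  + move=> q1 q2 _ IH1 _ IH2; apply: (trig_poly_ext (p := fun t => sin (arg y t) * q1 t + sin (arg y t) * q2 t)).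
      by move=> t; ring.
    exact: tp_add.
- move=> c p _ IH q tq; apply: (trig_poly_ext (p := fun t => c * (p t * q t))).
    by move=> t; ring.
  exact/tp_scale/IH.
- move=> p1 p2 _ IH1 _ IH2 q tq.
  apply: (trig_poly_ext (p := fun t => p1 t * q t + p2 t * q t)).
    by move=> t; ring.
  by apply: tp_add; [exact: IH1|exact: IH2].
Qed.

Lemma arg_continuous y : continuous (fun t => arg y t).
Proof.
move=> t; apply: cvgM; first exact: cvg_cst.
under eq_cvg do rewrite ipC; rewrite ipC.
exact: (ip_continuous (y := y) (lat_onb HL)).
Qed.

Lemma trig_poly_continuous p : trig_poly p -> continuous p.
Proof.
elim => {p}.
- move=> y _ t; apply: continuous_comp; [exact: arg_continuous|exact: continuous_cos].
- move=> y _ t; apply: continuous_comp; [exact: arg_continuous|exact: continuous_sin].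
- by move=> c p _ pc t; apply: cvgM; [exact: cvg_cst|exact: pc].
- by move=> p q _ pc _ qc t; apply: cvgD; [exact: pc|exact: qc].
Qed.

Lemma trig_poly_bounded p : trig_poly p -> exists M : R, forall t, `|p t| <= M.
Proof.
elim => {p}.
- by move=> y _; exists 1 => t; exact: cos_max.
- by move=> y _; exists 1 => t; exact: sin_max.
- by move=> c p _ [M pM]; exists (`|c| * M) => t; rewrite normrM ler_wpM2l.
- move=> p q _ [M pM] _ [N qN]; exists (M + N) => t.
  by rewrite (le_trans (ler_normD _ _))// lerD.
Qed.

Lemma trig_poly_periodic p : trig_poly p -> periodic_fun L p.
Proof.
have key y l t : dL y -> L l -> expi (arg y (t + l)) = expi (arg y t).
  by move=> dy Ll; have := pairing_periodic dy t Ll.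
elim => {p}.
- by move=> y dy l t Ll; have [] := key y l t dy Ll.
- by move=> y dy l t Ll; have [] := key y l t dy Ll.
- by move=> c p _ pp l t Ll; rewrite pp.
- by move=> p q _ pp _ qp l t Ll; rewrite pp// qp.
Qed.

Lemma trig_poly_measurable p : trig_poly p -> mfun p.
Proof. by move=> /trig_poly_continuous; exact: continuous_borel. Qed.

Lemma integrable_mul (g h : E -> R) (M : R) :
  mu.-integrable cell (EFin \o g) -> mfun h -> (forall t, cell t -> `|h t| <= M) ->
  mu.-integrable cell (EFin \o (fun t => g t * h t)).
Proof.
move=> ig mh hM; have := integrableMl mcell ig (h := h).
move=> /(_ (measurable_funTS mh)) H; apply: H.
exists M; split; rewrite ?num_real// => N MN x cx; apply: le_trans (ltW MN).
exact: hM.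
Qed.

Definition zero_coefs (g : E -> R) := forall y, dL y ->
  I (fun t => g t * cos (arg y t)) = 0 /\ I (fun t => g t * sin (arg y t)) = 0.

Lemma zero_coefs_trig g p : mu.-integrable cell (EFin \o g) -> zero_coefs g ->
  trig_poly p -> I (fun t => g t * p t) = 0.
Proof.
move=> ig g0; elim => {p}.
- by move=> y /g0[].
- by move=> y /g0[].
- move=> c p tp IH; have [M pM] := trig_poly_bounded tp.
  have ip' := integrable_mul ig (trig_poly_measurable tp) (fun t _ => pM t).
  rewrite (eq_Rintegral _ (g := fun t => c * (g t * p t))).
    by rewrite RintegralZl// ?IH ?mulr0//; exact: mcell.
  by move=> t _; rewrite mulrCA.
- move=> p q tp IHp tq IHq.
  have [M pM] := trig_poly_bounded tp; have [N qN] := trig_poly_bounded tq.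
  have ip' := integrable_mul ig (trig_poly_measurable tp) (fun t _ => pM t).
  have iq' := integrable_mul ig (trig_poly_measurable tq) (fun t _ => qN t).
  rewrite (eq_Rintegral _ (g := fun t => g t * p t + g t * q t)).
    by rewrite (RintegralD mcell ip' iq') IHp IHq addr0.
  by move=> t _; rewrite mulrDr.
Qed.

(* The powers of [bump] are trigonometric polynomials concentrating near the
   lattice: suitably normalised, they form an approximate identity. *)
Definition bump (t : E) : R := \prod_i ((1 + cos (arg (bd i) t)) / 2).

Lemma bump_factor i t : 0 <= (1 + cos (arg (bd i) t)) / 2 <= 1.
Proof. by have := cos_geN1 (arg (bd i) t); have := cos_le1 (arg (bd i) t); lra. Qed.

Lemma bump_ge0 t : 0 <= bump t.
Proof. by apply: prodr_ge0 => i _; have /andP[] := bump_factor i t. Qed.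

Lemma bump_le i t : bump t <= (1 + cos (arg (bd i) t)) / 2.
Proof.
have /andP[h0 h1] := bump_factor i t.
rewrite /bump (bigD1 i)//= ler_piMr//.
by apply: prodr_ile1 => j _; exact: bump_factor.
Qed.

Lemma bump0 : bump 0 = 1.
Proof.
rewrite /bump big1// => i _; rewrite ip0r mulr0 cos0 (_ : 1 + 1 = 2)// divff//.
Qed.

Lemma bump_trig : trig_poly bump.
Proof.
rewrite /bump; elim: (index_enum _) => [|i s IH].
  by apply: (trig_poly_ext (p := fun=> 1)) => [t|]; [rewrite big_nil|exact: trig_poly_cst].
apply: (trig_poly_ext (p := fun t => ((1 + cos (arg (bd i) t)) / 2) * \prod_(j <- s) ((1 + cos (arg (bd j) t)) / 2))).
  by move=> t; rewrite big_cons.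
apply: trig_polyM => //.
apply: (trig_poly_ext (p := fun t => 2^-1 + 2^-1 * cos (arg (bd i) t))).
  by move=> t; field.
by apply: tp_add; [exact: trig_poly_cst|apply/tp_scale/tp_cos/(dual_bd HL)].
Qed.

Lemma bumpX_trig N : trig_poly (fun t => bump t ^+ N).
Proof.
elim: N => [|N IH]; first exact: trig_poly_cst.
apply: (trig_poly_ext (p := fun t => bump t * bump t ^+ N)) => [t|].
  by rewrite exprS.
exact: (trig_polyM bump_trig IH).
Qed.

(** Each factor of [bump] is at least [bump] itself. A value near 1 therefore forces every
    coordinate of t in the basis [b] to be near an integer. *)
Lemma bump_near (d : R) : 0 < d -> exists2 eta : R, 0 < eta < 1 &
  forall t, 1 - eta < bump t -> exists2 l, L l & `|t - l| < d.
Proof.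
move=> d0; pose B := \sum_i `|b i|.
have B0 : 0 <= B by apply: sumr_ge0.
(* The tolerance on coordinates: the second bound gives e B < d, and 1/4 keeps cos(2 pi e)
   nonnegative, hence eta below 1. *)
pose e := Num.min (4^-1) (d / (2 * (1 + B))).
have e0 : 0 < e by rewrite lt_min invr_gt0 ltr0n divr_gt0// mulr_gt0// ltr_pwDl.
have e4 : e <= 4^-1 by rewrite ge_min lexx.
have eB : e * B < d.
  apply: (@le_lt_trans _ _ (d / (2 * (1 + B)) * B)).
    by rewrite ler_wpM2r// ge_min lexx orbT.
  by rewrite mulrAC ltr_pdivrMr ?mulr_gt0 ?ltr_pwDl// ltr_pM2l//; lra.
have pi0 : 0 < pi :> R := pi_gt0 R.
exists ((1 - cos (2 * pi * e)) / 2).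
  have c1 : cos (2 * pi * e) < 1 by apply: cos_lt1; lra.
  have c2 : 0 <= cos (2 * pi * e).
    apply: cos_ge0_pihalf; have := mulr_ge0 (ltW pi0) (ltW e0).
    have : pi * e <= pi / 4 by rewrite ler_pM2l.
    by lra.
  by lra.
(* Rounding to a nearest integer: the deviation is at most 1/2, a range on which cos(2 pi s)
   decreases with |s|. *)
move=> t tb; pose m i : int := Num.floor (ip t (bd i) + 2^-1).
exists (\sum_i b i *~ m i).
  by rewrite (lat_set HL); exists m.
have ci i : ip (t - \sum_i b i *~ m i) (bd i) = ip t (bd i) - (m i)%:~R.
  by rewrite ipBl (ip_lat_sum HL).
rewrite [t - _](lat_sum HL) (le_lt_trans (ler_norm_sum _ _ _))//.
apply: le_lt_trans eB; rewrite mulr_sumr; apply: ler_sum => i _.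
rewrite normrZ ler_wpM2r// ci.
set s := _ - _; have s2 : `|s| <= 2^-1.
  have h1 : (m i)%:~R <= ip t (bd i) + 2^-1 by exact: ge_floor.
  have h2 : ip t (bd i) + 2^-1 < (m i + 1)%:~R by exact: floorD1_gt.
  by rewrite intrD in h2; rewrite ler_norml /s; lra.
rewrite leNgt; apply/negP => es.
have := lt_le_trans tb (bump_le i t).
have -> : cos (arg (bd i) t) = cos (2 * pi * `|s|).
  have -> : cos (2 * pi * `|s|) = cos (2 * pi * s).
    have [s0|s0] := leP 0 s; first by rewrite ger0_norm.
    by rewrite ltr0_norm// mulrN cosN.
  rewrite ipC (_ : ip t (bd i) = s + (m i)%:~R) ?subrK//.
  have : expi (2 * pi * (s + (m i)%:~R)) = expi (2 * pi * s).
    by rewrite mulrDr expiD expi_int mulr1.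
  by rewrite {1 2}/s subrK => -[].
have : cos (2 * pi * `|s|) <= cos (2 * pi * e).
  have k0 : 0 < 2 * pi :> R by rewrite mulr_gt0.
  rewrite leNgt ltr_cos ?in_itv/= -?leNgt.
  - by rewrite ler_pM2l// ltW.
  - by rewrite mulr_ge0 ?(ltW k0)//=; have := ler_pM2l pi0 `|s| 2^-1; rewrite s2; lra.
  - by rewrite mulr_ge0 ?(ltW k0) ?(ltW e0)//=; have := ler_pM2l pi0 e 4^-1; rewrite e4; lra.
by lra.
Qed.

Variable Psi : E -> R.
Hypothesis Psi_c : continuous Psi.
Hypothesis Psi_p : periodic_fun L Psi.
Variable M : R.
Hypothesis Psi_M : forall t, `|Psi t| <= M.

Definition bump_avg N x := I (fun t => bump t ^+ N * Psi (x + t)) / I (fun t => bump t ^+ N).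

Lemma bumpX_integrable N : mu.-integrable cell (EFin \o (fun t => bump t ^+ N)).
Proof.
have tp := bumpX_trig N; have [K tK] := trig_poly_bounded tp.
exact: (cell_integrable HL Hmu (trig_poly_measurable tp) (fun t _ => tK t)).
Qed.

Lemma Psi_shift_integrable N x :
  mu.-integrable cell (EFin \o (fun t => bump t ^+ N * Psi (x + t))).
Proof.
apply: (integrable_mul (bumpX_integrable N) (M := M)) => //.
have := measurable_comp_shift x (continuous_borel Psi_c).
by under eq_fun do rewrite addrC.
Qed.

Definition bump_mass (c : R) := fine (mu ([set t | c < bump t] `&` cell)).

Lemma open_bump (c : R) : open [set t | c < bump t].
Proof.
rewrite (_ : [set t | _] = bump @^-1` [set y | c < y])//.
apply: open_comp; last exact: open_gt.
by move=> t _; exact: (trig_poly_continuous bump_trig).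
Qed.

Lemma bump_mass_gt0 c : c < 1 -> 0 < bump_mass c.
Proof.
move=> c1.
have := @open_cell_pos _ _ _ _ _ _ _ _ HL int_L mu Hmu _ (open_bump c).
move=> /(_ _ (ex_intro _ 0 _)) h.
have h0 : (0 < mu ([set t | (c < bump t)%R] `&` cell))%E.
  apply: h => /=; last by rewrite bump0.
  by move=> l x Ll /=; rewrite (trig_poly_periodic bump_trig).
rewrite fine_gt0// h0/=; apply: le_lt_trans (cell_fin HL Hmu).
apply: le_measure; rewrite ?inE//; last exact: mcell.
by apply: measurableI; [exact: open_borel (open_bump c)|exact: mcell].
Qed.

(** A lower bound on the normalising integral: with c close to 1 its decay in N is slower than that
    of [bump ^+ N] away from the lattice. *)
Lemma bumpX_lower c N : 0 <= c -> c ^+ N * bump_mass c <= I (fun t => bump t ^+ N).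
Proof.
move=> c0; set U := [set t | c < bump t].
have mU : measurable (U : set (borel E)) by exact: open_borel (open_bump c).
have -> : bump_mass c = I (fun t => \1_U t).
  rewrite /bump_mass /Rintegral integral_indic//; exact: mcell.
have iU : mu.-integrable cell (EFin \o (\1_U : E -> R)).
  apply: (cell_integrable HL Hmu (M := 1)); first exact: measurable_indic.
  by move=> t _; rewrite indicE; case: (_ \in _); rewrite ?normr1 ?normr0.
rewrite -RintegralZl//; last exact: mcell.
apply: le_Rintegral => //; first exact: mcell.
- have := integrable_lin mcell (c ^+ N) 0 iU iU; case=> h _.
  apply: eq_integrable h => //; first exact: mcell.
  by move=> t _ /=; rewrite mul0r addr0.
- exact: bumpX_integrable.
- move=> t _; rewrite indicE; have [tU|_] := boolP (t \in U).
    by rewrite mulr1 lerXn2r ?nnegrE ?bump_ge0//; move: tU; rewrite inE => /ltW.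
  by rewrite mulr0 exprn_ge0// bump_ge0.
Qed.

Lemma bumpX_gt0 N : 0 < I (fun t => bump t ^+ N).
Proof.
have h : 0 <= 2^-1 :> R by lra.
apply: lt_le_trans (bumpX_lower N h); rewrite mulr_gt0 ?exprn_gt0//.
by apply: bump_mass_gt0; lra.
Qed.

Lemma bump_avg_bounded N x : `|bump_avg N x| <= M.
Proof.
rewrite /bump_avg normrM normfV (gtr0_norm (bumpX_gt0 N)) ler_pdivrMr ?bumpX_gt0//.
apply: le_trans (le_normr_Rintegral mcell (Psi_shift_integrable N x)) _.
rewrite -RintegralZl//; [|exact: mcell|exact: bumpX_integrable].
apply: le_Rintegral; first exact: mcell.
- have := integrable_norm (Psi_shift_integrable N x).
  by apply: eq_integrable => //; exact: mcell.
- have := integrableZl mcell M (bumpX_integrable N).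
  by apply: eq_integrable => //; exact: mcell.
- move=> t _; rewrite normrM ger0_norm ?exprn_ge0 ?bump_ge0// mulrC.
  by rewrite ler_wpM2r ?exprn_ge0 ?bump_ge0.
Qed.

(** Where bump > 1 - eta, t is near a lattice vector and Psi(x + t) is within e of Psi(x). Elsewhere
    bump^N is at most (1 - eta)^N, while the normalising integral is at least (1 - eta/2)^N m; the
    quotient q of the two bases is below 1. The constant 2 M V / m uses |Psi| <= M and the volume V
    of [cell]. *)
Lemma bump_avg_diff (x : E) (e : R) : 0 < e -> exists2 q : R, 0 <= q < 1 &
  exists C : R, forall N, `|bump_avg N x - Psi x| <= e + C * q ^+ N.
Proof.
move=> e0.
have M0 : 0 <= M by apply: le_trans (Psi_M 0).
have /cvgrPdist_lt/(_ e e0)/nbhs_normP[d /= d0 dP] := Psi_c (x := x).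
have [eta /andP[eta0 eta1] etaP] := bump_near d0.
pose q := (1 - eta) / (1 - eta / 2).
have q0 : 0 < 1 - eta / 2 by lra.
exists q; first by rewrite divr_ge0 ?ltr_pdivrMr//= ?mul1r; lra.
pose m := bump_mass (1 - eta / 2).
have m0 : 0 < m by apply: bump_mass_gt0; lra.
exists (2 * M * V / m) => N.
have key t : `|Psi (x + t) - Psi x| * bump t ^+ N <= e * bump t ^+ N + 2 * M * (1 - eta) ^+ N.
  have bN0 : 0 <= bump t ^+ N by rewrite exprn_ge0 ?bump_ge0.
  have [tb|tb] := ltP (1 - eta) (bump t).
    have [l Ll tl] := etaP _ tb.
    rewrite -[leLHS]addr0 lerD//.
      rewrite ler_wpM2r//= distrC ltW//.
      rewrite -{1}(subrK l t) addrA Psi_p//; apply: dP => /=.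
      by rewrite opprD addNKr normrN.
    by rewrite !mulr_ge0 ?exprn_ge0//; lra.
  rewrite -[leLHS]add0r lerD//; first by rewrite mulr_ge0// ltW.
  apply: ler_pM => //.
    by rewrite (le_trans (ler_normB _ _))// mulr_natl mulr2n lerD.
  by rewrite lerXn2r ?nnegrE ?bump_ge0//; lra.
have iN := bumpX_integrable N.
have ic c : mu.-integrable cell (EFin \o (fun=> c : R)).
  by apply: (cell_integrable HL Hmu (M := `|c|)).
have ib c : mu.-integrable cell (EFin \o (fun t => c * bump t ^+ N)).
  have := integrableZl mcell c iN.
  by apply: eq_integrable => //; exact: mcell.
have -> : bump_avg N x - Psi x =
    I (fun t => (Psi (x + t) - Psi x) * bump t ^+ N) / I (fun t => bump t ^+ N).
  have -> : I (fun t => (Psi (x + t) - Psi x) * bump t ^+ N) =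
      I (fun t => bump t ^+ N * Psi (x + t) - Psi x * bump t ^+ N).
    by apply: eq_Rintegral => t _; ring.
  rewrite /bump_avg RintegralB ?RintegralZl//; [|exact: mcell|exact: mcell|exact: Psi_shift_integrable].
  by rewrite mulrBl mulfK// gt_eqF// bumpX_gt0.
rewrite normrM normfV (gtr0_norm (bumpX_gt0 N)) ler_pdivrMr ?bumpX_gt0//.
have idiff : mu.-integrable cell (EFin \o (fun t => (Psi (x + t) - Psi x) * bump t ^+ N)).
  have := integrableB mcell (Psi_shift_integrable N x) (ib (Psi x)).
  apply: eq_integrable => //; first exact: mcell.
  by move=> t _ /=; rewrite -EFinB; congr EFin; ring.
apply: le_trans (le_normr_Rintegral mcell idiff) _.
have h1 : I (fun t => `|(Psi (x + t) - Psi x) * bump t ^+ N|) <=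
   I (fun t => e * bump t ^+ N + 2 * M * (1 - eta) ^+ N).
  apply: le_Rintegral; first exact: mcell.
  - have := integrable_norm idiff.
    by apply: eq_integrable => //; exact: mcell.
  - have := integrableD mcell (ib e) (ic (2 * M * (1 - eta) ^+ N)).
    by apply: eq_integrable => //; exact: mcell.
  - by move=> t _; rewrite normrM (ger0_norm (exprn_ge0 _ (bump_ge0 _))).
apply: (le_trans h1).
rewrite (RintegralD mcell (ib e) (ic _)) (RintegralZl e mcell iN).
rewrite Rintegral_cst; last exact: mcell.
rewrite [leRHS]mulrDl lerD2l.
have h2 := bumpX_lower N (ltW q0).
rewrite /q expr_div_n.
have qN0 : 0 < (1 - eta / 2) ^+ N by rewrite exprn_gt0.
rewrite (_ : 2 * M * (1 - eta) ^+ N * V =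
  2 * M * V / m * ((1 - eta) ^+ N / (1 - eta / 2) ^+ N) * ((1 - eta / 2) ^+ N * m)); last first.
  by field; rewrite ?gt_eqF.
rewrite ler_wpM2l//; rewrite !mulr_ge0 ?invr_ge0 ?(ltW m0) ?(ltW qN0) ?exprn_ge0//; try lra.
exact/ltW/(cell_pos HL int_L Hmu).
Qed.

Lemma bump_avg_cvg (x : E) : bump_avg N x @[N --> \oo] --> Psi x.
Proof.
apply/cvgrPdist_le => e e0.
have e2 : 0 < e / 2 by rewrite divr_gt0.
have [q /andP[q0 q1] [C hC]] := bump_avg_diff x e2.
have : C * q ^+ N @[N --> \oo] --> C * 0.
  by apply: cvgM; [exact: cvg_cst|apply: cvg_expr; rewrite ger0_norm].
rewrite mulr0 => /cvgrPdist_le/(_ _ e2); apply: filterS => N.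
rewrite sub0r normrN => h; rewrite distrC (le_trans (hC N))//.
by have := ler_norm (C * q ^+ N); lra.
Qed.

(** The addition formulas separate t from x in cos and sin of (y, t - x), so integrating against Psi
    only changes the coefficients. *)
Lemma kernel_trig p : trig_poly p -> trig_poly (fun x => I (fun t => p (t - x) * Psi t)).
Proof.
have mPsi := continuous_borel Psi_c.
have iPsi q : trig_poly q -> mu.-integrable cell (EFin \o (fun t => q t * Psi t)).
  move=> tq; have [K qK] := trig_poly_bounded tq.
  apply: (integrable_mul (M := M)) => //.
  exact: (cell_integrable HL Hmu (trig_poly_measurable tq) (fun t _ => qK t)).
have shift q x : trig_poly q -> trig_poly (fun t => q (t - x)).
  elim => {q}.
  - move=> y dy; apply: (trig_poly_ext (p := fun t => cos (arg y x) * cos (arg y t) + sin (arg y x) * sin (arg y t))).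
      by move=> t; rewrite ipBr mulrBr cosB; ring.
    by apply: tp_add; apply: tp_scale; [exact: tp_cos|exact: tp_sin].
  - move=> y dy; apply: (trig_poly_ext (p := fun t => cos (arg y x) * sin (arg y t) + (- sin (arg y x)) * cos (arg y t))).
      by move=> t; rewrite ipBr mulrBr sinB; ring.
    by apply: tp_add; apply: tp_scale; [exact: tp_sin|exact: tp_cos].
  - by move=> c q _ IH; exact: tp_scale.
  - by move=> q1 q2 _ IH1 _ IH2; exact: tp_add.
elim => {p}.
- move=> y dy; apply: (trig_poly_ext (p := fun x => I (fun t => cos (arg y t) * Psi t) * cos (arg y x) + I (fun t => sin (arg y t) * Psi t) * sin (arg y x))).
    move=> x; rewrite -!RintegralZr//; try exact: mcell; try (by apply: iPsi; constructor).
    rewrite -RintegralD//; try exact: mcell.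
    + by apply: eq_Rintegral => t _; rewrite ipBr mulrBr cosB; ring.
    + have := integrableZr mcell (cos (arg y x)) (iPsi _ (tp_cos dy)).
      by apply: eq_integrable => //; exact: mcell.
    + have := integrableZr mcell (sin (arg y x)) (iPsi _ (tp_sin dy)).
      by apply: eq_integrable => //; exact: mcell.
  by apply: tp_add; apply: tp_scale; constructor.
- move=> y dy; apply: (trig_poly_ext (p := fun x => I (fun t => sin (arg y t) * Psi t) * cos (arg y x) + (- I (fun t => cos (arg y t) * Psi t)) * sin (arg y x))).
    move=> x; rewrite mulNr -!RintegralZr//; try exact: mcell; try (by apply: iPsi; constructor).
    rewrite -RintegralB//; try exact: mcell.
    + by apply: eq_Rintegral => t _; rewrite ipBr mulrBr sinB; ring.
    + have := integrableZr mcell (cos (arg y x)) (iPsi _ (tp_sin dy)).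
      by apply: eq_integrable => //; exact: mcell.
    + have := integrableZr mcell (sin (arg y x)) (iPsi _ (tp_cos dy)).
      by apply: eq_integrable => //; exact: mcell.
  by apply: tp_add; apply: tp_scale; constructor.
- move=> c p tp IH; apply: (trig_poly_ext (p := fun x => c * I (fun t => p (t - x) * Psi t))).
    move=> x; rewrite -RintegralZl//; [|exact: mcell|exact/iPsi/shift].
    by apply: eq_Rintegral => t _; ring.
  exact: tp_scale.
- move=> p q tp IHp tq IHq.
  apply: (trig_poly_ext (p := fun x => I (fun t => p (t - x) * Psi t) + I (fun t => q (t - x) * Psi t))).
    move=> x; rewrite -RintegralD//; [|exact: mcell|exact/iPsi/shift|exact/iPsi/shift].
    by apply: eq_Rintegral => t _; ring.
  exact: tp_add.
Qed.

(** By invariance of integrals over [cell], the translation can be moved from Psi to the power of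
    [bump]. *)
Lemma bump_avg_trig N : trig_poly (bump_avg N).
Proof.
apply: (trig_poly_ext (p := fun x => (I (fun t => bump t ^+ N))^-1 * I (fun t => bump (t - x) ^+ N * Psi t))).
  move=> x; rewrite /bump_avg mulrC; congr (_ / _).
  rewrite /Rintegral; congr fine.
  have mPsi := continuous_borel Psi_c.
  have mb := measurable_comp_shift (- x) (trig_poly_measurable (bumpX_trig N)).
  rewrite -(integral_cell_shift HL int_L Hmu x (g := fun t => bump (t - x) ^+ N * Psi t)).
  - by apply: eq_integral => t _; rewrite addrK (addrC t x).
  - exact: measurable_funM.
  - move=> l t Ll; rewrite Psi_p// addrAC.
    by rewrite (trig_poly_periodic bump_trig (t - x) Ll).
apply: tp_scale; exact: (kernel_trig (bumpX_trig N)).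
Qed.

(** g is orthogonal to the trigonometric polynomials [bump_avg N], which converge pointwise to Psi
    and are all bounded by M; dominated convergence concludes. *)
Lemma zero_coefs_continuous g : mu.-integrable cell (EFin \o g) -> zero_coefs g ->
  I (fun t => g t * Psi t) = 0.
Proof.
move=> ig g0.
have mbg N : measurable_fun cell (fun t : borel E => g t * bump_avg N t).
  apply: measurable_funM; first by have /integrableP[/measurable_EFinP] := ig.
  exact: measurable_funTS (trig_poly_measurable (bump_avg_trig N)).
have H := @Rintegral_dominated _ _ _ mu _ mcell (fun N t => g t * bump_avg N t)
  (fun t => g t * Psi t) (fun t => `|g t| * M) mbg.
have [] := H.
- by move=> t _; apply: cvgM; [exact: cvg_cst|exact: bump_avg_cvg].
- have := integrableZr mcell M (integrable_norm ig).
  by apply: eq_integrable => //; exact: mcell.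
- by move=> N t _; rewrite normrM ler_wpM2l// bump_avg_bounded.
move=> _; under eq_fun do rewrite (zero_coefs_trig ig g0 (bump_avg_trig _)).
by move=> h; rewrite -(cvg_unique _ h (cvg_cst 0)).
Qed.

End FourierUniqueness.

(** * Uniqueness for continuous and for integrable periodic functions *)

Section Periodic.
Variables (R : realType) (E : normedModType R) (ip : {dot E for idfun}).
Variables (n : nat) (u b bd : 'I_n -> E) (L : set E).
Hypothesis HL : lattice_basis ip u b bd L.
Hypothesis int_L : integral_lattice ip L.

Lemma cell_compact : exists2 K : set E, compact K & cell ip bd `<=` K.
Proof.
pose f (v : 'rV[R]_n) := \sum_i v ord0 i *: b i.
exists (f @` [set v : 'rV[R]_n | forall i, `[0, 1]%classic (v ord0 i)]).
  have cb : compact [set v : 'rV[R]_n | forall i, `[(0 : R), (1 : R)]%classic (v ord0 i)].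
    by apply: (@rV_compact R n (fun=> `[(0 : R), (1 : R)]%classic)) => i; exact: segment_compact.
  apply: continuous_compact => //; apply: continuous_subspaceT => v.
  apply: (@cvg_big _ _ _ _ _ _ _ _ _ (fun i (v : 'rV[R]_n) => v ord0 i *: b i)).
  - exact: add_continuous.
  - exact: nbhs_filter.
  - move=> i _; apply: (@cvgZr_tmp _ _ _ _ (nbhs_filter v)) => A nA.
    exists (fun _ j => [set y | j = i -> A y]) => [i0 j|w /(_ ord0 i)]; last by move=> /(_ erefl).
    have [->|/eqP ji] := eqVneq j i; first by rewrite (ord1 i0); apply: (@filterS _ _ _ A _ _ nA) => y Ay _.
    by apply: filterS filterT => y _ /ji.
move=> x cx; exists (\row_i ip x (bd i)).
  by move=> i /=; rewrite mxE in_itv/=; have /andP[-> /ltW ->] := cx i.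
by rewrite /f [RHS](lat_sum HL); apply: eq_bigr => i _; rewrite mxE.
Qed.

Lemma compact_abs_bounded (T : topologicalType) (K : set T) (g : T -> R) :
  compact K -> continuous g -> exists M, forall x, K x -> `|g x| <= M.
Proof.
move=> cK cg; have /compact_bounded[M [_ MK]] : compact (g @` K).
  by apply: continuous_compact => //; exact: continuous_subspaceT.
exists (M + 1) => x Kx; apply: (MK (M + 1)); first by rewrite ltrDl.
by exists x.
Qed.

Lemma periodic_bounded (g : E -> R) : continuous g -> periodic_fun L g ->
  exists M, forall x, `|g x| <= M.
Proof.
move=> cg pg; have [K cK sK] := cell_compact.
have [M gM] := compact_abs_bounded cK cg.
exists M => x; rewrite -(subrK (lat_floor ip b bd x) x) pg; last exact: (lat_floor_lat HL).
exact/gM/sK/(sub_lat_floor HL).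
Qed.

Lemma periodic2_bounded (g : E * E -> R) : continuous g ->
  (forall l1 l2 x y, L l1 -> L l2 -> g (x + l1, y + l2) = g (x, y)) ->
  exists M, forall p, `|g p| <= M.
Proof.
move=> cg pg; have [K cK sK] := cell_compact.
have [M gM] := compact_abs_bounded (compact_setX cK cK) cg.
exists M => -[x y].
rewrite -(subrK (lat_floor ip b bd x) x) -(subrK (lat_floor ip b bd y) y) pg; try exact: (lat_floor_lat HL).
by apply: gM; split; apply/sK/(sub_lat_floor HL).
Qed.

Variable mu : {sigma_finite_measure set (borel E) -> \bar R}.
Hypothesis Hmu : invariant_measure mu.
Local Notation cell := (cell ip bd : set (borel E)).
Local Notation mfun g := (measurable_fun [set: borel E] (g : borel E -> R)).
Local Notation I f := (\int[mu]_(x in cell) f x).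
Local Notation mcell := (measurable_cell HL).

(** Testing g against itself gives a zero integral for g^2. If g x were nonzero, |g| would exceed
    half of |g x| on a periodic open set, which meets [cell] in positive measure. *)
Lemma fourier_unique_continuous (g : E -> R) : continuous g -> periodic_fun L g ->
  zero_coefs ip bd L mu g -> forall x, g x = 0.
Proof.
move=> cg pg zg x; have [M gM] := periodic_bounded cg pg.
have mg := continuous_borel cg.
have ig := cell_integrable HL Hmu mg (fun t _ => gM t).
have g20 := zero_coefs_continuous HL int_L Hmu cg pg gM ig zg.
apply/eqP; apply: contraPT g20 => gx0; apply/eqP; rewrite gt_eqF//.
pose c := `|g x| / 2; have c0 : 0 < c by rewrite divr_gt0// normr_gt0.
pose U := [set t | c < `|g t|].
have oU : open U.
  rewrite (_ : U = (fun t => `|g t|) @^-1` [set y | c < y])//.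
  apply: open_comp; last exact: open_gt.
  by move=> t _; apply: continuous_comp; [exact: cg|exact: norm_continuous].
have mU := open_borel oU.
have mUc : (0 < mu (U `&` cell))%E.
  apply: (open_cell_pos HL int_L Hmu oU) => [l t Ll /=|]; first by rewrite /U/= pg.
  by exists x; rewrite /U/= /c; have := normr_gt0 (g x); rewrite gx0; lra.
have fUc : (mu (U `&` cell) < +oo)%E.
  apply: le_lt_trans (cell_fin HL Hmu); apply: le_measure; rewrite ?inE//.
  - by apply: measurableI => //; exact: mcell.
  - exact: mcell.
apply: (@lt_le_trans _ _ (c ^+ 2 * fine (mu (U `&` cell)))).
  by rewrite mulr_gt0 ?exprn_gt0// fine_gt0// mUc.
have -> : fine (mu (U `&` cell)) = I (fun t => \1_U t).
  by rewrite /Rintegral integral_indic//; exact: mcell.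
have iU : mu.-integrable cell (EFin \o (\1_U : E -> R)).
  apply: (cell_integrable HL Hmu (M := 1)); first exact: measurable_indic.
  by move=> t _; rewrite indicE; case: (_ \in _); rewrite ?normr1 ?normr0.
rewrite -RintegralZl//; last exact: mcell.
apply: le_Rintegral; first exact: mcell.
- have := integrableZl mcell (c ^+ 2) iU.
  by apply: eq_integrable => //; exact: mcell.
- exact: (integrable_mul HL ig mg (fun t _ => gM t)).
- move=> t _; rewrite indicE; have [tU|_] := boolP (t \in U).
    rewrite mulr1n mulr1 -expr2 -(real_normK (num_real (g t))).
    rewrite lerXn2r// ?nnegrE ?(ltW c0)//.
    by move: tU; rewrite inE; exact: ltW.
  by rewrite mulr0 -expr2 sqr_ge0.
Qed.

Definition set_dist (A : set E) (x : E) : R := inf [set `|x - y| | y in A].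

(** The functions min(1, k d), with d the distance to the complement of U, which is positive exactly
    on U. An empty complement is treated apart, since it has no distance function. *)
Lemma open_approx (U : set E) : open U -> exists phi : nat -> E -> R,
  [/\ forall k, continuous (phi k), forall k x, 0 <= phi k x <= 1
    & forall x, phi k x @[k --> \oo] --> (\1_U x : R)].
Proof.
move=> oU; have [A0|/set0P[a Aa]] := eqVneq (~` U) set0.
  have -> : U = setT by rewrite -[U]setCK A0 setC0.
  exists (fun _ _ => 1); split=> [k x|k x|x]; first exact: cvg_cst.
    by rewrite ler01 lexx.
  by rewrite indicE in_setT; exact: cvg_cst.
pose d := set_dist (~` U).
have ne x : [set `|x - y| | y in ~` U] !=set0 by exists `|x - a|; exists a.
have lb x : has_lbound [set `|x - y| | y in ~` U] by exists 0 => _ [y _ <-].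
have d0 x : 0 <= d x by apply: lb_le_inf => // _ [y _ <-].
have dle x y : ~ U y -> d x <= `|x - y| by move=> Uy; apply: ge_inf => //; exists y.
have lip x y : d x <= `|x - y| + d y.
  rewrite -lerBlDl; apply: lb_le_inf => // _ [z Uz <-].
  rewrite lerBlDl (le_trans (dle _ _ Uz))// (_ : x - z = (x - y) + (y - z)) ?ler_normD//.
  by rewrite addrA subrK.
have dc : continuous d.
  move=> x; apply/cvgrPdist_lt => e e0; apply/nbhs_normP; exists e => //= y xy.
  apply: le_lt_trans xy; rewrite ler_norml.
  by have := lip x y; have := lip y x; rewrite (distrC y x); lra.
exists (fun k x => Num.min 1 (k%:R * d x)); split.
- move=> k x; apply: (@continuous_min _ _ (fun=> 1) (fun x => k%:R * d x)).
    exact: cvg_cst.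
  by apply: cvgM; [exact: cvg_cst|exact: dc].
- by move=> k x; rewrite le_min ler01 mulr_ge0//= ge_min lexx.
- move=> x; rewrite indicE; have [xU|xU] := boolP (x \in U); last first.
    have -> : d x = 0.
      apply/eqP; rewrite eq_le d0 andbT (le_trans (dle x x _)) ?subrr ?normr0//.
      by move: xU; rewrite notin_setE.
    rewrite mulr0n; under eq_fun do rewrite mulr0.
    by rewrite min_r//; exact: cvg_cst.
  have dx : 0 < d x.
    have /nbhs_normP[e /= e0 eU] := open_nbhs_nbhs (conj oU (set_mem xU)).
    apply: lt_le_trans e0 _; apply: lb_le_inf => // _ [y Uy <-].
    by rewrite leNgt; apply/negP => xy; apply: Uy; exact: eU.
  apply: cvg_near_cst; near=> k; apply/eqP; rewrite min_l//.
  rewrite -ler_pdivrMr// mul1r; near: k; exact: nbhs_infty_ger.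
Unshelve. all: by end_near.
Qed.

Lemma esum_fsupport (I : choiceType) (S : set I) (A : {fset I}) (F : I -> \bar R) :
  [set` A] `<=` S -> (forall i, S i -> 0 <= F i)%E ->
  (forall i, S i -> i \notin A -> F i = 0)%E -> esum S F = (\sum_(i <- A) F i)%E.
Proof.
move=> AS F0 FA; rewrite (esumID [set` A])// [X in (_ + X)%E]esum1; last first.
  by move=> i [Si /negP iA]; exact: FA.
rewrite adde0 setIidr// esum_fset//; last by move=> i; rewrite inE => /AS; exact: F0.
by rewrite fsbig_finite//= set_fsetK.
Qed.

Section Periodization.
Variables (phi : E -> R) (rho : R).
Hypothesis phi_c : continuous phi.
Hypothesis phi_ge0 : forall x, 0 <= phi x.
Hypothesis phi_supp : forall x, rho <= `|x| -> phi x = 0.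

(** It turns a test function of bounded support on E into a periodic test function. Boundedness of
    the support leaves finitely many terms over each ball, hence finiteness and continuity. *)
Definition periodization (x : E) : R := fine (esum L (fun l => (phi (x + l))%:E)).

Lemma periodization_local (K : R) : exists k, forall x, `|x| < K ->
  esum L (fun l => (phi (x + l))%:E) = (\sum_(l <- lat_fset ip b L k) phi (x + l))%:E.
Proof.
have [ssS _ _] := lat_exhaustion HL int_L.
exists (Num.bound ((rho + K) * \sum_i `|b i|)) => x xK.
rewrite (esum_fsupport (A := lat_fset ip b L (Num.bound ((rho + K) * \sum_i `|b i|)))) ?sumEFin//.
- by move=> l /ssS.
- by move=> l _; rewrite lee_fin.
- move=> l Ll lA; rewrite phi_supp//; apply: contraNT lA; rewrite -ltNge => xl.
  rewrite /lat_fset in_fset_set; last first.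
    by apply: sub_finite_set (finite_dual_box HL (Num.bound ((rho + K) * \sum_i `|b i|))) => y [].
  rewrite inE; split => //; apply: (dual_box_bounded HL (int_L Ll)).
  rewrite -[l](addKr x) addrC (le_trans (ler_normD _ _))// normrN.
  by rewrite lerD// ltW.
Qed.

Lemma periodization_fin x : (periodization x)%:E = esum L (fun l => (phi (x + l))%:E).
Proof.
have [k kP] := periodization_local (`|x| + 1).
by rewrite /periodization kP// ltrDl.
Qed.

Lemma periodization_continuous : continuous periodization.
Proof.
move=> x; have [k kP] := periodization_local (`|x| + 1).
pose f y := \sum_(l <- lat_fset ip b L k) phi (y + l).
have near_eq : \forall y \near x, f y = periodization y.
  apply/nbhs_normP; exists 1 => //= y xy; rewrite /periodization kP//.
  by rewrite -(subrK x y) addrC (le_lt_trans (ler_normD _ _))// ltrD2l distrC.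
have fc : f y @[y --> x] --> f x.
  apply: (@cvg_big _ _ _ _ _ _ _ _ _ (fun l y => phi (y + l))).
  - exact: add_continuous.
  - by move=> l _; apply: continuous_comp; [exact: shift_continuous|exact: phi_c].
rewrite /continuous_at -(nbhs_singleton near_eq).
by apply: cvg_trans fc; apply: near_eq_cvg; apply: filterS near_eq.
Qed.

Lemma periodization_periodic : periodic_fun L periodization.
Proof.
move=> l x Ll; rewrite /periodization; congr fine.
rewrite [RHS](reindex_esum L L (fun l' => l + l'))//; last first.
  split => //.
  - by move=> l' Ll' /=; exact: (latD HL).
  - by move=> y z _ _ /addrI.
  - by move=> y Ly; exists (y - l); [exact: (latB HL)|rewrite addrC subrK].
by apply: eq_esum => l' _; rewrite addrA.
Qed.
Lemma ge0_periodization_integral (h : E -> R) : mfun h -> (forall x, 0 <= h x) ->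
  periodic_fun L h ->
  (\int[mu]_x (h x * phi x)%:E = \int[mu]_(x in cell) (h x * periodization x)%:E)%E.
Proof.
move=> mh h0 ph; have mphi := continuous_borel phi_c.
rewrite (integral_unfold_sum HL int_L Hmu)//; last 2 first.
- by apply/measurable_EFinP; exact: measurable_funM.
- by move=> x; rewrite lee_fin mulr_ge0.
apply: eq_integral => x _; rewrite EFinM periodization_fin.
rewrite -(ge0_esumZl (lat_exhaustion HL int_L))// ?lee_fin//.
  by apply: eq_esum => l Ll; rewrite EFinM ph.
by move=> l; rewrite lee_fin.
Qed.

Variable g : E -> R.
Hypothesis mg : mfun g.
Hypothesis pg : periodic_fun L g.
Hypothesis ig : mu.-integrable cell (EFin \o g).

Lemma mul_periodization_integrable :
  mu.-integrable cell (EFin \o (fun x => g x * periodization x)).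
Proof.
have [M pM] := periodic_bounded periodization_continuous periodization_periodic.
exact: (integrable_mul HL ig (continuous_borel periodization_continuous) (fun t _ => pM t)).
Qed.

Lemma periodization_integrable :
  mu.-integrable [set: borel E] (EFin \o (fun x => g x * phi x)).
Proof.
have mphi := continuous_borel phi_c.
apply/integrableP; split; first by apply/measurable_EFinP; exact: measurable_funM.
under eq_integral => x _ do rewrite /= normrM (ger0_norm (phi_ge0 x)).
rewrite (ge0_periodization_integral (h := fun x => `|g x|)) //; last 2 first.
- exact: measurableT_comp.
- by move=> l x Ll; rewrite pg.
have /integrableP[_] := mul_periodization_integrable.
apply: le_lt_trans; apply: ge0_le_integral.
- exact: mcell.
- by move=> x _; rewrite lee_fin mulr_ge0// fine_ge0// esum_ge0// => l _; rewrite lee_fin.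
- apply/measurable_EFinP; apply: measurable_funM.
    by apply/measurable_funTS; exact: measurableT_comp.
  exact: measurable_funTS (continuous_borel periodization_continuous).
- apply/measurable_EFinP/measurableT_comp => //; apply: measurable_funM.
    exact/measurable_funTS.
  exact: measurable_funTS (continuous_borel periodization_continuous).
- by move=> x _; rewrite /= lee_fin normrM ler_wpM2l// ler_norm.
Qed.
End Periodization.

(** Unfolding is available for nonnegative functions, so g is split into its positive and negative
    parts, both periodic and dominated by |g|. *)
Lemma periodization_Rintegral (phi : E -> R) (rho : R) (g : E -> R) :
  continuous phi -> (forall x, 0 <= phi x) -> (forall x, rho <= `|x| -> phi x = 0) ->
  mfun g -> periodic_fun L g -> mu.-integrable cell (EFin \o g) ->
  \int[mu]_x (g x * phi x) = I (fun x => g x * periodization phi x).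
Proof.
move=> cphi phi0 sphi mg pg ig.
pose gp x := Num.max (g x) 0; pose gn x := Num.max (- g x) 0.
have gE x : g x = gp x - gn x by rewrite /gp /gn !maxEle oppr_le0; case: ltgtP => ?; lra.
have mp : mfun gp by apply: measurable_maxr.
have mn : mfun gn by apply: measurable_maxr => //; exact: measurableT_comp.
have p0 x : 0 <= gp x by rewrite le_max lexx orbT.
have n0 x : 0 <= gn x by rewrite le_max lexx orbT.
have pp : periodic_fun L gp by move=> l x Ll; rewrite /gp pg.
have pn : periodic_fun L gn by move=> l x Ll; rewrite /gn pg.
have dom (h : E -> R) : mfun h -> (forall x, `|h x| <= `|g x|) -> mu.-integrable cell (EFin \o h).
  move=> mh hg; apply: (le_integrable mcell _ _ ig); first exact/measurable_EFinP/measurable_funTS.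
  by move=> x _; rewrite lee_fin.
have igp : mu.-integrable cell (EFin \o gp).
  by apply: dom => // x; rewrite ger0_norm// /gp maxEle; case: ifP => // _; rewrite ler_norm.
have ign : mu.-integrable cell (EFin \o gn).
  by apply: dom => // x; rewrite ger0_norm// /gn maxEle; case: ifP => // _; rewrite -normrN ler_norm.
transitivity (\int[mu]_x (gp x * phi x - gn x * phi x)).
  by apply: eq_Rintegral => x _; rewrite gE mulrBl.
rewrite RintegralB//; try exact: (periodization_integrable cphi phi0 sphi).
transitivity (I (fun x => gp x * periodization phi x) - I (fun x => gn x * periodization phi x)).
  by congr (_ - _); rewrite /Rintegral (ge0_periodization_integral cphi phi0 sphi).
rewrite -RintegralB//; try exact: (mul_periodization_integrable cphi phi0 sphi); last exact: mcell.
by apply: eq_Rintegral => x _; rewrite -mulrBl -gE.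
Qed.

Section L1Uniqueness.
Variable g : E -> R.
Hypothesis mg : mfun g.
Hypothesis pg : periodic_fun L g.
Hypothesis ig : mu.-integrable cell (EFin \o g).
Hypothesis zg : zero_coefs ip bd L mu g.

(** A cut-off: a periodic g is integrable on [cell] but in general not on E, whereas g times [tent]
    is. As [tent rho] is positive on the open ball of radius rho, letting rho grow loses no
    information on g. *)
Definition tent (rho : R) (x : E) : R := Num.max 0 (rho - `|x|).

Lemma tent_continuous rho : continuous (tent rho).
Proof.
move=> x; apply: (@continuous_max _ _ (fun=> 0) (fun x : E => rho - `|x|)).
  exact: cvg_cst.
by apply: cvgB; [exact: cvg_cst|exact: norm_continuous].
Qed.

Lemma tent_ge0 rho x : 0 <= tent rho x.
Proof. by rewrite le_max lexx. Qed.

Lemma tent_supp rho x : rho <= `|x| -> tent rho x = 0.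
Proof. by move=> h; rewrite /tent max_l// subr_le0. Qed.

Lemma tent_integrable rho : mu.-integrable [set: borel E] (EFin \o (fun x => g x * tent rho x)).
Proof.
exact: (periodization_integrable (@tent_continuous rho) (@tent_ge0 rho) (@tent_supp rho) mg pg ig).
Qed.

Lemma zero_coefs_open rho (U : set E) : open U ->
  \int[mu]_(x in (U : set (borel E))) (g x * tent rho x) = 0.
Proof.
move=> oU; have mU := open_borel oU.
have [phi [cphi phi01 phiU]] := open_approx oU.
have zero k : \int[mu]_x (g x * (phi k x * tent rho x)) = 0.
  have c : continuous (fun x => phi k x * tent rho x).
    by move=> x; apply: cvgM; [exact: cphi|exact: tent_continuous].
  have p x : 0 <= phi k x * tent rho x.
    by rewrite mulr_ge0 ?tent_ge0//; have /andP[] := phi01 k x.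
  have s x : rho <= `|x| -> phi k x * tent rho x = 0.
    by move=> h; rewrite tent_supp// mulr0.
  rewrite (periodization_Rintegral c p s mg pg ig).
  have pp := periodization_periodic (fun x => phi k x * tent rho x).
  have [M pM] := periodic_bounded (periodization_continuous c p s) pp.
  exact: (zero_coefs_continuous HL int_L Hmu (periodization_continuous c p s) pp pM ig zg).
have mt := continuous_borel (@tent_continuous rho).
have mf k : measurable_fun [set: borel E] (fun x : borel E => g x * (phi k x * tent rho x)).
  apply: measurable_funM => //; apply: measurable_funM => //.
  exact: continuous_borel (cphi k).
have H := @Rintegral_dominated _ _ _ mu _ measurableT (fun k x => g x * (phi k x * tent rho x))
  (fun x => g x * (\1_U x * tent rho x)) (fun x => `|g x * tent rho x|) mf.
have [] := H.
- move=> x _; apply: cvgM; first exact: cvg_cst.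
  by apply: cvgM; [exact: phiU|exact: cvg_cst].
- have := integrable_norm (tent_integrable rho).
  by apply: eq_integrable.
- move=> k x _; have /andP[h0 h1] := phi01 k x.
  by rewrite mulrCA normrM (ger0_norm h0) ler_piMl.
move=> _; under eq_fun do rewrite zero.
move=> h; rewrite Rintegral_mkcond (cvg_unique _ (@cvg_cst _ 0 _ \oo _) h)//.
apply: eq_Rintegral => x _; rewrite patchE indicE; case: ifP => _.
  by rewrite mul1r.
by rewrite mul0r mulr0.
Qed.

(** The sets over which the integral vanishes form a Dynkin system containing the open sets, which
    are stable under intersection and generate the Borel sets. *)
Lemma zero_coefs_measurable rho (A : set (borel E)) : measurable A ->
  (\int[mu]_(x in A) (g x * tent rho x)%:E = 0)%E.
Proof.
have it := tent_integrable rho.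
have fin (B : set (borel E)) : measurable B ->
    (\int[mu]_(x in B) (g x * tent rho x)%:E)%E \is a fin_num.
  by move=> mB; apply: integrable_fin_num => //; exact: (integrableS measurableT mB _ it).
have op (U : set E) : open U -> (\int[mu]_(x in (U : set (borel E))) (g x * tent rho x)%:E = 0)%E.
  move=> oU; have := zero_coefs_open rho oU; rewrite /Rintegral => h0.
  by rewrite -(fineK (fin U (open_borel oU))) h0.
move: A; have := @dynkin_induction _ (borel E) (@open E)
  (fun A : set (borel E) => (\int[mu]_(x in A) (g x * tent rho x)%:E = 0)%E).
apply => //.
- by move=> A B; exact: openI.
- exact: (op setT openT).
- move=> A mA A0; have := op setT openT.
  rewrite -(setUv A) integral_setU//; last 3 first.
  + exact: measurableC.
  + by rewrite setUv; have /measurable_int := it.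
  + by apply/disj_setPCl.
  by rewrite A0 add0e.
- move=> F mF tF F0; rewrite integral_bigcup//.
    by rewrite eseries0// => k _ _; exact: F0.
  apply: (integrableS measurableT _ _ it) => //.
  exact: bigcup_measurable.
Qed.

Lemma fourier_unique_ae : {ae mu, forall x : borel E, g x = 0}.
Proof.
have key k : {ae mu, forall x : borel E, g x * tent k%:R x = 0}.
  have it := tent_integrable k%:R.
  have := integral_ae_eq measurableT it (measurable_cst 0%E).
  move=> /(_ _)[|N [mN N0 sN]].
    by move=> A _ mA; rewrite integral0 (zero_coefs_measurable _ mA).
  exists N; split => // x nx; apply: sN => /= h; apply: nx.
  by have := h Logic.I; rewrite /= => -[].
have [N [mN N0 sN]] := ae_foralln key.
exists N; split => // x nx; apply: sN => /= h; apply: nx.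
have := h (Num.bound `|x|).+1; move/eqP; rewrite mulf_eq0 => /orP[/eqP//|].
rewrite gt_eqF// /tent lt_max subr_gt0; apply/orP; right.
apply: lt_le_trans (archi_boundP (normr_ge0 x)) _.
by rewrite ler_nat.
Qed.
End L1Uniqueness.

End Periodic.

(** * Quasi-periodic functions and theta series *)

Section ComplexSmooth.
Variables (R : realType) (V : normedModType R).
Local Notation C := R[i].
Local Notation Re := (@complex.Re R).
Local Notation Im := (@complex.Im R).
Implicit Types f g : V -> C.

Definition cderive (v : V) f (x : V) : C :=
  ('D_v (Re \o f) x +i* 'D_v (Im \o f) x)%C.

Lemma csmooth_intro (p q : V -> R) f : (forall x, Re (f x) = p x) ->
  (forall x, Im (f x) = q x) -> smooth p -> smooth q -> csmooth f.
Proof. by move=> /funext hp /funext hq sp sq; split; [rewrite -hp in sp|rewrite -hq in sq]. Qed.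

Lemma csmooth_cst (c : C) : csmooth (fun _ : V => c).
Proof. by split; exact: smooth_cst. Qed.

Lemma csmoothD f g : csmooth f -> csmooth g -> csmooth (fun x => f x + g x).
Proof.
move=> [fR fI] [gR gI].
by apply: (csmooth_intro _ _ (smoothD fR gR) (smoothD fI gI)) => x; rewrite ?ReD ?ImD.
Qed.

Lemma csmoothM f g : csmooth f -> csmooth g -> csmooth (fun x => f x * g x).
Proof.
move=> [fR fI] [gR gI].
apply: (csmooth_intro _ _ (smoothB (smoothM fR gR) (smoothM fI gI))
  (smoothD (smoothM fR gI) (smoothM fI gR))) => x; rewrite ?ReM ?ImM//=.
Qed.

Lemma csmooth_sum I (s : seq I) (F : I -> V -> C) :
  (forall i, csmooth (F i)) -> csmooth (fun x => \sum_(i <- s) F i x).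
Proof.
move=> sF; apply: (csmooth_intro _ _ (smooth_sum s (fun i => (sF i).1))
  (smooth_sum s (fun i => (sF i).2))) => x; rewrite ?Re_sum ?Im_sum//.
Qed.

Lemma csmooth_expi (q : V -> R) : smooth q -> csmooth (fun x => expi (q x)).
Proof. by move=> sq; split; [exact: smooth_cos|exact: smooth_sin]. Qed.

Lemma csmooth_derive v f : csmooth f -> csmooth (cderive v f).
Proof. by move=> [fR fI]; split; exact: smooth_derive. Qed.

Lemma cderiveM v f g x : csmooth f -> csmooth g ->
  cderive v (fun x => f x * g x) x = f x * cderive v g x + cderive v f x * g x.
Proof.
move=> [fR fI] [gR gI].
have dfR := smooth_is_derive x v fR; have dfI := smooth_is_derive x v fI.
have dgR := smooth_is_derive x v gR; have dgI := smooth_is_derive x v gI.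
have hR : is_derive x v (Re \o (fun x => f x * g x))
   ((Re (f x) * 'D_v (Re \o g) x + Re (g x) * 'D_v (Re \o f) x) +
    (-1) * (Im (f x) * 'D_v (Im \o g) x + Im (g x) * 'D_v (Im \o f) x)).
  rewrite (_ : _ \o _ = fun x => Re (f x) * Re (g x) + (-1) * (Im (f x) * Im (g x))); last first.
    by apply/funext => y /=; rewrite ReM mulN1r.
  apply: is_derive_addD; first exact: (is_derive_addM dfR dgR).
  have := is_derive_addM (is_derive_cst (-1 : R) x v) (is_derive_addM dfI dgI).
  by rewrite mulr0 addr0.
have hI : is_derive x v (Im \o (fun x => f x * g x))
   ((Re (f x) * 'D_v (Im \o g) x + Im (g x) * 'D_v (Re \o f) x) +
    (Im (f x) * 'D_v (Re \o g) x + Re (g x) * 'D_v (Im \o f) x)).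
  rewrite (_ : _ \o _ = fun x => Re (f x) * Im (g x) + Im (f x) * Re (g x)); last first.
    by apply/funext => y /=; rewrite ImM.
  by apply: is_derive_addD; [exact: (is_derive_addM dfR dgI)|exact: (is_derive_addM dfI dgR)].
apply: complex_eqP; rewrite ?ReD ?ImD ?ReM ?ImM /cderive/=.
  by rewrite (is_derive_unique hR) /=; ring.
by rewrite (is_derive_unique hI) /=; ring.
Qed.

Lemma cderive_expi v (q : V -> R) x a : is_derive x v q a ->
  cderive v (fun x => expi (q x)) x = (0 +i* a)%C * expi (q x).
Proof.
move=> dq; have hR := is_derive_chain (is_derive_cos (q x)) dq.
have hI := is_derive_chain (is_derive_sin (q x)) dq.
apply: complex_eqP; rewrite ?ReM ?ImM /cderive/=.
  by rewrite (is_derive_unique hR); ring.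
by rewrite (is_derive_unique hI); ring.
Qed.
End ComplexSmooth.

Lemma csmooth_comp_affine (R : realType) (V W : normedModType R) (A A0 : V -> W)
  (f : W -> R[i]) : continuous A ->
  (forall x v (h : R), A (x + h *: v) = A x + h *: A0 v) ->
  csmooth f -> csmooth (fun x => f (A x)).
Proof.
by move=> cA lA [fR fI]; split; [apply: (smooth_comp_affine cA lA fR)|apply: (smooth_comp_affine cA lA fI)].
Qed.

Lemma cderive_comp_affine (R : realType) (V W : normedModType R) (A A0 : V -> W)
  (f : W -> R[i]) x v :
  (forall x v (h : R), A (x + h *: v) = A x + h *: A0 v) ->
  csmooth f -> cderive v (fun x => f (A x)) x = cderive (A0 v) f (A x).
Proof.
move=> lA [fR fI]; rewrite /cderive.
by rewrite -(derive_comp_affine x v lA fR) -(derive_comp_affine x v lA fI).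
Qed.

Section Quasiperiodic.
Variables (R : realType) (E : normedModType R) (ip : {dot E for idfun}).
Variables (n : nat) (u b bd : 'I_n -> E) (L : set E).
Hypothesis HL : lattice_basis ip u b bd L.
Hypothesis int_L : integral_lattice ip L.
Local Notation C := R[i].
Local Notation Re := (@complex.Re R).
Local Notation Im := (@complex.Im R).
Local Notation dL := (Pilot.Defs.dual ip L).
Local Notation pr := (pairing ip).

Lemma expi_pi_floor (x : R) : x \is a Num.int -> (-1) ^ Num.floor x = expi (pi * x) :> C.
Proof.
move=> xint; rewrite -{2}(floorK xint); move: (Num.floor x) => m {x xint}.
have epi : expi pi = -1 :> C.
  by rewrite /expi cospi sinpi; apply/eqP; rewrite eq_complex/= oppr0 !eqxx.
have nat_case (k : nat) : expi (pi * k%:R) = (-1) ^+ k :> C.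
  elim: k => [|k IH]; first by rewrite mulr0 expi0.
  by rewrite -natr1 mulrDr mulr1 expiD IH epi exprSr.
case: m => k; first by rewrite -exprnP -nat_case.
transitivity (((-1) ^+ k.+1)^-1 : C); first by [].
rewrite NegzE mulrNz -pmulrn mulrN -expiJ nat_case -signr_odd.
by case: (odd _); rewrite ?expr0 ?expr1 ?invr1 ?invrN1; apply/eqP; rewrite eq_complex/= ?oppr0 !eqxx.
Qed.

(* The condition on <x/2, y> s(x, y) for [s] to be a section of the line bundle. *)
Definition quasi_periodic (G : E * E -> C) : Prop :=
  forall l1 l2 x y, L l1 -> L l2 -> G (x + l1, y + l2) = pr l1 y * G (x, y).

(** The sign of the multiplier is e^(pi i (l1, l2)). Together with the same factor coming from <(x +
    l1)/2, y + l2> it makes e^(2 pi i (l1, l2)), which is 1 by integrality; the terms in (x, l2)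
    cancel and those in (l1, y) double. *)
Lemma multiplier_pairing l1 l2 x y : L l1 -> L l2 ->
  pr (2^-1 *: (x + l1)) (y + l2) * multiplier ip l1 l2 x y = pr l1 y * pr (2^-1 *: x) y.
Proof.
move=> Ll1 Ll2; have il : ip l1 l2 \is a Num.int.
  by apply: expi_eq1; exact: (int_L Ll2 Ll1).
rewrite /multiplier expi_pi_floor// /pairing -!expiD.
rewrite -[RHS](mulr1) -(expi_int _ (Num.floor (ip l1 l2))) (floorK il) -expiD.
by congr expi; rewrite !(ipZl, ipDl, ipDr); field.
Qed.

Lemma section_quasi_periodic (s : E * E -> C) :
  is_section ip L s <-> quasi_periodic (fun p => pr (2^-1 *: p.1) p.2 * s p).
Proof.
split=> h l1 l2 x y Ll1 Ll2 /=.
  by rewrite h// mulrA multiplier_pairing// mulrA.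
apply: (mulfI (pairing_neq0 ip (2^-1 *: (x + l1)) (y + l2))).
by rewrite (h l1 l2 x y Ll1 Ll2) /= [LHS]mulrA [RHS]mulrA multiplier_pairing.
Qed.

Lemma quasi_periodic_section (G : E * E -> C) : quasi_periodic G ->
  is_section ip L (fun p => pr (- (2^-1 *: p.1)) p.2 * G p).
Proof.
move=> qG; apply/section_quasi_periodic => l1 l2 x y Ll1 Ll2 /=.
rewrite [LHS]mulrA pairingMN mul1r (qG _ _ _ _ Ll1 Ll2); congr (_ * _).
by rewrite mulrA pairingMN mul1r.
Qed.

Lemma quasi_periodic_normc G : quasi_periodic G ->
  forall l1 l2 x y, L l1 -> L l2 -> normc (G (x + l1, y + l2)) = normc (G (x, y)).
Proof. by move=> qG l1 l2 x y Ll1 Ll2; rewrite qG// normcM normc_pairing mul1r. Qed.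

Lemma quasi_periodic_slice G x y : quasi_periodic G -> dL y ->
  periodic_fun L (fun t => pr y t * G (x, t)).
Proof.
move=> qG dy l t Ll; rewrite -{1}(addr0 x) (qG 0 l x t (lat0 HL) Ll) pairing0l mul1r.
by rewrite pairingDr (pairingC _ y l) (dual_pairing Ll dy) mulr1.
Qed.

Lemma normc_continuous (T : topologicalType) (f : T -> C) :
  continuous (Re \o f) -> continuous (Im \o f) -> continuous (fun x => normc (f x)).
Proof.
move=> cR cI; rewrite (_ : (fun x => _) = fun x => Num.sqrt (sqmod (f x))); last first.
  by apply/funext => x; rewrite /sqmod; case: (f x).
move=> x; apply: continuous_comp; last exact: sqrt_continuous.
by apply: cvgD; apply: cvgM; [exact: cR|exact: cR|exact: cI|exact: cI].
Qed.

Lemma quasi_periodic_bounded G : quasi_periodic G -> csmooth G ->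
  exists M : R, forall p, normc (G p) <= M.
Proof.
move=> qG [cR cI].
have cG := normc_continuous (smooth_continuous cR) (smooth_continuous cI).
have [M hM] := periodic2_bounded HL cG (quasi_periodic_normc qG).
by exists M => p; rewrite (le_trans _ (hM p))// ler_norm.
Qed.

Variable a : E -> E -> C.
Hypothesis a_per : forall l l' x, dL l -> L l' -> a (l + l') x = a l x.
Hypothesis a_sum : forall p : E * E,
  csummable dL (fun l => a l (p.1 + l) * pr (- l) p.2).

Definition theta_series (p : E * E) : C := csum dL (fun l => a l (p.1 + l) * pr (- l) p.2).

(** Adding l1 to x amounts to reindexing the sum by l -> l + l1: the coefficient depends on the
    class of l only, and the character releases <l1, y>. Adding l2 to y changes nothing, as <l, l2>
    = 1. *)
Lemma theta_series_quasi_periodic : quasi_periodic theta_series.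
Proof.
move=> l1 l2 x y Ll1 Ll2; rewrite /theta_series.
rewrite -(csumZ (pr l1 y) (dual_exhaustion HL) (a_sum (x, y))).
have bij : set_bij dL dL (fun l => l + l1).
  split => [l dl /=|l l' _ _ /addIr//|l dl].
    by apply: (dualD HL) => //; exact: int_L.
  by exists (l - l1); [apply: (dualB HL) => //; exact: int_L|rewrite subrK].
rewrite -[RHS](csum_reindex _ bij); apply: eq_csum => l dl /=.
rewrite a_per// (addrC l l1) addrA pairingDr opprD pairingDl.
rewrite (_ : pr (- l) l2 = 1); last first.
  by rewrite pairingC (dual_pairing Ll2)//; exact: (dualN HL).
by rewrite mulr1 mulrCA (mulrA (pr l1 y)) pairingMN mul1r.
Qed.
End Quasiperiodic.

(** * Fourier coefficients of complex periodic functions *)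

Section ComplexFourier.
Variables (R : realType) (E : normedModType R) (ip : {dot E for idfun}).
Variables (n : nat) (u b bd : 'I_n -> E) (L : set E).
Hypothesis HL : lattice_basis ip u b bd L.
Hypothesis int_L : integral_lattice ip L.
Variable mu : {sigma_finite_measure set (borel E) -> \bar R}.
Hypothesis Hmu : invariant_measure mu.
Local Notation C := R[i].
Local Notation Re := (@complex.Re R).
Local Notation Im := (@complex.Im R).
Local Notation dL := (Pilot.Defs.dual ip L).
Local Notation pr := (pairing ip).
Local Notation cell := (cell ip bd : set (borel E)).
Local Notation mcell := (measurable_cell HL).
Local Notation V := (fine (mu cell)).
Local Notation cI := (cintegral mu cell).

Lemma cintegral_dominated (f_ : nat -> E -> C) (f : E -> C) (M : R) :
  (forall k, cmeasurable [set: borel E] (f_ k : borel E -> C)) ->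
  (forall x, ccvg (f_ ^~ x) (f x)) -> (forall k x, normc (f_ k x) <= M) ->
  ccvg (fun k => cI (f_ k)) (cI f).
Proof.
move=> mf cf fM; have iM := integrable_cst mcell (cell_fin HL Hmu) M.
split.
  apply: (Rintegral_dominated mcell (g := fun=> M) _ _ iM _).2.
  - by move=> k; have [h _] := mf k; exact: measurable_funTS h.
  - by move=> x _; have [] := cf x.
  - by move=> k x _; exact: le_trans (Re_le_normc _) (fM k x).
apply: (Rintegral_dominated mcell (g := fun=> M) _ _ iM _).2.
- by move=> k; have [_ h] := mf k; exact: measurable_funTS h.
- by move=> x _; have [] := cf x.
- by move=> k x _; exact: le_trans (Im_le_normc _) (fM k x).
Qed.

(** Partial sums are bounded by the sum of w, so the integral passes to the limit. By orthogonality
    it is constant along the partial sums as soon as y has entered them. *)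
Lemma fourier_series_coef (c : E -> C) (w : E -> R) : (forall l, dL l -> normc (c l) <= w l) ->
  summable dL (EFin \o w) -> forall y, dL y ->
  cI (fun t => pr y t * csum dL (fun l => c l * pr (- l) t)) = V%:C%C * c y.
Proof.
move=> cw sw y dy; have ex := dual_exhaustion HL; have [ssS ssm ssU] := ex.
have sc t : csummable dL (fun l => c l * pr (- l) t).
  by apply: csummable_le sw => l dl; rewrite normcM normc_pairing mulr1; exact: cw.
pose f_ k t := pr y t * \sum_(l <- dual_fset ip b L k) c l * pr (- l) t.
have term l : cintegrable mu cell (fun t => c l * pr (y - l) t).
  apply: (cintegrableZ mcell); exact: (pairing_integrable HL Hmu).
have fE k t : f_ k t = \sum_(l <- dual_fset ip b L k) c l * pr (y - l) t.
  by rewrite /f_ big_distrr/=; apply: eq_bigr => l _; rewrite pairingDl mulrCA.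
have mp z : cmeasurable [set: borel E] (fun t : borel E => pr z t).
  exact: (pairing_measurable HL).
have mf k : cmeasurable [set: borel E] (f_ k : borel E -> C).
  rewrite (_ : (f_ k : borel E -> C) = fun t => \sum_(l <- dual_fset ip b L k) c l * pr (y - l) t); last first.
    by apply/funext => t; exact: fE.
  by apply: cmeasurable_sum => l; apply: cmeasurableM => //; exact: cmeasurable_cst.
have lim1 : ccvg (fun k => cI (f_ k)) (cI (fun t => pr y t * csum dL (fun l => c l * pr (- l) t))).
  apply: (cintegral_dominated (M := rsum dL w)) => // [t|k t].
    by apply: ccvgM; [exact: ccvg_cst|exact: csum_exhaustion].
  rewrite normcM normc_pairing mul1r (le_trans (normc_sum _ _ _))//.
  apply: (@le_trans _ _ (\sum_(l <- dual_fset ip b L k) w l)).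
    rewrite big_seq [leRHS]big_seq; apply: ler_sum => l /ssS dl.
    by rewrite normcM normc_pairing mulr1 cw.
  have w0 l : dL l -> 0 <= w l by move=> dl; apply: le_trans (cw l dl); exact: normc_ge0.
  have cv := rsum_exhaustion ex sw.
  rewrite -(cvg_lim _ cv)//; apply: (@nondecreasing_cvgn_le _ (fun k => \sum_(l <- dual_fset ip b L k) w l) _ _ k) => //.
    move=> i j ij; rewrite -subr_ge0 (exhaustion_diff _ ex ij) big_seq_cond.
    by apply: sumr_ge0 => l /andP[/ssS/w0].
  by apply/cvg_ex; exists (rsum dL w).
apply: (ccvg_unique lim1); have [k0 yk0] := ssU y dy.
apply: (ccvg_near (s := fun=> V%:C%C * c y)); last exact: ccvg_cst.
near=> k; have yk : y \in dual_fset ip b L k.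
  by apply: (ssm k0) => //; near: k; exact: nbhs_infty_ge.
rewrite (eq_cintegral mu (fun t _ => fE k t)) (cintegral_sum mcell)//.
rewrite (big_fsetD1 y)//= big_seq big1 => [|l /=].
  rewrite addr0 (cintegralZ mcell); last exact: (pairing_integrable HL Hmu).
  rewrite (character_integral HL int_L Hmu) ?subrr ?eqxx; last exact: (dual0 HL).
  by rewrite mulrC.
rewrite !inE => /andP[ly /ssS dl].
rewrite (cintegralZ mcell); last exact: (pairing_integrable HL Hmu).
rewrite (character_integral HL int_L Hmu); last exact: (dualB HL).
by rewrite subr_eq0 eq_sym (negbTE ly) mulr0.
Unshelve. all: by end_near. Qed.

Lemma cintegrable_pairing (H : E -> C) z : cintegrable mu cell H ->
  cintegrable mu cell (fun t => pr z t * H t).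
Proof.
move=> [hR hI]; have [mR mI] := pairing_measurable HL z.
have b1 : forall t : E, cell t -> `|Re (pr z t)| <= 1.
  by move=> t _; rewrite -(normc_pairing ip z t); exact: Re_le_normc.
have b2 : forall t : E, cell t -> `|Im (pr z t)| <= 1.
  by move=> t _; rewrite -(normc_pairing ip z t); exact: Im_le_normc.
have iRR := integrable_mul HL hR mR b1; have iRI := integrable_mul HL hR mI b2.
have iIR := integrable_mul HL hI mR b1; have iII := integrable_mul HL hI mI b2.
split.
  have := integrableB mcell iRR iII; apply: eq_integrable => //; first exact: mcell.
  by move=> t _; rewrite [RHS]/= ReM; congr EFin => /=; ring.
have := integrableD mcell iRI iIR; apply: eq_integrable => //; first exact: mcell.
by move=> t _; rewrite [RHS]/= ImM; congr EFin => /=; ring.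
Qed.

Lemma zero_coefs_complex (H : E -> C) : cintegrable mu cell H ->
  (forall y, dL y -> cI (fun t => pr y t * H t) = 0) ->
  zero_coefs ip bd L mu (Re \o H) /\ zero_coefs ip bd L mu (Im \o H).
Proof.
move=> iH H0.
have key y : dL y -> cI (fun t => H t * (cos (2 * pi * ip y t))%:C%C) = 0 /\
    cI (fun t => H t * (sin (2 * pi * ip y t))%:C%C) = 0.
  move=> dy; have dNy := dualN HL dy.
  have ipr z := cintegrable_pairing z iH.
  have prN t : pr (- y) t = ((cos (2 * pi * ip y t)) -i* (sin (2 * pi * ip y t)))%C.
    by rewrite -pairingJ.
  (* Cosine and sine are combinations of the characters at y and -y, both of which are frequencies
     in the dual lattice. *)
  have eC t : H t * (cos (2 * pi * ip y t))%:C%C = (2^-1)%:C%C * (pr y t * H t + pr (- y) t * H t).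
    by rewrite prN; apply: complex_eqP; rewrite ?(ReM, ImM, ReD, ImD) /=; field.
  have eS t : H t * (sin (2 * pi * ip y t))%:C%C =
      (0 -i* 2^-1)%C * (pr y t * H t + (-1) * (pr (- y) t * H t)).
    by rewrite prN; apply: complex_eqP; rewrite ?(ReM, ImM, ReD, ImD) /=; field.
  have iN := cintegrableZ mcell (-1) (ipr (- y)).
  split.
    rewrite (eq_cintegral mu (fun t _ => eC t)) (cintegralZ mcell _ (cintegrableD mcell (ipr y) (ipr (- y)))).
    by rewrite (cintegralD mcell)// !H0// addr0 mulr0.
  rewrite (eq_cintegral mu (fun t _ => eS t)) (cintegralZ mcell _ (cintegrableD mcell (ipr y) iN)).
  by rewrite (cintegralD mcell)// (cintegralZ mcell)// !H0// mulr0 addr0 mulr0.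
split=> y dy; have [hc hs] := key y dy; split.
- apply: (eq_trans _ (congr1 Re hc)); rewrite Re_cintegral.
  by apply: eq_Rintegral => t _; rewrite ReM /=; ring.
- apply: (eq_trans _ (congr1 Re hs)); rewrite Re_cintegral.
  by apply: eq_Rintegral => t _; rewrite ReM /=; ring.
- apply: (eq_trans _ (congr1 Im hc)); rewrite Im_cintegral.
  by apply: eq_Rintegral => t _; rewrite ImM /=; ring.
- apply: (eq_trans _ (congr1 Im hs)); rewrite Im_cintegral.
  by apply: eq_Rintegral => t _; rewrite ImM /=; ring.
Qed.

Lemma complex_fourier_unique (H : E -> C) : continuous (Re \o H) -> continuous (Im \o H) ->
  periodic_fun L H -> (forall y, dL y -> cI (fun t => pr y t * H t) = 0) ->
  forall x, H x = 0.
Proof.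
move=> cR cIm pH H0 x.
have pR : periodic_fun L (Re \o H) by move=> l t Ll /=; rewrite pH.
have pI : periodic_fun L (Im \o H) by move=> l t Ll /=; rewrite pH.
have [M hM] := periodic_bounded HL cR pR; have [N hN] := periodic_bounded HL cIm pI.
have iH : cintegrable mu cell H.
  split; first exact: (cell_integrable HL Hmu (continuous_borel cR) (fun t _ => hM t)).
  exact: (cell_integrable HL Hmu (continuous_borel cIm) (fun t _ => hN t)).
have [zR zI] := zero_coefs_complex iH H0.
apply: complex_eqP; first exact: (fourier_unique_continuous HL int_L Hmu cR pR zR x).
exact: (fourier_unique_continuous HL int_L Hmu cIm pI zI x).
Qed.

Lemma complex_fourier_unique_ae (H : E -> C) :
  cmeasurable [set: borel E] (H : borel E -> C) -> cintegrable mu cell H ->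
  periodic_fun L H -> (forall y, dL y -> cI (fun t => pr y t * H t) = 0) ->
  {ae mu, forall x : borel E, H x = 0}.
Proof.
move=> [mR mI] iH pH H0; have [iR iI] := iH.
have pR : periodic_fun L (Re \o H) by move=> l t Ll /=; rewrite pH.
have pI : periodic_fun L (Im \o H) by move=> l t Ll /=; rewrite pH.
have [zR zI] := zero_coefs_complex iH H0.
have aR := fourier_unique_ae HL int_L Hmu mR pR iR zR.
have aI := fourier_unique_ae HL int_L Hmu mI pI iI zI.
by apply: filterS2 aR aI => x hR hI; exact: complex_eqP.
Qed.
End ComplexFourier.

(** * The Zak transform of Schwartz families *)

Section ZakAlgebra.
Variables (R : realType) (E : normedModType R) (ip : {dot E for idfun}).
Variables (n : nat) (u b bd : 'I_n -> E) (L : set E).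
Hypothesis HL : lattice_basis ip u b bd L.
Hypothesis int_L : integral_lattice ip L.
Local Notation C := R[i].
Local Notation dL := (Pilot.Defs.dual ip L).
Local Notation pr := (pairing ip).
Local Notation Zt := (discriminant ip L).
Local Notation disc := (disc_seq ip L).
Local Notation ord := ((order_discriminant ip L)%:R : C).
Local Notation iso := (inv_sqrt_order ip L).
Variable r : Zt -> E.
Hypothesis rP : representatives r.

Lemma inv_sqrt_order_sqr : iso * iso = ord^-1.
Proof.
have N0 : (0 : R) < (order_discriminant ip L)%:R by rewrite ltr0n (order_disc_gt0 HL int_L rP).
rewrite /inv_sqrt_order -rmorphM/= -invfM -expr2 sqr_sqrtr ?ltW//.
by rewrite rmorphV ?unitfE ?gt_eqF//= rmorph_nat.
Qed.

Lemma order_neq0 : ord != 0.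
Proof. by rewrite pnatr_eq0 -lt0n (order_disc_gt0 HL int_L rP). Qed.

(** The unitary finite Fourier transform of (f g x) in g. It is indexed by dual vectors instead of
    classes, to serve directly as the coefficient of a theta series. *)
Definition zak_coef (f : Zt -> E -> C) (l x : E) : C :=
  iso * \sum_(g <- disc) pr (- l) (r g) * f g x.

Lemma pairing_lat l y : L l -> dL y -> pr l y = 1.
Proof. exact: dual_pairing. Qed.

Lemma zak_coef_per f l l' x : dL l -> L l' -> zak_coef f (l + l') x = zak_coef f l x.
Proof.
move=> dl Ll'; congr (_ * _); apply: eq_bigr => g _; congr (_ * _).
by rewrite opprD pairingDl (pairing_lat (latN HL Ll') (rep_dual HL int_L rP g)) mulr1.
Qed.

Lemma character_sum_diff y z : dL y -> dL z -> \sum_(g <- disc) pr (r g) (y - z) =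
  if `[< L (y - z) >] then ord else 0.
Proof. by move=> dy dz; apply: (character_sum HL int_L rP); exact: (dualB HL). Qed.

(** Expanding the squares, orthogonality of characters kills the terms g different from g', and the
    two factors 1/sqrt(order) cancel the order of the group on the diagonal. *)
Lemma zak_coef_plancherel f x :
  \sum_(h <- disc) sqmod (zak_coef f (r h) x) = \sum_(g <- disc) sqmod (f g x).
Proof.
apply: complexI; rewrite !rmorph_sum/=.
rewrite (eq_bigr (fun h => \sum_(g <- disc) \sum_(g' <- disc)
   (ord^-1 * (f g x * conjc (f g' x))) * pr (r h) (r g' - r g))); last first.
  move=> h _; rewrite -mulcJ /zak_coef rmorphM/= rmorph_sum/= mulrACA.
  rewrite [X in iso * X](_ : _ = iso); last by rewrite /inv_sqrt_order/= oppr0.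
  rewrite inv_sqrt_order_sqr mulr_suml mulr_sumr; apply: eq_bigr => g _.
  rewrite mulr_sumr mulr_sumr; apply: eq_bigr => g' _.
  have conjM (z w : C) : conjc (z * w) = conjc z * conjc w by exact: rmorphM.
  rewrite conjM pairingJ opprK pairingDr pairingNr; ring.
rewrite exchange_big/=; apply: eq_bigr => g _.
rewrite exchange_big/= (bigD1_seq g)//=; [|exact: mem_disc HL int_L _|exact: uniq_disc].
rewrite -mulr_sumr character_sum_diff; try exact: (rep_dual HL int_L rP).
rewrite subrr asboolT; last exact: (lat0 HL).
rewrite mulrAC mulVf ?order_neq0// mul1r mulcJ big1 ?addr0// => g' gg'.
rewrite -mulr_sumr character_sum_diff; try exact: (rep_dual HL int_L rP).
rewrite asboolF ?mulr0// => /(rep_inj HL rP) E'; by rewrite E' eqxx in gg'.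
Qed.

Lemma zakE f p : (forall g, csummable dL (zak_term r f g p.1 p.2)) ->
  zak r f p = pr (- (2^-1 *: p.1)) p.2 * theta_series ip L (zak_coef f) p /\
  csummable dL (fun l => zak_coef f l (p.1 + l) * pr (- l) p.2).
Proof.
move=> sf; have ex := dual_exhaustion HL.
have eq l : zak_coef f l (p.1 + l) * pr (- l) p.2 = iso * \sum_(g <- disc) zak_term r f g p.1 p.2 l.
  rewrite /zak_coef -mulrA mulr_suml; congr (_ * _); apply: eq_bigr => g _.
  by rewrite /zak_term; ring.
split; last first.
  rewrite (funext eq); apply: csummableZ; exact: csummable_sum.
rewrite /theta_series (funext eq) (csumZ _ ex); last exact: csummable_sum.
by rewrite (csum_sum _ ex)// /zak (fsum_disc HL int_L) -mulrA mulrCA.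
Qed.

Lemma zak_section f : (forall p g, csummable dL (zak_term r f g p.1 p.2)) ->
  is_section ip L (zak r f).
Proof.
move=> sf.
rewrite (_ : zak r f = fun p => pr (- (2^-1 *: p.1)) p.2 * theta_series ip L (zak_coef f) p); last first.
  by apply/funext => p; rewrite (zakE (sf p)).1.
apply: (quasi_periodic_section int_L); apply: (theta_series_quasi_periodic HL int_L).
  by move=> l l' x; exact: zak_coef_per.
by move=> p; exact: (zakE (sf p)).2.
Qed.

Variable r' : Zt -> E.
Hypothesis rP' : representatives r'.

(** Z and its inverse are stated with independent choices of representatives. They differ by lattice
    vectors, on which pairings with dual vectors are 1, so the two formulas still match. *)
Lemma reps_diff g : L (r g - r' g).
Proof.
have := rP g; have := rP' g; have := valP g; rewrite inE => -[x dx <-].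
move=> [l Ll <-] [l' Ll' <-]; rewrite opprD addrACA subrr add0r; exact: (latB HL).
Qed.

Lemma pairing_reps g h : pr (r g) (r' h) = pr (r' g) (r' h).
Proof.
rewrite -(subrK (r' g) (r g)) pairingDl (pairing_lat (reps_diff g)) ?mul1r//.
exact: (rep_dual HL int_L rP').
Qed.

Lemma zak_coef_inverse f g x :
  iso * \sum_(h <- disc) pr (r' g) (r' h) * zak_coef f (r' h) x = f g x.
Proof.
rewrite (eq_bigr (fun h => \sum_(g' <- disc) (iso * f g' x) * pr (r' h) (r' g - r g'))); last first.
  move=> h _; rewrite /zak_coef mulrCA mulr_sumr mulr_sumr; apply: eq_bigr => g' _.
  by rewrite pairingDr pairingNr (pairingC _ (r' g)); ring.
rewrite exchange_big/= mulr_sumr (bigD1_seq g)//=; [|exact: mem_disc HL int_L _|exact: uniq_disc].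
have cs g' : \sum_(h <- disc) pr (r' h) (r' g - r g') = if g == g' then ord else 0.
  rewrite (character_sum HL int_L rP'); last first.
    by apply: (dualB HL); [exact: (rep_dual HL int_L rP')|exact: (rep_dual HL int_L rP)].
  congr (if _ then _ else _); apply/asboolP/eqP => [Lgg|<-].
    apply: (rep_inj HL rP); rewrite -(subrKA (r' g)) .
    by apply: (latD HL) => //; exact: reps_diff.
  by rewrite -opprB; apply: (latN HL); exact: reps_diff.
rewrite -mulr_sumr cs eqxx mulrA mulrA inv_sqrt_order_sqr mulrAC mulVf ?order_neq0// mul1r.
rewrite big1 ?addr0// => g' gg'; rewrite -mulr_sumr cs eq_sym (negbTE gg') mulr0 mulr0//.
Qed.

(** The other half of finite Fourier inversion. Periodicity of Phi is essential here: the inner sum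
    only sees the values at the chosen representatives [r' h]. *)
Lemma zak_coef_of_inverse (Phi : E -> E -> C) l x : dL l ->
  (forall l l' x, dL l -> L l' -> Phi (l + l') x = Phi l x) ->
  zak_coef (fun g t => iso * \sum_(h <- disc) pr (r' g) (r' h) * Phi (r' h) t) l x = Phi l x.
Proof.
move=> dl Phi_per; rewrite /zak_coef.
rewrite (eq_bigr (fun g => \sum_(h <- disc) (iso * Phi (r' h) x) * pr (r g) (r' h - l))); last first.
  move=> g _; rewrite mulrCA mulr_sumr mulr_sumr; apply: eq_bigr => h _.
  by rewrite pairingDr pairingNr -(pairing_reps g h) (pairingC _ (- l)) -pairingNr (pairingNr _ (r g)); ring.
have [g Lg] := rep_ex HL rP' dl.
rewrite exchange_big/= mulr_sumr (bigD1_seq g)//=; [|exact: mem_disc HL int_L _|exact: uniq_disc].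
have cs h : \sum_(g <- disc) pr (r g) (r' h - l) = if h == g then ord else 0.
  rewrite (character_sum HL int_L rP); last first.
    by apply: (dualB HL) => //; exact: (rep_dual HL int_L rP').
  congr (if _ then _ else _); apply/asboolP/eqP => [Lgg|->].
    apply: (rep_inj HL rP'); rewrite -(subrKA l); exact: (latD HL).
  by rewrite -opprB; apply: (latN HL).
rewrite -mulr_sumr cs eqxx mulrA mulrA inv_sqrt_order_sqr mulrAC mulVf ?order_neq0// mul1r.
rewrite big1 ?addr0 => [|h hg].
  have := Phi_per (r' g) (l - r' g) x (rep_dual HL int_L rP' g) Lg.
  by rewrite addrC subrK => ->.
by rewrite -mulr_sumr cs (negbTE hg) mulr0 mulr0.
Qed.
End ZakAlgebra.

(** * Schwartz families: summability and smoothness of the series *)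

Section Schwartz.
Variables (R : realType) (E : normedModType R) (ip : {dot E for idfun}).
Variables (n : nat) (u b bd : 'I_n -> E) (L : set E).
Hypothesis HL : lattice_basis ip u b bd L.
Hypothesis int_L : integral_lattice ip L.
Local Notation C := R[i].
Local Notation dL := (Pilot.Defs.dual ip L).
Local Notation pr := (pairing ip).
Local Notation Zt := (discriminant ip L).
Local Notation disc := (disc_seq ip L).
Local Notation weight := (weight ip b).

(** According to whether |x| is at most 1 or not, 1 + |x| is at most 2 or at most 2 |x|; hence the
    two decay constants and the factor 2^m. *)
Lemma rapid_bound (g : E -> R) (m : nat) : rapidly_decreasing g ->
  exists2 M : R, 0 <= M & forall x, (1 + `|x|) ^+ m * `|g x| <= M.
Proof.
move=> rg; have [M0 h0] := rg 0%N [::]; have [M1 h1] := rg m [::].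
have M00 : 0 <= M0 by apply: le_trans (h0 0); rewrite mulr_ge0.
have M10 : 0 <= M1 by apply: le_trans (h1 0); rewrite mulr_ge0 ?exprn_ge0.
exists (2 ^+ m * (M0 + M1)); first by rewrite mulr_ge0 ?addr_ge0 ?exprn_ge0.
move=> x; have := h0 x; have := h1 x; rewrite /= expr0 mul1r => h1x h0x.
have gx0 := normr_ge0 (g x); have x0 := normr_ge0 x.
have [x1|x1] := leP `|x| 1.
  apply: (@le_trans _ _ (2 ^+ m * `|g x|)).
    by rewrite ler_wpM2r// lerXn2r ?nnegrE ?addr_ge0//; lra.
  by rewrite ler_wpM2l ?exprn_ge0//; lra.
apply: (@le_trans _ _ ((2 * `|x|) ^+ m * `|g x|)).
  by rewrite ler_wpM2r// lerXn2r ?nnegrE ?addr_ge0 ?mulr_ge0//; lra.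
by rewrite exprMn -mulrA ler_wpM2l ?exprn_ge0//; lra.
Qed.

Lemma rapid_weight (g : E -> R) (rho : R) (p : nat) : rapidly_decreasing g ->
  exists2 A : R, 0 <= A & forall t y, `|t| <= rho ->
    (1 + `|y|) ^+ p * `|g (t + y)| <= A * weight y.
Proof.
move=> rg; have [K K0 hK] := weight_bound HL rho p.
have [M M0 hM] := rapid_bound (p + 2 * n) rg.
exists (K * M) => [|t y tr]; first exact: mulr_ge0.
have w0 := weight_ge0 ip b y.
apply: (@le_trans _ _ (K * (1 + `|t + y|) ^+ (p + 2 * n) * weight y * `|g (t + y)|)).
  by rewrite ler_wpM2r// hK.
rewrite (_ : _ * _ * _ * _ = K * ((1 + `|t + y|) ^+ (p + 2 * n) * `|g (t + y)|) * weight y); last ring.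
by rewrite ler_wpM2r// ler_wpM2l.
Qed.

Lemma schwartz_weight (f : E -> C) (rho : R) : schwartz f ->
  exists2 A : R, 0 <= A & forall t y, `|t| <= rho -> normc (f (t + y)) <= A * weight y.
Proof.
move=> [_ fR fI]; have [A A0 hA] := rapid_weight rho 0 fR.
have [B B0 hB] := rapid_weight rho 0 fI.
exists (A + B) => [|t y tr]; first exact: addr_ge0.
have := hA t y tr; have := hB t y tr; rewrite expr0 !mul1r => h1 h2.
by rewrite (le_trans (normc_le_ReIm _))// mulrDl lerD.
Qed.

Lemma schwartz_csummable (r : Zt -> E) (f : Zt -> E -> C) g t1 t2 : schwartz_family f ->
  csummable dL (zak_term r f g t1 t2).
Proof.
move=> sf; have [A A0 hA] := schwartz_weight `|t1| (sf g).
apply: csummable_le (summableZ A (summable_weight HL)) => l dl.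
by rewrite /zak_term !normcM !normc_pairing !mulr1 hA.
Qed.

Local Notation arg l q := (2 * pi * ip l q).

(** The class of families for termwise differentiation. A derivative in the second variable brings
    out a factor linear in l, so coefficients of polynomial growth must be allowed; the decay of g
    absorbs them. *)
Inductive zak_series : (E -> E * E -> R) -> Prop :=
| zak_cos (c : E -> R) (A : R) (p : nat) (g : E -> R) :
    (forall l, `|c l| <= A * (1 + `|l|) ^+ p) -> smooth g -> rapidly_decreasing g ->
    zak_series (fun l q => c l * g (q.1 + l) * cos (arg l q.2))
| zak_sin (c : E -> R) (A : R) (p : nat) (g : E -> R) :
    (forall l, `|c l| <= A * (1 + `|l|) ^+ p) -> smooth g -> rapidly_decreasing g ->
    zak_series (fun l q => c l * g (q.1 + l) * sin (arg l q.2))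
| zak_add H G : zak_series H -> zak_series G -> zak_series (fun l q => H l q + G l q).

Lemma arg_smooth l : smooth (fun q : E * E => arg l q.2).
Proof.
apply: smooth_linear => [q|q v h]; last by rewrite /= ipDr ipZr; ring.
apply: cvgM; first exact: cvg_cst.
rewrite ipC; under eq_cvg do rewrite ipC.
apply: (@continuous_comp _ _ _ snd (fun x => ip x l)); first exact: cvg_snd.
exact: (ip_continuous (y := l) (lat_onb HL)).
Qed.

Lemma arg_is_derive l (q v : E * E) : is_derive q v (fun q : E * E => arg l q.2) (arg l v.2).
Proof.
apply/is_deriveP => e e0; exists 1 => // h _.
have -> : arg l (q + h *: v).2 - arg l q.2 - h * arg l v.2 = 0.
  by rewrite [(q + h *: v).2]/= ipDr ipZr; ring.
by rewrite normr0 mulr_ge0// ltW.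
Qed.

Lemma shift_fst_affine (l : E) : continuous (fun q : E * E => q.1 + l) /\
  (forall (x v : E * E) (h : R), (x + h *: v).1 + l = (x.1 + l) + h *: v.1).
Proof.
split => [q|x v h]; last by rewrite /= addrAC.
by apply: cvgD; [exact: cvg_fst|exact: cvg_cst].
Qed.

Lemma smooth_shift_fst (g : E -> R) l : smooth g -> smooth (fun q : E * E => g (q.1 + l)).
Proof. have [ca la] := shift_fst_affine l; exact: (smooth_comp_affine ca la). Qed.

Lemma zak_series_smooth H l : zak_series H -> smooth (H l).
Proof.
elim => {H} [c A p g _ sg _|c A p g _ sg _|H G _ sH _ sG]; last exact: smoothD.
- apply: smoothM; last exact/smooth_cos/arg_smooth.
  by apply: smoothM; [exact: smooth_cst|exact: smooth_shift_fst].
- apply: smoothM; last exact/smooth_sin/arg_smooth.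
  by apply: smoothM; [exact: smooth_cst|exact: smooth_shift_fst].
Qed.

Lemma rapid_derive (g : E -> R) v : rapidly_decreasing g -> rapidly_decreasing (fun x => 'D_v g x).
Proof. by move=> rg k vs; have := rg k (rcons vs v); rewrite iterD_rcons. Qed.

Lemma coef_growth (c : E -> R) (A : R) (p : nat) (v : E) (s : R) :
  (forall l, `|c l| <= A * (1 + `|l|) ^+ p) ->
  forall l, `|s * arg l v * c l| <= (`|s| * (2 * pi) * `|v| * A) * (1 + `|l|) ^+ p.+1.
Proof.
move=> cA l; have pi0 : 0 <= 2 * pi :> R by rewrite mulr_ge0// pi_ge0.
rewrite normrM (normrM s) (normrM (2 * pi)) (ger0_norm pi0).
have iv : `|ip l v| <= `|l| * `|v| by exact: (CauchySchwarz (lat_onb HL)).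
have A0 : 0 <= A * (1 + `|l|) ^+ p by apply: le_trans (cA l).
rewrite (_ : _ * (1 + `|l|) ^+ p.+1 =
  (`|s| * (2 * pi * ((1 + `|l|) * `|v|))) * (A * (1 + `|l|) ^+ p)); last by rewrite exprS; ring.
apply: ler_pM => //; first by rewrite mulr_ge0// mulr_ge0.
rewrite ler_wpM2l// -!mulrA ler_wpM2l// ler_wpM2l ?pi_ge0// (le_trans iv)//.
by rewrite ler_wpM2r// lerDr.
Qed.

Lemma zak_series_derive H v : zak_series H -> zak_series (fun l q => 'D_v (H l) q).
Proof.
elim => {H} [c A p g cA sg rg|c A p g cA sg rg|H G zH IH zG IG].
- have h1 := zak_cos cA (smooth_derive v.1 sg) (rapid_derive v.1 rg).
  have h2 := zak_sin (coef_growth v.2 (-1) cA) sg rg.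
  have := zak_add h1 h2; congr zak_series; apply/funext => l; apply/funext => q.
  have [ca la] := shift_fst_affine l.
  have d1 := smooth_is_derive q v (smooth_shift_fst l sg).
  rewrite (derive_comp_affine q v la sg) in d1.
  have d2 := is_derive_chain (f := fun q : E * E => arg l q.2)
    (is_derive_cos (arg l q.2)) (arg_is_derive l q v).
  have d3 := is_derive_addM (is_derive_addM (is_derive_cst (c l) q v) d1) d2.
  by rewrite (is_derive_unique d3)/=; ring.
- have h1 := zak_sin cA (smooth_derive v.1 sg) (rapid_derive v.1 rg).
  have h2 := zak_cos (coef_growth v.2 1 cA) sg rg.
  have := zak_add h1 h2; congr zak_series; apply/funext => l; apply/funext => q.
  have [ca la] := shift_fst_affine l.
  have d1 := smooth_is_derive q v (smooth_shift_fst l sg).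
  rewrite (derive_comp_affine q v la sg) in d1.
  have d2 := is_derive_chain (f := fun q : E * E => arg l q.2)
    (is_derive_sin (arg l q.2)) (arg_is_derive l q v).
  have d3 := is_derive_addM (is_derive_addM (is_derive_cst (c l) q v) d1) d2.
  by rewrite (is_derive_unique d3)/=; ring.
- have := zak_add IH IG; congr zak_series; apply/funext => l; apply/funext => q.
  have dH := smooth_is_derive q v (zak_series_smooth l zH).
  have dG := smooth_is_derive q v (zak_series_smooth l zG).
  by rewrite (is_derive_unique (is_derive_addD dH dG)).
Qed.

Lemma zak_series_weight H (rho : R) : zak_series H -> exists2 B : R, 0 <= B &
  forall l q, dL l -> `|q| <= rho -> `|H l q| <= B * weight l.
Proof.
have key (c : E -> R) (A : R) (p : nat) (g : E -> R) (t : R -> R) :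
    (forall x, `|t x| <= 1) -> (forall l, `|c l| <= A * (1 + `|l|) ^+ p) ->
    rapidly_decreasing g -> exists2 B : R, 0 <= B &
    forall l (q : E * E), dL l -> `|q| <= rho ->
      `|c l * g (q.1 + l) * t (arg l q.2)| <= B * weight l.
  move=> t1 cA rg; have [B B0 hB] := rapid_weight rho p rg.
  have A0 : 0 <= A by have := cA 0; rewrite normr0 addr0 expr1n mulr1; apply: le_trans.
  exists (A * B) => [|l q dl qr]; first exact: mulr_ge0.
  have q1 : `|q.1| <= rho by apply: le_trans qr; rewrite prod_normE le_max lexx.
  rewrite normrM -[leRHS]mulr1; apply: ler_pM => //; rewrite normrM -mulrA.
  apply: (@le_trans _ _ (A * ((1 + `|l|) ^+ p * `|g (q.1 + l)|))).
    by rewrite mulrA ler_wpM2r.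
  by rewrite ler_wpM2l// hB.
elim => {H} [c A p g cA _ rg|c A p g cA _ rg|H G _ [B B0 hB] _ [B' B'0 hB']].
- exact: (key _ _ _ _ _ (@cos_max R) cA rg).
- exact: (key _ _ _ _ _ (@sin_max R) cA rg).
- exists (B + B') => [|l q dl qr]; first exact: addr_ge0.
  by rewrite (le_trans (ler_normD _ _))// mulrDl lerD ?hB ?hB'.
Qed.

Lemma zak_series_sum_smooth H : zak_series H -> smooth (fun q => rsum dL (fun l => H l q)).
Proof.
apply: (series_smooth (dual_exhaustion HL) (summable_weight HL) (fun l _ => weight_ge0 ip b l)).
- by move=> {}H l zH; exact/smooth_continuous/zak_series_smooth.
- by move=> {}H l zH x v; exact/smooth_derivable/zak_series_smooth.
- by move=> {}H v; exact: zak_series_derive.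
- by move=> {}H rho; exact: zak_series_weight.
Qed.

Lemma csmooth_pairing (s : R) : csmooth (fun q : E * E => pr (s *: q.1) q.2).
Proof.
apply: csmooth_expi; have [_ _ uS] := lat_onb HL.
rewrite (_ : (fun q => _) = fun q : E * E => \sum_i (2 * pi * s) * (ip q.1 (u i) * ip q.2 (u i))); last first.
  apply/funext => q; rewrite -mulr_sumr ipZl mulrA; congr (_ * _).
  rewrite {1}(uS q.1) ip_suml; apply: eq_bigr => i _.
  by rewrite ipZl (ipC _ (u i)).
apply: smooth_sum => i; apply: smoothM; first exact: smooth_cst.
have cu : continuous (fun x => ip x (u i)) := ip_continuous (y := u i) (lat_onb HL).
apply: smoothM; apply: smooth_linear.
- move=> q; apply: (@continuous_comp _ _ _ fst (fun x => ip x (u i))); [exact: cvg_fst|exact: cu].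
- by move=> q v h; rewrite /= ipDl ipZl.
- move=> q; apply: (@continuous_comp _ _ _ snd (fun x => ip x (u i))); [exact: cvg_snd|exact: cu].
- by move=> q v h; rewrite /= ipDl ipZl.
Qed.

Variable r : Zt -> E.

Lemma zak_term_sum_smooth (f : E -> C) (g : Zt) : schwartz f ->
  csmooth (fun q => csum dL (fun l => f (q.1 + l) * pr (- l) q.2 * pr (- l) (r g))).
Proof.
move=> [[sR sI] rR rI].
have bnd (t : R -> R) (s : R) : (forall x, `|t x| <= 1) -> `|s| <= 1 ->
    forall l, `|s * t (arg l (r g))| <= 1 * (1 + `|l|) ^+ 0.
  by move=> t1 s1 l; rewrite expr0 mulr1 normrM mulr_ile1.
have s1 : `|1 : R| <= 1 by rewrite normr1.
have sN : `|-1 : R| <= 1 by rewrite normrN1.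
have c1 := bnd cos 1 (@cos_max R) s1; have cN := bnd cos (-1) (@cos_max R) sN.
have n1 := bnd sin 1 (@sin_max R) s1; have nN := bnd sin (-1) (@sin_max R) sN.
split.
  (* The real part of f(x + l) e^(-2 pi i (l, y + r g)), expanded by the addition formulas into four
     terms with real coefficients cos or sin of 2 pi (l, r g); the imaginary part is treated
     alike. *)
  have := zak_series_sum_smooth (zak_add
    (zak_add (zak_cos c1 sR rR) (zak_sin nN sR rR))
    (zak_add (zak_sin c1 sI rI) (zak_cos n1 sI rI))).
  congr smooth; apply/funext => q /=; congr rsum; apply/funext => l /=.
  rewrite -[in RHS]mulrA -pairingDr ReM /pairing /expi/= ipNl mulrN cosN sinN ipDr.
  by rewrite (mulrDr (2 * pi)) cosD sinD; ring.
have := zak_series_sum_smooth (zak_add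
  (zak_add (zak_cos c1 sI rI) (zak_sin nN sI rI))
  (zak_add (zak_sin cN sR rR) (zak_cos nN sR rR))).
congr smooth; apply/funext => q /=; congr rsum; apply/funext => l /=.
rewrite -[in RHS]mulrA -pairingDr ImM /pairing /expi/= ipNl mulrN cosN sinN ipDr.
by rewrite (mulrDr (2 * pi)) cosD sinD; ring.
Qed.

Hypothesis rP : representatives r.

Lemma zak_smooth_section (f : Zt -> E -> C) : schwartz_family f -> smooth_section ip L (zak r f).
Proof.
move=> sf; split.
  by apply: (zak_section HL int_L rP) => p g; exact: schwartz_csummable.
apply: csmoothM.
  apply: csmoothM; first exact: csmooth_cst.
  have := csmooth_pairing (- 2^-1).
  by under [X in csmooth X -> _]eq_fun do rewrite scaleNr.
have := csmooth_sum disc (fun g => zak_term_sum_smooth g (sf g)).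
by under [X in csmooth X -> _]eq_fun do rewrite -(fsum_disc HL int_L).
Qed.

Lemma zak_linear_at (a : C) (f f' : Zt -> E -> C) p :
  (forall g, csummable dL (zak_term r f g p.1 p.2)) ->
  (forall g, csummable dL (zak_term r f' g p.1 p.2)) ->
  zak r (fun g t => a * f g t + f' g t) p = a * zak r f p + zak r f' p.
Proof.
move=> sf sf'; rewrite /zak !(fsum_disc HL int_L).
rewrite mulrCA -mulrDr; congr (_ * _); rewrite mulr_sumr -big_split/=.
apply: eq_bigr => g _; have ex := dual_exhaustion HL.
rewrite -(csumZ a ex (sf g)) -(csumD ex (csummableZ a (sf g)) (sf' g)).
by apply: eq_csum => l _; rewrite /zak_term; ring.
Qed.

Lemma zak_linear (a : C) (f f' : Zt -> E -> C) : schwartz_family f -> schwartz_family f' ->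
  zak r (fun g t => a * f g t + f' g t) = (fun p => a * zak r f p + zak r f' p).
Proof.
by move=> sf sf'; apply/funext => p; apply: zak_linear_at => g; exact: schwartz_csummable.
Qed.
End Schwartz.

(** * The inverse of the Zak transform *)

Section QuasiPeriodicDerivatives.
Variables (R : realType) (E : normedModType R) (ip : {dot E for idfun}).
Variables (n : nat) (u b bd : 'I_n -> E) (L : set E).
Hypothesis HL : lattice_basis ip u b bd L.
Hypothesis int_L : integral_lattice ip L.
Local Notation C := R[i].
Local Notation dL := (Pilot.Defs.dual ip L).
Local Notation pr := (pairing ip).
Local Notation arg l q := (2 * pi * ip l q).

Lemma csmooth_pairing_snd l : csmooth (fun q : E * E => pr l q.2).
Proof. exact/csmooth_expi/(arg_smooth HL). Qed.

Lemma cderive_pairing_snd l (q v : E * E) :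
  cderive v (fun q : E * E => pr l q.2) q = (0 +i* arg l v.2)%C * pr l q.2.
Proof. exact: (cderive_expi (arg_is_derive ip l q v)). Qed.

Lemma shift_pair_affine (c : E * E) : continuous (fun q : E * E => q + c) /\
  (forall (x v : E * E) (h : R), (x + h *: v) + c = (x + c) + h *: v).
Proof.
split => [q|x v h]; last by rewrite addrAC.
by apply: cvgD; [exact: cvg_id|exact: cvg_cst].
Qed.

Lemma quasi_periodic_shift h G : dL h -> quasi_periodic ip L G ->
  quasi_periodic ip L (fun p => pr h p.2 * G (p.1 - h, p.2)).
Proof.
move=> dh qG l1 l2 x y Ll1 Ll2 /=; rewrite addrAC qG// pairingDr.
by rewrite (pairingC _ h l2) (dual_pairing Ll2 dh) mulr1 mulrCA.
Qed.

Lemma quasi_periodic_sum I (s : seq I) (c : I -> C) (G : I -> E * E -> C) :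
  (forall i, quasi_periodic ip L (G i)) ->
  quasi_periodic ip L (fun p => \sum_(i <- s) c i * G i p).
Proof.
move=> qG l1 l2 x y Ll1 Ll2; rewrite mulr_sumr; apply: eq_bigr => i _.
by rewrite qG// mulrCA.
Qed.

Lemma csmooth_shift h G : csmooth G -> csmooth (fun p : E * E => pr h p.2 * G (p.1 - h, p.2)).
Proof.
move=> sG; apply: csmoothM; first exact: csmooth_pairing_snd.
have [ca la] := shift_pair_affine (- h, 0).
rewrite (_ : (fun p => _) = fun p => G (p + (- h, 0))); first exact: (csmooth_comp_affine ca la sG).
by apply/funext => p; congr G; apply/eqP; rewrite xpair_eqE/= addr0 !eqxx.
Qed.

(** The extra term is the derivative of <l1, y>. It vanishes for directions in the first factor, and
    for the second it is what the correction in [nabla] cancels. *)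
Lemma cderive_quasi_periodic (v : E * E) G : csmooth G -> quasi_periodic ip L G ->
  forall l1 l2 x y, L l1 -> L l2 -> cderive v G (x + l1, y + l2) =
    pr l1 y * (cderive v G (x, y) + (0 +i* arg l1 v.2)%C * G (x, y)).
Proof.
move=> sG qG l1 l2 x y Ll1 Ll2; have [ca la] := shift_pair_affine (l1, l2).
rewrite -[LHS](cderive_comp_affine (x, y) v la sG).
rewrite (_ : (fun p => G (p + (l1, l2))) = fun p => pr l1 p.2 * G p); last first.
  by apply/funext => -[x' y']; rewrite -(qG l1 l2 x' y' Ll1 Ll2).
rewrite (cderiveM v (x, y) (csmooth_pairing_snd l1) sG).
by rewrite cderive_pairing_snd/=; ring.
Qed.

Lemma quasi_periodic_derive v G : csmooth G -> quasi_periodic ip L G ->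
  quasi_periodic ip L (cderive (v, 0) G).
Proof.
move=> sG qG l1 l2 x y Ll1 Ll2; rewrite cderive_quasi_periodic//= ip0r mulr0.
by rewrite -[X in _ + X * _]/(0 : C) mul0r addr0.
Qed.

(* The covariant derivative in the second variable, which preserves
   quasi-periodicity. *)
Definition nabla (w : E) (G : E * E -> C) (p : E * E) : C :=
  cderive (0, w) G p + (0 -i* arg p.1 w)%C * G p.

Lemma csmooth_nabla w G : csmooth G -> csmooth (nabla w G).
Proof.
move=> sG; apply: csmoothD; first exact: csmooth_derive.
apply: (csmoothM _ sG); split; first exact: smooth_cst.
rewrite (_ : _ \o _ = fun p : E * E => - arg p.1 w)//; apply: smooth_linear.
  move=> q; apply: cvgN; apply: cvgM; first exact: cvg_cst.
  apply: (@continuous_comp _ _ _ fst (fun x => ip x w)); first exact: cvg_fst.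
  exact: (ip_continuous (y := w) (lat_onb HL)).
by move=> q v h; rewrite /= ipDl ipZl; ring.
Qed.

Lemma quasi_periodic_nabla w G : csmooth G -> quasi_periodic ip L G ->
  quasi_periodic ip L (nabla w G).
Proof.
move=> sG qG l1 l2 x y Ll1 Ll2; rewrite /nabla cderive_quasi_periodic// qG//=.
rewrite mulrDr [RHS]mulrDr -addrA; congr (_ + _).
rewrite [X in _ + X]mulrCA -mulrDr -mulrDl; congr (_ * (_ * _)).
by apply: complex_eqP; rewrite /= ?ipDl; ring.
Qed.
End QuasiPeriodicDerivatives.

(** * Integrals over slices: smoothness and decay *)

Section CoefficientIntegrals.
Variables (R : realType) (E : normedModType R) (ip : {dot E for idfun}).
Variables (n : nat) (u b bd : 'I_n -> E) (L : set E).
Hypothesis HL : lattice_basis ip u b bd L.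
Hypothesis int_L : integral_lattice ip L.
Variable mu : {sigma_finite_measure set (borel E) -> \bar R}.
Hypothesis Hmu : invariant_measure mu.
Local Notation C := R[i].
Local Notation Re := (@complex.Re R).
Local Notation Im := (@complex.Im R).
Local Notation cell := (cell ip bd : set (borel E)).
Local Notation mcell := (measurable_cell HL).
Local Notation V := (fine (mu cell)).
Local Notation cI := (cintegral mu cell).
Local Notation arg l q := (2 * pi * ip l q).

(** The mean value theorem twice, which gives B instead of the sharp B/2. The bound is required on
    the one line only, since a second derivative in y of G is bounded on each slice but need not be
    bounded on E x E. *)
Lemma taylor_line_slice (W : normedModType R) (g : W -> R) (B : R) (x w : W) : smooth g ->
  (forall s, `|'D_w (fun z => 'D_w g z) (x + s *: w)| <= B) ->
  forall h, `|g (x + h *: w) - g x - h * 'D_w g x| <= B * h ^+ 2.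
Proof.
move=> sg gB h.
have d1 t : `|t| <= `|h| -> `|'D_w g (x + t *: w) - 'D_w g x| <= B * `|h|.
  move=> th; have B0 : 0 <= B by apply: le_trans (gB 0).
  apply: (@le_trans _ _ (B * `|t|)); last by rewrite ler_wpM2l.
  apply: (@mvt_line _ _ (fun z => 'D_w g z) (fun z => 'D_w (fun z => 'D_w g z) z) x w B `|t|) => //.
  by move=> y; apply: smooth_is_derive; exact: smooth_derive.
pose psi (t : R) := g (x + t *: w) - t * 'D_w g x.
have dpsi (t : R) : is_derive t (1 : R) psi ('D_w g (x + t *: w) - 'D_w g x).
  have h1 := is_derive_line (smooth_is_derive (x + t *: w) w sg).
  have h2 : is_derive t (1 : R) (fun t : R => (- 'D_w g x) * t) (- 'D_w g x).
    have := is_derive_addM (is_derive_cst (- 'D_w g x) t (1 : R)) (is_derive_id t (1 : R)).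
    by rewrite /= mulr1 mulr0 addr0.
  have := is_derive_addD h1 h2; congr is_derive.
  by apply/funext => s; rewrite /psi mulrC mulrN.
have := @mvt_line _ R psi (fun t => 'D_w g (x + t *: w) - 'D_w g x) 0 1 (B * `|h|) `|h| dpsi _ h (lexx _).
rewrite add0r {1}/psi {1}/psi scale0r addr0 mul0r subr0 [h *: 1]mulr1.
rewrite -[X in _ -> _ <= B * X]real_normK ?num_real// expr2 mulrA addrAC.
by apply => t th; rewrite add0r [t *: 1]mulr1; exact: d1.
Qed.

Lemma taylor_line (W : normedModType R) (g : W -> R) (B : R) (x w : W) : smooth g ->
  (forall y, `|'D_w (fun z => 'D_w g z) y| <= B) ->
  forall h, `|g (x + h *: w) - g x - h * 'D_w g x| <= B * h ^+ 2.
Proof. by move=> sg gB; exact: taylor_line_slice. Qed.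

(** A quadratic remainder uniform in t integrates to at most B V h^2, so no dominated convergence is
    needed. The 1 in B V + 1 only protects against division by 0. *)
Lemma integral_is_derive (F : E -> E -> R) (DF : E -> R) (x v : E) (B : R) :
  (forall h t, `|F (x + h *: v) t - F x t - h * DF t| <= B * h ^+ 2) ->
  (forall y, mu.-integrable cell (EFin \o F y)) -> mu.-integrable cell (EFin \o DF) ->
  is_derive x v (fun y => \int[mu]_(t in cell) F y t) (\int[mu]_(t in cell) DF t).
Proof.
move=> FB iF iDF.
have B0 : 0 <= B by have := FB 1 0; rewrite expr1n mulr1; apply: le_trans.
have V0 := cell_pos HL int_L Hmu.
apply/is_deriveP => e e0; exists (e / (B * V + 1)).
  by rewrite divr_gt0// ltr_wpDl// mulr_ge0// ltW.
move=> h hd.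
have ihD := integrableZl mcell h iDF.
have i1 : mu.-integrable cell (EFin \o (fun t => F (x + h *: v) t - F x t)).
  have := integrableB mcell (iF (x + h *: v)) (iF x).
  by apply: eq_integrable => //; exact: mcell.
have i2 : mu.-integrable cell (EFin \o (fun t => F (x + h *: v) t - F x t - h * DF t)).
  have := integrableB mcell i1 ihD.
  by apply: eq_integrable => //; exact: mcell.
have -> : \int[mu]_(t in cell) F (x + h *: v) t - \int[mu]_(t in cell) F x t
    - h * \int[mu]_(t in cell) DF t = \int[mu]_(t in cell) (F (x + h *: v) t - F x t - h * DF t).
  rewrite (RintegralB mcell i1); last exact: ihD.
  by rewrite (RintegralB mcell (iF _) (iF x)) (RintegralZl h mcell iDF).
apply: (le_trans (le_normr_Rintegral mcell i2)).
apply: (@le_trans _ _ (\int[mu]_(t in cell) (B * h ^+ 2))).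
  apply: le_Rintegral; first exact: mcell.
  - have := integrable_norm i2; by apply: eq_integrable => //; exact: mcell.
  - exact: (integrable_cst mcell (cell_fin HL Hmu)).
  - by move=> t _; exact: FB.
rewrite Rintegral_cst; last exact: mcell.
rewrite -(real_normK (num_real h)).
move: hd; rewrite ltr_pdivlMr ?ltr_wpDl ?mulr_ge0 ?(ltW V0)// => hd.
rewrite (_ : _ * V = `|h| * (B * V) * `|h|); last by ring.
rewrite ler_wpM2r//; have := normr_ge0 h; nra.
Qed.

(** Changing one orthonormal coordinate at a time shows that f is Lipschitz. *)
Lemma bounded_partials_continuous (f : E -> R) (df : 'I_n -> E -> R) (B : R) :
  (forall i y, is_derive y (u i) f (df i y)) -> (forall i y, `|df i y| <= B) ->
  continuous f.
Proof.
move=> dfi dfB; have onb := lat_onb HL.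
have key (s : seq 'I_n) (c : 'I_n -> R) x :
    `|f (x + \sum_(i <- s) c i *: u i) - f x| <= \sum_(i <- s) B * `|c i|.
  elim: s x => [|i s IH] x; first by rewrite !big_nil addr0 subrr normr0.
  rewrite !big_cons addrA -(subrKA (f (x + c i *: u i))).
  rewrite (le_trans (ler_normD _ _))// [leRHS]addrC lerD//.
  by apply: (@mvt_line _ _ f (df i) x (u i) B `|c i|) => //.
have lip x y : `|f y - f x| <= (\sum_(i < n) `|B|) * `|y - x|.
  have := key (index_enum 'I_n) (fun i => ip (y - x) (u i)) x.
  have [_ _ uS] := onb; rewrite -(uS (y - x)) (addrC x (y - x)) subrK => h.
  rewrite (le_trans h)// mulr_suml; apply: ler_sum => i _.
  apply: (@le_trans _ _ (`|B| * `|ip (y - x) (u i)|)); first by rewrite ler_wpM2r ?ler_norm.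
  by rewrite ler_wpM2l//; exact: (coord_le_norm onb).
set K := (\sum_(i < n) `|B|) in lip.
have K0 : 0 <= K by apply: sumr_ge0.
move=> x; apply/cvgrPdist_lt => e e0; apply/nbhs_normP; exists (e / (K + 1)) => /=.
  by rewrite divr_gt0// ltr_wpDl.
move=> y /=; rewrite ltr_pdivlMr ?ltr_wpDl// => h.
apply: le_lt_trans (lip y x) _; apply: le_lt_trans h.
by rewrite mulrC ler_wpM2l// lerDl.
Qed.

Section SmoothQuasiPeriodic.
Variable G : E * E -> C.
Hypothesis sG : csmooth G.
Hypothesis qG : quasi_periodic ip L G.

Lemma slice_continuous x : continuous (fun y : E => (x, y) : E * E).
Proof. by move=> y; apply: cvg_pair; [exact: cvg_cst|exact: cvg_id]. Qed.

Lemma continuous_slice (H : E * E -> R) x : continuous H -> continuous (fun y : E => H (x, y)).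
Proof.
move=> cH y; apply: (@continuous_comp _ _ _ _ H _ (@slice_continuous x y)); exact: cH.
Qed.

Lemma slice_measurable x : cmeasurable [set: borel E] (fun t : borel E => G (x, t : E)).
Proof.
have [sR sI] := sG; split.
  exact: (continuous_borel (continuous_slice (smooth_continuous sR))).
exact: (continuous_borel (continuous_slice (smooth_continuous sI))).
Qed.

Lemma slice_integrable x : cintegrable mu cell (fun t => G (x, t)).
Proof.
have [M hM] := quasi_periodic_bounded HL qG sG.
apply: (@cintegrable_bounded _ _ _ _ _ mcell (cell_fin HL Hmu) _ M) => //.
by have [h1 h2] := slice_measurable x; split; [exact: measurable_funTS h1|exact: measurable_funTS h2].
Qed.

Definition mean x : C := cI (fun t => G (x, t)).

Lemma mean_bounded : exists M : R, forall x, normc (mean x) <= M.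
Proof.
have [M hM] := quasi_periodic_bounded HL qG sG; exists (M * V + M * V) => x.
have [iR iI] := slice_integrable x.
have iM := integrable_cst mcell (cell_fin HL Hmu) M.
apply: le_trans (normc_le_ReIm _) _; rewrite /mean Re_cintegral Im_cintegral; apply: lerD.
  apply: (le_trans (le_normr_Rintegral mcell iR)).
  rewrite -Rintegral_cst; last exact: mcell.
  apply: le_Rintegral; first exact: mcell.
  - have := integrable_norm iR; by apply: eq_integrable => //; exact: mcell.
  - exact: iM.
  - by move=> t _; rewrite (le_trans (Re_le_normc _)).
apply: (le_trans (le_normr_Rintegral mcell iI)).
rewrite -Rintegral_cst; last exact: mcell.
apply: le_Rintegral; first exact: mcell.
- have := integrable_norm iI; by apply: eq_integrable => //; exact: mcell.
- exact: iM.
- by move=> t _; rewrite (le_trans (Im_le_normc _)).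
Qed.
End SmoothQuasiPeriodic.

Lemma second_derivative_bounded G (w : E * E) : csmooth G ->
  quasi_periodic ip L (cderive w (cderive w G)) ->
  exists B : R, (forall p, `|'D_w (fun z => 'D_w (Re \o G) z) p| <= B) /\
               (forall p, `|'D_w (fun z => 'D_w (Im \o G) z) p| <= B).
Proof.
move=> sG qG; have [B hB] := quasi_periodic_bounded HL qG (csmooth_derive w (csmooth_derive w sG)).
exists B; split => p; rewrite (le_trans _ (hB p))//; [exact: (Re_le_normc (cderive w (cderive w G) p))|].
exact: (Im_le_normc (cderive w (cderive w G) p)).
Qed.

Lemma mean_is_derive G x v : csmooth G -> quasi_periodic ip L G ->
  is_derive x v (Re \o mean G) (Re (mean (cderive (v, 0) G) x)) /\
  is_derive x v (Im \o mean G) (Im (mean (cderive (v, 0) G) x)).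
Proof.
move=> sG qG; have [sR sI] := sG.
have sD := csmooth_derive (v, 0) sG; have qD := quasi_periodic_derive HL v sG qG.
have qDD := quasi_periodic_derive HL v sD qD.
have [B [BR BI]] := second_derivative_bounded sG qDD.
have pE t h : (x + h *: v, t) = (x, t) + h *: (v, 0) :> E * E.
  by apply/eqP; rewrite xpair_eqE/= scaler0 addr0 !eqxx.
split.
- apply: (integral_is_derive (F := fun y t => Re (G (y, t)))
     (DF := fun t => Re (cderive (v, 0) G (x, t))) (B := B)).
  + by move=> h t; rewrite pE; exact: (taylor_line (x, t) sR BR).
  + by move=> y; have [] := slice_integrable sG qG y.
  + by have [] := slice_integrable sD qD x.
- apply: (integral_is_derive (F := fun y t => Im (G (y, t)))
     (DF := fun t => Im (cderive (v, 0) G (x, t))) (B := B)).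
  + by move=> h t; rewrite pE; exact: (taylor_line (x, t) sI BI).
  + by move=> y; have [] := slice_integrable sG qG y.
  + by have [] := slice_integrable sD qD x.
Qed.
(** On a slice G is periodic in y, so the plain derivative along w integrates to 0 and only the
    correction term of [nabla] remains. Multiplication by (x, w) thus stays among means of
    quasi-periodic functions. *)
Lemma mean_derive2 G (w x : E) : csmooth G -> quasi_periodic ip L G ->
  mean (nabla ip w G) x = (0 -i* arg x w)%C * mean G x.
Proof.
move=> sG qG; have [sR sI] := sG.
have sN := csmooth_nabla HL w sG; have qN := quasi_periodic_nabla HL w sG qG.
have iN := slice_integrable sN qN x; have iG := slice_integrable sG qG x.
have iD : cintegrable mu cell (fun t => cderive (0, w) G (x, t)).
  have := cintegrableD mcell iN (cintegrableZ mcell (0 +i* arg x w)%C iG).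
  apply: (eq_cintegrable mcell) => t _; rewrite /nabla/= -addrA -mulrDl.
  rewrite (_ : (0 -i* arg x w)%C + (0 +i* arg x w)%C = 0) ?mul0r ?addr0//.
  by apply/eqP; rewrite eq_complex/= addr0 addNr !eqxx.
suff D0 : cI (fun t => cderive (0, w) G (x, t)) = 0.
  rewrite /mean; apply: (eq_trans (cintegralD mcell iD (cintegrableZ mcell (0 -i* arg x w)%C iG))).
  rewrite D0 add0r; exact: (cintegralZ mcell _ iG).
have sD := csmooth_derive (0, w) sG; have [sDR sDI] := sD.
have [sDDR sDDI] := csmooth_derive (0, w) sD.
have pG : forall l y, L l -> G (x, y + l) = G (x, y).
  by move=> l y Ll; rewrite -{1}(addr0 x) (qG 0 l x y (lat0 HL) Ll) pairing0l mul1r.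
have pDD (H : E * E -> R) (y l : E) : smooth H ->
    (forall y, H (x, y + l) = H (x, y)) -> 'D_(0, w) H (x, y + l) = 'D_(0, w) H (x, y).
  move=> sH pH.
  apply: is_derive_unique; apply/is_deriveP => e e0.
  have [d d0 hd] := (is_deriveP _ _ _ _).1 (smooth_is_derive (x, y) (0, w) sH) e e0.
  exists d => // h h1; apply: le_trans (hd h h1).
  have -> : (x, y + l) + h *: (0, w) = (x, (y + h *: w) + l) :> E * E.
    by apply/eqP; rewrite xpair_eqE/= scaler0 addr0 addrAC !eqxx.
  have -> : (x, y) + h *: (0, w) = (x, y + h *: w) :> E * E.
    by apply/eqP; rewrite xpair_eqE/= scaler0 addr0 !eqxx.
  by rewrite !pH.
have key (H : E * E -> R) : smooth H -> (forall l y, L l -> H (x, y + l) = H (x, y)) ->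
    mu.-integrable cell (EFin \o (fun t => 'D_(0, w) H (x, t))) ->
    \int[mu]_(t in cell) 'D_(0, w) H (x, t) = 0.
  move=> sH pH iH.
  have sH1 := smooth_derive (0, w) sH; have sH2 := smooth_derive (0, w) sH1.
  have cH2 : continuous (fun t : E => 'D_(0, w) (fun z => 'D_(0, w) H z) (x, t)).
    exact: (@continuous_slice _ x (smooth_continuous sH2)).
  have pH2 : periodic_fun L (fun t : E => 'D_(0, w) (fun z => 'D_(0, w) H z) (x, t)).
    move=> l y Ll; apply: (pDD _ y l sH1) => y'; apply: (pDD _ y' l sH) => y''; exact: pH.
  have [B hB] := periodic_bounded HL cH2 pH2.
  have cH : continuous (fun t : E => H (x, t)).
    exact: (continuous_slice (smooth_continuous sH)).
  have pH' : periodic_fun L (fun t : E => H (x, t)) by move=> l y Ll; exact: pH.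
  have [M hM] := periodic_bounded HL cH pH'.
  have mH := continuous_borel cH.
  (* The integral of the derivative is the derivative at 0 of the integral of a translate, which is
     constant by invariance over [cell]. *)
  have d1 : is_derive (0 : E) w (fun y => \int[mu]_(t in cell) H (x, t + y)) (\int[mu]_(t in cell) 'D_(0, w) H (x, t)).
    apply: (integral_is_derive (F := fun y t => H (x, t + y)) (B := B)) => // [h t|y].
      have -> : (x, t + (0 + h *: w)) = (x, t) + h *: (0, w) :> E * E.
        by apply/eqP; rewrite xpair_eqE/= scaler0 addr0 add0r !eqxx.
      rewrite (addr0 t); apply: (taylor_line_slice sH) => s.
      have -> : (x, t) + s *: (0, w) = (x, t + s *: w) :> E * E.
        by apply/eqP; rewrite xpair_eqE/= scaler0 addr0 !eqxx.
      exact: hB.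
    apply: (cell_integrable HL Hmu (M := M)) => //.
    exact: (measurable_comp_shift y mH).
  have d2 : (fun y : E => \int[mu]_(t in cell) H (x, t + y)) = fun=> \int[mu]_(t in cell) H (x, t).
    by apply/funext => y; rewrite /Rintegral (integral_cell_shift HL int_L Hmu y mH pH').
  rewrite d2 in d1; rewrite -(is_derive_unique d1).
  exact: (is_derive_unique (is_derive_cst _ _ _)).
have [iDR iDI] := iD.
apply: complex_eqP; rewrite ?Re_cintegral ?Im_cintegral; apply: key => // l y Ll /=; by rewrite pG.
Qed.

Lemma mean_continuous G : csmooth G -> quasi_periodic ip L G ->
  continuous (Re \o mean G) /\ continuous (Im \o mean G).
Proof.
move=> sG qG.
have [B hB] : exists B : 'I_n -> R, forall i x, normc (mean (cderive (u i, 0) G) x) <= B i.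
  have h i : exists B : R, forall x, normc (mean (cderive (u i, 0) G) x) <= B.
    exact: (mean_bounded (csmooth_derive _ sG) (quasi_periodic_derive HL _ sG qG)).
  exists (fun i => projT1 (cid (h i))) => i; exact: (projT2 (cid (h i))).
have hB' i x : normc (mean (cderive (u i, 0) G) x) <= \sum_j `|B j|.
  rewrite (le_trans (hB i x))// (le_trans (ler_norm _))// (bigD1 i)//= lerDl.
  exact: sumr_ge0.
split.
- apply: (bounded_partials_continuous (df := fun i x => Re (mean (cderive (u i, 0) G) x)) (B := \sum_j `|B j|)) => i y.
    exact: (mean_is_derive y (u i) sG qG).1.
  exact: le_trans (Re_le_normc _) (hB' i y).
- apply: (bounded_partials_continuous (df := fun i x => Im (mean (cderive (u i, 0) G) x)) (B := \sum_j `|B j|)) => i y.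
    exact: (mean_is_derive y (u i) sG qG).2.
  exact: le_trans (Im_le_normc _) (hB' i y).
Qed.

Lemma mean_iterD G vs : csmooth G -> quasi_periodic ip L G ->
  exists G', [/\ csmooth G', quasi_periodic ip L G', iterD vs (Re \o mean G) = Re \o mean G'
    & iterD vs (Im \o mean G) = Im \o mean G'].
Proof.
move=> sG qG; elim: vs => [|v vs [G' [sG' qG' eR eI]]]; first by exists G.
exists (cderive (v, 0) G'); split; first exact: csmooth_derive.
- exact: (quasi_periodic_derive HL v sG' qG').
- rewrite /= eR; apply/funext => x; have [h _] := mean_is_derive x v sG' qG'.
  exact: (is_derive_unique h).
- rewrite /= eI; apply/funext => x; have [_ h] := mean_is_derive x v sG' qG'.
  exact: (is_derive_unique h).
Qed.

Lemma mean_csmooth G : csmooth G -> quasi_periodic ip L G -> csmooth (mean G).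
Proof.
move=> sG qG; split=> vs; have [G' [sG' qG' eR eI]] := mean_iterD vs sG qG.
- rewrite eR; split=> [|x v]; first by have [] := mean_continuous sG' qG'.
  by have [[]] := mean_is_derive x v sG' qG'.
- rewrite eI; split=> [|x v]; first by have [] := mean_continuous sG' qG'.
  by have [_ []] := mean_is_derive x v sG' qG'.
Qed.

(** Induction on k for all G at once: |x| is at most the sum of its coordinates in absolute value,
    and each coordinate is traded for a [nabla]. The factor 2 pi so gained is at least 1 and is
    dropped. *)
Lemma mean_decay (k : nat) G : csmooth G -> quasi_periodic ip L G ->
  exists M : R, forall x, `|x| ^+ k * normc (mean G x) <= M.
Proof.
elim: k G => [|k IH] G sG qG.
  have [M hM] := mean_bounded sG qG; exists M => x; by rewrite expr0 mul1r.
have [B hB] : exists B : 'I_n -> R, forall i x, `|x| ^+ k * normc (mean (nabla ip (u i) G) x) <= B i.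
  have h i := IH _ (csmooth_nabla HL (u i) sG) (quasi_periodic_nabla HL (u i) sG qG).
  exists (fun i => projT1 (cid (h i))) => i; exact: (projT2 (cid (h i))).
exists (\sum_i B i) => x.
apply: (@le_trans _ _ (\sum_i `|ip x (u i)| * (`|x| ^+ k * normc (mean G x)))).
  rewrite -mulr_suml exprS -mulrA ler_wpM2r ?mulr_ge0 ?exprn_ge0 ?normc_ge0//.
  exact: (norm_le_coords (lat_onb HL)).
apply: ler_sum => i _; apply: le_trans (hB i x).
rewrite (mean_derive2 (u i) x sG qG) normcM mulrCA ler_wpM2l ?exprn_ge0//.
rewrite ler_wpM2r ?normc_ge0//.
apply: le_trans (Im_le_normc _); rewrite /= normrN normrM ler_peMl//.
have := @pi_ge2 R; have := pi_gt0 R => p0 p2; rewrite ger0_norm; lra.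
Qed.

Lemma mean_schwartz G : csmooth G -> quasi_periodic ip L G -> schwartz (mean G).
Proof.
move=> sG qG; split; first exact: mean_csmooth.
- move=> k vs; have [G' [sG' qG' eR eI]] := mean_iterD vs sG qG.
  have [M hM] := mean_decay k sG' qG'; exists M => x; rewrite eR.
  by apply: le_trans (hM x); rewrite ler_wpM2l ?exprn_ge0//; exact: Re_le_normc.
- move=> k vs; have [G' [sG' qG' eR eI]] := mean_iterD vs sG qG.
  have [M hM] := mean_decay k sG' qG'; exists M => x; rewrite eI.
  by apply: le_trans (hM x); rewrite ler_wpM2l ?exprn_ge0//; exact: Im_le_normc.
Qed.
End CoefficientIntegrals.

(** * The two inversion formulas *)

Section ZakInverse.
Variables (R : realType) (E : normedModType R) (ip : {dot E for idfun}).
Variables (n : nat) (u b bd : 'I_n -> E) (L : set E).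
Hypothesis HL : lattice_basis ip u b bd L.
Hypothesis int_L : integral_lattice ip L.
Variable mu : {sigma_finite_measure set (borel E) -> \bar R}.
Hypothesis Hmu : invariant_measure mu.
Hypothesis mu_vol : forall A, mu A = vol u A.
Local Notation C := R[i].
Local Notation dL := (Pilot.Defs.dual ip L).
Local Notation pr := (pairing ip).
Local Notation Zt := (discriminant ip L).
Local Notation disc := (disc_seq ip L).
Local Notation iso := (inv_sqrt_order ip L).
Local Notation cell := (cell ip bd : set (borel E)).
Local Notation mcell := (measurable_cell HL).
Local Notation V := (fine (mu cell)).
Local Notation cI := (cintegral mu cell).
Local Notation mean := (mean ip bd mu).
Variables r r' : Zt -> E.
Hypothesis rP : representatives r.
Hypothesis rP' : representatives r'.
Variable F : set E.
Hypothesis tF : tiles L mu F.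

Definition untwist (s : E * E -> C) (p : E * E) : C := pr (2^-1 *: p.1) p.2 * s p.

(** Shifting the function instead of the slice presents the coefficient, as a function of x, as the
    mean of a quasi-periodic function. The y-th coefficient of the slice at x is then the value at x
    + y. *)
Definition fourier_coef (s : E * E -> C) (y x : E) : C :=
  (V^-1)%:C%C * mean (fun p => pr y p.2 * untwist s (p.1 - y, p.2)) x.

(** Since (t + h)/2 = h + (t - h)/2, the kernel of the inverse formula is the character at h times
    the factor that untwists s at t - h. *)
Lemma zak_inv_integrandE s h t t' :
  zak_inv_integrand r' s h t t' = pr (r' h) t' * untwist s (t - r' h, t').
Proof.
rewrite /zak_inv_integrand /untwist/= -pairing_scale mulrA mulrC; congr (_ * _).
rewrite -pairingDl; congr pairing; rewrite scalerBr scalerDr addrCA; congr (_ + _).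
rewrite -{2}(scale1r (r' h)) -scalerBl; congr (_ *: _); lra.
Qed.

Lemma measure_tiles : mu F = mu cell.
Proof.
have [mF _] := tF.
have := ge0_integral_tiles HL int_L Hmu tF (g := fun=> 1%E) (measurable_cst _) (fun=> lee01) (fun _ _ _ => erefl).
rewrite !integral_cst ?mul1e//; exact: mcell.
Qed.

Lemma covolume_cell : covolume u F = V.
Proof. by rewrite /covolume -mu_vol measure_tiles. Qed.

Lemma cintegral_tiles (g : E -> C) : cmeasurable [set: borel E] (g : borel E -> C) ->
  periodic_fun L g -> cintegral mu F g = cI g.
Proof.
move=> [gR gI] pg; rewrite /cintegral.
rewrite (integral_tiles HL int_L Hmu tF gR); last by move=> l x Ll /=; rewrite pg.
by rewrite (integral_tiles HL int_L Hmu tF gI)// => l x Ll /=; rewrite pg.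
Qed.

Lemma cintegral_vol D g : cintegral (vol u) D g = cintegral mu D g.
Proof. by rewrite (_ : vol u = mu :> (set _ -> _))//; apply/funext => A; rewrite mu_vol. Qed.

Lemma cintegrable_vol D g : cintegrable (vol u) D g <-> cintegrable mu D g.
Proof. by rewrite (_ : vol u = mu :> (set _ -> _))//; apply/funext => A; rewrite mu_vol. Qed.

Section Quasi.
Variable s : E * E -> C.
Hypothesis qs : is_section ip L s.

Lemma untwist_quasi_periodic : quasi_periodic ip L (untwist s).
Proof. exact/(section_quasi_periodic int_L). Qed.

Lemma untwistK p : s p = pr (- (2^-1 *: p.1)) p.2 * untwist s p.
Proof. by rewrite /untwist mulrA pairingNM mul1r. Qed.

Lemma integrand_periodic y x : dL y -> periodic_fun L (fun t => pr y t * untwist s (x - y, t)).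
Proof. by move=> dy; exact: (quasi_periodic_slice HL _ untwist_quasi_periodic dy). Qed.

Lemma fourier_coef_per l l' x : dL l -> L l' ->
  fourier_coef s (l + l') x = fourier_coef s l x.
Proof.
move=> dl Ll'; congr (_ * _); apply: eq_cintegral => t _ /=.
have := untwist_quasi_periodic (x - l) t (latN HL Ll') (lat0 HL).
rewrite addr0 -addrA -opprD => ->.
by rewrite pairingDl mulrA -(mulrA (pr l t)) pairingMN mulr1.
Qed.

Hypothesis ms : forall x, cmeasurable [set: borel E] (fun t : borel E => untwist s (x, t : E)).

Lemma integrand_measurable y x :
  cmeasurable [set: borel E] (fun t : borel E => pr y t * untwist s (x - y, t : E)).
Proof. by apply: cmeasurableM; [exact: (pairing_measurable HL)|exact: ms]. Qed.

Lemma zak_invE g t : zak_inv u r' F s g t =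
  iso * \sum_(h <- disc) pr (r' g) (r' h) * fourier_coef s (r' h) t.
Proof.
rewrite /zak_inv (fsum_disc HL int_L); congr (_ * _); apply: eq_bigr => h _.
congr (_ * _); rewrite covolume_cell /fourier_coef; congr (_ * _).
rewrite cintegral_vol (_ : zak_inv_integrand r' s h t = fun t' => pr (r' h) t' * untwist s (t - r' h, t')); last first.
  by apply/funext => t'; exact: zak_inv_integrandE.
apply: cintegral_tiles; first exact: integrand_measurable.
exact: (integrand_periodic _ (rep_dual HL int_L rP' h)).
Qed.

Lemma zak_coef_zak_inv l x : dL l -> zak_coef r (zak_inv u r' F s) l x = fourier_coef s l x.
Proof.
move=> dl; rewrite -(zak_coef_of_inverse HL int_L rP rP' (Phi := fourier_coef s))//.
  by congr (_ * _); apply: eq_bigr => g _; rewrite zak_invE.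
exact: fourier_coef_per.
Qed.

Lemma fourier_coef_slice l x : fourier_coef s l (x + l) =
  (V^-1)%:C%C * cI (fun t => pr l t * untwist s (x, t)).
Proof. by rewrite /fourier_coef /mean/= addrK. Qed.
End Quasi.

Lemma zak_coef_weight f x : schwartz_family f -> exists2 A : R, 0 <= A &
  forall y, normc (zak_coef r f y (x + y)) <= A * weight ip b y.
Proof.
move=> sf; have [A hA] : exists A : Zt -> R, forall g, 0 <= A g /\
    forall y, normc (f g (x + y)) <= A g * weight ip b y.
  have h g : exists A : R, 0 <= A /\ forall y, normc (f g (x + y)) <= A * weight ip b y.
    by have [A A0 hA] := schwartz_weight HL `|x| (sf g); exists A; split => // y; exact: hA.
  exists (fun g => projT1 (cid (h g))) => g; exact: (projT2 (cid (h g))).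
have w0 y := weight_ge0 ip b y.
exists (normc iso * \sum_(g <- disc) A g).
  by rewrite mulr_ge0 ?normc_ge0// sumr_ge0// => g _; have [] := hA g.
move=> y; rewrite /zak_coef normcM -mulrA ler_wpM2l ?normc_ge0//.
rewrite (le_trans (normc_sum _ _ _))// mulr_suml; apply: ler_sum => g _.
by rewrite normcM normc_pairing mul1r; have [_] := hA g; exact.
Qed.

Lemma zak_slice_coef f x l : schwartz_family f -> dL l ->
  cI (fun t => pr l t * untwist (zak r f) (x, t)) = V%:C%C * zak_coef r f l (x + l).
Proof.
move=> sf dl; have [A A0 hA] := zak_coef_weight x sf.
rewrite -(fourier_series_coef HL int_L Hmu (fun y _ => hA y) (summableZ A (summable_weight HL)) dl).
apply: eq_cintegral => t _; congr (_ * _).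
rewrite /untwist (zakE HL int_L (p := (x, t)) (fun g => schwartz_csummable HL r g x t sf)).1.
by rewrite mulrA pairingMN mul1r.
Qed.

Section Smooth.
Variable s : E * E -> C.
Hypothesis ss : smooth_section ip L s.

Lemma untwist_csmooth : csmooth (untwist s).
Proof. exact: (csmoothM (csmooth_pairing HL _) ss.2). Qed.

Lemma untwist_slice_measurable x :
  cmeasurable [set: borel E] (fun t : borel E => untwist s (x, t : E)).
Proof. exact: (slice_measurable untwist_csmooth). Qed.

Lemma zak_inv_cintegrable h t :
  cintegrable (vol u) (F : set (borel E)) (zak_inv_integrand r' s h t).
Proof.
have [qs _] := ss; have qu := untwist_quasi_periodic qs; have [mF _] := tF.
apply/cintegrable_vol.
have [M hM] := quasi_periodic_bounded HL qu untwist_csmooth.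
rewrite (_ : zak_inv_integrand r' s h t = fun t' => pr (r' h) t' * untwist s (t - r' h, t')); last first.
  by apply/funext => t'; exact: zak_inv_integrandE.
apply: (@cintegrable_bounded _ _ _ _ _ mF _ _ M).
- by have := cell_fin HL Hmu; rewrite -measure_tiles.
- have [h1 h2] := integrand_measurable untwist_slice_measurable (r' h) t.
  by split; [exact: measurable_funTS h1|exact: measurable_funTS h2].
- by move=> t' _; rewrite normcM normc_pairing mul1r.
Qed.

Lemma zak_inv_schwartz : schwartz_family (zak_inv u r' F s).
Proof.
move=> g; have [qs _] := ss; have qu := untwist_quasi_periodic qs.
pose G h p := pr (r' h) p.2 * untwist s (p.1 - r' h, p.2).
have qG h : quasi_periodic ip L (G h) by exact: (quasi_periodic_shift (rep_dual HL int_L rP' h) qu).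
have sG h : csmooth (G h) by exact: (csmooth_shift HL _ untwist_csmooth).
pose c h := iso * pr (r' g) (r' h) * (V^-1)%:C%C.
(* The whole finite sum is the mean of one smooth quasi-periodic function, so it is a Schwartz
   function without any closure lemma for sums. *)
have -> : zak_inv u r' F s g = mean (fun p => \sum_(h <- disc) c h * G h p).
  apply/funext => t; rewrite (zak_invE qs untwist_slice_measurable).
  have iG h : cintegrable mu cell (fun t' => c h * G h (t, t')).
    by apply: (cintegrableZ mcell); exact: (slice_integrable HL Hmu (sG h) (qG h)).
  apply: esym; apply: (eq_trans (cintegral_sum mcell disc iG)); apply: esym.
  rewrite mulr_sumr; apply: eq_bigr => h _.
  rewrite (cintegralZ mcell _ (slice_integrable HL Hmu (sG h) (qG h) t)).
  by rewrite /fourier_coef /c !mulrA.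
apply: (mean_schwartz HL int_L Hmu).
  by apply: csmooth_sum => h; apply: csmoothM => //; exact: csmooth_cst.
by apply: quasi_periodic_sum => h; exact: qG.
Qed.

(** On every slice both sections, once untwisted, are continuous periodic functions with the same
    Fourier coefficients, so they agree at every point. *)
Lemma zakK : zak r (zak_inv u r' F s) = s.
Proof.
have [qs _] := ss; have qu := untwist_quasi_periodic qs.
have sf := zak_inv_schwartz.
have sZ := zak_smooth_section HL int_L rP sf.
have [qZ _] := sZ.
apply/funext => -[x y].
rewrite (untwistK s) (untwistK (zak r (zak_inv u r' F s))); congr (_ * _).
pose D t := untwist (zak r (zak_inv u r' F s)) (x, t) - untwist s (x, t).
suff : D y = 0 by move/eqP; rewrite subr_eq0 => /eqP.
have qz := untwist_quasi_periodic qZ.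
have sdiff : csmooth (fun p => untwist (zak r (zak_inv u r' F s)) p + (-1) * untwist s p).
  apply: csmoothD; last by apply: csmoothM; [exact: csmooth_cst|exact: untwist_csmooth].
  by apply: csmoothM; [exact: (csmooth_pairing HL)|exact: sZ.2].
have DE : D = fun t => untwist (zak r (zak_inv u r' F s)) (x, t) + (-1) * untwist s (x, t).
  by apply/funext => t; rewrite mulN1r.
have slice_per G : quasi_periodic ip L G -> periodic_fun L (fun t => G (x, t)).
  by move=> qG l t Ll; rewrite -{1}(addr0 x) (qG 0 l x t (lat0 HL) Ll) pairing0l mul1r.
have iz := slice_integrable HL Hmu sdiff.
apply: (complex_fourier_unique HL int_L Hmu (H := D)).
- by rewrite DE; exact: (continuous_slice (smooth_continuous sdiff.1)).
- by rewrite DE; exact: (continuous_slice (smooth_continuous sdiff.2)).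
- by move=> l t Ll; rewrite /D (slice_per _ qz l t Ll) (slice_per _ qu l t Ll).
- move=> l dl.
  have mul_int (G : E * E -> C) : csmooth G -> quasi_periodic ip L G ->
      cintegrable mu cell (fun t => pr l t * G (x, t)).
    move=> sG qG.
    have := slice_integrable HL Hmu (csmooth_shift HL l sG) (quasi_periodic_shift dl qG) (x + l).
    by apply: (eq_cintegrable mcell) => t _ /=; rewrite addrK.
  have sU : csmooth (untwist (zak r (zak_inv u r' F s))).
    by apply: csmoothM; [exact: (csmooth_pairing HL)|exact: sZ.2].
  have i1 := mul_int _ sU qz; have i2 := mul_int _ untwist_csmooth qu.
  have -> : cI (fun t => pr l t * D t) = cI (fun t => pr l t * untwist (zak r (zak_inv u r' F s)) (x, t) + (-1) * (pr l t * untwist s (x, t))).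
    by apply: eq_cintegral => t _; rewrite /D; ring.
  rewrite (cintegralD mcell i1 (cintegrableZ mcell (-1) i2)) (cintegralZ mcell (-1) i2).
  have -> : cI (fun t => pr l t * untwist (zak r (zak_inv u r' F s)) (x, t)) = V%:C%C * fourier_coef s l (x + l).
    by rewrite -(zak_coef_zak_inv qs untwist_slice_measurable)// zak_slice_coef.
  rewrite fourier_coef_slice mulrA -rmorphM/= divff ?gt_eqF ?(cell_pos HL int_L Hmu)//.
  by rewrite mul1r mulN1r subrr.
Qed.
End Smooth.

Lemma zak_invK f : schwartz_family f -> zak_inv u r' F (zak r f) = f.
Proof.
move=> sf; have sZ := zak_smooth_section HL int_L rP sf; have [qZ _] := sZ.
apply/funext => g; apply/funext => t.
rewrite (zak_invE qZ (untwist_slice_measurable sZ)) -[RHS](zak_coef_inverse HL int_L rP rP').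
congr (_ * _); apply: eq_bigr => h _; congr (_ * _).
have dh := rep_dual HL int_L rP' h.
(* Each class h uses its own slice, the one at t - r' h, whose coefficient at r' h is taken at t. *)
rewrite -{1}(subrK (r' h) t) fourier_coef_slice.
rewrite (zak_slice_coef _ sf dh) mulrA -rmorphM/= mulVf ?gt_eqF ?(cell_pos HL int_L Hmu)//.
by rewrite mul1r subrK.
Qed.
End ZakInverse.

(** * The extension to L^2 *)

Section Bessel.
Variables (R : realType) (E : normedModType R) (ip : {dot E for idfun}).
Variables (n : nat) (u b bd : 'I_n -> E) (L : set E).
Hypothesis HL : lattice_basis ip u b bd L.
Hypothesis int_L : integral_lattice ip L.
Variable mu : {sigma_finite_measure set (borel E) -> \bar R}.
Hypothesis Hmu : invariant_measure mu.
Local Notation C := R[i].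
Local Notation Re := (@complex.Re R).
Local Notation dL := (Pilot.Defs.dual ip L).
Local Notation pr := (pairing ip).
Local Notation Zt := (discriminant ip L).
Local Notation disc := (disc_seq ip L).
Local Notation cell := (cell ip bd : set (borel E)).
Local Notation mcell := (measurable_cell HL).
Local Notation V := (fine (mu cell)).
Local Notation cI := (cintegral mu cell).

Lemma finite_parseval (A : {fset E}) (c : E -> C) : [set` A] `<=` dL ->
  mu.-integrable cell (EFin \o (fun t => sqmod (\sum_(l <- A) c l * pr (- l) t))) /\
  \int[mu]_(t in cell) sqmod (\sum_(l <- A) c l * pr (- l) t) = V * \sum_(l <- A) sqmod (c l).
Proof.
move=> AdL; have term l m : cintegrable mu cell (fun t => (c l * conjc (c m)) * pr (m - l) t).
  by apply: (cintegrableZ mcell); exact: (pairing_integrable HL Hmu).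
have sqE t : (sqmod (\sum_(l <- A) c l * pr (- l) t))%:C%C =
    \sum_(l <- A) \sum_(m <- A) (c l * conjc (c m)) * pr (m - l) t.
  rewrite -mulcJ rmorph_sum/= mulr_suml; apply: eq_bigr => l _.
  rewrite mulr_sumr; apply: eq_bigr => m _.
  have conjM (z w : C) : conjc (z * w) = conjc z * conjc w by exact: rmorphM.
  by rewrite conjM pairingJ opprK pairingDl; ring.
have isum l : cintegrable mu cell (fun t => \sum_(m <- A) (c l * conjc (c m)) * pr (m - l) t).
  exact: (cintegrable_sum mcell _ (term l)).
have itot := cintegrable_sum mcell A isum.
have [iR _] := itot; split.
  move: iR; apply: eq_integrable => //; first exact: mcell.
  by move=> t _; rewrite /= -sqE.
transitivity (Re (cI (fun t => \sum_(l <- A) \sum_(m <- A) (c l * conjc (c m)) * pr (m - l) t))).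
  by rewrite Re_cintegral; apply: eq_Rintegral => t _; rewrite -sqE.
rewrite (cintegral_sum mcell A isum) Re_sum mulr_sumr big_seq [RHS]big_seq.
apply: eq_bigr => l lA; rewrite (cintegral_sum mcell A (term l)).
rewrite (big_fsetD1 l)//= big_seq big1 ?addr0; last first.
  move=> m; rewrite !inE => /andP[ml mA].
  rewrite (cintegralZ mcell _ (pairing_integrable HL Hmu _)).
  rewrite (character_integral HL int_L Hmu); last by apply: (dualB HL); exact: AdL.
  by rewrite subr_eq0 (negbTE ml) mulr0.
rewrite (cintegralZ mcell _ (pairing_integrable HL Hmu _)).
rewrite (character_integral HL int_L Hmu); last by apply: (dualB HL); exact: AdL.
by rewrite subrr eqxx mulcJ -rmorphM/= mulrC.
Qed.

(** The integral of |H - S|^2 is nonnegative, where S is the Fourier sum over A; the cross term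
    contributes -2 and the square of S contributes +1 times V times the sum of the |c l|^2. *)
Lemma bessel (H : E -> C) (A : {fset E}) : cmeasurable cell (H : borel E -> C) ->
  (\int[mu]_(t in cell) (sqmod (H t))%:E < +oo)%E -> [set` A] `<=` dL ->
  \sum_(l <- A) sqmod ((V^-1)%:C%C * cI (fun t => pr l t * H t)) <=
  V^-1 * \int[mu]_(t in cell) sqmod (H t).
Proof.
move=> mH H2 AdL; have iH := cintegrable_L2 mcell (cell_fin HL Hmu) mH H2.
have V0 := cell_pos HL int_L Hmu.
have [c cE] : exists c, c = (fun l => (V^-1)%:C%C * cI (fun t => pr l t * H t)) by eexists.
suff : \sum_(l <- A) sqmod (c l) <= V^-1 * \int[mu]_(t in cell) sqmod (H t) by rewrite cE.
pose S t := \sum_(l <- A) c l * pr (- l) t.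
have [iS SE] := finite_parseval c AdL.
have mp y : cmeasurable cell (fun t : borel E => pr y t).
  have [h1 h2] := pairing_measurable HL y.
  by split; [exact: measurable_funTS h1|exact: measurable_funTS h2].
have ipH l : cintegrable mu cell (fun t => pr l t * H t).
  apply: (cintegrable_L2 mcell (cell_fin HL Hmu)); first exact: cmeasurableM.
  by under eq_integral do rewrite sqmodM sqmod_pairing mul1r.
have HS t : H t * conjc (S t) = \sum_(l <- A) conjc (c l) * (pr l t * H t).
  rewrite /S rmorph_sum/= mulr_sumr; apply: eq_bigr => l _.
  have conjM (z w : C) : conjc (z * w) = conjc z * conjc w by exact: rmorphM.
  by rewrite conjM pairingJ opprK; ring.
have iterm l : cintegrable mu cell (fun t => conjc (c l) * (pr l t * H t)).
  exact: (cintegrableZ mcell).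
have iHS : cintegrable mu cell (fun t => H t * conjc (S t)).
  by apply: (eq_cintegrable mcell) (cintegrable_sum mcell A iterm) => t _; rewrite HS.
have cIHS : Re (cI (fun t => H t * conjc (S t))) = V * \sum_(l <- A) sqmod (c l).
  rewrite (eq_cintegral mu (fun t _ => HS t)) (cintegral_sum mcell A iterm) Re_sum mulr_sumr.
  apply: eq_bigr => l _; rewrite (cintegralZ mcell _ (ipH l)).
  have -> : cI (fun t => pr l t * H t) = V%:C%C * c l.
    by rewrite cE mulrA -rmorphM/= divff ?gt_eqF// mul1r.
  by rewrite mulrCA ReZ (mulrC (conjc _)) mulcJ.
have iH2 : mu.-integrable cell (EFin \o (fun t => sqmod (H t))).
  apply/integrableP; split; first exact/measurable_EFinP/measurable_sqmod.
  by under eq_integral do rewrite /= ger0_norm ?sqmod_ge0//.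
have iRe : mu.-integrable cell (EFin \o (fun t => Re (H t * conjc (S t)))) by case: iHS.
have pol t : sqmod (H t - S t) = sqmod (H t) + (-2) * Re (H t * conjc (S t)) + sqmod (S t).
  by rewrite /sqmod ReM ReJ ImJ ReD ImD ReN ImN; ring.
have i2 := (integrable_lin mcell 1 (-2) iH2 iRe).1.
have i3 := (integrable_lin mcell 1 1 i2 iS).2.
have : 0 <= \int[mu]_(t in cell) sqmod (H t - S t).
  by apply: Rintegral_ge0 => t _; exact: sqmod_ge0.
have -> : \int[mu]_(t in cell) sqmod (H t - S t) =
    \int[mu]_(t in cell) (1 * (1 * sqmod (H t) + (-2) * Re (H t * conjc (S t))) + 1 * sqmod (S t)).
  by apply: eq_Rintegral => t _; rewrite pol !mul1r.
rewrite i3 (integrable_lin mcell 1 (-2) iH2 iRe).2 SE.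
rewrite -[\int[mu]_(t in cell) Re _]/(Re (cI (fun t => H t * conjc (S t)))) cIHS => h.
by rewrite ler_pdivlMl//; lra.
Qed.

Lemma esum_bessel (H : E -> C) : cmeasurable cell (H : borel E -> C) ->
  (esum dL (fun l => (sqmod ((V^-1)%:C%C * cI (fun t => pr l t * H t)))%:E) <=
   (V^-1)%:E * \int[mu]_(t in cell) (sqmod (H t))%:E)%E.
Proof.
move=> mH; have V0 := cell_pos HL int_L Hmu.
have i0 : (0 <= \int[mu]_(t in cell) (sqmod (H t))%:E)%E.
  by apply: integral_ge0 => t _; rewrite lee_fin sqmod_ge0.
have [H2|] := ltP (\int[mu]_(t in cell) (sqmod (H t))%:E)%E +oo%E; last first.
  by rewrite leye_eq => /eqP ->; rewrite gt0_muley ?leey// lte_fin invr_gt0.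
have fin : (\int[mu]_(t in cell) (sqmod (H t))%:E)%E \is a fin_num by rewrite ge0_fin_numE.
apply: ge_ereal_sup => _ [A [finA AS] <-].
rewrite fsbig_finite//= sumEFin -(fineK fin) -EFinM lee_fin.
by apply: bessel => // l /=; rewrite in_fset_set// inE; exact: AS.
Qed.

Variable r : Zt -> E.
Hypothesis rP : representatives r.

Lemma esum_dual_split (phi : E -> \bar R) : (forall l, 0 <= phi l)%E ->
  esum dL phi = (\sum_(h <- disc) esum L (fun l => phi (r h + l)%R))%E.
Proof.
move=> phi0; pose S h := [set l | L (l - r h)].
have -> : esum dL phi = esum dL (fun l => (\sum_(h <- disc) if l \in S h then phi l else 0)%E).
  apply: eq_esum => l dl; have [g Lg] := rep_ex HL rP dl.
  rewrite (bigD1_seq g)//=; [|exact: mem_disc HL int_L _|exact: uniq_disc].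
  rewrite mem_set// big1 ?adde0// => h hg; rewrite memNset// => Lh.
  move/eqP: hg; apply; apply: (rep_inj HL rP).
  have -> : r h - r g = (l - r g) - (l - r h) by rewrite opprB [RHS]addrC addrA subrK.
  exact: (latB HL Lg Lh).
rewrite esum_sum => [|l h _ _]; last by case: ifP.
apply: eq_bigr => h _; rewrite -esum_mkcondr.
rewrite (reindex_esum L _ (fun l => r h + l))//; split.
- move=> l Ll; split; last by rewrite /S/= (addrC (r h) l) addrK.
  by apply: (dualD HL); [exact: (rep_dual HL int_L rP)|exact: int_L].
- by move=> l m _ _ /addrI.
- by move=> l [dl Sl]; exists (l - r h) => //; rewrite addrC subrK.
Qed.

(** The dual lattice is the disjoint union of the classes r h + L. For each class the sum over L
    unfolds the cell to E, and invariance absorbs the shift by r h. *)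
Lemma dual_unfold (a : E -> E -> \bar R) :
  (forall l, measurable_fun [set: borel E] (a l : borel E -> \bar R)) ->
  (forall l x, 0 <= a l x)%E ->
  (forall l l' x, dL l -> L l' -> a (l + l') x = a l x) ->
  (\int[mu]_(x in cell) esum dL (fun l => a l (x + l)%R) =
   \sum_(h <- disc) \int[mu]_x a (r h) x)%E.
Proof.
move=> ma a0 pa.
have mash h l : measurable_fun [set: borel E] (fun x : borel E => a (r h) ((x + l)%R + r h)%R).
  have := measurable_comp_shift l (measurable_comp_shift (r h) (ma (r h))).
  by [].
rewrite (eq_integral (fun x : borel E => (\sum_(h <- disc) esum L (fun l => a (r h) (((x : E) + l) + r h)%R))%E)); last first.
  move=> x _; rewrite esum_dual_split//; apply: eq_bigr => h _; apply: eq_esum => l Ll.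
  by rewrite (pa _ _ _ (rep_dual HL int_L rP h) Ll) (addrC (r h) l) addrA.
rewrite ge0_integral_sum//.
- apply: eq_bigr => h _.
  rewrite -(integral_unfold_sum HL int_L Hmu (h := fun x => a (r h) (x + r h)%R))//.
    exact: (ge0_integral_shift Hmu).
  exact: (measurable_comp_shift (r h) (ma (r h))).
- exact: mcell.
- move=> h; apply: measurable_funTS.
  by apply: (measurable_esum (lat_exhaustion HL int_L)) => //.
- by move=> h x _; apply: esum_ge0.
Qed.
End Bessel.

Section FiniteSupport.
Variables (R : realType) (I : choiceType).
Local Notation C := R[i].
Variables (S : set I) (A : {fset I}).
Hypothesis AS : [set` A] `<=` S.

Lemma rsum_fsupport (F : I -> R) : (forall i, S i -> i \notin A -> F i = 0) ->
  rsum S F = \sum_(i <- A) F i.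
Proof.
move=> FA; rewrite /rsum.
rewrite (esum_fsupport (A := A) AS (F := (EFin \o F)^\+%E)); last 2 first.
- by move=> i _; exact: funepos_ge0.
- by move=> i Si iA; rewrite funeposE /= FA// maxxx.
rewrite (esum_fsupport (A := A) AS (F := (EFin \o F)^\-%E)); last 2 first.
- by move=> i _; exact: funeneg_ge0.
- by move=> i Si iA; rewrite funenegE /= FA// oppr0 maxxx.
have pE i : (EFin \o F)^\+%E i = (Num.max (F i) 0)%:E by rewrite funeposE EFin_max.
have nE i : (EFin \o F)^\-%E i = (Num.max (- F i) 0)%:E by rewrite funenegE EFin_max.
rewrite (eq_bigr _ (fun i _ => pE i)) (eq_bigr _ (fun i _ => nE i)) !sumEFin /= -sumrB.
by apply: eq_bigr => i _; rewrite !maxEle oppr_le0; case: ltgtP => ?; lra.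
Qed.

Lemma csum_fsupport (F : I -> C) : (forall i, S i -> i \notin A -> F i = 0) ->
  csum S F = \sum_(i <- A) F i.
Proof.
move=> FA; apply: complex_eqP; rewrite ?Re_sum ?Im_sum /=; apply: rsum_fsupport => i Si iA;
  by rewrite /= FA.
Qed.

Lemma csummable_fsupport (F : I -> C) : (forall i, S i -> i \notin A -> F i = 0) ->
  csummable S F.
Proof.
move=> FA; apply: (@csummable_le _ _ _ _ (fun i => normc (F i))) => //.
rewrite /summable; under eq_esum do rewrite /= ger0_norm ?normc_ge0//.
rewrite (esum_fsupport (A := A) AS) ?sumEFin ?ltry//.
- by move=> i _; rewrite lee_fin normc_ge0.
- by move=> i Si iA; rewrite FA// normc0.
Qed.
End FiniteSupport.

Section Limits.
Context d (T : measurableType d) (R : realType).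

Lemma cmeasurable_ccvg (D : set T) (F : nat -> T -> R[i]) (G : T -> R[i]) :
  (forall k, cmeasurable D (F k)) -> (forall x, D x -> ccvg (F ^~ x) (G x)) -> measurable D ->
  cmeasurable D G.
Proof.
move=> mF FG mD; split.
- apply: (measurable_fun_cvg (h := fun k x => complex.Re (F k x))) => [k|x Dx].
    by have [] := mF k.
  by have [] := FG x Dx.
- apply: (measurable_fun_cvg (h := fun k x => complex.Im (F k x))) => [k|x Dx].
    by have [] := mF k.
  by have [] := FG x Dx.
Qed.
End Limits.

(** * The isometry for families of bounded support *)

Section BoundedSupport.
Variables (R : realType) (E : normedModType R) (ip : {dot E for idfun}).
Variables (n : nat) (u b bd : 'I_n -> E) (L : set E).
Hypothesis HL : lattice_basis ip u b bd L.
Hypothesis int_L : integral_lattice ip L.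
Variable mu : {sigma_finite_measure set (borel E) -> \bar R}.
Hypothesis Hmu : invariant_measure mu.
Local Notation C := R[i].
Local Notation Re := (@complex.Re R).
Local Notation Im := (@complex.Im R).
Local Notation dL := (Pilot.Defs.dual ip L).
Local Notation pr := (pairing ip).
Local Notation Zt := (discriminant ip L).
Local Notation disc := (disc_seq ip L).
Local Notation cell := (cell ip bd : set (borel E)).
Local Notation mcell := (measurable_cell HL).
Local Notation V := (fine (mu cell)).
Local Notation family := (Zt -> E -> C).
Local Notation E2 := (borel E * borel E)%type.
Local Notation P := (product_measure1 mu mu).
Local Notation K := (cell `*` cell : set E2).
Local Notation cmeas2 s := (cmeasurable [set: E2] (s : E2 -> C)).
Local Notation untwist := (untwist ip).
Variable r : Zt -> E.
Hypothesis rP : representatives r.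

Definition fam_measurable (f : family) :=
  forall g, cmeasurable [set: borel E] (f g : borel E -> C).

Definition bounded_support (f : family) :=
  exists M : R, forall g x, M < `|x| -> f g x = 0.

Definition sumsq (f : family) (x : E) : R := \sum_(g <- disc) sqmod (f g x).

Definition fam_norm2 (f : family) : \bar R := (\int[mu]_x (sumsq f x)%:E)%E.

(** Taken over the cell and without the factor 1/Vol of the inner product on sections; hence the
    factor V in the isometry formulas below. *)
Definition sec_norm2 (s : E * E -> C) : \bar R := (\int[P]_(p in K) (sqmod (s p))%:E)%E.

Lemma sumsq_ge0 f x : 0 <= sumsq f x.
Proof. by apply: sumr_ge0 => g _; exact: sqmod_ge0. Qed.

Lemma fam_norm2_ge0 f : (0 <= fam_norm2 f)%E.
Proof. by apply: integral_ge0 => x _; rewrite lee_fin sumsq_ge0. Qed.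

Lemma sec_norm2_ge0 s : (0 <= sec_norm2 s)%E.
Proof. by apply: integral_ge0 => x _; rewrite lee_fin sqmod_ge0. Qed.

Lemma measurable_sumsq f : fam_measurable f ->
  measurable_fun [set: borel E] (sumsq f : borel E -> R).
Proof.
move=> mf; rewrite /sumsq; elim: (disc_seq ip L) => [|g s IH].
  by under eq_fun do rewrite big_nil; exact: measurable_cst.
under eq_fun do rewrite big_cons; apply: measurable_funD => //.
exact: measurable_sqmod.
Qed.

Lemma measurable_K : measurable K.
Proof. by apply: measurableX; exact: mcell. Qed.

Lemma support_fset (M : R) (t : E) : exists A : {fset E}, [set` A] `<=` dL /\
  forall l, dL l -> l \notin A -> M < `|t + l|.
Proof.
have fin := finite_dual_bounded HL (M + `|t|).
exists (fset_set [set y | dL y /\ `|y| <= M + `|t|]); split.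
  by move=> l /=; rewrite in_fset_set// inE => -[].
move=> l dl; rewrite in_fset_set// => /negP h; rewrite ltNge; apply/negP => tl; apply: h.
rewrite inE; split => //; rewrite -[l](addKr t) addrC (le_trans (ler_normB _ _))//.
by rewrite lerD2r.
Qed.

Lemma zak_coef_support f M l x : (forall g y, M < `|y| -> f g y = 0) -> M < `|x| ->
  zak_coef r f l x = 0.
Proof.
move=> fM Mx; rewrite /zak_coef big1 ?mulr0// => g _; by rewrite fM// mulr0.
Qed.

Lemma bounded_support_csummable f g t1 t2 : bounded_support f ->
  csummable dL (zak_term r f g t1 t2).
Proof.
move=> [M fM]; have [A [AdL hA]] := support_fset M t1.
apply: (csummable_fsupport AdL) => l dl /(hA l dl) h.
by rewrite /zak_term fM// !mul0r.
Qed.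

Lemma measurable_addE (l : E) : measurable_fun [set: E2] (fun p : E2 => (p.1 + l : E) : borel E).
Proof. exact: (measurableT_comp (measurable_shift l) measurable_fst). Qed.

Lemma cmeasurable_comp d1 d2 (T1 : measurableType d1) (T2 : measurableType d2)
  (f : T2 -> C) (h : T1 -> T2) : cmeasurable setT f -> measurable_fun setT h ->
  cmeasurable setT (fun x => f (h x)).
Proof.
move=> [fR fI] mh; split.
- exact: (measurableT_comp fR mh).
- exact: (measurableT_comp fI mh).
Qed.

Lemma cmeasurable_pairing2 : cmeas2 (fun p : E * E => pr p.1 p.2).
Proof.
apply: cmeasurable_expi; apply: measurable_funM => //.
have [_ _ uS] := lat_onb HL.
rewrite (_ : (fun p => _) = fun p : E2 => \sum_i (ip (p.1 : E) (u i) * ip (p.2 : E) (u i))); last first.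
  apply/funext => p; rewrite {1}(uS p.1) ip_suml; apply: eq_bigr => i _.
  by rewrite ipZl (ipC _ (u i)).
apply: measurable_sum => i.
have mi : measurable_fun [set: borel E] (fun x : borel E => ip (x : E) (u i)).
  exact: (continuous_borel (ip_continuous (y := u i) (lat_onb HL))).
apply: measurable_funM.
- exact: (measurableT_comp mi measurable_fst).
- exact: (measurableT_comp mi measurable_snd).
Qed.

Lemma cmeasurable_scaled_pairing (c : R) : cmeas2 (fun p : E * E => pr (c *: p.1) p.2).
Proof.
have mc : measurable_fun [set: borel E] (fun x : borel E => (c *: (x : E)) : borel E).
  by apply: continuous_borel_borel => x; apply: cvgZl_tmp; exact: cvg_id.
have m2 : measurable_fun [set: E2] (fun p : E2 => ((c *: (p.1 : E)) : borel E, p.2)).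
  apply/measurable_fun_pairP; split; last exact: measurable_snd.
  exact: (measurableT_comp mc measurable_fst).
exact: (cmeasurable_comp cmeasurable_pairing2 m2).
Qed.

Lemma untwist_measurable s : cmeas2 s -> cmeas2 (untwist s).
Proof. by move=> ms; apply: cmeasurableM => //; exact: cmeasurable_scaled_pairing. Qed.

Lemma sqmod_untwist s p : sqmod (untwist s p) = sqmod (s p).
Proof. by rewrite /untwist sqmodM sqmod_pairing mul1r. Qed.

Lemma slice_cmeasurable s (x : E) : cmeas2 s ->
  cmeasurable [set: borel E] (fun t : borel E => s (x, t : E)).
Proof. by move=> ms; exact: (cmeasurable_comp ms (pair1_measurable (x : borel E))). Qed.

Lemma zak_coef_measurable f l : fam_measurable f ->
  cmeasurable [set: borel E] (zak_coef r f l : borel E -> C).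
Proof.
move=> mf; apply: cmeasurableM; first exact: cmeasurable_cst.
by apply: cmeasurable_sum => g; apply: cmeasurableM => //; exact: cmeasurable_cst.
Qed.

Section Family.
Variable f : family.
Hypothesis mf : fam_measurable f.
Hypothesis bf : bounded_support f.

Lemma bs_zak_section : is_section ip L (zak r f).
Proof. by apply: (zak_section HL int_L rP) => p g; exact: bounded_support_csummable. Qed.

Lemma bs_untwist p : untwist (zak r f) p = csum dL (fun l => zak_coef r f l (p.1 + l) * pr (- l) p.2).
Proof.
rewrite /untwist (zakE HL int_L (p := p) (fun g => bounded_support_csummable g p.1 p.2 bf)).1.
by rewrite mulrA pairingMN mul1r.
Qed.

Lemma bs_csummable p : csummable dL (fun l => zak_coef r f l (p.1 + l) * pr (- l) p.2).
Proof.
exact: (zakE HL int_L (p := p) (fun g => bounded_support_csummable g p.1 p.2 bf)).2.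
Qed.

(** On one slice the series is a finite sum over a set that does not depend on y, so Parseval
    reduces to a finite computation. *)
Lemma bs_zak_finite x : exists A : {fset E}, [/\ [set` A] `<=` dL,
  forall y, untwist (zak r f) (x, y) = \sum_(l <- A) zak_coef r f l (x + l) * pr (- l) y &
  forall l, dL l -> l \notin A -> zak_coef r f l (x + l) = 0].
Proof.
have [M fM] := bf; have [A [AdL hA]] := support_fset M x.
have z l : dL l -> l \notin A -> zak_coef r f l (x + l) = 0.
  by move=> dl /(hA l dl); exact: zak_coef_support.
exists A; split => // y; rewrite bs_untwist (csum_fsupport AdL)// => l dl lA.
by rewrite z// mul0r.
Qed.

Lemma bs_zak_measurable : cmeas2 (zak r f).
Proof.
rewrite (_ : zak r f = fun p => pr ((- 2^-1) *: p.1) p.2 * untwist (zak r f) p); last first.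
  by apply/funext => p; rewrite scaleNr -untwistK.
apply: cmeasurableM; first exact: cmeasurable_scaled_pairing.
pose F k (p : E * E) := \sum_(l <- dual_fset ip b L k) zak_coef r f l (p.1 + l) * pr (- l) p.2.
apply: (@cmeasurable_ccvg _ E2 R setT F) => // [k|p _].
  apply: cmeasurable_sum => l; apply: cmeasurableM.
    exact: (cmeasurable_comp (zak_coef_measurable l mf) (measurable_addE l)).
  exact: (cmeasurable_comp (pairing_measurable HL (- l)) measurable_snd).
by rewrite bs_untwist; exact: (csum_exhaustion (dual_exhaustion HL) (bs_csummable p)).
Qed.

Lemma bs_zak_slice_norm x :
  (\int[mu]_(y in cell) (sqmod (untwist (zak r f) (x, y)))%:E =
   V%:E * esum dL (fun l => (sqmod (zak_coef r f l (x + l)))%:E))%E.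
Proof.
have [A [AdL eA zA]] := bs_zak_finite x.
have [iA vA] := finite_parseval HL int_L Hmu (fun l => zak_coef r f l (x + l)) AdL.
under eq_integral do rewrite eA.
rewrite -[LHS]fineK; last exact: (integrable_fin_num mcell iA).
rewrite -[fine _]/(\int[mu]_(t in cell) _) vA EFinM; congr (_ * _)%E.
rewrite (esum_fsupport AdL) ?sumEFin//.
- by move=> l _; rewrite lee_fin sqmod_ge0.
- by move=> l dl lA; rewrite zA// sqmod0.
Qed.

Lemma sec_norm2E s : cmeas2 s -> sec_norm2 s =
  (\int[mu]_(x in cell) \int[mu]_(y in cell) (sqmod (untwist s (x, y)))%:E)%E.
Proof.
move=> ms; have mse : measurable_fun [set: E2] (fun p : E2 => (sqmod (s p))%:E).
  exact/measurable_EFinP/measurable_sqmod.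
have h0 p : (0 <= (sqmod (s p))%:E)%E by rewrite lee_fin sqmod_ge0.
apply: (eq_trans (ge0_integral_prod mu mcell mcell mse h0)).
by apply: eq_integral => x _; apply: eq_integral => y _; rewrite sqmod_untwist.
Qed.

Lemma sumsq_plancherel (c : family) : fam_measurable c ->
  (\int[mu]_(x in cell) esum dL (fun l => (sqmod (zak_coef r c l (x + l)))%:E) =
   fam_norm2 c)%E.
Proof.
move=> mc.
rewrite (dual_unfold HL int_L Hmu rP (a := fun l x => (sqmod (zak_coef r c l x))%:E)); last 3 first.
- by move=> l; apply/measurable_EFinP/measurable_sqmod; exact: zak_coef_measurable.
- by move=> l x; rewrite lee_fin sqmod_ge0.
- by move=> l l' x dl Ll'; rewrite (zak_coef_per HL int_L rP).
rewrite -ge0_integral_sum//.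
- by apply: eq_integral => x _; rewrite sumEFin (zak_coef_plancherel HL int_L rP).
- by move=> h; apply/measurable_EFinP/measurable_sqmod; exact: zak_coef_measurable.
- by move=> h x _; rewrite lee_fin sqmod_ge0.
Qed.

Lemma bs_zak_isometry : (sec_norm2 (zak r f) = V%:E * fam_norm2 f)%E.
Proof.
rewrite sec_norm2E; last exact: bs_zak_measurable.
under eq_integral do rewrite bs_zak_slice_norm.
have V0 := cell_pos HL int_L Hmu.
rewrite ge0_integralZl_EFin ?(ltW V0)//.
- by rewrite sumsq_plancherel.
- exact: mcell.
- by move=> x _; apply: esum_ge0 => l _; rewrite lee_fin sqmod_ge0.
- apply: measurable_funTS; apply: (measurable_esum (dual_exhaustion HL)) => //.
  + move=> l; apply/measurable_EFinP/measurable_sqmod.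
    exact: (cmeasurable_comp (zak_coef_measurable l mf) (measurable_shift l)).
  + by move=> l x; rewrite lee_fin sqmod_ge0.
Qed.
End Family.

Lemma bs_zak_linear (a : C) f f' : bounded_support f -> bounded_support f' ->
  zak r (fun g t => a * f g t + f' g t) = (fun p => a * zak r f p + zak r f' p).
Proof.
move=> bf bf'; apply/funext => p.
by apply: (zak_linear_at HL int_L) => g; exact: bounded_support_csummable.
Qed.

Definition trunc (f : family) (N : nat) : family :=
  fun g x => if `|x| <= N%:R then f g x else 0.

Definition remainder (f : family) (N : nat) : family :=
  fun g x => if `|x| <= N%:R then 0 else f g x.

Lemma trunc_bounded f N : bounded_support (trunc f N).
Proof. by exists N%:R => g x Nx; rewrite /trunc leNgt Nx. Qed.

Lemma measurable_ball (N : nat) : measurable ([set x | `|x| <= N%:R] : set (borel E)).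
Proof.
rewrite (_ : [set x | _] = ~` [set x : E | N%:R < `|x|]); last first.
  by apply/seteqP; split => x /=; rewrite leNgt => /negP.
apply: measurableC; apply: open_borel.
rewrite (_ : [set x | _] = (fun x : E => `|x|) @^-1` [set y | N%:R < y])//.
by apply: open_comp => [x _|]; [exact: norm_continuous|exact: open_gt].
Qed.

Lemma measurable_ballC (N : nat) (c : borel E -> C) :
  cmeasurable setT c -> cmeasurable [set: borel E] (fun x : borel E => if `|x : E| <= N%:R then c x else 0).
Proof.
move=> [cR cI]; have mB := measurable_ball N.
have m1 : measurable_fun [set: borel E] (\1_[set x : E | `|x| <= N%:R] : borel E -> R).
  exact: measurable_indic.
split.
- rewrite (_ : _ \o _ = fun x : borel E => Re (c x) * \1_[set x : E | `|x| <= N%:R] x).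
    exact: measurable_funM.
  apply/funext => x /=; rewrite indicE; case: (boolP (`|x| <= N%:R)) => h.
    by rewrite mem_set// mulr1.
  by rewrite memNset ?mulr0//; exact/negP.
- rewrite (_ : _ \o _ = fun x : borel E => Im (c x) * \1_[set x : E | `|x| <= N%:R] x).
    exact: measurable_funM.
  apply/funext => x /=; rewrite indicE; case: (boolP (`|x| <= N%:R)) => h.
    by rewrite mem_set// mulr1.
  by rewrite memNset ?mulr0//; exact/negP.
Qed.

Lemma trunc_measurable f N : fam_measurable f -> fam_measurable (trunc f N).
Proof. by move=> mf g; apply: measurable_ballC; exact: mf. Qed.

Lemma remainderE f N : remainder f N = fun g x => (-1) * trunc f N g x + f g x.
Proof.
apply/funext => g; apply/funext => x; rewrite /remainder /trunc mulN1r.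
by case: ifP; rewrite ?addNr// oppr0 add0r.
Qed.

Lemma fam_measurable_lin (a : C) f f' : fam_measurable f -> fam_measurable f' ->
  fam_measurable (fun g x => a * f g x + f' g x).
Proof.
move=> mf mf' g; apply: cmeasurableD => //; apply: cmeasurableM => //.
exact: cmeasurable_cst.
Qed.

Lemma remainder_measurable f N : fam_measurable f -> fam_measurable (remainder f N).
Proof.
by move=> mf; rewrite remainderE; apply: fam_measurable_lin => //; exact: trunc_measurable.
Qed.

Lemma trunc_lin (a : C) f f' N : trunc (fun g x => a * f g x + f' g x) N =
  fun g x => a * trunc f N g x + trunc f' N g x.
Proof.
apply/funext => g; apply/funext => x; rewrite /trunc; case: ifP => //.
by rewrite mulr0 addr0.
Qed.

Lemma le_sumsq f f' x : (forall g, sqmod (f g x) <= sqmod (f' g x)) -> sumsq f x <= sumsq f' x.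
Proof. by move=> h; apply: ler_sum => g _. Qed.

Lemma le_fam_norm2 f f' : fam_measurable f -> fam_measurable f' ->
  (forall x g, sqmod (f g x) <= sqmod (f' g x)) -> (fam_norm2 f <= fam_norm2 f')%E.
Proof.
move=> mf mf' h; apply: ge0_le_integral => //.
- by move=> x _; rewrite lee_fin sumsq_ge0.
- by apply/measurable_EFinP; exact: measurable_sumsq.
- by apply/measurable_EFinP; exact: measurable_sumsq.
- by move=> x _; rewrite lee_fin; apply: le_sumsq => g; exact: h.
Qed.

(** By linearity the difference is the transform of the part of f with N < |x| <= M, which has
    bounded support and is dominated by the remainder beyond N. *)
Lemma zak_trunc_diff f N M : fam_measurable f -> (N <= M)%N ->
  (sec_norm2 (fun p => zak r (trunc f M) p - zak r (trunc f N) p)%R <=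
   V%:E * fam_norm2 (remainder f N))%E.
Proof.
move=> mf NM; have mN := trunc_measurable N mf; have mM := trunc_measurable M mf.
pose D : family := fun g x => (-1) * trunc f N g x + trunc f M g x.
have bD : bounded_support D.
  exists M%:R => g x Mx; rewrite /D /trunc leNgt (le_lt_trans _ Mx) ?ler_nat//= leNgt Mx/=.
  by rewrite mulr0 addr0.
have mD : fam_measurable D by exact: fam_measurable_lin.
have -> : (fun p => zak r (trunc f M) p - zak r (trunc f N) p) = zak r D.
  rewrite /D (bs_zak_linear (-1) (trunc_bounded f N) (trunc_bounded f M)).
  by apply/funext => p; rewrite mulN1r addrC.
rewrite (bs_zak_isometry mD bD); apply: lee_wpmul2l.
  by rewrite lee_fin ltW//; exact: (cell_pos HL int_L Hmu).
apply: le_fam_norm2 => //; first exact: remainder_measurable.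
move=> x g; rewrite /D /trunc /remainder; case: ifP => xN.
  by rewrite (le_trans xN) ?ler_nat// mulN1r addNr sqmod0.
by rewrite mulr0 add0r; case: ifP => //; rewrite sqmod0 sqmod_ge0.
Qed.

Lemma remainder_cvg f : fam_measurable f -> (fam_norm2 f < +oo)%E ->
  fine (fam_norm2 (remainder f N)) @[N --> \oo] --> 0.
Proof.
move=> mf f2; have mS := measurable_sumsq mf.
have iS : mu.-integrable [set: borel E] (EFin \o sumsq f).
  apply/integrableP; split; first exact/measurable_EFinP.
  by under eq_integral do rewrite /= ger0_norm ?sumsq_ge0//.
have H := @Rintegral_dominated _ _ _ mu _ measurableT (fun N x => sumsq (remainder f N) x) (fun=> 0) (sumsq f).
have [] := H.
- by move=> N; apply: measurable_sumsq; exact: remainder_measurable.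
- move=> x _; apply: cvg_near_cst; near=> N.
  rewrite /sumsq big1// => g _; rewrite /remainder ifT ?sqmod0//.
  by near: N; exact: nbhs_infty_ger.
- exact: iS.
- move=> N x _; rewrite ger0_norm ?sumsq_ge0//; apply: le_sumsq => g.
  by rewrite /remainder; case: ifP => //; rewrite sqmod0 sqmod_ge0.
by move=> _; rewrite Rintegral_cst// mul0r.
Unshelve. all: by end_near. Qed.

Lemma remainder_norm2_fin f N : fam_measurable f -> (fam_norm2 f < +oo)%E ->
  (fam_norm2 (remainder f N) < +oo)%E.
Proof.
move=> mf; apply: le_lt_trans; apply: le_fam_norm2 => //; first exact: remainder_measurable.
by move=> x g; rewrite /remainder; case: ifP => //; rewrite sqmod0 sqmod_ge0.
Qed.
End BoundedSupport.

Section FatouBound.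
Context d (T : measurableType d) (R : realType).
Variables (m : {measure set T -> \bar R}) (D : set T) (mD : measurable D).
Local Open Scope ereal_scope.

(** Fatou's lemma for a limit that exists only almost everywhere. It carries the bound on
    differences of truncations over to the limit section. *)
Lemma fatou_bound (g_ : nat -> T -> \bar R) (g : T -> \bar R) (c : \bar R) :
  (forall k, measurable_fun D (g_ k)) -> (forall k x, D x -> 0 <= g_ k x) ->
  measurable_fun D g -> (forall x, D x -> 0 <= g x) ->
  {ae m, forall x, D x -> g_ k x @[k --> \oo] --> g x} ->
  (forall k, \int[m]_(x in D) g_ k x <= c) -> \int[m]_(x in D) g x <= c.
Proof.
move=> mg_ g_0 mg g0 cvg hc.
rewrite (@ge0_ae_eq_integral _ _ _ m D g (fun x => limn_einf (g_ ^~ x)))//; last 3 first.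
- rewrite (_ : (fun x => _) = fun x => - limn_esup (fun k => - g_ k x)).
    apply: measurableT_comp => //; apply: measurable_fun_limn_esup => k.
    by apply: measurableT_comp => //; exact: mg_.
  apply/funext => x; rewrite -limn_einfN; congr limn_einf.
  by apply/funext => k; rewrite /= oppeK.
- move=> x Dx; rewrite limn_einf_lim; apply: lime_ge; first exact: is_cvg_einfs.
  apply: nearW => k; apply: le_ereal_inf_tmp => _ [j _ <-]; exact: g_0.
- by apply: filterS cvg => x hx Dx; have [-> _] := cvg_limn_einf_sup (hx Dx).
apply: (le_trans (fatou m mD mg_ g_0)).
rewrite limn_einf_lim; apply: lime_le; first exact: is_cvg_einfs.
apply: nearW => k; apply: le_trans (hc k); apply: ereal_inf_lbound.
by exists k => //=.
Qed.
End FatouBound.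

Lemma geometric_gaps_cvg (R : realType) (v : nat -> R) (B q : R) : 0 <= q < 1 -> 0 <= B ->
  (forall k, `|v k.+1 - v k| <= B * q ^+ k) -> cvgn v.
Proof.
move=> /andP[q0 q1] B0 vB.
have c1 : cvgn (series (telescope v)).
  apply: normed_cvg; apply: (@series_le_cvg _ _ (geometric B q)) => [k|k|k|].
  - exact: normr_ge0.
  - by rewrite /= mulr_ge0// exprn_ge0.
  - exact: vB.
  - by apply: is_cvg_geometric_series; rewrite ger0_norm.
rewrite telescopeK in c1.
rewrite (_ : v = (fun k => (v k - v 0%N) + v 0%N)); last by apply/funext => k; rewrite subrK.
by apply: is_cvgD => //; exact: is_cvg_cst.
Qed.

(** * The almost everywhere limit of the truncated transforms *)

Section ZakBar.
Variables (R : realType) (E : normedModType R) (ip : {dot E for idfun}).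
Variables (n : nat) (u b bd : 'I_n -> E) (L : set E).
Hypothesis HL : lattice_basis ip u b bd L.
Hypothesis int_L : integral_lattice ip L.
Variable mu : {sigma_finite_measure set (borel E) -> \bar R}.
Hypothesis Hmu : invariant_measure mu.
Local Notation C := R[i].
Local Notation Re := (@complex.Re R).
Local Notation Im := (@complex.Im R).
Local Notation Zt := (discriminant ip L).
Local Notation cell := (cell ip bd : set (borel E)).
Local Notation V := (fine (mu cell)).
Local Notation family := (Zt -> E -> C).
Local Notation E2 := (borel E * borel E)%type.
Local Notation P := (product_measure1 mu mu).
Local Notation K := (cell `*` cell : set E2).
Local Notation mK := (measurable_K HL).
Local Notation cmeas2 s := (cmeasurable [set: E2] (s : E2 -> C)).
Local Notation fnorm2 := (fam_norm2 mu).
Local Notation snorm2 := (sec_norm2 ip bd mu).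
Variable r : Zt -> E.
Hypothesis rP : representatives r.

(** The rate 16^-k beats the weight 4^k of [zak_gap]: the integral of the gaps is at most V times
    the sum of 4^-k. A finite weighted gap in turn forces increments of order 2^-k, which are
    summable. *)
Definition fast (f : family) (N : nat -> nat) : Prop :=
  [/\ forall k, (k <= N k)%N, forall k, (N k <= N k.+1)%N
    & forall k, (fnorm2 (remainder f (N k)) <= ((16^-1) ^+ k)%:E)%E].

Lemma fast_ex f : fam_measurable f -> (fnorm2 f < +oo)%E -> exists N, fast f N.
Proof.
move=> mf f2.
have h k : exists N0, forall N, (N0 <= N)%N -> (fnorm2 (remainder f N) <= ((16^-1) ^+ k)%:E)%E.
  have e0 : 0 < (16^-1) ^+ k :> R by rewrite exprn_gt0.
  have /cvgrPdist_le/(_ _ e0)[N0 _ hN] := remainder_cvg mf f2.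
  exists N0 => N N0N; have := hN N N0N; rewrite /= sub0r normrN => hle.
  have fin : fnorm2 (remainder f N) \is a fin_num.
    by rewrite ge0_fin_numE ?fam_norm2_ge0// remainder_norm2_fin.
  by rewrite -(fineK fin) lee_fin (le_trans (ler_norm _)).
pose N0 k := projT1 (cid (h k)); have N0P k := projT2 (cid (h k)).
(* Adding all previous thresholds makes N monotone, at least k and at least the k-th threshold. *)
pose N k := (k + \sum_(i < k.+1) N0 i)%N.
exists N; split=> k; first exact: leq_addr.
- by rewrite /N [in X in (_ <= X)%N]big_ord_recr/= leq_add ?leq_addr.
- by apply: N0P; rewrite /N big_ord_recr/= addnA leq_addl.
Qed.

(** The default [id] makes the extension total; it matters only for families without a fast
    sequence, in particular none of the measurable square-integrable ones. *)
Definition fast_seq (f : family) : nat -> nat :=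
  if pselect (exists N, fast f N) is left h then projT1 (cid h) else id.

Definition zak_seq (f : family) (k : nat) : E * E -> C := zak r (trunc f (fast_seq f k)).

Definition zak_gap (f : family) (p : E * E) : \bar R :=
  (\sum_(k <oo) (4 ^+ k * sqmod (zak_seq f k.+1 p - zak_seq f k p))%:E)%E.

(* The gaps of [fast_seq] being geometric in L^2, the limit exists almost
   everywhere. *)
Definition zak_bar (f : family) (p : E * E) : C :=
  if (zak_gap f p < +oo)%E then
    (limn (fun k => Re (zak_seq f k p)) +i* limn (fun k => Im (zak_seq f k p)))%C
  else 0.

Lemma zak_gap_cvg f p : (zak_gap f p < +oo)%E -> ccvg (fun k => zak_seq f k p) (zak_bar f p).
Proof.
move=> gfin; pose B := fine (zak_gap f p).
have t0 k : (0 <= (4 ^+ k * sqmod (zak_seq f k.+1 p - zak_seq f k p))%:E)%E.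
  by rewrite lee_fin mulr_ge0 ?sqmod_ge0 ?exprn_ge0.
have g0 : (0 <= zak_gap f p)%E by apply: nneseries_ge0.
have gE : zak_gap f p = B%:E by rewrite /B fineK// ge0_fin_numE.
have B0 : 0 <= B by rewrite -lee_fin -gE.
have tB k : 4 ^+ k * sqmod (zak_seq f k.+1 p - zak_seq f k p) <= B.
  rewrite -lee_fin -gE; apply: le_trans (nneseries_lim_ge k.+1 (fun i _ _ => t0 i)).
  by rewrite big_nat_recr//= leeDr// sume_ge0.
(* Applied to the real and imaginary parts of an increment. The constant 1 + B stands in for the
   square root of B, as B <= (1 + B)^2. *)
have gap (x : R) k : x ^+ 2 <= sqmod (zak_seq f k.+1 p - zak_seq f k p) -> `|x| <= (1 + B) * 2^-1 ^+ k.
  move=> xs; rewrite -(@ler_pXn2r _ 2)// ?nnegrE ?mulr_ge0 ?exprn_ge0 ?addr_ge0//.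
  rewrite real_normK ?num_real// exprMn -exprM mulnC exprM.
  rewrite (_ : 2^-1 ^+ 2 = 4^-1); last by field.
  apply: (@le_trans _ _ (B * 4^-1 ^+ k)).
    rewrite exprVn ler_pdivlMr ?exprn_gt0// mulrC (le_trans _ (tB k))//.
    by rewrite ler_wpM2l ?exprn_ge0.
  by rewrite ler_wpM2r ?exprn_ge0//; nra.
have q01 : 0 <= (2^-1 : R) < 1 by lra.
rewrite /zak_bar gfin; split => /=.
- apply: (geometric_gaps_cvg q01 (B := 1 + B)); first exact: addr_ge0.
  by move=> k; apply: gap; rewrite /sqmod ReD ReN lerDl sqr_ge0.
- apply: (geometric_gaps_cvg q01 (B := 1 + B)); first exact: addr_ge0.
  by move=> k; apply: gap; rewrite /sqmod ImD ImN lerDr sqr_ge0.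
Qed.

Lemma section_sub s t : is_section ip L s -> is_section ip L t ->
  is_section ip L (fun p => s p - t p).
Proof. by move=> ss st l1 l2 x y Ll1 Ll2; rewrite ss// st//; ring. Qed.

Lemma section_sqmod s : is_section ip L s -> forall l1 l2 x y, L l1 -> L l2 ->
  sqmod (s (x + l1, y + l2)) = sqmod (s (x, y)).
Proof.
move=> ss l1 l2 x y Ll1 Ll2; rewrite -!(sqmod_untwist ip s).
by rewrite (untwist_quasi_periodic int_L ss)// sqmodM sqmod_pairing mul1r.
Qed.

Lemma zak_seq_section f k : is_section ip L (zak_seq f k).
Proof. exact: (bs_zak_section HL int_L rP (trunc_bounded f _)). Qed.

(** The gaps involve squared moduli of sections only. So the exceptional set on which [zak_bar] is 0
    is invariant under the lattice, and [zak_bar] is a section everywhere, not just almost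
    everywhere. *)
Lemma zak_gap_periodic f l1 l2 x y : L l1 -> L l2 ->
  zak_gap f (x + l1, y + l2) = zak_gap f (x, y).
Proof.
move=> Ll1 Ll2; apply: eq_eseriesr => k _; congr (_ * _)%:E.
exact: (section_sqmod (section_sub (zak_seq_section f k.+1) (zak_seq_section f k))).
Qed.

Lemma zak_bar_section f : is_section ip L (zak_bar f).
Proof.
move=> l1 l2 x y Ll1 Ll2.
have [gfin|ginf] := boolP (zak_gap f (x, y) < +oo)%E; last first.
  by rewrite /zak_bar (zak_gap_periodic f x y Ll1 Ll2) (negbTE ginf) mulr0.
have gfin' : (zak_gap f (x + l1, y + l2)%R < +oo)%E by rewrite zak_gap_periodic.
apply: (ccvg_unique (zak_gap_cvg gfin')).
have := ccvgM (ccvg_cst (multiplier ip l1 l2 x y)) (zak_gap_cvg gfin).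
by congr ccvg; apply/funext => k; rewrite -(zak_seq_section f k x y Ll1 Ll2).
Qed.

Section Fixed.
Variable f : family.
Hypothesis mf : fam_measurable f.
Hypothesis f2 : (fnorm2 f < +oo)%E.

Lemma fast_seqP : fast f (fast_seq f).
Proof.
rewrite /fast_seq; case: pselect => [h|/(_ (fast_ex mf f2))//].
exact: projT2 (cid h).
Qed.

Lemma zak_seq_measurable k : cmeas2 (zak_seq f k).
Proof. exact: (bs_zak_measurable HL int_L _ (trunc_measurable _ mf) (trunc_bounded f _)). Qed.

Lemma zak_gap_measurable : measurable_fun [set: E2] (zak_gap f : E2 -> \bar R).
Proof.
apply: ge0_emeasurable_sum => [k p _ _|k _].
  by rewrite lee_fin mulr_ge0 ?sqmod_ge0 ?exprn_ge0.
apply/measurable_EFinP; apply: measurable_funM => //; apply: measurable_sqmod.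
by apply: cmeasurableB; exact: zak_seq_measurable.
Qed.

Lemma zak_gap_fin_measurable : measurable [set p : E2 | (zak_gap f p < +oo)%E].
Proof.
rewrite -[X in measurable X]setTI; apply: emeasurable_fun_infty_o => //.
exact: zak_gap_measurable.
Qed.

Lemma zak_bar_measurable : cmeas2 (zak_bar f).
Proof.
pose G := [set p : E2 | (zak_gap f p < +oo)%E].
pose F k (p : E2) : C := if (zak_gap f p < +oo)%E then zak_seq f k p else 0.
have mG : measurable_fun [set: E2] (\1_G : E2 -> R).
  by apply: measurable_indic; exact: zak_gap_fin_measurable.
apply: (@cmeasurable_ccvg _ E2 R setT F) => // [k|p _].
- have [mR mI] := zak_seq_measurable k; split.
    rewrite (_ : _ \o _ = fun p : E2 => Re (zak_seq f k p) * \1_G p); first exact: measurable_funM.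
    apply/funext => p; rewrite /= /F indicE; case: ifPn => h.
      by rewrite mem_set// mulr1.
    by rewrite memNset ?mulr0//; exact/negP.
  rewrite (_ : _ \o _ = fun p : E2 => Im (zak_seq f k p) * \1_G p); first exact: measurable_funM.
  apply/funext => p; rewrite /= /F indicE; case: ifPn => h.
    by rewrite mem_set// mulr1.
  by rewrite memNset ?mulr0//; exact/negP.
- have [gfin|ginf] := boolP (zak_gap f p < +oo)%E.
    by have := zak_gap_cvg gfin; congr ccvg; apply/funext => k; rewrite /F gfin.
  rewrite /zak_bar (negbTE ginf) (_ : F ^~ p = fun=> 0); first exact: ccvg_cst.
  by apply/funext => k; rewrite /F (negbTE ginf).
Qed.

Lemma zak_gap_ae : {ae P, forall p, K p -> (zak_gap f p < +oo)%E}.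
Proof.
have V0 := cell_pos HL int_L Hmu.
have [Nk Nmono Nfast] := fast_seqP.
have t0 k p : (0 <= (4 ^+ k * sqmod (zak_seq f k.+1 p - zak_seq f k p))%:E)%E.
  by rewrite lee_fin mulr_ge0 ?sqmod_ge0 ?exprn_ge0.
have ms k : measurable_fun [set: E2] (fun p : E2 => sqmod (zak_seq f k.+1 p - zak_seq f k p)).
  by apply: measurable_sqmod; apply: cmeasurableB; exact: zak_seq_measurable.
have int_gap : (\int[P]_(p in K) zak_gap f p < +oo)%E.
  rewrite /zak_gap (integral_nneseries P mK)//; last first.
    by move=> k; apply/measurable_EFinP/measurable_funTS; exact: measurable_funM.
  apply: (@le_lt_trans _ _ (\sum_(k <oo) (V * (4^-1) ^+ k)%:E)%E).
    apply: lee_nneseries => [k _ _|k _]; first by apply: integral_ge0.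
    under eq_integral do rewrite EFinM.
    rewrite ge0_integralZl_EFin ?exprn_ge0//; last 3 first.
    - exact: mK.
    - by move=> p _; rewrite lee_fin sqmod_ge0.
    - by apply/measurable_EFinP; exact: measurable_funTS (ms k).
    rewrite (_ : V * 4^-1 ^+ k = 4 ^+ k * (V * 16^-1 ^+ k)); last first.
      by rewrite mulrCA; congr (_ * _); rewrite -exprMn; congr (_ ^+ _); field.
    rewrite EFinM lee_wpmul2l ?lee_fin ?exprn_ge0//.
    apply: (le_trans (zak_trunc_diff HL int_L Hmu rP mf (Nmono k))).
    by rewrite EFinM lee_wpmul2l ?lee_fin ?(ltW V0)// Nfast.
  have := @cvg_geometric_series R V (4^-1).
  rewrite ger0_norm ?invr_ge0// => /(_ ltac:(lra)) hc.
  have -> : (\sum_(k <oo) (V * (4^-1) ^+ k)%:E)%E = (V * (1 - 4^-1)^-1)%:E.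
    apply/cvg_lim => //; apply: cvg_EFin; first by apply: nearW => k; rewrite /= sumEFin.
    by apply: cvg_trans hc; apply: near_eq_cvg; apply: nearW => k; rewrite /= sumEFin.
  exact: ltry.
have g0 p : (0 <= zak_gap f p)%E by apply: nneseries_ge0.
have ig : P.-integrable K (zak_gap f).
  apply/integrableP; split; first exact: measurable_funTS zak_gap_measurable.
  by under eq_integral do rewrite gee0_abs//.
by apply: filterS (integrable_ae mK ig) => p h /h; rewrite ge0_fin_numE.
Qed.

Lemma zak_bar_fatou N : (snorm2 (fun p => zak_bar f p - zak r (trunc f N) p)%R <=
  V%:E * fnorm2 (remainder f N))%E.
Proof.
have [Nk Nmono Nfast] := fast_seqP.
have NM k m : (k <= m)%N -> (fast_seq f k <= fast_seq f m)%N.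
  elim: m => [|m IH]; first by rewrite leqn0 => /eqP ->.
  by rewrite leq_eqVlt => /orP[/eqP ->//|/IH h]; exact: leq_trans h (Nmono m).
have mz : cmeas2 (zak r (trunc f N)).
  exact: (bs_zak_measurable HL int_L _ (trunc_measurable _ mf) (trunc_bounded f _)).
(* The index is offset by N because [fast_seq f (k + N)] is then at least N, so each term is a
   difference of truncations to which the bound applies. *)
apply: (fatou_bound mK (g_ := fun k p => (sqmod (zak_seq f (k + N)%N p - zak r (trunc f N) p))%:E)).
- move=> k; apply/measurable_EFinP; apply: measurable_funTS; apply: measurable_sqmod.
  by apply: cmeasurableB => //; exact: zak_seq_measurable.
- by move=> k p _; rewrite lee_fin sqmod_ge0.
- apply/measurable_EFinP; apply: measurable_funTS; apply: measurable_sqmod.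
  by apply: cmeasurableB => //; exact: zak_bar_measurable.
- by move=> p _; rewrite lee_fin sqmod_ge0.
- apply: filterS zak_gap_ae => p h /h gfin; apply: cvg_EFin; first exact: nearW.
  have c1 := ccvgD (zak_gap_cvg gfin) (ccvg_cst (- zak r (trunc f N) p)).
  have := ccvg_sqmod c1; rewrite -(cvg_shiftn N); exact.
- move=> k; apply: (zak_trunc_diff HL int_L Hmu rP mf).
  by apply: leq_trans (Nk (k + N)%N); exact: leq_addl.
Qed.
End Fixed.

Lemma sec_norm2_dom (A B : R) w s t : 0 <= A -> 0 <= B ->
  cmeas2 w -> cmeas2 s -> cmeas2 t ->
  (forall p, sqmod (w p) <= A * sqmod (s p) + B * sqmod (t p)) ->
  (snorm2 w <= A%:E * snorm2 s + B%:E * snorm2 t)%E.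
Proof.
move=> A0 B0 mw ms mt h.
have mq v : cmeas2 v -> measurable_fun K (fun p : E2 => (sqmod (v p))%:E).
  by move=> mv; apply/measurable_EFinP; exact: measurable_funTS (measurable_sqmod mv).
have s0 p : (0 <= (sqmod (s p))%:E)%E by rewrite lee_fin sqmod_ge0.
have t0 p : (0 <= (sqmod (t p))%:E)%E by rewrite lee_fin sqmod_ge0.
rewrite /snorm2 -!ge0_integralZl_EFin//; try exact: mK; try exact: mq.
rewrite -ge0_integralD//; last 5 first.
- exact: mK.
- by move=> p _; rewrite mule_ge0.
- by apply: measurable_funeM; exact: mq.
- by move=> p _; rewrite mule_ge0.
- by apply: measurable_funeM; exact: mq.
apply: ge0_le_integral; first exact: mK.
- by move=> p _; rewrite lee_fin sqmod_ge0.
- exact: mq.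
- by apply: emeasurable_funD; apply: measurable_funeM; exact: mq.
- by move=> p _; rewrite -!EFinM -EFinD lee_fin.
Qed.
End ZakBar.

(** * The L^2 transform as a relation *)

Section ZakLimits.
Variables (R : realType) (E : normedModType R) (ip : {dot E for idfun}).
Variables (n : nat) (u b bd : 'I_n -> E) (L : set E).
Hypothesis HL : lattice_basis ip u b bd L.
Hypothesis int_L : integral_lattice ip L.
Variable mu : {sigma_finite_measure set (borel E) -> \bar R}.
Hypothesis Hmu : invariant_measure mu.
Local Notation C := R[i].
Local Notation dL := (Pilot.Defs.dual ip L).
Local Notation Zt := (discriminant ip L).
Local Notation disc := (disc_seq ip L).
Local Notation cell := (cell ip bd : set (borel E)).
Local Notation mcell := (measurable_cell HL).
Local Notation V := (fine (mu cell)).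
Local Notation family := (Zt -> E -> C).
Local Notation E2 := (borel E * borel E)%type.
Local Notation P := (product_measure1 mu mu).
Local Notation mK := (measurable_K HL).
Local Notation cmeas2 s := (cmeasurable [set: E2] (s : E2 -> C)).
Local Notation fnorm2 := (fam_norm2 mu).
Local Notation snorm2 := (sec_norm2 ip bd mu).
Variable r : Zt -> E.
Hypothesis rP : representatives r.

(** The section equation holds everywhere, the limit in L^2 only; for measurable f this determines s
    up to null sets. *)
Definition is_zak (f : family) (s : E * E -> C) : Prop :=
  [/\ is_section ip L s, cmeas2 s & forall e : R, 0 < e -> exists N0, forall N, (N0 <= N)%N ->
    (snorm2 (fun p => s p - zak r (trunc f N) p)%R <= e%:E)%E].

Lemma is_zak_intro f s : fam_measurable f -> (fnorm2 f < +oo)%E ->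
  is_section ip L s -> cmeas2 s ->
  (forall N, (snorm2 (fun p => s p - zak r (trunc f N) p)%R <=
    V%:E * fnorm2 (remainder f N))%E) -> is_zak f s.
Proof.
move=> mf f2 ss ms h; split=> // e e0.
have V0 := cell_pos HL int_L Hmu.
have eV : 0 < e / V by rewrite divr_gt0.
have /cvgrPdist_le/(_ _ eV)[N0 _ hN] := remainder_cvg mf f2.
exists N0 => N N0N; apply: (le_trans (h N)).
have fin : fnorm2 (remainder f N) \is a fin_num.
  by rewrite ge0_fin_numE ?fam_norm2_ge0// remainder_norm2_fin.
have := hN N N0N; rewrite /= sub0r normrN => hle.
by rewrite -(fineK fin) -EFinM lee_fin mulrC -ler_pdivlMr// (le_trans (ler_norm _)).
Qed.

Lemma zak_bar_is_zak f : fam_measurable f -> (fnorm2 f < +oo)%E ->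
  is_zak f (zak_bar mu r f).
Proof.
move=> mf f2; apply: is_zak_intro => //.
- exact: (zak_bar_section HL int_L mu rP).
- exact: (zak_bar_measurable HL int_L).
- exact: (zak_bar_fatou HL int_L Hmu rP mf f2).
Qed.

(** The dual vectors within distance N of -t form another exhaustion, and an absolutely summable
    family has the same sum along any exhaustion. Truncating f at radius N is truncating its series
    in this way. *)
Lemma csum_ball (t : E) (F : E -> C) : csummable dL F ->
  ccvg (fun N => csum dL (fun l => if `|t + l| <= N%:R then F l else 0)) (csum dL F).
Proof.
move=> sF.
have fin N : finite_set [set y | dL y /\ `|t + y| <= N%:R].
  apply: sub_finite_set (finite_dual_bounded HL (N%:R + `|t|)) => y [dy ty]; split => //.
  by rewrite -[y](addKr t) addrC (le_trans (ler_normB _ _))// lerD2r.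
pose A N := fset_set [set y | dL y /\ `|t + y| <= N%:R].
have AP N y : reflect (dL y /\ `|t + y| <= N%:R) (y \in A N).
  by rewrite /A in_fset_set//; apply: (iffP idP); rewrite inE.
have ex : exhaustion dL A.
  split=> [N y /AP[]//|N M NM y /AP[dy ty]|y dy].
    by apply/AP; split => //; rewrite (le_trans ty)// ler_nat.
  by exists (Num.bound `|t + y|); apply/AP; split => //; apply/ltW/archi_boundP.
have := csum_exhaustion ex sF; congr ccvg; apply/funext => N.
rewrite (@csum_fsupport _ _ _ (A N)).
- by apply: eq_big_seq => y /AP[_ ->].
- by move=> y /AP[].
- by move=> y dy /AP h; case: ifPn => // ty; exfalso; apply: h.
Qed.

Lemma zak_trunc_cvg f p : (forall g, csummable dL (zak_term r f g p.1 p.2)) ->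
  ccvg (fun N => zak r (trunc f N) p) (zak r f p).
Proof.
move=> sf; rewrite /zak; apply: ccvgM; first exact: ccvg_cst.
rewrite (fsum_disc HL int_L).
under [X in ccvg X]eq_fun do rewrite (fsum_disc HL int_L).
apply: ccvg_sum => g; have := csum_ball p.1 (sf g); congr ccvg.
apply/funext => N; apply: eq_csum => l _; rewrite /zak_term /trunc.
by case: ifP => // _; rewrite !mul0r.
Qed.

Lemma zak_is_zak f : fam_measurable f -> (fnorm2 f < +oo)%E ->
  (forall g t1 t2, csummable dL (zak_term r f g t1 t2)) -> is_zak f (zak r f).
Proof.
move=> mf f2 sf.
have mt N : cmeas2 (zak r (trunc f N)).
  exact: (bs_zak_measurable HL int_L _ (trunc_measurable _ mf) (trunc_bounded f _)).
have mz : cmeas2 (zak r f).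
  apply: (@cmeasurable_ccvg _ E2 R setT (fun N => zak r (trunc f N))) => // p _.
  exact: zak_trunc_cvg.
apply: is_zak_intro => //; first exact: (zak_section HL int_L rP).
move=> N.
apply: (fatou_bound mK (g_ := fun k p => (sqmod (zak r (trunc f (k + N)%N) p - zak r (trunc f N) p))%:E)).
- move=> k; apply/measurable_EFinP; apply: measurable_funTS; apply: measurable_sqmod.
  by apply: cmeasurableB.
- by move=> k p _; rewrite lee_fin sqmod_ge0.
- apply/measurable_EFinP; apply: measurable_funTS; apply: measurable_sqmod.
  by apply: cmeasurableB.
- by move=> p _; rewrite lee_fin sqmod_ge0.
- apply: filterE => p _; apply: cvg_EFin; first exact: nearW.
  have c1 := ccvgD (zak_trunc_cvg (fun g => sf g p.1 p.2)) (ccvg_cst (- zak r (trunc f N) p)).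
  have := ccvg_sqmod c1; rewrite -(cvg_shiftn N); exact.
- by move=> k; apply: (zak_trunc_diff HL int_L Hmu rP mf); exact: leq_addl.
Qed.

Lemma is_zak_lin (a : C) f f' s s' : fam_measurable f -> fam_measurable f' ->
  is_zak f s -> is_zak f' s' ->
  is_zak (fun g x => a * f g x + f' g x) (fun p => a * s p + s' p).
Proof.
move=> mf mf' [ss ms hs] [ss' ms' hs'].
have mt h N : fam_measurable h -> cmeas2 (zak r (trunc h N)).
  by move=> mh; exact: (bs_zak_measurable HL int_L _ (trunc_measurable _ mh) (trunc_bounded h _)).
have mas : cmeas2 (fun p => a * s p) by apply: cmeasurableM => //; exact: cmeasurable_cst.
split.
- by move=> l1 l2 x y Ll1 Ll2; rewrite ss// ss'//; ring.
- exact: cmeasurableD.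
move=> e e0; have a0 := sqmod_ge0 a.
(* Chosen so that 2 |a|^2 e1 + 2 e1 = e, after |z + w|^2 <= 2 |z|^2 + 2 |w|^2. *)
have e1 : 0 < e / (2 * sqmod a + 2) by rewrite divr_gt0// ltr_wpDl// mulr_ge0.
have [N1 h1] := hs _ e1; have [N2 h2] := hs' _ e1.
exists (maxn N1 N2) => N; rewrite geq_max => /andP[N1N N2N].
have a20 : 0 <= 2 * sqmod a by rewrite mulr_ge0.
have := @sec_norm2_dom _ _ _ _ _ _ _ _ HL mu (2 * sqmod a) 2
  (fun p => a * s p + s' p - zak r (trunc (fun g x => a * f g x + f' g x) N) p)
  (fun p => s p - zak r (trunc f N) p) (fun p => s' p - zak r (trunc f' N) p) a20 (ler0n _ _).
have zE p : a * s p + s' p - zak r (trunc (fun g x => a * f g x + f' g x) N) p =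
  a * (s p - zak r (trunc f N) p) + (s' p - zak r (trunc f' N) p).
  by rewrite trunc_lin (bs_zak_linear HL int_L r a (trunc_bounded f N) (trunc_bounded f' N)); ring.
have md h v : fam_measurable h -> cmeas2 v -> cmeas2 (fun p => v p - zak r (trunc h N) p).
  by move=> mh mv; apply: cmeasurableB => //; exact: mt.
move=> hdom; apply: (le_trans (hdom _ _ _ _)).
- by rewrite (funext zE); apply: cmeasurableD; [apply: cmeasurableM; [exact: cmeasurable_cst|exact: md]|exact: md].
- exact: md.
- exact: md.
- by move=> p; rewrite zE (le_trans (sqmodD2 _ _))// sqmodM mulrA.
apply: (@le_trans _ _ ((2 * sqmod a)%:E * (e / (2 * sqmod a + 2))%:E + 2%:E * (e / (2 * sqmod a + 2))%:E)%E).
  by apply: leeD; apply: lee_wpmul2l; rewrite ?lee_fin//; [exact: h1|exact: h2].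
rewrite -!EFinM -EFinD lee_fin -mulrDl mulrC divfK//.
by rewrite gt_eqF// ltr_wpDl.
Qed.

Lemma sumsq_trunc (f : family) N x : sumsq f x = sumsq (trunc f N) x + sumsq (remainder f N) x.
Proof.
rewrite /sumsq -big_split/=; apply: eq_bigr => g _; rewrite /trunc /remainder.
by case: ifP => _; rewrite sqmod0 ?addr0 ?add0r.
Qed.

Lemma fam_norm2_trunc (f : family) N : fam_measurable f ->
  (fnorm2 f = fnorm2 (trunc f N) + fnorm2 (remainder f N))%E.
Proof.
move=> mf; rewrite /fam_norm2 -ge0_integralD//.
- by apply: eq_integral => x _; rewrite (sumsq_trunc f N) EFinD.
- by move=> x _; rewrite lee_fin sumsq_ge0.
- by apply/measurable_EFinP; apply: measurable_sumsq; exact: trunc_measurable.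
- by move=> x _; rewrite lee_fin sumsq_ge0.
- by apply/measurable_EFinP; apply: measurable_sumsq; exact: remainder_measurable.
Qed.

(** The limit e -> 0 followed by d -> 0 in the weighted triangle inequality: given eta, d is taken
    with d Y <= eta/2, then e with (1 + 1/d) e = eta/2. *)
Lemma le_eps2 (X Y : R) : 0 <= Y ->
  (forall d e, 0 < d -> 0 < e -> X <= (1 + d) * Y + (1 + d^-1) * e) -> X <= Y.
Proof.
move=> Y0 h; apply/ler_addgt0Pr => eta eta0.
pose d := eta / (2 * (Y + 1)).
have Y1 : 0 < 2 * (Y + 1) by rewrite mulr_gt0// ltr_wpDl.
have d0 : 0 < d by rewrite divr_gt0.
have dV : 0 < 1 + d^-1 by rewrite addr_gt0// invr_gt0.
have e0 : 0 < eta / 2 / (1 + d^-1) by rewrite !divr_gt0.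
apply: (le_trans (h _ _ d0 e0)); rewrite [in X in _ + X]mulrC divfK ?gt_eqF//.
have dY : d * Y <= eta / 2.
  by rewrite /d mulrAC ler_pdivrMr//; nra.
lra.
Qed.

(** s and the transform of a truncation bound each other up to a factor 1 + d and a small L^2 error,
    and the transform of a truncation has the expected norm. Finiteness of the norm of s comes
    first, to allow real arithmetic. *)
Lemma is_zak_norm f s : fam_measurable f -> (fnorm2 f < +oo)%E -> is_zak f s ->
  (snorm2 s = V%:E * fnorm2 f)%E.
Proof.
move=> mf f2 [ss ms hs]; have V0 := cell_pos HL int_L Hmu.
have mt N : cmeas2 (zak r (trunc f N)).
  exact: (bs_zak_measurable HL int_L _ (trunc_measurable _ mf) (trunc_bounded f _)).
have iso N := bs_zak_isometry HL int_L Hmu rP (trunc_measurable N mf) (trunc_bounded f N).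
have md N : cmeas2 (fun p => s p - zak r (trunc f N) p) by exact: cmeasurableB.
have fin : fnorm2 f \is a fin_num by rewrite ge0_fin_numE// fam_norm2_ge0.
have tfin N : fnorm2 (trunc f N) \is a fin_num.
  rewrite ge0_fin_numE ?fam_norm2_ge0//; apply: le_lt_trans f2.
  by rewrite (fam_norm2_trunc N mf) leeDl// fam_norm2_ge0.
have rfin N : fnorm2 (remainder f N) \is a fin_num.
  by rewrite ge0_fin_numE ?fam_norm2_ge0// remainder_norm2_fin.
have dom1 d N : 0 < d -> (snorm2 s <= (1 + d)%:E * (V%:E * fnorm2 (trunc f N)) +
    (1 + d^-1)%:E * snorm2 (fun p => s p - zak r (trunc f N) p)%R)%E.
  move=> d0; rewrite -iso; apply: (sec_norm2_dom HL) => //; try by rewrite addr_ge0// ?invr_ge0 ltW.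
  by move=> p; rewrite (le_trans _ (sqmodD_eps _ _ d0))// addrC subrK.
have sfin : snorm2 s \is a fin_num.
  rewrite ge0_fin_numE ?sec_norm2_ge0//.
  have [N hN] := hs 1 ltr01; apply: (le_lt_trans (dom1 1 N ltr01)).
  rewrite lte_add_pinfty//; first by rewrite -(fineK (tfin N)) -!EFinM ltry.
  rewrite (@le_lt_trans _ _ ((1 + 1^-1)%:E * 1%:E)%E) ?ltry//.
  by apply: lee_wpmul2l; rewrite ?lee_fin ?addr_ge0 ?invr_ge0 ?hN.
have dom2 d N : 0 < d -> (V%:E * fnorm2 (trunc f N) <= (1 + d)%:E * snorm2 s +
    (1 + d^-1)%:E * snorm2 (fun p => s p - zak r (trunc f N) p)%R)%E.
  move=> d0; rewrite -iso; apply: (sec_norm2_dom HL) => //; try by rewrite addr_ge0// ?invr_ge0 ltW.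
  move=> p; rewrite -(sqmodN (s p - _)) (le_trans _ (sqmodD_eps _ _ d0))//.
  by rewrite opprB addrC subrK.
have X0 : 0 <= fine (snorm2 s) by rewrite fine_ge0 ?sec_norm2_ge0.
have Y0 : 0 <= fine (fnorm2 f) by rewrite fine_ge0 ?fam_norm2_ge0.
rewrite -(fineK sfin) -(fineK fin) -EFinM; congr EFin; apply/eqP; rewrite eq_le; apply/andP; split.
- apply: le_eps2 => [|d e d0 e0]; first by rewrite mulr_ge0// ltW.
  have [N hN] := hs e e0; rewrite -lee_fin (fineK sfin).
  apply: (le_trans (dom1 d N d0)); rewrite [leRHS]EFinD; apply: leeD.
    rewrite EFinM EFinM (fineK fin); apply: lee_wpmul2l; first by rewrite lee_fin addr_ge0// ltW.
    apply: lee_wpmul2l; first by rewrite lee_fin ltW.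
    by rewrite (fam_norm2_trunc N mf) leeDl// fam_norm2_ge0.
  by rewrite EFinM; apply: lee_wpmul2l; rewrite ?lee_fin ?addr_ge0 ?invr_ge0 ?(ltW d0)// hN.
- apply: le_eps2 => // d e d0 e0.
  have e2 : 0 < e / 2 by rewrite divr_gt0.
  have [N1 h1] := hs _ e2.
  have eV : 0 < e / 2 / V by rewrite divr_gt0.
  have /cvgrPdist_le/(_ _ eV)[N2 _ h2] := remainder_cvg mf f2.
  pose N := maxn N1 N2.
  have := h2 N (leq_maxr _ _); rewrite /= sub0r normrN => /(le_trans (ler_norm _)).
  rewrite ler_pdivlMr// mulrC => hr.
  rewrite -lee_fin EFinM (fineK fin) (fam_norm2_trunc N mf) muleDr//; last exact: ge0_adde_def (fam_norm2_ge0 _ _) (fam_norm2_ge0 _ _).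
  apply: (@le_trans _ _ (((1 + d) * fine (snorm2 s) + (1 + d^-1) * (e / 2)) + e / 2)%:E); last first.
    rewrite lee_fin -addrA lerD2l mulrDl mul1r mulrDl mul1r.
    have de : 0 < d^-1 * e by rewrite mulr_gt0// invr_gt0.
    by lra.
  rewrite [leRHS]EFinD; apply: leeD; last by rewrite -(fineK (rfin N)) -EFinM lee_fin.
  apply: (le_trans (dom2 d N d0)); rewrite [leRHS]EFinD EFinM (fineK sfin) leeD2l//.
  by rewrite EFinM; apply: lee_wpmul2l; rewrite ?lee_fin ?addr_ge0 ?invr_ge0 ?(ltW d0)// h1// leq_maxl.
Qed.

(** The hypothesis concerns one cell, whereas equality of sections is asked almost everywhere on E x
    E; periodicity of |s|^2 and unfolding in each variable bridge the two. *)
Lemma sec_norm2_eq0 s : is_section ip L s -> cmeas2 s -> snorm2 s = 0%E ->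
  {ae P, forall p, s p = 0}.
Proof.
move=> ss ms s0.
pose h (p : E2) := (sqmod (s p))%:E.
have mh : measurable_fun [set: E2] h by apply/measurable_EFinP; exact: measurable_sqmod.
have h0 p : (0 <= h p)%E by rewrite lee_fin sqmod_ge0.
pose phi (x : E) := (\int[mu]_(y in cell) h (x, y))%E.
have phi0 x : (0 <= phi x)%E by exact: integral_ge0.
have mphi : measurable_fun [set: borel E] (phi : borel E -> \bar R).
  by apply: ge0_measurable_section => //; exact: mcell.
have L0 : L 0 by exact: (lat0 HL).
have hper l1 l2 x y : L l1 -> L l2 -> h ((x + l1)%R, (y + l2)%R) = h (x, y).
  by move=> Ll1 Ll2; rewrite /h (section_sqmod int_L ss).
have phiper l x : L l -> phi (x + l) = phi x.
  by move=> Ll; apply: eq_integral => y _; rewrite -[y in LHS]addr0 hper.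
have phicell : (\int[mu]_(x in cell) phi x = 0)%E.
  by rewrite -s0 /sec_norm2 ge0_integral_prod//; exact: mcell.
have phiE : (\int[mu]_x phi x = 0)%E.
  rewrite (integral_unfold HL int_L Hmu)//; apply: esum1 => l Ll.
  by rewrite -[RHS]phicell; apply: eq_integral => x _; rewrite phiper.
have ex := lat_exhaustion HL int_L.
have hT : (\int[P]_p h p = 0)%E.
  rewrite -setXTT (ge0_integral_prod mu measurableT measurableT mh h0).
  under eq_integral => x _.
    rewrite (integral_unfold HL int_L Hmu (h := fun y => h (x, y)))//; last first.
      exact: measurableT_comp mh (measurable_pair1 _).
    rewrite (_ : esum L _ = esum L (fun=> phi x)); last first.
      by apply: eq_esum => l Ll; apply: eq_integral => y _; rewrite -[x in LHS]addr0 hper.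
    over.
  rewrite (integral_esum mu ex)//.
  by apply: esum1 => l _; exact: phiE.
have : (\int[P]_(p in setT) `|h p|)%E = 0%E.
  by rewrite -[RHS]hT; apply: eq_integral => p _; rewrite gee0_abs.
move/(ae_eq_integral_abs P measurableT mh); apply: filterS => p /(_ I) /= [hp].
exact: sqmod_eq0.
Qed.

(** By linearity s - s' is related to f - f', whose norm is 0, so s - s' has norm 0. *)
Lemma is_zak_unique f f' s s' : fam_measurable f -> fam_measurable f' ->
  is_zak f s -> is_zak f' s' -> (forall g, {ae mu, forall x, f g x = f' g x}) ->
  {ae P, forall p, s p = s' p}.
Proof.
move=> mf mf' zs zs' ff'.
have zd := is_zak_lin (-1) mf' mf zs' zs.
have md := fam_measurable_lin (-1) mf' mf.
have d0 : fnorm2 (fun g x => -1 * f' g x + f g x) = 0%E.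
  have aeF : {ae mu, forall x : borel E, forall g, f g x = f' g x}.
    have : {ae mu, forall x : borel E, forall g, g \in disc -> f g x = f' g x}.
      elim: disc => [|g l IH]; first by apply: filterE.
      have hg := ff' g.
      near=> x => g'; rewrite inE => /orP[/eqP ->|].
        by near: x; exact: hg.
      by move: g'; near: x; exact: IH.
    by apply: filterS => x hx g; apply: hx; exact: mem_disc HL int_L _.
  rewrite /fam_norm2 (ge0_ae_eq_integral (g := fun=> 0%E))//.
  - by rewrite integral0.
  - by apply/measurable_EFinP; exact: measurable_sumsq.
  - by move=> x _; rewrite lee_fin sumsq_ge0.
  - apply: filterS aeF => x hx _; rewrite /sumsq big1// => g _.
    by rewrite hx mulN1r addNr sqmod0.
have := is_zak_norm md _ zd; rewrite d0 mule0 => /(_ (ltry 0)) nd.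
have [sd msd _] := zd.
apply: (@filterS _ _ (ae_filter_ringOfSetsType P) _ _ _ (sec_norm2_eq0 sd msd nd)) => p /eqP.
by rewrite mulN1r addrC subr_eq0 => /eqP.
Unshelve. all: by end_near.
Qed.
End ZakLimits.

(** * Every square-integrable section is a transform *)

Section Surjectivity.
Variables (R : realType) (E : normedModType R) (ip : {dot E for idfun}).
Variables (n : nat) (u b bd : 'I_n -> E) (L : set E).
Hypothesis HL : lattice_basis ip u b bd L.
Hypothesis int_L : integral_lattice ip L.
Variable mu : {sigma_finite_measure set (borel E) -> \bar R}.
Hypothesis Hmu : invariant_measure mu.
Hypothesis mu_vol : forall A, mu A = vol u A.
Local Notation C := R[i].
Local Notation dL := (Pilot.Defs.dual ip L).
Local Notation pr := (pairing ip).
Local Notation Zt := (discriminant ip L).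
Local Notation disc := (disc_seq ip L).
Local Notation cell := (cell ip bd : set (borel E)).
Local Notation mcell := (measurable_cell HL).
Local Notation V := (fine (mu cell)).
Local Notation cI := (cintegral mu cell).
Local Notation E2 := (borel E * borel E)%type.
Local Notation P := (product_measure1 mu mu).
Local Notation cmeas2 s := (cmeasurable [set: E2] (s : E2 -> C)).
Local Notation untw := (untwist ip).
Local Notation fnorm2 := (fam_norm2 mu).
Local Notation snorm2 := (sec_norm2 ip bd mu).
Variables r r' : Zt -> E.
Hypothesis rP : representatives r.
Hypothesis rP' : representatives r'.
Variable F : set E.
Hypothesis tF : tiles L mu F.

Lemma section_integral_measurable (g : E2 -> R) : measurable_fun [set: E2] g ->
  measurable_fun [set: borel E] (fun x : borel E => fine (\int[mu]_(y in cell) (g (x, y))%:E)%E).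
Proof.
move=> mg; have mE : measurable_fun [set: E2] (EFin \o g) by exact/measurable_EFinP.
apply: (measurableT_comp (fine_measurable measurableT)).
under eq_fun do rewrite integralE.
apply: emeasurable_funB.
- have := ge0_measurable_section mu mcell (measurable_funepos mE).
  move=> /(_ (fun p => funepos_ge0 _ p)); congr measurable_fun; apply/funext => x.
  by apply: eq_integral => y _; rewrite !funeposE.
- have := ge0_measurable_section mu mcell (measurable_funeneg mE).
  move=> /(_ (fun p => funeneg_ge0 _ p)); congr measurable_fun; apply/funext => x.
  by apply: eq_integral => y _; rewrite !funenegE.
Qed.

Lemma section_cintegral_measurable (G : E * E -> C) : cmeas2 G ->
  cmeasurable [set: borel E] (fun x : borel E => cI (fun t => G (x : E, t))).
Proof.
move=> [mR mI]; split; first exact: (section_integral_measurable mR).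
exact: (section_integral_measurable mI).
Qed.

Definition slice_coef (s : E * E -> C) (l x : E) : C :=
  (V^-1)%:C%C * cI (fun t => pr l t * untw s (x, t)).

Lemma slice_coef_measurable s l : cmeas2 s ->
  cmeasurable [set: borel E] (slice_coef s l : borel E -> C).
Proof.
move=> ms; apply: cmeasurableM; first exact: cmeasurable_cst.
apply: (@section_cintegral_measurable (fun p => pr l p.2 * untw s p)).
apply: cmeasurableM; last exact: (untwist_measurable HL).
exact: (cmeasurable_comp (pairing_measurable HL l) measurable_snd).
Qed.

Lemma slice_coef_norm s : cmeas2 s ->
  (\int[mu]_(x in cell) esum dL (fun l => (sqmod (slice_coef s l x))%:E) <=
   (V^-1)%:E * snorm2 s)%E.
Proof.
move=> ms; have V0 := cell_pos HL int_L Hmu.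
have mq : measurable_fun [set: E2] (fun p : E2 => (sqmod (untw s p))%:E).
  by apply/measurable_EFinP; apply: measurable_sqmod; exact: (untwist_measurable HL).
have q0 (p : E2) : (0 <= (sqmod (untw s p))%:E)%E by rewrite lee_fin sqmod_ge0.
rewrite (sec_norm2E HL mu ms) -ge0_integralZl_EFin ?invr_ge0 ?(ltW V0)//; last 3 first.
- exact: mcell.
- by move=> x _; exact: integral_ge0.
- by apply: measurable_funTS; exact: (ge0_measurable_section mu mcell mq q0).
apply: ge0_le_integral; first exact: mcell.
- by move=> x _; apply: esum_ge0 => l _; rewrite lee_fin sqmod_ge0.
- apply: (measurable_esum (dual_exhaustion HL)); first exact: mcell.
    move=> l; apply/measurable_EFinP; apply: measurable_funTS.
    by apply: measurable_sqmod; exact: slice_coef_measurable.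
  by move=> l x; rewrite lee_fin sqmod_ge0.
- apply: measurable_funeM; apply: measurable_funTS.
  exact: (ge0_measurable_section mu mcell mq q0).
- move=> x _; apply: (esum_bessel HL int_L Hmu).
  have [m1 m2] := slice_cmeasurable x (untwist_measurable HL ms).
  by split; exact: measurable_funTS.
Qed.

Lemma slice_integrable_ae s : cmeas2 s -> (snorm2 s < +oo)%E ->
  {ae mu, forall x : borel E, cell x -> cintegrable mu cell (fun t => untw s (x : E, t))}.
Proof.
move=> ms s2.
have mq : measurable_fun [set: E2] (fun p : E2 => (sqmod (untw s p))%:E).
  by apply/measurable_EFinP; apply: measurable_sqmod; exact: (untwist_measurable HL).
have q0 (p : E2) : (0 <= (sqmod (untw s p))%:E)%E by rewrite lee_fin sqmod_ge0.
have i0 x : (0 <= \int[mu]_(y in cell) (sqmod (untw s (x, y)))%:E)%E by exact: integral_ge0.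
have ig : mu.-integrable cell (fun x => \int[mu]_(y in cell) (sqmod (untw s (x, y)))%:E)%E.
  apply/integrableP; split.
    by apply: measurable_funTS; exact: (ge0_measurable_section mu mcell mq q0).
  by under eq_integral do rewrite gee0_abs//; rewrite -(sec_norm2E HL mu ms).
have := integrable_ae mcell ig; apply: filterS => x h /h; rewrite ge0_fin_numE// => fx.
apply: (@cintegrable_L2 _ _ _ _ _ mcell (cell_fin HL Hmu)) => //.
have [m1 m2] := slice_cmeasurable x (untwist_measurable HL ms).
by split; exact: measurable_funTS.
Qed.

(** Additivity needs integrability of both slices, which for square-integrable sections holds for
    almost every x only. *)
Lemma slice_coefB s t l x : cintegrable mu cell (fun y => untw s (x, y)) ->
  cintegrable mu cell (fun y => untw t (x, y)) ->
  slice_coef (fun p => s p - t p) l x = slice_coef s l x - slice_coef t l x.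
Proof.
move=> /(cintegrable_pairing HL l) si /(cintegrable_pairing HL l) ti.
rewrite /slice_coef -mulrBr; congr (_ * _).
apply: (@eq_trans _ _ (cI (fun y => pr l y * untw s (x, y) + (-1) * (pr l y * untw t (x, y))))).
  by apply: (eq_cintegral mu) => y _; rewrite /untwist; ring.
rewrite (cintegralD mcell si (cintegrableZ mcell (-1) ti)) (cintegralZ mcell (-1) ti).
by rewrite mulN1r.
Qed.

Lemma bs_slice_coef f l x : bounded_support f -> dL l ->
  slice_coef (zak r f) l x = zak_coef r f l (x + l).
Proof.
move=> bf dl; have V0 := cell_pos HL int_L Hmu.
have [A [AS Afin A0]] := bs_zak_finite HL int_L r bf x.
have sw : csummable dL (fun l => (normc (zak_coef r f l (x + l)))%:C%C).
  by apply: (csummable_fsupport AS) => i di iA; rewrite A0// normc0.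
rewrite /slice_coef.
rewrite (_ : cI _ = V%:C%C * zak_coef r f l (x + l)); last first.
  rewrite -(fourier_series_coef HL int_L Hmu (fun i _ => lexx (normc (zak_coef r f i (x + i)))) sw.1 dl).
  by apply: (eq_cintegral mu) => t _; rewrite (bs_untwist HL int_L).
by rewrite mulrA -rmorphM/= mulVf ?mul1r// gt_eqF.
Qed.

Section FixedSection.
Variable s : E * E -> C.
Hypothesis qs : is_section ip L s.
Hypothesis ms : cmeas2 s.
Hypothesis s2 : (snorm2 s < +oo)%E.
Local Notation f := (zak_inv u r' F s).

Lemma zak_inv_measurable : fam_measurable f.
Proof.
move=> g; rewrite (_ : f g = fun t => inv_sqrt_order ip L *
  \sum_(h <- disc) pr (r' g) (r' h) * fourier_coef ip bd mu s (r' h) t); last first.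
  apply/funext => t; apply: (zak_invE HL int_L Hmu mu_vol rP' tF qs) => x.
  exact: slice_cmeasurable (untwist_measurable HL ms).
apply: cmeasurableM; first exact: cmeasurable_cst.
apply: cmeasurable_sum => h; apply: cmeasurableM; first exact: cmeasurable_cst.
apply: cmeasurableM; first exact: cmeasurable_cst.
apply: section_cintegral_measurable; apply: cmeasurableM.
  exact: (cmeasurable_comp (pairing_measurable HL _) measurable_snd).
apply: (cmeasurable_comp (untwist_measurable HL ms) (h := fun p : E2 => ((p.1 : E) - r' h, p.2) : E2)).
by apply: measurable_fun_pair; [exact: measurable_addE|exact: measurable_snd].
Qed.

Lemma zak_coef_slice l x : dL l -> zak_coef r f l (x + l) = slice_coef s l x.
Proof.
move=> dl; rewrite (zak_coef_zak_inv HL int_L Hmu mu_vol rP rP' tF qs)//.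
  exact: fourier_coef_slice.
by move=> y; exact: slice_cmeasurable (untwist_measurable HL ms).
Qed.

(** Plancherel turns the norm of f into the integral of the squared slice coefficients of s, which
    Bessel's inequality bounds. *)
Lemma zak_inv_norm : (fnorm2 f <= (V^-1)%:E * snorm2 s)%E.
Proof.
rewrite -(sumsq_plancherel HL int_L Hmu rP zak_inv_measurable).
apply: le_trans (slice_coef_norm ms); rewrite le_eqVlt; apply/orP; left; apply/eqP.
apply: eq_integral => x _; apply: eq_esum => l dl; by rewrite zak_coef_slice.
Qed.

Lemma zak_inv_norm_fin : (fnorm2 f < +oo)%E.
Proof.
apply: (le_lt_trans zak_inv_norm).
have fs : snorm2 s \is a fin_num by rewrite ge0_fin_numE ?sec_norm2_ge0.
by rewrite -(fineK fs) -EFinM ltry.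
Qed.

(** Completeness is obtained without Parseval for s: the slice coefficients of w = s - t are shown
    to have integrated square 0, and uniqueness for integrable periodic functions kills almost every
    slice of w. *)
Lemma is_zak_zak_inv t : is_zak bd mu r f t -> {ae P, forall p, t p = s p}.
Proof.
move=> zt; have [qt mt ht] := zt; have V0 := cell_pos HL int_L Hmu.
have mf := zak_inv_measurable; have f2 := zak_inv_norm_fin.
have fin : fnorm2 f \is a fin_num by rewrite ge0_fin_numE ?fam_norm2_ge0.
have t2 : (snorm2 t < +oo)%E.
  by rewrite (is_zak_norm HL int_L Hmu rP mf f2 zt) -(fineK fin) -EFinM ltry.
pose w p := s p - t p.
have mw : cmeas2 w by exact: cmeasurableB.
have qw : is_section ip L w by exact: section_sub.
pose S v x := esum dL (fun l => (sqmod (slice_coef v l x))%:E).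
have ex := dual_exhaustion HL.
have mS v : cmeas2 v -> measurable_fun cell (S v : borel E -> \bar R).
  move=> mv; apply: (measurable_esum ex); first exact: mcell.
    move=> l; apply/measurable_EFinP; apply: measurable_funTS.
    by apply: measurable_sqmod; exact: slice_coef_measurable.
  by move=> l x; rewrite lee_fin sqmod_ge0.
have S0 v x : (0 <= S v x)%E by apply: esum_ge0 => l _; rewrite lee_fin sqmod_ge0.
have Sw0 : (\int[mu]_(x in cell) S w x = 0)%E.
  pose T N x := esum dL (fun l => (sqmod (zak_coef r (remainder f N) l (x + l)))%:E).
  have T0 N x : (0 <= T N x)%E by apply: esum_ge0 => l _; rewrite lee_fin sqmod_ge0.
  have mrem N := remainder_measurable N mf.
  have mT N : measurable_fun cell (T N : borel E -> \bar R).
    apply: (measurable_esum ex); first exact: mcell.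
      move=> l; apply/measurable_EFinP; apply: measurable_funTS; apply: measurable_sqmod.
      exact: (cmeasurable_comp (zak_coef_measurable r l (mrem N)) (measurable_shift l)).
    by move=> l x; rewrite lee_fin sqmod_ge0.
  have mz N : cmeas2 (zak r (trunc f N)).
    exact: (bs_zak_measurable HL int_L _ (trunc_measurable _ mf) (trunc_bounded f _)).
  pose D N p := t p - zak r (trunc f N) p.
  have mD N : cmeas2 (D N) by exact: cmeasurableB.
  (* w is (s - Z(trunc f N)) minus (t - Z(trunc f N)). The first has the coefficients of the
     remainder of f beyond N, the second is small in L^2 because t is related to f. *)
  have bound N : (\int[mu]_(x in cell) S w x <= 2%:E * fnorm2 (remainder f N) +
      2%:E * ((V^-1)%:E * snorm2 (D N)))%E.
    apply: (@le_trans _ _ (\int[mu]_(x in cell) (2%:E * T N x + 2%:E * S (D N) x))%E).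
      apply: (ae_ge0_le_integral mcell) => //.
      - exact: mS.
      - by move=> x _; rewrite adde_ge0// mule_ge0.
      - by apply: emeasurable_funD; apply: measurable_funeM; [exact: mT|exact: mS].
      have zfin : (snorm2 (zak r (trunc f N)) < +oo)%E.
        rewrite (bs_zak_isometry HL int_L Hmu rP (trunc_measurable N mf) (trunc_bounded f N)).
        have tfin : fnorm2 (trunc f N) \is a fin_num.
          rewrite ge0_fin_numE ?fam_norm2_ge0//; apply: le_lt_trans f2.
          by rewrite (fam_norm2_trunc mu N mf) leeDl// fam_norm2_ge0.
        by rewrite -(fineK tfin) -EFinM ltry.
      apply: filterS3 (slice_integrable_ae ms s2) (slice_integrable_ae mt t2)
        (slice_integrable_ae (mz N) zfin) => x hs ht' hz cx.
      rewrite /S /T -!(ge0_esumZl ex)//; try by move=> l; rewrite lee_fin sqmod_ge0.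
      rewrite -esumD; last 2 first.
      - by move=> l _; rewrite mule_ge0// lee_fin sqmod_ge0.
      - by move=> l _; rewrite mule_ge0// lee_fin sqmod_ge0.
      apply: le_esum => l dl; rewrite -!EFinM -EFinD lee_fin.
      rewrite (_ : slice_coef w l x = zak_coef r (remainder f N) l (x + l) + - slice_coef (D N) l x).
        by rewrite (le_trans (sqmodD2 _ _))// sqmodN.
      rewrite (slice_coefB l (hs cx) (ht' cx)) (slice_coefB l (ht' cx) (hz cx)).
      rewrite (bs_slice_coef x (trunc_bounded f N) dl) -zak_coef_slice//.
      rewrite (_ : zak_coef r (remainder f N) l (x + l) =
        zak_coef r f l (x + l) - zak_coef r (trunc f N) l (x + l)); first by ring.
      rewrite /zak_coef -mulrBr -sumrB; congr (_ * _); apply: eq_bigr => g _.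
      by rewrite remainderE -mulrBr; congr (_ * _); ring.
    rewrite ge0_integralD//; last 5 first.
    - exact: mcell.
    - by move=> x _; rewrite mule_ge0.
    - by apply: measurable_funeM; exact: mT.
    - by move=> x _; rewrite mule_ge0.
    - by apply: measurable_funeM; exact: mS.
    rewrite !ge0_integralZl_EFin//; try exact: mcell; try exact: mS; try exact: mT.
    apply: leeD; apply: lee_wpmul2l => //; last exact: slice_coef_norm.
    by rewrite /T (sumsq_plancherel HL int_L Hmu rP (mrem N)).
  apply/eqP; rewrite eq_le integral_ge0 ?andbT; last by move=> x _; exact: S0.
  apply/lee_addgt0Pr => e e0; rewrite add0e.
  (* Each of the two terms carries a factor 2 and must stay below e/2; the second also carries 1/V,
     hence the tolerance V e/4. *)
  have e1 : 0 < e / 4 by rewrite divr_gt0.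
  have e2 : 0 < V * (e / 4) by rewrite mulr_gt0.
  have [N1 h1] := ht _ e2.
  have /cvgrPdist_le/(_ _ e1)[N2 _ h2] := remainder_cvg mf f2.
  pose N := maxn N1 N2.
  have rfin : fnorm2 (remainder f N) \is a fin_num.
    by rewrite ge0_fin_numE ?fam_norm2_ge0// remainder_norm2_fin.
  have := h2 N (leq_maxr _ _); rewrite /= sub0r normrN => /(le_trans (ler_norm _)) hr.
  apply: (le_trans (bound N)).
  apply: (@le_trans _ _ (2%:E * (e / 4)%:E + 2%:E * ((V^-1)%:E * (V * (e / 4))%:E))%E).
    apply: leeD; apply: lee_wpmul2l => //; first by rewrite -(fineK rfin) lee_fin.
    by apply: lee_wpmul2l; [rewrite lee_fin invr_ge0 ltW|exact: h1 (leq_maxl _ _)].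
  rewrite -!EFinM -EFinD lee_fin (mulrA V^-1) mulVf ?gt_eqF// mul1r; lra.
have Sae : {ae mu, forall x : borel E, cell x -> S w x = 0%E}.
  have : (\int[mu]_(x in cell) `|S w x| = 0)%E.
    by rewrite -[RHS]Sw0; apply: eq_integral => x _; rewrite gee0_abs.
  by move/(ae_eq_integral_abs mu mcell (mS _ mw)).
have w0 : snorm2 w = 0%E.
  rewrite (sec_norm2E HL mu mw).
  have mq : measurable_fun [set: E2] (fun p : E2 => (sqmod (untw w p))%:E).
    by apply/measurable_EFinP; apply: measurable_sqmod; exact: (untwist_measurable HL).
  have q0 (p : E2) : (0 <= (sqmod (untw w p))%:E)%E by rewrite lee_fin sqmod_ge0.
  rewrite (ge0_ae_eq_integral mcell (g := fun=> 0%E)); first by rewrite integral0.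
  - by apply: measurable_funTS; exact: (ge0_measurable_section mu mcell mq q0).
  - exact: measurable_cst.
  - by move=> x _; exact: integral_ge0.
  - by [].
  apply: filterS3 (slice_integrable_ae ms s2) (slice_integrable_ae mt t2) Sae => x hs ht' hS cx.
  have [m1 m2] := slice_cmeasurable x (untwist_measurable HL mw).
  have iw : cintegrable mu cell (fun y => untw w (x, y)).
    have := cintegrableD mcell (hs cx) (cintegrableZ mcell (-1) (ht' cx)).
    by apply: (eq_cintegrable mcell) => y _; rewrite /untwist /w; ring.
  have pw : periodic_fun L (fun y => untw w (x, y)).
    move=> l y Ll; have := untwist_quasi_periodic int_L qw x y (lat0 HL) Ll.
    by rewrite addr0 pairing0l mul1r.
  have cw y : dL y -> cI (fun t => pr y t * untw w (x, t)) = 0.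
    move=> dy.
    have : (sqmod (slice_coef w y x))%:E = 0%E.
      apply/eqP; rewrite eq_le; apply/andP; split; last by rewrite lee_fin sqmod_ge0.
      rewrite -(hS cx); apply: esum_ge.
      by exists [set y]; [split; [exact: finite_set1|move=> _ ->]|rewrite fsbig_set1].
    move=> [] /sqmod_eq0 /eqP; rewrite mulf_eq0 => /orP[/eqP h|/eqP//].
    have : V^-1 = 0 by case: h.
    by move/eqP; rewrite invr_eq0 gt_eqF.
  have := complex_fourier_unique_ae HL int_L Hmu (conj m1 m2) iw pw cw => ae0.
  rewrite (ge0_ae_eq_integral mcell (g := fun=> 0%E)); first by rewrite integral0.
  - by apply: measurable_funTS; exact: measurableT_comp mq (measurable_pair1 x).
  - exact: measurable_cst.
  - by [].
  - by [].
  - by apply: filterS ae0 => y hy _; rewrite hy sqmod0.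
have := sec_norm2_eq0 HL int_L Hmu qw mw w0 => h.
by apply: (@filterS _ _ (ae_filter_ringOfSetsType P) _ _ _ h) => p /eqP; rewrite subr_eq0 => /eqP.
Qed.
End FixedSection.
End Surjectivity.

(** * Inner products *)

Section Polarization.
Variable R : realType.
Local Notation C := R[i].

(** The polarization formula, for Q c = |c t + s|^2 or its integral, with inner products antilinear
    in t. *)
Definition polar (Q : C -> R) : C :=
  (4^-1 * (Q 1 - Q (-1)) +i* (4^-1 * (Q 'i - Q (- 'i))))%C.

Lemma polarZ (a : R) Q : polar (fun c => a * Q c) = a%:C%C * polar Q.
Proof. by apply: complex_eqP; rewrite ?ReM ?ImM/=; ring. Qed.

Lemma polar_sum I (l : seq I) (Q : I -> C -> R) :
  polar (fun c => \sum_(i <- l) Q i c) = \sum_(i <- l) polar (Q i).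
Proof.
elim: l => [|i l IH]; first by rewrite big_nil /polar !big_nil subrr mulr0.
rewrite big_cons -IH; apply: complex_eqP; rewrite ?ReD ?ImD/= !big_cons; ring.
Qed.

Context d (T : measurableType d) (m : {measure set T -> \bar R}) (D : set T).
Hypothesis mD : measurable D.
Variables s t : T -> C.
Hypotheses (ms : cmeasurable D s) (mt : cmeasurable D t).
Hypothesis s2 : (\int[m]_(x in D) (sqmod (s x))%:E < +oo)%E.
Hypothesis t2 : (\int[m]_(x in D) (sqmod (t x))%:E < +oo)%E.

Lemma cmeasurable_lin c : cmeasurable D (fun x => c * t x + s x).
Proof. by apply: cmeasurableD => //; apply: cmeasurableM => //; exact: cmeasurable_cst. Qed.

Lemma sqmod_lin_fin c : (\int[m]_(x in D) (sqmod (c * t x + s x))%:E < +oo)%E.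
Proof.
have mq (v : T -> C) : cmeasurable D v -> measurable_fun D (fun x => (sqmod (v x))%:E).
  by move=> mv; apply/measurable_EFinP; exact: measurable_sqmod.
apply: (@le_lt_trans _ _ (\int[m]_(x in D) ((2 * sqmod c)%:E * (sqmod (t x))%:E + 2%:E * (sqmod (s x))%:E))%E).
  apply: ge0_le_integral => //.
  - by move=> x _; rewrite lee_fin sqmod_ge0.
  - by apply: mq; exact: cmeasurable_lin.
  - by apply: emeasurable_funD; apply: measurable_funeM; exact: mq.
  - by move=> x _; rewrite -!EFinM -EFinD lee_fin (le_trans (sqmodD2 _ _))// sqmodM mulrA.
have c0 : 0 <= 2 * sqmod c by rewrite mulr_ge0 ?sqmod_ge0.
have q0 (v : T -> C) x : (0 <= (sqmod (v x))%:E)%E by rewrite lee_fin sqmod_ge0.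
rewrite ge0_integralD//; last 4 first.
- by move=> x _; rewrite mule_ge0.
- by apply: measurable_funeM; exact: mq.
- by move=> x _; rewrite mule_ge0.
- by apply: measurable_funeM; exact: mq.
rewrite !ge0_integralZl_EFin//; try exact: mq.
by rewrite lte_add_pinfty// lte_mul_pinfty// ge0_fin_numE// integral_ge0.
Qed.

Lemma cintegral_polar : cintegral m D (fun x => s x * conjc (t x)) =
  polar (fun c => \int[m]_(x in D) sqmod (c * t x + s x)).
Proof.
have iq c : m.-integrable D (EFin \o (fun x => sqmod (c * t x + s x))).
  apply/integrableP; split.
    by apply/measurable_EFinP; apply: measurable_sqmod; exact: cmeasurable_lin.
  by under eq_integral do rewrite /= ger0_norm ?sqmod_ge0//; exact: sqmod_lin_fin.
have [_ hR] := integrable_lin mD 4^-1 (- 4^-1) (iq 1) (iq (-1)).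
have [_ hI] := integrable_lin mD 4^-1 (- 4^-1) (iq 'i%C) (iq (- 'i%C)).
apply: complex_eqP.
- rewrite Re_cintegral /polar/= mulrBr -mulNr -hR; apply: eq_Rintegral => x _.
  by rewrite Re_mulJ mul1r mulN1r (addrC (t x)) (addrC (- t x)); ring.
- rewrite Im_cintegral /polar/= mulrBr -mulNr -hI; apply: eq_Rintegral => x _.
  by rewrite Im_mulJ (addrC ('i%C * t x)) (addrC (- 'i%C * t x)) (mulNr 'i%C (t x)); ring.
Qed.
End Polarization.

Section InnerProducts.
Variables (R : realType) (E : normedModType R) (ip : {dot E for idfun}).
Variables (n : nat) (u b bd : 'I_n -> E) (L : set E).
Hypothesis HL : lattice_basis ip u b bd L.
Hypothesis int_L : integral_lattice ip L.
Variable mu : {sigma_finite_measure set (borel E) -> \bar R}.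
Hypothesis Hmu : invariant_measure mu.
Hypothesis mu_vol : forall A, mu A = vol u A.
Local Notation C := R[i].
Local Notation dL := (Pilot.Defs.dual ip L).
Local Notation Zt := (discriminant ip L).
Local Notation disc := (disc_seq ip L).
Local Notation cell := (cell ip bd : set (borel E)).
Local Notation mcell := (measurable_cell HL).
Local Notation V := (fine (mu cell)).
Local Notation family := (Zt -> E -> C).
Local Notation E2 := (borel E * borel E)%type.
Local Notation P := (product_measure1 mu mu).
Local Notation cmeas2 s := (cmeasurable [set: E2] (s : E2 -> C)).
Local Notation fnorm2 := (fam_norm2 mu).
Local Notation snorm2 := (sec_norm2 ip bd mu).
Variable r : Zt -> E.
Hypothesis rP : representatives r.
Variable F : set E.
Hypothesis tF : tiles L mu F.

Lemma volE : vol u = mu.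
Proof. by apply/funext => A; rewrite mu_vol. Qed.

Lemma vol2E : vol2 u = P.
Proof. by rewrite /vol2 volE. Qed.

Lemma fam_norm2E (f : family) : fam_measurable f ->
  fnorm2 f = (\sum_(g <- disc) \int[mu]_x (sqmod (f g x))%:E)%E.
Proof.
move=> mf; rewrite /fam_norm2 -ge0_integral_sum//.
- by apply: eq_integral => x _; rewrite /sumsq sumEFin.
- by move=> g; apply/measurable_EFinP; apply: measurable_sqmod; exact: mf.
- by move=> g x _; rewrite lee_fin sqmod_ge0.
Qed.

Lemma L2_familyP (f : family) : L2_family u f <-> fam_measurable f /\ (fnorm2 f < +oo)%E.
Proof.
have i0 (f0 : family) g : (0 <= \int[mu]_x (sqmod (f0 g x))%:E)%E.
  by apply: integral_ge0 => x _; rewrite lee_fin sqmod_ge0.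
split=> [h|[mf f2] g]; last first.
  split; first exact: mf.
  rewrite volE; apply: le_lt_trans f2; rewrite fam_norm2E//.
  rewrite (bigD1_seq g)/=; [|exact: mem_disc HL int_L _|exact: uniq_disc].
  by rewrite leeDl// sume_ge0.
have mf : fam_measurable f by move=> g; have [] := h g.
split=> //; rewrite fam_norm2E//; apply: lte_sum_pinfty => g _.
by have [_] := h g; rewrite volE.
Qed.

Lemma integral_section s : is_section ip L s -> cmeas2 s ->
  (\int[vol2 u]_(p in F `*` F) (sqmod (s p))%:E = snorm2 s)%E.
Proof.
move=> ss ms; rewrite vol2E.
have mq : measurable_fun [set: E2] (fun p : E2 => (sqmod (s p))%:E).
  by apply/measurable_EFinP; exact: measurable_sqmod.
have q0 (p : E2) : (0 <= (sqmod (s p))%:E)%E by rewrite lee_fin sqmod_ge0.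
rewrite (ge0_integral_prod_tiles HL int_L Hmu tF mq q0); last first.
  by move=> l1 l2 x y Ll1 Ll2; rewrite (section_sqmod int_L ss).
by rewrite /sec_norm2 (ge0_integral_prod mu mcell mcell mq q0).
Qed.

(** The norm identity applied to c f' + f for c = 1, -1, i, -i, then polarised on both sides. The
    factor V of the norm identity cancels the 1/Vol of the inner product on sections. *)
Lemma is_zak_ip f f' s s' : L2_family u f -> L2_family u f' ->
  is_zak bd mu r f s -> is_zak bd mu r f' s' ->
  ip_section u F s s' = ip_family u f f'.
Proof.
move=> h h' zs zs'; have [mf f2] := (L2_familyP f).1 h; have [mf' f2'] := (L2_familyP f').1 h'.
have [ss ms _] := zs; have [ss' ms' _] := zs'; have [mF _] := tF.
have V0 := cell_pos HL int_L Hmu.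
have fin (f0 : family) : fam_measurable f0 -> (fnorm2 f0 < +oo)%E -> fnorm2 f0 \is a fin_num.
  by move=> m0 h0; rewrite ge0_fin_numE ?fam_norm2_ge0.
have sec_fin f0 s0 : fam_measurable f0 -> (fnorm2 f0 < +oo)%E -> is_zak bd mu r f0 s0 ->
    (\int[vol2 u]_(p in F `*` F) (sqmod (s0 p))%:E < +oo)%E.
  move=> m0 h0 z0; have [q0 w0 _] := z0; rewrite integral_section//.
  by rewrite (is_zak_norm HL int_L Hmu rP m0 h0 z0) -(fineK (fin _ m0 h0)) -EFinM ltry.
have fl c g : (\int[mu]_x (sqmod (c * f' g x + f g x))%:E < +oo)%E.
  apply: sqmod_lin_fin => //.
  - by have [_] := h g; rewrite volE.
  - by have [_] := h' g; rewrite volE.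
pose fc c : family := fun g x => c * f' g x + f g x.
have mfc c : fam_measurable (fc c) by exact: fam_measurable_lin.
have fc2 c : (fnorm2 (fc c) < +oo)%E.
  by rewrite fam_norm2E//; apply: lte_sum_pinfty => g _; exact: fl.
have fcE c : fine (fnorm2 (fc c)) = \sum_(g <- disc) \int[mu]_x sqmod (c * f' g x + f g x).
  rewrite fam_norm2E// -sum_fine// => g _; rewrite ge0_fin_numE ?fl//.
  by apply: integral_ge0 => x _; rewrite lee_fin sqmod_ge0.
have zc c : is_zak bd mu r (fc c) (fun p => c * s' p + s p) by exact: (is_zak_lin HL int_L).
have scE c : \int[P]_(p in F `*` F) sqmod (c * s' p + s p) = V * fine (fnorm2 (fc c)).
  have [q0 w0 _] := zc c; rewrite /Rintegral.
  have := integral_section q0 w0; rewrite vol2E => ->.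
  by rewrite (is_zak_norm HL int_L Hmu rP (mfc c) (fc2 c) (zc c)) -(fineK (fin _ (mfc c) (fc2 c))).
have mFF : measurable (F `*` F : set E2) by exact: measurableX.
rewrite /ip_section (covolume_cell HL int_L Hmu mu_vol tF) vol2E.
rewrite (@cintegral_polar _ _ _ P _ mFF); last 4 first.
- by have [m1 m2] := ms; split; exact: measurable_funTS.
- by have [m1 m2] := ms'; split; exact: measurable_funTS.
- by have := sec_fin _ _ mf f2 zs; rewrite vol2E.
- by have := sec_fin _ _ mf' f2' zs'; rewrite vol2E.
rewrite (_ : (fun c => _) = fun c => V * fine (fnorm2 (fc c))); last exact/funext.
rewrite polarZ mulrA -rmorphM/= mulVf ?gt_eqF// mul1r.
rewrite (_ : (fun c => _) = fun c => \sum_(g <- disc) \int[mu]_x sqmod (c * f' g x + f g x)); last exact/funext.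
rewrite polar_sum /ip_family (fsum_disc HL int_L); apply: eq_bigr => g _.
rewrite volE; apply/esym; apply: cintegral_polar => //.
- by have [_] := h g; rewrite volE.
- by have [_] := h' g; rewrite volE.
Qed.

Lemma schwartz_measurable (f : family) : schwartz_family f -> fam_measurable f.
Proof.
move=> sf g; have [[sR sI] _ _] := sf g; split.
  exact: (continuous_borel (smooth_continuous sR)).
exact: (continuous_borel (smooth_continuous sI)).
Qed.

Lemma weight_le1 y : weight ip b y <= 1.
Proof.
apply: prodr_ile1 => i _; rewrite invr_ge0 addr_ge0 ?sqr_ge0//=.
by rewrite invf_le1 ?lerDl ?sqr_ge0// ltr_wpDr ?sqr_ge0.
Qed.

(** Unfolded onto [cell], the sum of |f(x + l)|^2 over L is at most A^2 times the sum of [weight]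
    over the dual lattice, since the weight is at most 1 and so dominates its square. *)
Lemma schwartz_L2 (f : family) : schwartz_family f -> L2_family u f.
Proof.
move=> sf g; have mf := schwartz_measurable sf; split; first exact: mf.
rewrite volE (integral_unfold_sum HL int_L Hmu); last 2 first.
- by apply/measurable_EFinP; apply: measurable_sqmod; exact: mf.
- by move=> x; rewrite lee_fin sqmod_ge0.
have [A A0 hA] := schwartz_weight HL (\sum_i `|b i|) (sf g).
have w0 y := weight_ge0 ip b y.
pose B := fine (esum dL (fun l => (weight ip b l)%:E)).
have BE : esum dL (fun l => (weight ip b l)%:E) = B%:E.
  rewrite /B fineK// ge0_fin_numE; last by apply: esum_ge0 => l _; rewrite lee_fin.
  have := summable_weight HL; rewrite /summable.
  by under eq_esum do rewrite /= ger0_norm//.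
have bound x : cell x -> (esum L (fun l => (sqmod (f g (x + l)))%:E) <= (A ^+ 2 * B)%:E)%E.
  move=> cx; rewrite EFinM -BE.
  have B1 l : (sqmod (f g (x + l)) <= A ^+ 2 * weight ip b l).
    have h := hA x l (cell_bounded HL cx).
    rewrite -normc_sqr (le_trans (_ : _ <= (A * weight ip b l) ^+ 2))//.
      by rewrite ler_pXn2r ?nnegrE ?normc_ge0 ?mulr_ge0.
    by rewrite exprMn ler_wpM2l ?sqr_ge0// expr2 ler_piMl ?weight_le1.
  have A2 : (0 <= (A ^+ 2)%:E)%E by rewrite lee_fin sqr_ge0.
  have wE l : (0 <= (weight ip b l)%:E)%E by rewrite lee_fin.
  rewrite -(ge0_esumZl (dual_exhaustion HL) A2 wE).
  rewrite esum_mkcond [leRHS]esum_mkcond; apply: le_esum => l _.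
  case: ifPn => [Ll|_].
    by rewrite mem_set ?lee_fin -?EFinM ?lee_fin//; apply: int_L; exact: set_mem.
  by case: ifP => // _; rewrite -EFinM lee_fin mulr_ge0 ?sqr_ge0.
have AB0 : 0 <= A ^+ 2 * B.
  rewrite mulr_ge0 ?sqr_ge0// -lee_fin -BE; apply: esum_ge0 => l _; rewrite lee_fin; exact: w0.
apply: (@le_lt_trans _ _ (\int[mu]_(x in cell) (A ^+ 2 * B)%:E)%E).
  apply: ge0_le_integral; first exact: mcell.
  - by move=> x _; apply: esum_ge0 => l _; rewrite lee_fin sqmod_ge0.
  - apply: (measurable_esum (lat_exhaustion HL int_L)); first exact: mcell.
      move=> l; apply/measurable_EFinP; apply: measurable_funTS; apply: measurable_sqmod.
      exact: (cmeasurable_comp (mf g) (measurable_shift l)).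
    by move=> l x; rewrite lee_fin sqmod_ge0.
  - exact: measurable_cst.
  - by move=> x cx; exact: bound.
by rewrite (integral_cst mu mcell) lte_mul_pinfty ?lee_fin// (cell_fin HL Hmu).
Qed.
End InnerProducts.

Theorem theorem3 (R : realType) (E : normedModType R) (n : nat)
    (ip : {dot E for idfun}) (u : 'I_n -> E) (L F : set E)
    (r r' : discriminant ip L -> E) :
  euclidean ip u ->
  full_rank_lattice n L ->
  integral_lattice ip L ->
  fundamental_domain u L F ->
  representatives r ->
  representatives r' ->
  let Z := @zak R E ip L r in
  let Zinv := @zak_inv R E ip n u L r' F in
  (* the series and the integrals in the two formulas converge absolutely *)
  (forall f g t1 t2, schwartz_family f ->
     csummable (dual ip L) (zak_term r f g t1 t2)) /\
  (forall s h t, smooth_section ip L s ->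
     cintegrable (vol u) (F : set (borel E)) (zak_inv_integrand r' s h t)) /\
  (* Z is a linear isomorphism with inverse Zinv *)
  (forall f, schwartz_family f -> smooth_section ip L (Z f)) /\
  (forall (a : R[i]) f f', schwartz_family f -> schwartz_family f' ->
     Z (fun g t => a * f g t + f' g t) = (fun p => a * Z f p + Z f' p)) /\
  (forall s, smooth_section ip L s -> schwartz_family (Zinv s)) /\
  (forall f, schwartz_family f -> Zinv (Z f) = f) /\
  (forall s, smooth_section ip L s -> Z (Zinv s) = s) /\
  (* Z preserves the inner products *)
  (forall f f', schwartz_family f -> schwartz_family f' ->
     ip_section u F (Z f) (Z f') = ip_family u f f') /\
  (* Z extends to an isometry between the L^2 spaces, whose elements are
     represented by functions up to almost everywhere equality *)
  (exists Zbar : (discriminant ip L -> E -> R[i]) -> (E * E -> R[i]),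
     (forall f, L2_family u f -> L2_section ip u L F (Zbar f)) /\
     (forall f f', L2_family u f -> L2_family u f' ->
        ae_eq_family u f f' -> ae_eq_section u (Zbar f) (Zbar f')) /\
     (forall (a : R[i]) f f', L2_family u f -> L2_family u f' ->
        ae_eq_section u (Zbar (fun g t => a * f g t + f' g t))
                        (fun p => a * Zbar f p + Zbar f' p)) /\
     (forall f, schwartz_family f ->
        L2_family u f /\ ae_eq_section u (Zbar f) (Z f)) /\
     (forall f f', L2_family u f -> L2_family u f' ->
        ip_section u F (Zbar f) (Zbar f') = ip_family u f f') /\
     (forall s, L2_section ip u L F s ->
        exists f, L2_family u f /\ ae_eq_section u (Zbar f) s)).
Proof.
move=> eu lL int_L [mF cov dis] rP rP' Z Zinv.
have [b [bd HL]] := lattice_basis_ex eu lL.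
have [mu [mu_vol inv fin pos]] := vol_measure eu.
have Hmu : invariant_measure mu by split.
have tF : tiles L mu F.
  apply: (fundamental_tiles HL int_L Hmu mF); first by rewrite mu_vol.
  by move=> l Ll l0; rewrite mu_vol; exact: dis.
have L2P := L2_familyP HL int_L mu_vol.
have vE := vol2E mu_vol.
have sum f g t1 t2 (sf : schwartz_family f) := schwartz_csummable HL r g t1 t2 sf.
(* With both Z and its extension satisfying [is_zak], the two inner product identities and the
   agreement on Schwartz families become instances of lemmas on the relation. *)
have zz f : schwartz_family f -> is_zak bd mu r f (Z f).
  move=> sf; have [mf f2] := (L2P f).1 (schwartz_L2 HL int_L Hmu mu_vol sf).
  by apply: (zak_is_zak HL int_L Hmu rP mf f2) => g t1 t2; exact: sum.
have zb f : L2_family u f -> is_zak bd mu r f (zak_bar mu r f).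
  by move=> /L2P[mf f2]; exact: (zak_bar_is_zak HL int_L Hmu rP mf f2).
split; first exact: sum.
split; first by move=> s h t ss; exact: (zak_inv_cintegrable HL int_L Hmu mu_vol r' tF ss).
split; first by move=> f sf; exact: (zak_smooth_section HL int_L rP sf).
split; first by move=> a f f' sf sf'; exact: (zak_linear HL int_L r a sf sf').
split; first by move=> s ss; exact: (zak_inv_schwartz HL int_L Hmu mu_vol rP' tF ss).
split; first by move=> f sf; exact: (zak_invK HL int_L Hmu mu_vol rP rP' tF sf).
split; first by move=> s ss; exact: (zakK HL int_L Hmu mu_vol rP rP' tF ss).
split.
  move=> f f' sf sf'; apply: (is_zak_ip HL int_L Hmu mu_vol rP tF) (zz f sf) (zz f' sf');
  exact: (schwartz_L2 HL int_L Hmu mu_vol).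
exists (zak_bar mu r); split.
  move=> f /[dup] h /L2P[mf f2]; have [qs ms _] := zb f h; split => //.
  rewrite (integral_section HL int_L Hmu mu_vol tF qs ms).
  rewrite (is_zak_norm HL int_L Hmu rP mf f2 (zb f h)).
  have ff : fam_norm2 mu f \is a fin_num by rewrite ge0_fin_numE ?fam_norm2_ge0.
  by rewrite -(fineK ff) -EFinM ltry.
split.
  move=> f f' h h' e; have [mf _] := (L2P f).1 h; have [mf' _] := (L2P f').1 h'.
  rewrite /ae_eq_section vE; apply: (is_zak_unique HL int_L Hmu rP mf mf' (zb f h) (zb f' h')) => g.
  by have := e g; rewrite (volE mu_vol).
split.
  move=> a f f' h h'; have [mf _] := (L2P f).1 h; have [mf' _] := (L2P f').1 h'.
  have hl : L2_family u (fun g t => a * f g t + f' g t).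
    move=> g; have [m1 i1] := h g; have [m2 i2] := h' g; split.
      by apply: cmeasurableD => //; apply: cmeasurableM => //; exact: cmeasurable_cst.
    move: i1 i2; rewrite (volE mu_vol) => i1 i2.
    exact: (sqmod_lin_fin measurableT m2 m1 i2 i1).
  have [ml _] := (L2P _).1 hl.
  rewrite /ae_eq_section vE; apply: (is_zak_unique HL int_L Hmu rP ml ml (zb _ hl)).
    exact: (is_zak_lin HL int_L a mf mf' (zb f h) (zb f' h')).
  by move=> g; apply: aeW.
split.
  move=> f sf; have h := schwartz_L2 HL int_L Hmu mu_vol sf; split => //.
  have [mf _] := (L2P f).1 h; rewrite /ae_eq_section vE.
  apply: (is_zak_unique HL int_L Hmu rP mf mf (zb f h) (zz f sf)).
  by move=> g; apply: aeW.
split; first by move=> f f' h h'; exact: (is_zak_ip HL int_L Hmu mu_vol rP tF h h' (zb f h) (zb f' h')).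
move=> s [qs ms]; rewrite (integral_section HL int_L Hmu mu_vol tF qs ms) => s2.
have mf := zak_inv_measurable HL int_L Hmu mu_vol rP' tF qs ms.
have f2 := zak_inv_norm_fin HL int_L Hmu mu_vol rP rP' tF qs ms s2.
have h := (L2P _).2 (conj mf f2).
exists (zak_inv u r' F s); split => //.
rewrite /ae_eq_section vE.
exact: (is_zak_zak_inv HL int_L Hmu mu_vol rP rP' tF qs ms s2 (zb _ h)).
Qed.
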